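(* Let $\alpha>0$ be real and let $n$ be a nonnegative integer with $n>\alpha/24$. Put $q:=\lfloor \alpha/24\rfloor$. Then \[ p_\alpha(n)=\nu_\alpha(n)^{-\frac{\alpha}{2}-1}\sum_{m=0}^{q}\mu_\alpha(m)^{\frac{\alpha}{2}+1}\,p_\alpha(m)\sum_{k=1}^{\infty}\frac{2\pi}{k}\,A_k^{(\alpha)}(n,m)\,I_{\frac{\alpha}{2}+1}\!\left(\frac{4\pi}{k}\,\nu_\alpha(n)\,\mu_\alpha(m)\right). \]
   Context: For real $\alpha$, the fractional partition numbers $p_\alpha(n)$ ($n\ge 0$ integer) are defined by the formal power series identity $\prod_{k=1}^\infty (1-x^k)^{-\alpha}=\sum_{n\ge 0}p_\alpha(n)x^n$. For $n>\alpha/24$ set $\nu_\alpha(n):=\sqrt{n-\alpha/24}$, and for $m\le \alpha/24$ set $\mu_\alpha(m):=\sqrt{\alpha/24-m}$. $I_\nu(z):=(z/2)^\nu\sum_{j\ge0}\frac{(z/2)^{2j}}{j!\,\Gamma(\nu+j+1)}$ is the modified Bessel function of the first kind. The Dedekind sum is $s(h,k):=\sum_{r=1}^{k-1}\frac{r}{k}\left(\frac{hr}{k}-\left\lfloor\frac{hr}{k}\right\rfloor-\frac12\right)$. The $\alpha$-Kloosterman sum is \[A_k^{(\alpha)}(n,m):=\sum_{\substack{0\le h<k\\ \gcd(h,k)=1}} e^{\alpha\pi i\, s(h,k)+\frac{2\pi i}{k}(mH-nh)},\] where for each $h$, $H$ is an integer with $hH\equiv -1 \pmod k$. *)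

(* Defs.v *)
From Stdlib Require Import Reals Lra Lia ZArith Arith.
From Coquelicot Require Import Coquelicot.
Open Scope R_scope.

(* [x ^ y] for [0 <= x].  [Rpower] cannot be used alone: [Rpower 0 y = 1] for
   every [y], since [ln 0 = 0] in Stdlib. *)
Definition rpow (x y : R) : R :=
  if Rlt_dec 0 x then Rpower x y else if Req_EM_T y 0 then 1 else 0.

(* Euler's integral; meaningful for [0 < s]. *)
Definition Gamma (s : R) : R :=
  RInt_gen (fun t => Rpower t (s - 1) * exp (- t))
           (at_right 0) (Rbar_locally p_infty).

(* Used for [0 <= z] and [0 < nu] only, where [rpow] and [Gamma] are
   meaningful. *)
Definition BesselI (nu z : R) : R :=
  rpow (z / 2) nu *
  Series (fun j => (z / 2) ^ (2 * j) / (INR (fact j) * Gamma (nu + INR j + 1))).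

(* A formal power series is its sequence of coefficients. *)
Definition fps := nat -> R.

Definition fps_one : fps := fun i => if Nat.eqb i 0 then 1 else 0.

Definition fps_mul (f g : fps) : fps :=
  fun n => sum_n (fun i => f i * g (n - i)%nat) n.

(* [a (a - 1) ... (a - j + 1) / j!] *)
Fixpoint gbinom (a : R) (j : nat) : R :=
  match j with
  | O => 1
  | S i => gbinom a i * (a - INR i) / INR (S i)
  end.

(* [(1 - x ^ k) ^ a], for [0 < k]: the binomial series
   [sum_j gbinom a j * y ^ j] of [(1 + y) ^ a] at [y = - x ^ k]. *)
Definition fps_factor (a : R) (k : nat) : fps :=
  fun i => if Nat.eqb (i mod k) 0
           then gbinom a (i / k) * (-1) ^ (i / k) else 0.

Fixpoint fps_partial_prod (a : R) (N : nat) : fps :=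
  match N with
  | O => fps_one
  | S M => fps_mul (fps_partial_prod a M) (fps_factor a (S M))
  end.

(* The infinite product is the coefficientwise limit of its partial products:
   its coefficient of [x ^ n] is already that of the [n]-th partial product, by
   [fps_partial_prod_stable]. *)
Definition frac_partition (alpha : R) (n : nat) : R :=
  fps_partial_prod (- alpha) n n.

Lemma fps_partial_prod_stable (alpha : R) (n N : nat) :
  (n <= N)%nat -> fps_partial_prod (- alpha) N n = frac_partition alpha n.
Proof.
unfold frac_partition; intros le_nN; induction le_nN as [|N le_nN IH]; auto.
rewrite <- IH; simpl; unfold fps_mul.
destruct n as [|n].
- rewrite sum_O; unfold fps_factor.
  rewrite Nat.Div0.mod_0_l, Nat.Div0.div_0_l; simpl; ring.
- rewrite sum_Sn, (sum_n_ext_loc _ (fun _ => 0)).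
  + rewrite sum_n_const, Nat.sub_diag; unfold fps_factor.
    rewrite Nat.Div0.mod_0_l, Nat.Div0.div_0_l; unfold plus; simpl; ring.
  + intros i le_in; unfold fps_factor.
    rewrite Nat.mod_small by lia.
    destruct (Nat.eqb_spec (S n - i) 0) as [E|_]; [lia | apply Rmult_0_r].
Qed.

Definition nu (alpha : R) (n : nat) : R := sqrt (INR n - alpha / 24).
Definition mu (alpha : R) (m : nat) : R := sqrt (alpha / 24 - INR m).

(* [Int_part] is the floor function. *)
Definition dedekind_sum (h k : nat) : R :=
  sum_n_m (fun r => INR r / INR k *
                    (INR (h * r) / INR k
                     - IZR (Int_part (INR (h * r) / INR k)) - 1 / 2))
          1 (k - 1).

(* [e ^ (i t)] *)
Definition expi (t : R) : C := (cos t, sin t).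

(* For [0 < k].  [H h] is the chosen integer with [h * H h = -1] modulo [k]. *)
Definition kloosterman (alpha : R) (k : nat) (H : nat -> Z) (n m : nat) : C :=
  sum_n_m (fun h : nat =>
             if Nat.eqb (Nat.gcd h k) 1
             then expi (alpha * PI * dedekind_sum h k
                        + 2 * PI / INR k
                          * (INR m * IZR (H h) - INR n * INR h))
             else RtoC 0)
          0 (k - 1).

(* Main.v *)
Require Import Defs.
From Stdlib Require Import Reals Lra Lia Psatz ZArith Arith List Permutation FinFun.
From Coquelicot Require Import Coquelicot.
Open Scope R_scope.

(* Rademacher's circle method.  With [q = exp (- 2 pi x)] the generating function of [p(m)] is
   [exp (alpha L(x))], [L(x) = - sum log (1 - q^k)].  The transformation law of [L] under the modular
   group is obtained by integrating that of the weight two Eisenstein series (partial fractions of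
   [coth], and an exchange of two conditionally convergent summations), followed by a Euclidean
   induction using the reciprocity law for Dedekind sums.  An antiderivative of the generating function
   times [exp (2 pi n x)] grows by a multiple of [p(n)] over a period; telescoping it over the arcs of
   the Ford circles at the Farey fractions of order [N] writes [p(n)] as a sum of integrals of
   [w^(- alpha/2 - 2) exp (b_m w + c / w)] over segments of the line [Re w = 1], where
   [b_m = 2 pi (alpha/24 - m)] and [c = 2 pi (n - alpha/24) / k^2].  Extending all the segments to
   the whole line costs [O (N^(- alpha/2))].  The line integral vanishes for [b_m <= 0], by a shift to
   the right, so only [m <= alpha/24] survives; for [b_m > 0], expanding [exp (c / w)] reduces it to
   [int w^(-s) exp w = 2 pi / Gamma(s)], that is, to the power series of the Bessel function. *)

(** * Complex exponential and logarithm *)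

(** Why the error vanishes. The transformation law contributes [w^(- alpha/2)] and the change of
    variable another [w^(-2)]. With [a = alpha/2], the factor [|w|^(-2)] makes every integral along
    a line or ray converge, and the remaining [|w|^(- a)] makes the tails small. The arc at [h / k]
    ends where [|w|] is at least [N / (2 k)], so completing it costs a multiple of
    [k^(- a - 2) (2 k / N)^(a + 1)], that is, of [1 / (k N^(a + 1))]. At most [k] numerators for
    each of [N] denominators give the total [N^(- a)], which tends to [0] because [alpha > 0]. Two
    constants are found indirectly. The value [zeta(2)] stays symbolic in the inversion formula
    until a fixed point of the modular group determines it. The line integral of [w^(-s) exp w] is
    tied to Euler's integral through a Poisson kernel, which concentrates at the point [w = 1],
    instead of through residues or a Hankel contour. Contours are only ever moved across
    rectangles. *)

Lemma C_eta (a b : C) : fst a = fst b -> snd a = snd b -> a = b.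
Proof. destruct a, b; simpl; intros -> ->; reflexivity. Qed.

Lemma fst_Cinv (z : C) : fst (/ z)%C = fst z / (fst z ^ 2 + snd z ^ 2).
Proof. reflexivity. Qed.

Lemma Csqr_pos (z : C) : z <> 0 -> 0 < fst z ^ 2 + snd z ^ 2.
Proof.
intros nz; destruct z as [x y]; simpl.
destruct (Req_dec x 0) as [->|]; [|nra].
destruct (Req_dec y 0) as [->|]; [|nra].
now destruct nz.
Qed.

Lemma Cneq_fst (z : C) : 0 < fst z -> z <> 0.
Proof. intros pos E; rewrite E in pos; simpl in pos; lra. Qed.

Lemma fst_le_Cmod (z : C) : Rabs (fst z) <= Cmod z.
Proof. eapply Rle_trans; [|apply Rmax_Cmod]; apply Rmax_l. Qed.

Lemma snd_le_Cmod (z : C) : Rabs (snd z) <= Cmod z.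
Proof. eapply Rle_trans; [|apply Rmax_Cmod]; apply Rmax_r. Qed.

Lemma Cmod_le_sum (z : C) : Cmod z <= Rabs (fst z) + Rabs (snd z).
Proof.
replace z with (RtoC (fst z) + Ci * RtoC (snd z))%C at 1
  by (apply C_eta; simpl; ring).
eapply Rle_trans; [apply Cmod_triangle|].
rewrite Cmod_mult, !Cmod_R, Cmod_Ci; lra.
Qed.

Definition cexp (z : C) : C := (exp (fst z) * cos (snd z), exp (fst z) * sin (snd z)).

Lemma cexp_plus (a b : C) : cexp (a + b)%C = (cexp a * cexp b)%C.
Proof.
apply C_eta; unfold cexp; simpl; rewrite exp_plus, ?cos_plus, ?sin_plus; ring.
Qed.

Lemma cexp_0 : cexp 0 = 1.
Proof. apply C_eta; unfold cexp; simpl; rewrite exp_0, ?cos_0, ?sin_0; ring. Qed.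

Lemma cexp_R (x : R) : cexp (RtoC x) = RtoC (exp x).
Proof. apply C_eta; unfold cexp; simpl; rewrite ?cos_0, ?sin_0; ring. Qed.

Lemma Cmod_cexp (z : C) : Cmod (cexp z) = exp (fst z).
Proof.
unfold Cmod, cexp; simpl fst; simpl snd.
replace (_ + _) with (exp (fst z) ^ 2).
- apply sqrt_pow2, Rlt_le, exp_pos.
- pose proof (sin2_cos2 (snd z)) as E; unfold Rsqr in E.
  transitivity (exp (fst z) ^ 2 * (sin (snd z) * sin (snd z) + cos (snd z) * cos (snd z))).
  + rewrite E; ring.
  + ring.
Qed.

Lemma cexp_neq_0 (z : C) : cexp z <> 0.
Proof. apply Cmod_gt_0; rewrite Cmod_cexp; apply exp_pos. Qed.

Lemma cexp_opp (z : C) : cexp (- z)%C = (/ cexp z)%C.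
Proof.
assert (E : (cexp (- z) * cexp z)%C = 1).
{ rewrite <- cexp_plus, <- cexp_0; f_equal; ring. }
rewrite <- (Cmult_1_l (/ cexp z)), <- E; field; apply cexp_neq_0.
Qed.

Lemma cexp_nat (n : nat) (z : C) : cexp (RtoC (INR n) * z)%C = (cexp z ^ n)%C.
Proof.
induction n as [|n IH].
- simpl Cpow; rewrite <- cexp_0; f_equal; simpl INR; ring.
- rewrite Cpow_S, <- IH, <- cexp_plus, S_INR, RtoC_plus; f_equal; ring.
Qed.

Lemma cexp_2PI_nat (n : nat) : cexp (RtoC (2 * PI * INR n) * Ci)%C = 1.
Proof.
apply C_eta; unfold cexp; simpl.
- replace (2 * PI * INR n * 0 - 0 * 1) with 0 by ring.
  replace (2 * PI * INR n * 1 + 0 * 0) with (0 + 2 * INR n * PI) by ring.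
  rewrite cos_period, cos_0, exp_0; ring.
- replace (2 * PI * INR n * 0 - 0 * 1) with 0 by ring.
  replace (2 * PI * INR n * 1 + 0 * 0) with (0 + 2 * INR n * PI) by ring.
  rewrite sin_period, sin_0; ring.
Qed.

Lemma cexp_2PI (n : Z) : cexp (RtoC (2 * PI * IZR n) * Ci)%C = 1.
Proof.
destruct (Z_le_gt_dec 0 n) as [pos|neg].
- rewrite <- (Z2Nat.id n pos), <- INR_IZR_INZ; apply cexp_2PI_nat.
- replace (RtoC (2 * PI * IZR n) * Ci)%C
    with (- (RtoC (2 * PI * INR (Z.to_nat (- n))) * Ci))%C.
  + rewrite cexp_opp, cexp_2PI_nat; field; apply C1_nz.
  + rewrite INR_IZR_INZ, Z2Nat.id, opp_IZR by lia.
    rewrite Ropp_mult_distr_r_reverse, RtoC_opp; ring.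
Qed.

(** Equal moduli give equal real parts; then [cos d = 1] for the difference [d] of the imaginary
    parts, so [sin (d / 2) = 0], and [|d / 2| < PI] leaves only [d = 0]. Identities between
    principal logarithms are proved by exponentiating and bounding imaginary parts. *)
Lemma cexp_inj (a b : C) :
  cexp a = cexp b -> Rabs (snd a - snd b) < 2 * PI -> a = b.
Proof.
intros E lt.
assert (F : fst a = fst b).
{ apply exp_inv; rewrite <- !Cmod_cexp; now rewrite E. }
apply C_eta; [exact F|].
assert (E1 : exp (fst a) * cos (snd a) = exp (fst b) * cos (snd b)) by exact (f_equal fst E).
assert (E2 : exp (fst a) * sin (snd a) = exp (fst b) * sin (snd b)) by exact (f_equal snd E).
rewrite F in E1, E2; pose proof (exp_pos (fst b)) as pos.
apply Rmult_eq_reg_l in E1; [|lra]; apply Rmult_eq_reg_l in E2; [|lra].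
assert (K : cos (snd a - snd b) = 1).
{ rewrite cos_minus, E1, E2; pose proof (sin2_cos2 (snd b)); unfold Rsqr in *; lra. }
set (d := snd a - snd b) in *.
assert (S : sin (d / 2) = 0).
{ replace d with (2 * (d / 2)) in K by field; rewrite cos_2a_sin in K; nra. }
apply Rabs_def2 in lt.
destruct (Rtotal_order (d / 2) 0) as [neg|[z|pos']].
- pose proof (sin_gt_0 (- (d / 2))); rewrite sin_neg in *; lra.
- unfold d in z; lra.
- pose proof (sin_gt_0 (d / 2)); lra.
Qed.

(* Principal logarithm; meaningful on the right half-plane only. *)
Definition clog (z : C) : C := (ln (Cmod z), atan (snd z / fst z)).

Lemma cexp_clog (z : C) : 0 < fst z -> cexp (clog z) = z.
Proof.
intros pos; pose proof (Cneq_fst z pos) as nz.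
unfold cexp, clog; simpl fst; simpl snd.
rewrite exp_ln by now apply Cmod_gt_0.
rewrite cos_atan, sin_atan.
assert (E : sqrt (1 + (snd z / fst z)²) = Cmod z / fst z).
{ apply sqrt_lem_1.
  - pose proof (Rle_0_sqr (snd z / fst z)); lra.
  - apply Rlt_le, Rdiv_lt_0_compat; [now apply Cmod_gt_0|exact pos].
  - transitivity (Cmod z ^ 2 / fst z ^ 2); [field; lra|].
    rewrite Cmod2_alt; unfold Rsqr, Re, Im; field; lra. }
rewrite E.
assert (nzm : Cmod z <> 0) by (apply Rgt_not_eq; now apply Cmod_gt_0).
destruct z as [x y]; apply C_eta; simpl fst; simpl snd; field; split; auto;
  simpl in pos; lra.
Qed.

Lemma snd_clog_bound (z : C) : - (PI / 2) < snd (clog z) < PI / 2.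
Proof. unfold clog; simpl; pose proof (atan_bound (snd z / fst z)); lra. Qed.

Lemma clog_R (x : R) : clog (RtoC x) = RtoC (ln (Rabs x)).
Proof.
apply C_eta; unfold clog; simpl fst; simpl snd.
- now rewrite Cmod_R.
- unfold Rdiv; rewrite Rmult_0_l; apply atan_0.
Qed.

Lemma clog_inv (z : C) : 0 < fst z -> clog (/ z)%C = (- clog z)%C.
Proof.
intros pos.
assert (pos' : 0 < fst (/ z)%C).
{ rewrite fst_Cinv; apply Rdiv_lt_0_compat; [exact pos|].
  apply Csqr_pos, Cneq_fst, pos. }
apply cexp_inj.
- rewrite cexp_opp, !cexp_clog by assumption; reflexivity.
- pose proof (snd_clog_bound z) as B1; pose proof (snd_clog_bound (/ z)%C) as B2.
  simpl snd at 2; apply Rabs_def1; simpl in *; lra.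
Qed.

Lemma clog_scal (x : R) (z : C) :
  0 < x -> 0 < fst z -> clog (RtoC x * z)%C = (RtoC (ln x) + clog z)%C.
Proof.
intros px pos.
assert (pos' : 0 < fst (RtoC x * z)%C) by (simpl; nra).
apply cexp_inj.
- rewrite cexp_plus, !cexp_clog, cexp_R, exp_ln by assumption; reflexivity.
- pose proof (snd_clog_bound z) as B1; pose proof (snd_clog_bound (RtoC x * z)%C) as B2.
  simpl snd at 2; apply Rabs_def1; simpl in *; lra.
Qed.

(** * Componentwise calculus of complex-valued functions of a real variable *)

(** Derivative in a real parameter, so that each rule reduces to real calculus. Holomorphy is
    expressed later through its effect on such curves. *)
Definition Cder (f : R -> C) (t : R) (l : C) : Prop :=
  is_derive (fun x => fst (f x)) t (fst l) /\ is_derive (fun x => snd (f x)) t (snd l).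

Lemma is_derive_eq (f : R -> R) (t a b : R) : is_derive f t a -> a = b -> is_derive f t b.
Proof. now intros D <-. Qed.

Lemma is_derive_Rmult (f g : R -> R) (t a b : R) :
  is_derive f t a -> is_derive g t b -> is_derive (fun x => f x * g x) t (a * g t + f t * b).
Proof. intros D1 D2; exact (is_derive_mult f g t a b D1 D2 Rmult_comm). Qed.

Lemma is_derive_Rcomp (h g : R -> R) (t a b : R) :
  is_derive h (g t) b -> is_derive g t a -> is_derive (fun x => h (g x)) t (a * b).
Proof. intros D1 D2; exact (is_derive_comp (V := R_NormedModule) h g t b a D1 D2). Qed.

Lemma Cder_eq (f : R -> C) (t : R) (a b : C) : Cder f t a -> a = b -> Cder f t b.
Proof. now intros D <-. Qed.

Lemma Cder_ext (f g : R -> C) (t : R) (l : C) :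
  (forall x, f x = g x) -> Cder f t l -> Cder g t l.
Proof.
intros E [D1 D2]; split;
  [apply (is_derive_ext (fun x => fst (f x)))|apply (is_derive_ext (fun x => snd (f x)))];
  auto; intros x; now rewrite E.
Qed.

Lemma Cder_const (c : C) (t : R) : Cder (fun _ => c) t 0.
Proof. split; exact (is_derive_const (K := R_AbsRing) (V := R_NormedModule) _ _). Qed.

Lemma Cder_RtoC (f : R -> R) (t l : R) : is_derive f t l -> Cder (fun x => RtoC (f x)) t (RtoC l).
Proof.
intros D; split; [exact D|].
exact (is_derive_const (K := R_AbsRing) (V := R_NormedModule) _ _).
Qed.

Lemma Cder_id (t : R) : Cder (fun x => RtoC x) t 1.
Proof. exact (Cder_RtoC (fun x => x) t 1 (is_derive_id (K := R_AbsRing) t)). Qed.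

Lemma Cder_plus (f g : R -> C) (t : R) (a b : C) :
  Cder f t a -> Cder g t b -> Cder (fun x => f x + g x)%C t (a + b)%C.
Proof.
intros [A1 A2] [B1 B2]; split; simpl.
- exact (is_derive_plus (V := R_NormedModule) _ _ _ _ _ A1 B1).
- exact (is_derive_plus (V := R_NormedModule) _ _ _ _ _ A2 B2).
Qed.

Lemma Cder_opp (f : R -> C) (t : R) (a : C) : Cder f t a -> Cder (fun x => - f x)%C t (- a)%C.
Proof.
intros [A1 A2]; split; simpl.
- exact (is_derive_opp (V := R_NormedModule) _ _ _ A1).
- exact (is_derive_opp (V := R_NormedModule) _ _ _ A2).
Qed.

Lemma Cder_minus (f g : R -> C) (t : R) (a b : C) :
  Cder f t a -> Cder g t b -> Cder (fun x => f x - g x)%C t (a - b)%C.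
Proof. intros A B; apply Cder_plus; [exact A | now apply Cder_opp]. Qed.

Lemma Cder_mult (f g : R -> C) (t : R) (a b : C) :
  Cder f t a -> Cder g t b -> Cder (fun x => f x * g x)%C t (a * g t + f t * b)%C.
Proof.
intros [A1 A2] [B1 B2]; split; simpl.
- eapply is_derive_eq.
  + exact (is_derive_minus (V := R_NormedModule) _ _ _ _ _
      (is_derive_Rmult _ _ _ _ _ A1 B1) (is_derive_Rmult _ _ _ _ _ A2 B2)).
  + unfold minus, plus, opp; simpl; ring.
- eapply is_derive_eq.
  + exact (is_derive_plus (V := R_NormedModule) _ _ _ _ _
      (is_derive_Rmult _ _ _ _ _ A1 B2) (is_derive_Rmult _ _ _ _ _ A2 B1)).
  + unfold plus; simpl; ring.
Qed.

Lemma Cder_scal (c : C) (f : R -> C) (t : R) (a : C) :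
  Cder f t a -> Cder (fun x => c * f x)%C t (c * a)%C.
Proof.
intros A; eapply Cder_eq; [exact (Cder_mult _ _ _ _ _ (Cder_const c t) A)|]; simpl; ring.
Qed.

Lemma is_derive_sqr_sum (f g : R -> R) (t a b : R) :
  is_derive f t a -> is_derive g t b ->
  is_derive (fun x => f x ^ 2 + g x ^ 2) t (2 * f t * a + 2 * g t * b).
Proof.
intros A B; eapply is_derive_eq.
- exact (is_derive_plus (V := R_NormedModule) _ _ _ _ _
    (is_derive_pow _ 2 _ _ A) (is_derive_pow _ 2 _ _ B)).
- unfold plus; simpl; ring.
Qed.

Lemma Cder_inv (f : R -> C) (t : R) (a : C) :
  Cder f t a -> f t <> 0 -> Cder (fun x => / f x)%C t (- a / (f t * f t))%C.
Proof.
intros [A1 A2] nz; pose proof (Csqr_pos _ nz) as pos.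
assert (D := is_derive_inv _ _ _ (is_derive_sqr_sum _ _ _ _ _ A1 A2)
               (Rgt_not_eq _ _ pos)).
assert (O := is_derive_opp (V := R_NormedModule) _ _ _ A2).
assert (D1 := is_derive_Rmult _ _ _ _ _ A1 D).
assert (D2 := is_derive_Rmult _ _ _ _ _ O D).
unfold opp in D2; simpl in D1, D2.
split; (eapply is_derive_eq; [first [exact D1 | exact D2]|]);
  destruct (f t) as [x y]; destruct a as [a b]; simpl in *; field; nra.
Qed.

Lemma Cder_cexp (f : R -> C) (t : R) (a : C) :
  Cder f t a -> Cder (fun x => cexp (f x)) t (a * cexp (f t))%C.
Proof.
intros [A1 A2].
assert (E := is_derive_Rcomp exp _ _ _ _ (is_derive_exp (fst (f t))) A1).
assert (K := is_derive_Rcomp cos _ _ _ _ (is_derive_cos (snd (f t))) A2).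
assert (S := is_derive_Rcomp sin _ _ _ _ (is_derive_sin (snd (f t))) A2).
split; (eapply is_derive_eq;
  [ first [exact (is_derive_Rmult _ _ _ _ _ E K) | exact (is_derive_Rmult _ _ _ _ _ E S)]
  | unfold cexp; simpl; ring]).
Qed.

Lemma Cder_clog (f : R -> C) (t : R) (a : C) :
  Cder f t a -> 0 < fst (f t) -> Cder (fun x => clog (f x)) t (a / f t)%C.
Proof.
intros [A1 A2] pos.
pose proof (Csqr_pos _ (Cneq_fst _ pos)) as pos2.
destruct a as [a b]; simpl in A1, A2.
split.
- apply (is_derive_ext (fun x => ln (sqrt (fst (f x) ^ 2 + snd (f x) ^ 2)))); [reflexivity|].
  assert (D := is_derive_sqr_sum _ _ _ _ _ A1 A2).
  assert (S := is_derive_sqrt _ _ _ D pos2).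
  eapply is_derive_eq;
    [exact (is_derive_Rcomp ln (fun x => sqrt (fst (f x) ^ 2 + snd (f x) ^ 2)) _ _ _
              (is_derive_ln _ (sqrt_lt_R0 _ pos2)) S)|].
  cbv beta; unfold Cdiv; simpl fst; simpl snd.
  set (q := sqrt _). 
  assert (Q : q * q = fst (f t) ^ 2 + snd (f t) ^ 2) by (apply sqrt_sqrt; lra).
  assert (qp : 0 < q) by (apply sqrt_lt_R0; lra).
  transitivity ((2 * fst (f t) * a + 2 * snd (f t) * b) / (2 * (q * q))); [field; lra|].
  rewrite Q; field; nra.
- unfold clog; simpl.
  assert (I := is_derive_inv _ _ _ A1 (Rgt_not_eq _ _ pos)).
  eapply is_derive_eq.
  + exact (is_derive_Rcomp atan (fun x => snd (f x) * / fst (f x)) _ _ _ (is_derive_atan _)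
             (is_derive_Rmult _ _ _ _ _ A2 I)).
  + simpl; unfold Rsqr; field; repeat split; nra.
Qed.

(** The domain is any uniform space: the same rules then serve for curves and for functions of two
    real variables, as differentiation under the integral requires. *)
Definition Ccont {U : UniformSpace} (f : U -> C) (x : U) : Prop :=
  continuous (fun u => fst (f u)) x /\ continuous (fun u => snd (f u)) x.

Section ContinuityRules.
Context {U : UniformSpace}.
Implicit Types (f g : U -> C) (x : U).

Lemma Ccont_const (c : C) x : Ccont (fun _ => c) x.
Proof. split; apply continuous_const. Qed.

Lemma Ccont_RtoC (r : U -> R) x : continuous r x -> Ccont (fun u => RtoC (r u)) x.
Proof. intros; split; [assumption | apply continuous_const]. Qed.

Lemma Ccont_pair (r s : U -> R) x :
  continuous r x -> continuous s x -> Ccont (fun u => (r u, s u)) x.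
Proof. now split. Qed.

Lemma Ccont_plus f g x : Ccont f x -> Ccont g x -> Ccont (fun u => f u + g u)%C x.
Proof.
intros [A1 A2] [B1 B2]; split; simpl.
- exact (continuous_plus (V := R_NormedModule) _ _ _ A1 B1).
- exact (continuous_plus (V := R_NormedModule) _ _ _ A2 B2).
Qed.

Lemma Ccont_opp f x : Ccont f x -> Ccont (fun u => - f u)%C x.
Proof.
intros [A1 A2]; split; simpl.
- exact (continuous_opp (V := R_NormedModule) _ _ A1).
- exact (continuous_opp (V := R_NormedModule) _ _ A2).
Qed.

Lemma Ccont_minus f g x : Ccont f x -> Ccont g x -> Ccont (fun u => f u - g u)%C x.
Proof. intros; apply Ccont_plus; [|apply Ccont_opp]; assumption. Qed.

Lemma Ccont_mult f g x : Ccont f x -> Ccont g x -> Ccont (fun u => f u * g u)%C x.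
Proof.
intros [A1 A2] [B1 B2]; split; simpl.
- exact (continuous_minus (V := R_NormedModule) _ _ _
    (continuous_mult (K := R_AbsRing) _ _ _ A1 B1) (continuous_mult (K := R_AbsRing) _ _ _ A2 B2)).
- exact (continuous_plus (V := R_NormedModule) _ _ _
    (continuous_mult (K := R_AbsRing) _ _ _ A1 B2) (continuous_mult (K := R_AbsRing) _ _ _ A2 B1)).
Qed.

Lemma continuous_comp_R (h : R -> R) (r : U -> R) x :
  continuous r x -> continuous h (r x) -> continuous (fun u => h (r u)) x.
Proof. intros; now apply (continuous_comp r h). Qed.

Lemma continuous_Rmult (r s : U -> R) x :
  continuous r x -> continuous s x -> continuous (fun u => r u * s u) x.
Proof. intros A B; exact (continuous_mult (K := R_AbsRing) _ _ _ A B). Qed.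

Lemma continuous_Rplus (r s : U -> R) x :
  continuous r x -> continuous s x -> continuous (fun u => r u + s u) x.
Proof. intros A B; exact (continuous_plus (V := R_NormedModule) _ _ _ A B). Qed.

Lemma continuous_sqr_sum f x :
  Ccont f x -> continuous (fun u => fst (f u) ^ 2 + snd (f u) ^ 2) x.
Proof.
intros [A1 A2]; apply continuous_Rplus; simpl;
  repeat (apply continuous_Rmult; try assumption); apply continuous_const.
Qed.

Lemma Ccont_inv f x : Ccont f x -> f x <> 0 -> Ccont (fun u => / f u)%C x.
Proof.
intros A nz; pose proof (Csqr_pos _ nz) as pos.
assert (I : continuous (fun u => / (fst (f u) ^ 2 + snd (f u) ^ 2)) x).
{ apply (continuous_comp_R Rinv); [now apply continuous_sqr_sum|].
  apply continuous_Rinv; lra. }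
destruct A as [A1 A2]; split; unfold Cinv; simpl fst; simpl snd; apply continuous_Rmult; auto.
exact (continuous_opp (V := R_NormedModule) _ _ A2).
Qed.

Lemma Ccont_div f g x :
  Ccont f x -> Ccont g x -> g x <> 0 -> Ccont (fun u => f u / g u)%C x.
Proof. intros; apply Ccont_mult; [|apply Ccont_inv]; assumption. Qed.

Lemma Ccont_cexp f x : Ccont f x -> Ccont (fun u => cexp (f u)) x.
Proof.
intros [A1 A2]; split; unfold cexp; simpl; apply continuous_Rmult.
- apply (continuous_comp_R exp); [assumption | apply continuous_exp].
- apply (continuous_comp_R cos); [assumption | apply continuous_cos].
- apply (continuous_comp_R exp); [assumption | apply continuous_exp].
- apply (continuous_comp_R sin); [assumption | apply continuous_sin].
Qed.

Lemma Ccont_clog f x : Ccont f x -> 0 < fst (f x) -> Ccont (fun u => clog (f u)) x.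
Proof.
intros A pos; pose proof (Csqr_pos _ (Cneq_fst _ pos)) as pos2.
assert (B := continuous_sqr_sum _ _ A); destruct A as [A1 A2].
split; unfold clog, Cmod; simpl fst; simpl snd.
- apply (continuous_comp_R ln).
  + apply (continuous_comp_R sqrt); [exact B | apply continuous_sqrt].
  + apply continuous_ln, sqrt_lt_R0, pos2.
- apply (continuous_comp_R atan); [|apply continuous_atan].
  apply continuous_Rmult; [assumption|].
  apply (continuous_comp_R Rinv); [assumption|]; apply continuous_Rinv; lra.
Qed.

End ContinuityRules.

Lemma Cder_Ccont (f : R -> C) (t : R) (l : C) : Cder f t l -> Ccont f t.
Proof.
intros [A B]; split; apply @ex_derive_continuous; eexists; eassumption.
Qed.

(** * Limits and absolutely convergent series of complex numbers *)

(** One notion for all filters: sequences, continuity at a point and difference quotients obey the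
    same rules, and one dominated convergence theorem covers them. *)
Definition Clim {T : Type} (F : (T -> Prop) -> Prop) (f : T -> C) (l : C) : Prop :=
  forall eps : posreal, F (fun x => Cmod (f x - l)%C < eps).

Section Limits.
Context {T : Type} (F : (T -> Prop) -> Prop) {FF : Filter F}.
Implicit Types (f g : T -> C) (a b l : C).

Lemma Clim_ext f g l : (forall x, f x = g x) -> Clim F f l -> Clim F g l.
Proof.
intros E L eps; apply (filter_imp (fun x => Cmod (f x - l)%C < eps)); [|apply L].
intros x; now rewrite E.
Qed.

Lemma Clim_eq f a b : Clim F f a -> a = b -> Clim F f b.
Proof. now intros L <-. Qed.

Lemma Clim_ext_loc f g l : F (fun x => f x = g x) -> Clim F f l -> Clim F g l.
Proof.
intros E L eps; generalize (filter_and _ _ E (L eps)); apply filter_imp.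
intros x [Ex H]; now rewrite <- Ex.
Qed.

Lemma Clim_squeeze f l (r : T -> R) :
  F (fun x => Cmod (f x - l)%C <= r x) ->
  (forall eps : posreal, F (fun x => r x < eps)) -> Clim F f l.
Proof.
intros B L eps; generalize (filter_and _ _ B (L eps)); apply filter_imp.
intros x [H1 H2]; lra.
Qed.

Lemma Clim_const l : Clim F (fun _ => l) l.
Proof.
intros eps; apply filter_forall; intros _.
replace (l - l)%C with (RtoC 0) by ring; rewrite Cmod_0; apply cond_pos.
Qed.

Lemma Clim_plus f g a b :
  Clim F f a -> Clim F g b -> Clim F (fun x => f x + g x)%C (a + b)%C.
Proof.
intros A B eps.
assert (pos : 0 < eps / 2) by (pose proof (cond_pos eps); lra).
generalize (filter_and _ _ (A (mkposreal _ pos)) (B (mkposreal _ pos))).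
apply filter_imp; intros x [H1 H2]; simpl in H1, H2.
replace (f x + g x - (a + b))%C with ((f x - a) + (g x - b))%C by ring.
pose proof (Cmod_triangle (f x - a) (g x - b)); lra.
Qed.

Lemma Clim_scal f a (c : C) : Clim F f a -> Clim F (fun x => c * f x)%C (c * a)%C.
Proof.
intros A eps; pose proof (Cmod_ge_0 c) as pc.
assert (pos : 0 < eps / (Cmod c + 1)).
{ apply Rdiv_lt_0_compat; [apply cond_pos | lra]. }
generalize (A (mkposreal _ pos)); apply filter_imp; intros x H; simpl in H.
replace (c * f x - c * a)%C with (c * (f x - a))%C by ring.
rewrite Cmod_mult; apply (Rle_lt_trans _ (Cmod c * (eps / (Cmod c + 1)))).
- apply Rmult_le_compat_l; lra.
- apply (Rmult_lt_reg_r (Cmod c + 1)); [lra|].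
  replace (Cmod c * (eps / (Cmod c + 1)) * (Cmod c + 1)) with (Cmod c * eps) by (field; lra).
  pose proof (cond_pos eps); nra.
Qed.

Lemma Clim_minus f g a b :
  Clim F f a -> Clim F g b -> Clim F (fun x => f x - g x)%C (a - b)%C.
Proof.
intros A B; apply Clim_plus; [exact A|].
apply (Clim_ext (fun x => (-1) * g x)%C); [intros; ring|].
replace (- b)%C with ((-1) * b)%C by ring; now apply Clim_scal.
Qed.

Lemma Clim_mult f g a b :
  Clim F f a -> Clim F g b -> Clim F (fun x => f x * g x)%C (a * b)%C.
Proof.
intros A B.
assert (Z : Clim F (fun x => (f x - a) * (g x - b))%C 0).
{ intros eps.
  assert (pos : 0 < Rmin 1 eps) by (apply Rmin_glb_lt; [lra | apply cond_pos]).
  generalize (filter_and _ _ (A (mkposreal _ pos)) (B (mkposreal _ pos))).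
  apply filter_imp; intros x [H1 H2]; simpl in H1, H2.
  replace ((f x - a) * (g x - b) - 0)%C with ((f x - a) * (g x - b))%C by ring.
  rewrite Cmod_mult.
  pose proof (Rmin_l 1 eps); pose proof (Rmin_r 1 eps).
  pose proof (Cmod_ge_0 (f x - a)); pose proof (Cmod_ge_0 (g x - b)); nra. }
apply (Clim_ext (fun x => (f x - a) * (g x - b) + (b * f x + a * g x) - a * b)%C);
  [intros; ring|].
eapply Clim_eq.
- apply Clim_minus; [apply Clim_plus; [exact Z|apply Clim_plus; apply Clim_scal; eassumption]|].
  apply Clim_const.
- ring.
Qed.

Lemma Clim_inv f a : Clim F f a -> a <> 0 -> Clim F (fun x => / f x)%C (/ a)%C.
Proof.
intros A nz eps; apply Cmod_gt_0 in nz as pos.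
assert (p1 : 0 < Rmin (Cmod a / 2) (eps * (Cmod a * Cmod a) / 2)).
{ apply Rmin_glb_lt; [lra|]; pose proof (cond_pos eps).
  assert (0 < Cmod a * Cmod a) by nra; nra. }
generalize (A (mkposreal _ p1)); apply filter_imp; intros x H; simpl in H.
pose proof (Rmin_l (Cmod a / 2) (eps * (Cmod a * Cmod a) / 2)) as M1.
pose proof (Rmin_r (Cmod a / 2) (eps * (Cmod a * Cmod a) / 2)) as M2.
assert (G : Cmod a / 2 < Cmod (f x)).
{ pose proof (Cmod_triangle (f x) (a - f x)) as Tr.
  replace (f x + (a - f x))%C with a in Tr by ring.
  replace (a - f x)%C with (- (f x - a))%C in Tr by ring.
  rewrite Cmod_opp in Tr; lra. }
assert (nzf : f x <> 0) by (apply Cmod_gt_0; lra).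
replace (/ f x - / a)%C with (- (f x - a) * / (f x * a))%C by (field; auto).
rewrite Cmod_mult, Cmod_opp, Cmod_inv, Cmod_mult by (now apply Cmult_neq_0).
apply (Rmult_lt_reg_r (Cmod (f x) * Cmod a)); [nra|].
rewrite Rmult_assoc, Rinv_l, Rmult_1_r by nra.
apply (Rlt_le_trans _ (eps * (Cmod a * Cmod a) / 2)); [lra|].
pose proof (cond_pos eps); assert (0 < eps * Cmod a) by nra; nra.
Qed.

End Limits.

Lemma Clim_unique {T : Type} (F : (T -> Prop) -> Prop) {FF : ProperFilter F}
  (f : T -> C) (a b : C) : Clim F f a -> Clim F f b -> a = b.
Proof.
intros A B; apply Ceq_minus, Cmod_eq_0.
destruct (Rle_lt_or_eq_dec 0 _ (Cmod_ge_0 (a - b))) as [pos|E]; [exfalso|now symmetry].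
assert (p2 : 0 < Cmod (a - b) / 2) by lra.
destruct (filter_ex _ (filter_and _ _ (A (mkposreal _ p2)) (B (mkposreal _ p2))))
  as [x [H1 H2]]; simpl in H1, H2.
pose proof (Cmod_triangle (a - f x) (f x - b)) as Tr.
replace ((a - f x) + (f x - b))%C with (a - b)%C in Tr by ring.
replace (a - f x)%C with (- (f x - a))%C in Tr by ring.
rewrite Cmod_opp in Tr; lra.
Qed.

Lemma Clim_le {T : Type} (F : (T -> Prop) -> Prop) {FF : ProperFilter F}
  (f : T -> C) (l : C) (M : R) :
  Clim F f l -> F (fun x => Cmod (f x) <= M) -> Cmod l <= M.
Proof.
intros A B; destruct (Rle_lt_dec (Cmod l) M) as [|lt]; [assumption|exfalso].
assert (p : 0 < Cmod l - M) by lra.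
destruct (filter_ex _ (filter_and _ _ (A (mkposreal _ p)) B)) as [x [H1 H2]]; simpl in H1.
pose proof (Cmod_triangle (l - f x) (f x)) as Tr.
replace (l - f x + f x)%C with l in Tr by ring.
replace (l - f x)%C with (- (f x - l))%C in Tr by ring.
rewrite Cmod_opp in Tr; lra.
Qed.

Lemma Clim_components {T : Type} (F : (T -> Prop) -> Prop) {FF : Filter F} (f : T -> C) (l : C) :
  Clim F f l <-> filterlim (fun x => fst (f x)) F (locally (fst l)) /\
                 filterlim (fun x => snd (f x)) F (locally (snd l)).
Proof.
split.
- intros L; split; apply filterlim_locally; intros eps; generalize (L eps); apply filter_imp;
    intros x H; unfold ball; simpl; unfold AbsRing_ball, abs, minus, plus, opp; simpl;
    (eapply Rle_lt_trans; [|exact H]).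
  + exact (fst_le_Cmod (f x - l)%C).
  + exact (snd_le_Cmod (f x - l)%C).
- intros [A B] eps.
  assert (pos : 0 < eps / 2) by (pose proof (cond_pos eps); lra).
  generalize (filter_and _ _ (proj1 (filterlim_locally _ _) A (mkposreal _ pos))
    (proj1 (filterlim_locally _ _) B (mkposreal _ pos))); apply filter_imp; intros x [H1 H2].
  unfold ball in H1, H2; simpl in H1, H2.
  unfold AbsRing_ball, abs, minus, plus, opp in H1, H2; simpl in H1, H2.
  pose proof (Cmod_le_sum (f x - l)%C) as S; simpl in S; lra.
Qed.

Lemma Ccont_Clim {U : UniformSpace} (f : U -> C) (x : U) : Ccont f x <-> Clim (locally x) f (f x).
Proof. split; intros H; [apply (Clim_components (locally x))|apply (Clim_components (locally x)) in H]; exact H. Qed.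

(** With difference quotients as limits along the punctured neighbourhood filter, termwise
    differentiation becomes an instance of [Tannery]. *)
Lemma Cder_Clim (f : R -> C) (t : R) (l : C) :
  Cder f t l <-> Clim (locally' 0) (fun h => (f (t + h)%R - f t) / RtoC h)%C l.
Proof.
assert (E : forall (g : R -> R) (m : R), is_derive g t m <->
  filterlim (fun h => (g (t + h) - g t) / h) (locally' 0) (locally m)).
{ intros g m; rewrite is_derive_Reals; unfold derivable_pt_lim; split.
  - intros D; apply filterlim_locally; intros eps.
    destruct (D eps (cond_pos eps)) as [d Hd]; exists d; intros h Bh nz.
    unfold ball in *; simpl in *; unfold AbsRing_ball, abs, minus, plus, opp in *; simpl in *.
    apply Hd; [exact nz|]; now replace h with (h + - 0) by ring.
  - intros L eps pos; apply filterlim_locally with (eps := mkposreal _ pos) in L.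
    destruct L as [d Hd]; exists d; intros h nz Bh; apply (Hd h); [|exact nz].
    unfold ball; simpl; unfold AbsRing_ball, abs, minus, plus, opp; simpl.
    now replace (h + - 0) with h by ring. }
assert (nz' : locally' 0 (fun h : R => h <> 0)).
{ exists (mkposreal 1 Rlt_0_1); intros; assumption. }
rewrite (Clim_components (locally' 0)).
pose proof (E (fun x => fst (f x)) (fst l)) as E1.
pose proof (E (fun x => snd (f x)) (snd l)) as E2.
split; intros [A B]; split.
- apply E1 in A; eapply filterlim_ext_loc; [|exact A].
  generalize nz'; apply filter_imp; intros h nz; unfold Cdiv; simpl; field; auto.
- apply E2 in B; eapply filterlim_ext_loc; [|exact B].
  generalize nz'; apply filter_imp; intros h nz; unfold Cdiv; simpl; field; auto.
- apply E1; eapply filterlim_ext_loc; [|exact A].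
  generalize nz'; apply filter_imp; intros h nz; unfold Cdiv; simpl; field; auto.
- apply E2; eapply filterlim_ext_loc; [|exact B].
  generalize nz'; apply filter_imp; intros h nz; unfold Cdiv; simpl; field; auto.
Qed.

Lemma Series_0 (a : nat -> R) : (forall n, a n = 0) -> Series a = 0.
Proof.
intros Z; rewrite (Series_ext _ (fun n => 0 * 0)) by (intros n; rewrite Z; ring).
now rewrite Series_scal_l, Rmult_0_l.
Qed.

(** Used under [Csum], that is, absolute convergence, where both component series converge. *)
Definition CSer (a : nat -> C) : C :=
  (Series (fun n => fst (a n)), Series (fun n => snd (a n))).

Definition Csum (a : nat -> C) : Prop := ex_series (fun n => Cmod (a n)).

Lemma Csum_le (a : nat -> C) (M : nat -> R) :
  (forall n, Cmod (a n) <= M n) -> ex_series M -> Csum a.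
Proof.
intros B E; apply (ex_series_le (V := R_CompleteNormedModule) _ M); [|exact E].
intros n; unfold norm; simpl; unfold abs; simpl; rewrite Rabs_pos_eq; auto using Cmod_ge_0.
Qed.

Lemma Csum_ext (a b : nat -> C) : (forall n, a n = b n) -> Csum a -> Csum b.
Proof. intros E; apply ex_series_ext; intros n; now rewrite E. Qed.

Lemma Csum_ex (a : nat -> C) :
  Csum a -> ex_series (fun n => fst (a n)) /\ ex_series (fun n => snd (a n)).
Proof.
intros A; split; (apply (ex_series_le (V := R_CompleteNormedModule) _ _ ) with (2 := A));
  intros n; unfold norm; simpl; unfold abs; simpl; [apply fst_le_Cmod|apply snd_le_Cmod].
Qed.

Lemma CSer_ext (a b : nat -> C) : (forall n, a n = b n) -> CSer a = CSer b.
Proof.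
intros E; unfold CSer; f_equal; apply Series_ext; intros n; now rewrite E.
Qed.

Lemma Csum_plus (a b : nat -> C) : Csum a -> Csum b -> Csum (fun n => a n + b n)%C.
Proof.
intros A B; apply (Csum_le _ (fun n => Cmod (a n) + Cmod (b n))).
- intros n; apply Cmod_triangle.
- now apply (ex_series_plus (V := R_NormedModule)).
Qed.

Lemma Csum_scal (c : C) (a : nat -> C) : Csum a -> Csum (fun n => c * a n)%C.
Proof.
intros A; apply (ex_series_ext (fun n => Cmod c * Cmod (a n))).
- intros n; now rewrite Cmod_mult.
- now apply (ex_series_scal_l (K := R_AbsRing) (V := R_NormedModule) (Cmod c)).
Qed.

Lemma Csum_opp (a : nat -> C) : Csum a -> Csum (fun n => - a n)%C.
Proof. apply ex_series_ext; intros n; now rewrite Cmod_opp. Qed.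

Lemma Csum_minus (a b : nat -> C) : Csum a -> Csum b -> Csum (fun n => a n - b n)%C.
Proof. intros A B; apply Csum_plus; [|apply Csum_opp]; assumption. Qed.

Lemma CSer_plus (a b : nat -> C) :
  Csum a -> Csum b -> CSer (fun n => a n + b n)%C = (CSer a + CSer b)%C.
Proof.
intros A B; apply Csum_ex in A; apply Csum_ex in B; destruct A, B.
apply C_eta; simpl; apply Series_plus; assumption.
Qed.

Lemma CSer_opp (a : nat -> C) : CSer (fun n => - a n)%C = (- CSer a)%C.
Proof. apply C_eta; simpl; apply Series_opp. Qed.

Lemma CSer_minus (a b : nat -> C) :
  Csum a -> Csum b -> CSer (fun n => a n - b n)%C = (CSer a - CSer b)%C.
Proof.
intros A B; unfold Cminus; rewrite <- CSer_opp; apply CSer_plus; [|apply Csum_opp]; assumption.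
Qed.

Lemma CSer_scal (c : C) (a : nat -> C) : Csum a -> CSer (fun n => c * a n)%C = (c * CSer a)%C.
Proof.
intros A; apply Csum_ex in A; destruct A as [A1 A2].
apply C_eta; simpl.
- rewrite Series_minus, !Series_scal_l; [reflexivity| |];
    now apply (ex_series_scal_l (K := R_AbsRing) (V := R_NormedModule)).
- rewrite Series_plus, !Series_scal_l; [reflexivity| |];
    now apply (ex_series_scal_l (K := R_AbsRing) (V := R_NormedModule)).
Qed.

Lemma CSer_RtoC (a : nat -> R) : CSer (fun n => RtoC (a n)) = RtoC (Series a).
Proof. apply C_eta; simpl; [reflexivity|]; apply Series_0; reflexivity. Qed.

(** Bounding the components separately would lose a constant. Multiplying by the conjugate of the
    sum [S] rotates it onto the real axis: [|S|^2] is the real part of the sum of [Cconj S * a n],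
    hence at most [|S|] times the sum of the moduli. *)
Lemma CSer_bound (a : nat -> C) : Csum a -> Cmod (CSer a) <= Series (fun n => Cmod (a n)).
Proof.
intros A.
destruct (Rle_lt_or_eq_dec 0 _ (Cmod_ge_0 (CSer a))) as [pos|E].
2:{ rewrite <- E; apply (Rle_trans _ (Series (fun _ => 0))).
    - rewrite Series_0; [apply Rle_refl | reflexivity].
    - apply Series_le; [|exact A]; intros n; split; [lra|apply Cmod_ge_0]. }
set (S := CSer a) in *.
assert (Q : Cmod S * Cmod S = fst (Cconj S * S)%C).
{ pose proof (Cmod2_alt S) as Q; unfold Re, Im in Q; simpl in *; lra. }
assert (L : fst (Cconj S * S)%C <= Series (fun n => Cmod S * Cmod (a n))).
{ unfold S at 2; rewrite <- (CSer_scal _ _ A); unfold CSer; simpl fst.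
  assert (X : Csum (fun n => Cconj S * a n)%C) by now apply Csum_scal.
  eapply Rle_trans; [apply Rle_abs|].
  eapply Rle_trans; [apply Series_Rabs|].
  - eapply (ex_series_le (V := R_CompleteNormedModule)); [|exact X].
    intros n; unfold norm; simpl; unfold abs; simpl; rewrite Rabs_Rabsolu.
    apply (fst_le_Cmod (Cconj S * a n)%C).
  - apply Series_le.
    + intros n; split; [apply Rabs_pos|].
      eapply Rle_trans; [apply (fst_le_Cmod (Cconj S * a n)%C)|].
      rewrite Cmod_mult, Cmod_conj; apply Rle_refl.
    + now apply (ex_series_scal_l (K := R_AbsRing) (V := R_NormedModule)). }
rewrite Series_scal_l, <- Q in L; now apply Rmult_le_reg_l in L.
Qed.

Lemma CSer_le (a : nat -> C) (M : nat -> R) :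
  (forall n, Cmod (a n) <= M n) -> ex_series M -> Cmod (CSer a) <= Series M.
Proof.
intros B E; eapply Rle_trans; [apply CSer_bound; now apply (Csum_le _ M)|].
apply Series_le; [|exact E]; intros n; split; [apply Cmod_ge_0|apply B].
Qed.

Lemma Csum_shift (a : nat -> C) : Csum a <-> Csum (fun n => a (S n)).
Proof.
unfold Csum; rewrite (ex_series_incr_1 (V := R_NormedModule) (fun n => Cmod (a n))).
reflexivity.
Qed.

Lemma CSer_shift (a : nat -> C) : Csum a -> CSer a = (a 0%nat + CSer (fun n => a (S n)))%C.
Proof.
intros A; apply Csum_ex in A; destruct A as [A1 A2]; apply C_eta; simpl.
- now rewrite Series_incr_1.
- now rewrite Series_incr_1.
Qed.

Lemma Csum_shift_n (a : nat -> C) (N : nat) : Csum a <-> Csum (fun n => a (N + n)%nat).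
Proof.
unfold Csum; rewrite (ex_series_incr_n (V := R_NormedModule) (fun n => Cmod (a n)) N).
reflexivity.
Qed.

(* Unlike [sum_n a N], this has [N] terms. *)
Fixpoint Csumn (a : nat -> C) (N : nat) : C :=
  match N with O => 0 | S M => (Csumn a M + a M)%C end.

Lemma Csumn_ext (a b : nat -> C) (N : nat) :
  (forall n, (n < N)%nat -> a n = b n) -> Csumn a N = Csumn b N.
Proof.
induction N as [|N IH]; intros E; simpl; [reflexivity|].
rewrite IH, E by auto; reflexivity.
Qed.

Lemma Csumn_plus (a b : nat -> C) (N : nat) :
  Csumn (fun n => a n + b n)%C N = (Csumn a N + Csumn b N)%C.
Proof. induction N as [|N IH]; simpl; [ring | rewrite IH; ring]. Qed.

Lemma Csumn_scal (c : C) (a : nat -> C) (N : nat) :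
  Csumn (fun n => c * a n)%C N = (c * Csumn a N)%C.
Proof. induction N as [|N IH]; simpl; [ring | rewrite IH; ring]. Qed.

Lemma Csumn_shift (a : nat -> C) (N : nat) :
  Csumn a (S N) = (a 0%nat + Csumn (fun n => a (S n)) N)%C.
Proof. induction N as [|N IH]; [simpl; ring|]; simpl in *; rewrite IH; ring. Qed.

Lemma Csumn_split (a : nat -> C) (M N : nat) :
  Csumn a (M + N) = (Csumn a M + Csumn (fun n => a (M + n)%nat) N)%C.
Proof.
induction N as [|N IH]; simpl; [rewrite Nat.add_0_r; ring|].
rewrite Nat.add_succ_r; simpl; rewrite IH; ring.
Qed.

Lemma Csumn_telescope (a : nat -> C) (N : nat) :
  Csumn (fun n => a (S n) - a n)%C N = (a N - a 0%nat)%C.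
Proof. induction N as [|N IH]; simpl; [ring | rewrite IH; ring]. Qed.

Lemma Csumn_sum_n (a : nat -> C) (N : nat) :
  Csumn a (S N) = sum_n (G := C_AbelianMonoid) a N.
Proof.
induction N as [|N IH]; [rewrite sum_O; apply Cplus_0_l|].
rewrite sum_Sn, <- IH; reflexivity.
Qed.

Lemma Csumn_Cmod_le (a : nat -> C) (N : nat) (M : R) :
  (forall n, (n < N)%nat -> Cmod (a n) <= M) -> Cmod (Csumn a N) <= INR N * M.
Proof.
induction N as [|N IH]; intros B; simpl Csumn.
- rewrite Cmod_0; simpl; lra.
- rewrite S_INR; pose proof (Cmod_triangle (Csumn a N) (a N)).
  pose proof (B N (Nat.lt_succ_diag_r N)); assert (Cmod (Csumn a N) <= INR N * M) by auto; lra.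
Qed.

Lemma CSer_split (a : nat -> C) (N : nat) :
  Csum a -> CSer a = (Csumn a N + CSer (fun n => a (N + n)%nat))%C.
Proof.
revert a; induction N as [|N IH]; intros a A; simpl; [symmetry; apply Cplus_0_l|].
rewrite (IH a A), (CSer_shift (fun n => a (N + n)%nat)) by now apply Csum_shift_n.
rewrite Nat.add_0_r.
rewrite (CSer_ext (fun n => a (N + S n)%nat) (fun n => a (S (N + n))))
  by (intros; f_equal; lia).
apply Cplus_assoc.
Qed.

Lemma Series_tail (M : nat -> R) (eps : posreal) :
  (forall n, 0 <= M n) -> ex_series M -> exists N, Series (fun n => M (N + n)%nat) < eps.
Proof.
intros P E; destruct E as [l L]; pose proof (is_series_unique _ _ L) as U.
assert (L' : is_lim_seq (sum_n M) l) by exact L.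
apply is_lim_seq_spec in L'; destruct (L' eps) as [N H].
exists (S N); specialize (H N (Nat.le_refl N)).
assert (X := Series_incr_n M (S N) (Nat.lt_0_succ N) (ex_intro _ l L)).
simpl pred in X; rewrite <- sum_n_Reals, U in X.
apply Rabs_def2 in H; lra.
Qed.

(** The first [N] terms converge one by one, and both tails are below the tail of [M], which is
    small. This is dominated convergence for series, along any filter. *)
Lemma Tannery {T : Type} (F : (T -> Prop) -> Prop) {FF : ProperFilter F}
  (a : T -> nat -> C) (l : nat -> C) (M : nat -> R) :
  ex_series M ->
  F (fun x => forall n, Cmod (a x n) <= M n) ->
  (forall n, Clim F (fun x => a x n) (l n)) ->
  Clim F (fun x => CSer (a x)) (CSer l).
Proof.
intros E B L.
assert (Bl : forall n, Cmod (l n) <= M n).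
{ intros n; apply (Clim_le F (fun x => a x n)); [apply L|].
  revert B; apply filter_imp; auto. }
assert (P : forall n, 0 <= M n) by (intros n; eapply Rle_trans; [apply Cmod_ge_0|apply Bl]).
assert (Sl : Csum l) by now apply (Csum_le _ M).
intros eps.
assert (p4 : 0 < eps / 4) by (pose proof (cond_pos eps); lra).
destruct (Series_tail M (mkposreal _ p4) P E) as [N TN]; simpl in TN.
assert (ET : ex_series (fun n => M (N + n)%nat)) by now apply (ex_series_incr_n (V := R_NormedModule) M N).
assert (LN : Clim F (fun x => Csumn (a x) N) (Csumn l N)).
{ clear TN ET; induction N as [|N IH]; simpl; [apply Clim_const; apply FF|].
  apply Clim_plus; [apply FF|exact IH|apply L]. }
generalize (filter_and _ _ B (LN (mkposreal _ p4))); apply filter_imp; intros x [Bx Hx]; simpl in Hx.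
assert (Sx : Csum (a x)) by now apply (Csum_le _ M).
rewrite (CSer_split (a x) N Sx), (CSer_split l N Sl).
assert (T1 := CSer_le (fun n => a x (N + n)%nat) (fun n => M (N + n)%nat) (fun n => Bx _) ET).
assert (T2 := CSer_le (fun n => l (N + n)%nat) (fun n => M (N + n)%nat) (fun n => Bl _) ET).
set (r1 := CSer (fun n => a x (N + n)%nat)) in *; set (r2 := CSer (fun n => l (N + n)%nat)) in *.
replace (Csumn (a x) N + r1 - (Csumn l N + r2))%C
  with ((Csumn (a x) N - Csumn l N) + (r1 + - r2))%C by ring.
pose proof (Cmod_triangle (Csumn (a x) N - Csumn l N) (r1 + - r2)).
pose proof (Cmod_triangle r1 (- r2)); rewrite Cmod_opp in *.
pose proof (cond_pos eps); lra.
Qed.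

Lemma CSer_Clim (a : nat -> C) : Csum a -> Clim eventually (fun N => Csumn a N) (CSer a).
Proof.
intros A eps.
destruct (Series_tail (fun n => Cmod (a n)) eps (fun n => Cmod_ge_0 _) A) as [N TN].
exists N; intros n le.
rewrite (CSer_split a n A).
replace (Csumn a n - (Csumn a n + CSer (fun k => a (n + k)%nat)))%C
  with (- CSer (fun k => a (n + k)%nat))%C by ring.
rewrite Cmod_opp; eapply Rle_lt_trans; [apply CSer_bound; now apply Csum_shift_n|].
eapply Rle_lt_trans; [|exact TN].
assert (E : ex_series (fun k => Cmod (a (N + k)%nat))) by now apply (Csum_shift_n a N).
destruct (Nat.eq_dec n N) as [->|ne]; [apply Rle_refl|].
rewrite (Series_incr_n (fun k => Cmod (a (N + k)%nat)) (n - N)) by (lia || exact E).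
rewrite (Series_ext (fun k => Cmod (a (N + (n - N + k))%nat)) (fun k => Cmod (a (n + k)%nat)))
  by (intros; do 2 f_equal; lia).
assert (0 <= sum_f_R0 (fun k => Cmod (a (N + k)%nat)) (pred (n - N)))
  by (apply cond_pos_sum; intros; apply Cmod_ge_0); lra.
Qed.

Lemma CSer_unique (a : nat -> C) (l : C) :
  Csum a -> Clim eventually (fun N => Csumn a N) l -> CSer a = l.
Proof. intros A; apply Clim_unique; [apply eventually_filter | now apply CSer_Clim]. Qed.

Lemma Csumn_CSer (a : nat -> nat -> C) (N : nat) :
  (forall n, Csum (fun m => a m n)) ->
  Csumn (fun n => CSer (fun m => a m n)) N = CSer (fun m => Csumn (a m) N) /\
  Csum (fun m => Csumn (a m) N).
Proof.
intros A; induction N as [|N [IH1 IH2]]; simpl.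
- split; [rewrite CSer_RtoC, Series_0; reflexivity|].
  exists 0; eapply is_series_ext; [intros n; symmetry; apply Cmod_0|].
  unfold is_series; eapply filterlim_ext; [intros n; symmetry; apply sum_n_const|].
  eapply filterlim_ext; [intros n; symmetry; apply Rmult_0_r|]; apply filterlim_const.
- rewrite IH1, <- CSer_plus by auto; split; [reflexivity|now apply Csum_plus].
Qed.

(** Finitely many columns can be exchanged with the rows by additivity, and their number tends to
    infinity by [Tannery], each partial row sum being dominated by the sum of the moduli of its row.
    The last conclusion records the convergence of the partial sums over columns. *)
Lemma CSer_fubini (a : nat -> nat -> C) :
  (forall m, Csum (a m)) -> ex_series (fun m => Series (fun n => Cmod (a m n))) ->
  (forall n, Csum (fun m => a m n)) /\
  CSer (fun m => CSer (a m)) = CSer (fun n => CSer (fun m => a m n)) /\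
  Clim eventually (Csumn (fun n => CSer (fun m => a m n))) (CSer (fun m => CSer (a m))).
Proof.
intros A E.
assert (B : forall m n, Cmod (a m n) <= Series (fun n => Cmod (a m n))).
{ intros m n.
  assert (X := Series_incr_n (fun n => Cmod (a m n)) (S n) (Nat.lt_0_succ n) (A m)); rewrite X.
  assert (0 <= Series (fun k => Cmod (a m (S n + k)%nat))).
  { apply (Rle_trans _ (Series (fun _ => 0))); [rewrite Series_0; [lra|reflexivity]|].
    apply Series_le.
    - intros; split; [lra|apply Cmod_ge_0].
    - apply (ex_series_incr_n (V := R_NormedModule) (fun n => Cmod (a m n)) (S n)), A. }
  simpl pred; destruct n; [simpl in *; lra|].
  simpl sum_f_R0; assert (0 <= sum_f_R0 (fun n => Cmod (a m n)) n)
    by (apply cond_pos_sum; intros; apply Cmod_ge_0); lra. }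
assert (S : forall n, Csum (fun m => a m n)) by (intros n; eapply Csum_le; [|exact E]; intros; apply B).
assert (L : Clim eventually (Csumn (fun n => CSer (fun m => a m n))) (CSer (fun m => CSer (a m)))).
{ apply (Clim_ext _ (fun N => CSer (fun m => Csumn (a m) N))).
  - intros N; symmetry; now apply Csumn_CSer.
  - apply (Tannery eventually _ _ _ E).
    + exists 0%nat; intros N _ m.
      clear - A.
      (* A partial sum is the sum of a series cut off by zeros, so that [CSer_le] bounds it. *)
      assert (X : Csum (fun n => if (n <? N)%nat then a m n else 0)).
      { eapply Csum_le; [|exact (A m)]; intros n; destruct (n <? N)%nat;
          [apply Rle_refl|rewrite Cmod_0; apply Cmod_ge_0]. }
      assert (Y := CSer_split _ N X); cbv beta in Y.
      rewrite (CSer_ext (fun n => if (N + n <? N)%nat then a m (N + n)%nat else 0) (fun _ => RtoC 0)),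
        CSer_RtoC, Series_0 in Y;
        [|reflexivity|intros n; destruct (Nat.ltb_spec (N + n) N); [lia|reflexivity]].
      rewrite (Csumn_ext _ (fun n => a m n)) in Y
        by (intros n lt; destruct (Nat.ltb_spec n N); [reflexivity|lia]).
      change (Csumn (a m) N) with (Csumn (fun n => a m n) N).
      rewrite Cplus_0_r in Y; rewrite <- Y; apply CSer_le; [|exact (A m)].
      intros n; destruct (n <? N)%nat; [apply Rle_refl|rewrite Cmod_0; apply Cmod_ge_0].
    + intros m; now apply CSer_Clim. }
split; [exact S|split; [|exact L]].
apply Clim_components in L; [|apply eventually_filter].
symmetry; apply C_eta; unfold CSer; simpl.
all: apply is_series_unique; unfold is_series.
all: destruct L as [L1 L2]; simpl in L1, L2.
(* The index shift accounts for [sum_n] having one term more than [Csumn]. *)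
- assert (L1' := proj1 (is_lim_seq_incr_1 _ _) (L1 : is_lim_seq _ (Finite _))).
  unfold is_lim_seq in L1'; eapply filterlim_ext; [|exact L1'].
  intros N; simpl; induction N as [|N IH]; [rewrite sum_O; simpl; ring|].
  rewrite sum_Sn, <- IH; reflexivity.
- assert (L2' := proj1 (is_lim_seq_incr_1 _ _) (L2 : is_lim_seq _ (Finite _))).
  unfold is_lim_seq in L2'; eapply filterlim_ext; [|exact L2'].
  intros N; simpl; induction N as [|N IH]; [rewrite sum_O; simpl; ring|].
  rewrite sum_Sn, <- IH; reflexivity.
Qed.

(** * Mean value inequality, termwise differentiation, integration *)

(** The real mean value theorem is applied to the projection of [f] on the direction of [f b - f a],
    which keeps the constant [M]. *)
Lemma C_mean_value (f g : R -> C) (a b M : R) :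
  a <= b -> (forall t, a <= t <= b -> Cder f t (g t)) ->
  (forall t, a <= t <= b -> Cmod (g t) <= M) -> Cmod (f b - f a)%C <= M * (b - a).
Proof.
intros le D B.
set (Z := (f b - f a)%C).
destruct (Rle_lt_or_eq_dec 0 _ (Cmod_ge_0 Z)) as [pos|E].
2:{ rewrite <- E; specialize (B a (conj (Rle_refl a) le)); pose proof (Cmod_ge_0 (g a)); nra. }
set (r := fun t => fst Z * fst (f t) + snd Z * snd (f t)).
set (r' := fun t => fst Z * fst (g t) + snd Z * snd (g t)).
assert (Dr : forall t, a <= t <= b -> is_derive r t (r' t)).
{ intros t Ht; destruct (D t Ht) as [D1 D2].
  exact (is_derive_plus (V := R_NormedModule) _ _ _ _ _
    (is_derive_scal _ _ _ _ D1) (is_derive_scal _ _ _ _ D2)). }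
destruct (MVT_gen r a b r') as [c [Hc Ec]].
- intros x Hx; rewrite Rmin_left, Rmax_right in Hx by lra; apply Dr; lra.
- intros x Hx; rewrite Rmin_left, Rmax_right in Hx by lra.
  apply continuity_pt_filterlim, (ex_derive_continuous (V := R_NormedModule)).
  exists (r' x); apply Dr; lra.
- rewrite Rmin_left, Rmax_right in Hc by lra.
  assert (Q : Cmod Z * Cmod Z = r b - r a).
  { pose proof (Cmod2_alt Z) as Q; unfold Re, Im in Q; unfold r.
    assert (F1 : fst Z = fst (f b) - fst (f a)) by reflexivity.
    assert (F2 : snd Z = snd (f b) - snd (f a)) by reflexivity.
    nra. }
  assert (Bc : r' c <= Cmod Z * M).
  { apply (Rle_trans _ (Cmod (Cconj Z * g c)%C)).
    - eapply Rle_trans; [|apply fst_le_Cmod]; eapply Rle_trans; [|apply Rle_abs].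
      unfold r'; simpl; lra.
    - rewrite Cmod_mult, Cmod_conj; apply Rmult_le_compat_l; [lra|]; apply B; lra. }
  apply (Rmult_le_reg_l (Cmod Z)); [exact pos|]; rewrite Q, Ec; nra.
Qed.

(** The mean value inequality bounds each difference quotient of [f n] by [M n], so [Tannery]
    applies to the quotients. *)
Lemma Cder_CSer (f g : nat -> R -> C) (M : nat -> R) (a b t : R) :
  a < t < b ->
  (forall n x, a < x < b -> Cder (f n) x (g n x)) ->
  (forall n x, a < x < b -> Cmod (g n x) <= M n) ->
  ex_series M ->
  (forall x, a < x < b -> Csum (fun n => f n x)) ->
  Cder (fun x => CSer (fun n => f n x)) t (CSer (fun n => g n t)).
Proof.
intros It D B E S; apply Cder_Clim.
pose (d := Rmin (t - a) (b - t)).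
assert (pd : 0 < d) by (apply Rmin_glb_lt; lra).
assert (near : locally' 0 (fun h => h <> 0 /\ a < t + h < b)).
{ exists (mkposreal _ pd); intros h Bh nz; split; [exact nz|].
  unfold ball in Bh; simpl in Bh; unfold AbsRing_ball, abs, minus, plus, opp in Bh; simpl in Bh.
  apply Rabs_def2 in Bh; unfold d in Bh.
  pose proof (Rmin_l (t - a) (b - t)); pose proof (Rmin_r (t - a) (b - t)); lra. }
apply (Clim_ext_loc _ (fun h => CSer (fun n => (f n (t + h)%R - f n t) / RtoC h)%C)).
- revert near; apply filter_imp; intros h [nz Ih].
  unfold Cdiv; rewrite <- CSer_minus by now apply S.
  rewrite (Cmult_comm _ (/ RtoC h)%C), <- CSer_scal by now apply Csum_minus; apply S.
  apply CSer_ext; intros n; apply Cmult_comm.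
- apply (@Tannery R (locally' 0) (Rbar_locally'_filter (Finite 0))
           (fun h n => (f n (t + h)%R - f n t) / RtoC h)%C (fun n => g n t) M E).
  + revert near; apply filter_imp; intros h [nz Ih] n.
    rewrite Cmod_div by (intros X; apply nz, RtoC_inj, X).
    rewrite Cmod_R.
    apply (Rmult_le_reg_r (Rabs h)); [now apply Rabs_pos_lt|].
    unfold Rdiv; rewrite Rmult_assoc, Rinv_l, Rmult_1_r by now apply Rabs_no_R0.
    destruct (Rle_or_lt 0 h) as [ph|nh].
    * rewrite Rabs_pos_eq by lra.
      eapply Rle_trans; [apply (C_mean_value (f n) (g n) t (t + h) (M n))|].
      -- lra.
      -- intros x Hx; apply D; lra.
      -- intros x Hx; apply B; lra.
      -- apply Req_le; ring.
    * rewrite Rabs_left by lra.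
      replace (f n (t + h)%R - f n t)%C with (- (f n t - f n (t + h)%R))%C by ring.
      rewrite Cmod_opp.
      eapply Rle_trans; [apply (C_mean_value (f n) (g n) (t + h) t (M n))|].
      -- lra.
      -- intros x Hx; apply D; lra.
      -- intros x Hx; apply B; lra.
      -- apply Req_le; ring.
  + intros n; apply Cder_Clim, D, It.
Qed.

Lemma Ccont_CSer {U : UniformSpace} (f : nat -> U -> C) (M : nat -> R) (x : U) :
  ex_series M -> locally x (fun y => forall n, Cmod (f n y) <= M n) ->
  (forall n, Ccont (f n) x) -> Ccont (fun y => CSer (fun n => f n y)) x.
Proof.
intros E B K; apply Ccont_Clim.
apply (Tannery (locally x) (fun y n => f n y) (fun n => f n x) M E B).
intros n; apply Ccont_Clim, K.
Qed.

(** * Integrals of complex-valued functions of a real variable *)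

Definition CRInt (f : R -> C) (a b : R) : C :=
  (RInt (fun t => fst (f t)) a b, RInt (fun t => snd (f t)) a b).

Lemma Ccont_ex_RInt (f : R -> C) (a b : R) :
  a <= b -> (forall t, a <= t <= b -> Ccont f t) ->
  ex_RInt (fun t => fst (f t)) a b /\ ex_RInt (fun t => snd (f t)) a b.
Proof.
intros le K; split; apply (ex_RInt_continuous (V := R_CompleteNormedModule)); intros t Ht;
  rewrite Rmin_left, Rmax_right in Ht by exact le; apply K, Ht.
Qed.

Lemma CRInt_correct (f : R -> C) (a b : R) :
  a <= b -> (forall t, a <= t <= b -> Ccont f t) ->
  @is_RInt C_R_NormedModule f a b (CRInt f a b).
Proof.
intros le K; destruct (Ccont_ex_RInt f a b le K) as [A B].
apply (is_RInt_fct_extend_pair (U := R_NormedModule) (V := R_NormedModule) f a b);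
  now apply (RInt_correct (V := R_CompleteNormedModule)).
Qed.

Lemma CRInt_ext (f g : R -> C) (a b : R) :
  a <= b -> (forall t, a <= t <= b -> f t = g t) -> CRInt f a b = CRInt g a b.
Proof.
intros le E; unfold CRInt; f_equal; apply RInt_ext; intros t Ht;
  rewrite Rmin_left, Rmax_right in Ht by exact le; rewrite E by lra; reflexivity.
Qed.

Lemma CRInt_bound (f : R -> C) (g : R -> R) (a b lg : R) :
  a <= b -> (forall t, a <= t <= b -> Ccont f t) ->
  (forall t, a <= t <= b -> Cmod (f t) <= g t) -> is_RInt g a b lg ->
  Cmod (CRInt f a b) <= lg.
Proof.
intros le K B I.
rewrite Cmod_norm.
refine (norm_RInt_le (V := C_R_NormedModule) f g a b _ _ le _ (CRInt_correct f a b le K) I).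
intros t Ht; eapply Rle_trans; [apply Req_le; symmetry; exact (Cmod_norm (f t))|exact (B t Ht)].
Qed.

Lemma CRInt_bound_const (f : R -> C) (a b M : R) :
  a <= b -> (forall t, a <= t <= b -> Ccont f t) ->
  (forall t, a <= t <= b -> Cmod (f t) <= M) -> Cmod (CRInt f a b) <= (b - a) * M.
Proof.
intros le K B; apply (CRInt_bound f (fun _ => M)); auto.
exact (is_RInt_const (V := R_NormedModule) a b M).
Qed.

Lemma CRInt_FTC (F f : R -> C) (a b : R) :
  a <= b -> (forall t, a <= t <= b -> Cder F t (f t)) ->
  (forall t, a <= t <= b -> Ccont f t) -> CRInt f a b = (F b - F a)%C.
Proof.
intros le D K; apply C_eta; unfold CRInt; simpl; apply is_RInt_unique.
- apply (is_RInt_derive (V := R_CompleteNormedModule) (fun t => fst (F t)));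
    intros t Ht; rewrite Rmin_left, Rmax_right in Ht by exact le; [apply D|apply K]; exact Ht.
- apply (is_RInt_derive (V := R_CompleteNormedModule) (fun t => snd (F t)));
    intros t Ht; rewrite Rmin_left, Rmax_right in Ht by exact le; [apply D|apply K]; exact Ht.
Qed.

Lemma CRInt_plus (f g : R -> C) (a b : R) :
  a <= b -> (forall t, a <= t <= b -> Ccont f t) -> (forall t, a <= t <= b -> Ccont g t) ->
  CRInt (fun t => f t + g t)%C a b = (CRInt f a b + CRInt g a b)%C.
Proof.
intros le K1 K2; destruct (Ccont_ex_RInt f a b le K1), (Ccont_ex_RInt g a b le K2).
apply C_eta; simpl; now apply (RInt_plus (V := R_CompleteNormedModule)).
Qed.

Lemma CRInt_scal (c : C) (f : R -> C) (a b : R) :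
  a <= b -> (forall t, a <= t <= b -> Ccont f t) ->
  CRInt (fun t => c * f t)%C a b = (c * CRInt f a b)%C.
Proof.
intros le K; destruct (Ccont_ex_RInt f a b le K) as [A B].
assert (X : forall k r, ex_RInt r a b -> ex_RInt (fun t => k * r t) a b)
  by (intros k r; apply (ex_RInt_scal (V := R_NormedModule))).
assert (Y : forall k r, ex_RInt r a b -> RInt (fun t => k * r t) a b = k * RInt r a b)
  by (intros k r; apply (RInt_scal (V := R_CompleteNormedModule))).
apply C_eta; unfold CRInt; simpl.
- rewrite <- !Y by assumption; apply (RInt_minus (V := R_CompleteNormedModule)); now apply X.
- rewrite <- !Y by assumption; apply (RInt_plus (V := R_CompleteNormedModule)); now apply X.
Qed.

Lemma CRInt_minus (f g : R -> C) (a b : R) :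
  a <= b -> (forall t, a <= t <= b -> Ccont f t) -> (forall t, a <= t <= b -> Ccont g t) ->
  CRInt (fun t => f t - g t)%C a b = (CRInt f a b - CRInt g a b)%C.
Proof.
intros le K1 K2; destruct (Ccont_ex_RInt f a b le K1), (Ccont_ex_RInt g a b le K2).
apply C_eta; simpl; now apply (RInt_minus (V := R_CompleteNormedModule)).
Qed.

Lemma CRInt_Chasles (f : R -> C) (a b c : R) :
  a <= b <= c -> (forall t, a <= t <= c -> Ccont f t) ->
  CRInt f a c = (CRInt f a b + CRInt f b c)%C.
Proof.
intros le K.
destruct (Ccont_ex_RInt f a b) as [A1 A2]; [lra|intros; apply K; lra|].
destruct (Ccont_ex_RInt f b c) as [B1 B2]; [lra|intros; apply K; lra|].
apply C_eta; simpl; symmetry; now apply (RInt_Chasles (V := R_CompleteNormedModule)).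
Qed.

Lemma CRInt_Csumn (f : nat -> R -> C) (N : nat) (a b : R) :
  a <= b -> (forall n t, a <= t <= b -> Ccont (f n) t) ->
  CRInt (fun t => Csumn (fun n => f n t) N) a b = Csumn (fun n => CRInt (f n) a b) N /\
  (forall t, a <= t <= b -> Ccont (fun t => Csumn (fun n => f n t) N) t).
Proof.
intros le K; induction N as [|N [IH1 IH2]]; simpl.
- split; [|intros; apply Ccont_const].
  apply C_eta; unfold CRInt; simpl; rewrite RInt_const; apply Rmult_0_r.
- split; [rewrite CRInt_plus, IH1 by auto; reflexivity|].
  intros t Ht; apply Ccont_plus; auto.
Qed.

Lemma CRInt_CSer (f : nat -> R -> C) (M : nat -> R) (a b : R) :
  a <= b -> (forall n t, Ccont (f n) t) -> (forall n t, Cmod (f n t) <= M n) -> ex_series M ->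
  Csum (fun n => CRInt (f n) a b) /\
  CRInt (fun t => CSer (fun n => f n t)) a b = CSer (fun n => CRInt (f n) a b).
Proof.
intros le K B E.
assert (S : Csum (fun n => CRInt (f n) a b)).
{ apply (Csum_le _ (fun n => (b - a) * M n)).
  - intros n; apply CRInt_bound_const; auto.
  - now apply (ex_series_scal_l (K := R_AbsRing) (V := R_NormedModule) (b - a)). }
split; [exact S|symmetry; apply CSer_unique; [exact S|]].
assert (KS : forall t, Ccont (fun y => CSer (fun n => f n y)) t).
{ intros t; apply (Ccont_CSer f M); auto; apply filter_forall; auto. }
assert (P : forall n, 0 <= M n) by (intros n; eapply Rle_trans; [apply Cmod_ge_0|apply (B n 0)]).
apply (Clim_squeeze _ _ _ (fun N => (b - a) * Series (fun n => M (N + n)%nat))).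
- exists 0%nat; intros N _.
  destruct (CRInt_Csumn f N a b le) as [E1 E2]; [auto|].
  rewrite <- E1, <- CRInt_minus by auto.
  apply CRInt_bound_const; auto.
  + intros t Ht; apply Ccont_minus; auto.
  + intros t _; rewrite (CSer_split _ N) by now apply (Csum_le _ M).
    replace (_ - _)%C with (- CSer (fun n => f (N + n)%nat t))%C by ring.
    rewrite Cmod_opp; apply CSer_le; [auto|].
    now apply (ex_series_incr_n (V := R_NormedModule) M N).
- intros eps.
  assert (pos : 0 < eps / (b - a + 1)) by (apply Rdiv_lt_0_compat; [apply cond_pos|lra]).
  destruct (Series_tail M (mkposreal _ pos) P E) as [N TN]; simpl in TN.
  exists N; intros n Hn.
  assert (T : Series (fun k => M (n + k)%nat) <= Series (fun k => M (N + k)%nat)).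
  { destruct (Nat.eq_dec n N) as [->|ne]; [apply Rle_refl|].
    rewrite (Series_incr_n (fun k => M (N + k)%nat) (n - N))
      by (lia || now apply (ex_series_incr_n (V := R_NormedModule) M N)).
    rewrite (Series_ext (fun k => M (N + (n - N + k))%nat) (fun k => M (n + k)%nat))
      by (intros; f_equal; lia).
    assert (0 <= sum_f_R0 (fun k => M (N + k)%nat) (pred (n - N)))
      by (apply cond_pos_sum; intros; apply P); lra. }
  apply (Rle_lt_trans _ ((b - a) * (eps / (b - a + 1)))).
  + apply Rmult_le_compat_l; lra.
  + apply (Rmult_lt_reg_r (b - a + 1)); [lra|].
    replace ((b - a) * (eps / (b - a + 1)) * (b - a + 1)) with ((b - a) * eps) by (field; lra).
    pose proof (cond_pos eps); nra.
Qed.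

Lemma Ccont_2d (f : R * R -> C) (x t : R) :
  Ccont (U := prod_UniformSpace R_UniformSpace R_UniformSpace) f (x, t) ->
  continuity_2d_pt (fun u v => fst (f (u, v))) x t /\
  continuity_2d_pt (fun u v => snd (f (u, v))) x t.
Proof.
intros [A B]; split; apply continuity_2d_pt_filterlim.
- eapply filterlim_ext; [|exact A]; now intros [u v].
- eapply filterlim_ext; [|exact B]; now intros [u v].
Qed.

(** The last hypothesis reaches outside [[a, b]] because joint continuity is tested on full plane
    neighbourhoods, including those of points with [t = a] or [t = b]. *)
Lemma Cder_CRInt_param (f f' : R * R -> C) (a b x0 x1 x : R) :
  a <= b -> x0 < x < x1 ->
  (forall u t, x0 < u < x1 -> a <= t <= b -> Cder (fun v => f (v, t)) u (f' (u, t))) ->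
  (forall u t, x0 < u < x1 -> a <= t <= b -> Ccont (fun s => f (u, s)) t) ->
  (forall t, a <= t <= b ->
     Ccont (U := prod_UniformSpace R_UniformSpace R_UniformSpace) f' (x, t)) ->
  (forall u t, x0 < u < x1 -> Cder (fun v => f (v, t)) u (f' (u, t))) ->
  Cder (fun u => CRInt (fun t => f (u, t)) a b) x (CRInt (fun t => f' (x, t)) a b).
Proof.
intros le Ix D K K' Dall.
pose (d := Rmin (x - x0) (x1 - x)).
assert (pd : 0 < d) by (apply Rmin_glb_lt; lra).
assert (near : forall u : R, Rabs (u - x) < d -> x0 < u < x1).
{ intros u Bu; apply Rabs_def2 in Bu; unfold d in Bu.
  pose proof (Rmin_l (x - x0) (x1 - x)); pose proof (Rmin_r (x - x0) (x1 - x)); lra. }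
assert (nearL : forall P : R -> Prop, (forall u, x0 < u < x1 -> P u) -> locally x P).
{ intros P H; exists (mkposreal _ pd); intros u Bu; apply H, near, Bu. }
split; unfold CRInt; simpl.
- rewrite (RInt_ext (fun t => fst (f' (x, t))) (fun t => Derive (fun u => fst (f (u, t))) x)).
  + apply is_derive_RInt_param.
    * apply nearL; intros u Hu t Ht; rewrite Rmin_left, Rmax_right in Ht by exact le.
      exists (fst (f' (u, t))); apply D; assumption.
    * intros t Ht; rewrite Rmin_left, Rmax_right in Ht by exact le.
      apply (continuity_2d_pt_ext_loc (fun u v => fst (f' (u, v)))); [|apply Ccont_2d, K', Ht].
      exists (mkposreal _ pd); intros u v Hu Hv; symmetry; apply is_derive_unique.
      apply Dall, near, Hu.
    * apply nearL; intros u Hu; apply Ccont_ex_RInt; auto.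
  + intros t Ht; rewrite Rmin_left, Rmax_right in Ht by exact le.
    symmetry; apply is_derive_unique, D; lra.
- rewrite (RInt_ext (fun t => snd (f' (x, t))) (fun t => Derive (fun u => snd (f (u, t))) x)).
  + apply is_derive_RInt_param.
    * apply nearL; intros u Hu t Ht; rewrite Rmin_left, Rmax_right in Ht by exact le.
      exists (snd (f' (u, t))); apply D; assumption.
    * intros t Ht; rewrite Rmin_left, Rmax_right in Ht by exact le.
      apply (continuity_2d_pt_ext_loc (fun u v => snd (f' (u, v)))); [|apply Ccont_2d, K', Ht].
      exists (mkposreal _ pd); intros u v Hu Hv; symmetry; apply is_derive_unique.
      apply Dall, near, Hu.
    * apply nearL; intros u Hu; apply Ccont_ex_RInt; auto.
  + intros t Ht; rewrite Rmin_left, Rmax_right in Ht by exact le.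
    symmetry; apply is_derive_unique, D; lra.
Qed.

(* [f'] is the complex derivative of [f] on the right half-plane, expressed through curves. *)
Record Chol (f f' : C -> C) : Prop := {
  Chol_der : forall (g : R -> C) (t : R) (l : C),
    Cder g t l -> 0 < fst (g t) -> Cder (fun x => f (g x)) t (l * f' (g t))%C;
  Chol_cont : forall (U : UniformSpace) (g : U -> C) (x : U),
    Ccont g x -> 0 < fst (g x) -> Ccont (fun u => f (g u)) x;
  Chol_cont' : forall (U : UniformSpace) (g : U -> C) (x : U),
    Ccont g x -> 0 < fst (g x) -> Ccont (fun u => f' (g u)) x }.

Lemma Cder_horizontal (x t : R) : Cder (fun v => (v, t) : C) x 1.
Proof.
split; [exact (is_derive_id (K := R_AbsRing) x)|].
exact (is_derive_const (K := R_AbsRing) (V := R_NormedModule) _ _).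
Qed.

Lemma Cder_vertical (x t : R) : Cder (fun v => (x, v) : C) t Ci.
Proof.
split; [exact (is_derive_const (K := R_AbsRing) (V := R_NormedModule) _ _)|].
exact (is_derive_id (K := R_AbsRing) t).
Qed.

Lemma Ccont_horizontal (x t : R) : Ccont (fun v => (v, t) : C) x.
Proof. eapply Cder_Ccont, Cder_horizontal. Qed.

Lemma Ccont_vertical (x t : R) : Ccont (fun v => (x, v) : C) t.
Proof. eapply Cder_Ccont, Cder_vertical. Qed.

(** The integral over a vertical segment is differentiated in its abscissa. As the vertical
    derivative of [f] is [Ci * f'], the integral of [f'] is [- Ci] times the difference of the
    values of [f] at the two ends; integrating this in the abscissa produces the horizontal
    sides. *)
Lemma Cauchy_rectangle (f f' : C -> C) (a b x0 x1 : R) :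
  Chol f f' -> a <= b -> 0 < x0 <= x1 ->
  (CRInt (fun t => f (x1, t)) a b - CRInt (fun t => f (x0, t)) a b)%C =
  (- Ci * (CRInt (fun x => f (x, b)) x0 x1 - CRInt (fun x => f (x, a)) x0 x1))%C.
Proof.
intros [Hd Hc Hc'] le [pos le'].
assert (D : forall u t, 0 < u -> Cder (fun v => f (v, t)) u (f' (u, t))).
{ intros u t pu; eapply Cder_eq; [exact (Hd _ _ _ (Cder_horizontal u t) pu)|apply Cmult_1_l]. }
assert (V : forall x, 0 < x ->
  Cder (fun u => CRInt (fun t => f (u, t)) a b) x (- Ci * (f (x, b) - f (x, a)))%C).
{ intros x px; eapply Cder_eq.
  - apply (Cder_CRInt_param f f' a b 0 (x + 1) x le); [lra|..].
    + intros u t Hu _; apply D; lra.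
    + intros u t Hu _; apply Hc; [apply Ccont_vertical|simpl; lra].
    + intros t _; apply (Hc' (prod_UniformSpace R_UniformSpace R_UniformSpace) (fun p => p));
        [|exact px]; split; [apply continuous_fst|apply continuous_snd].
    + intros u t Hu; apply D; lra.
  - rewrite <- (CRInt_FTC (fun t => f (x, t)) (fun t => Ci * f' (x, t))%C a b le).
    + rewrite CRInt_scal; [|exact le|].
      * rewrite Cmult_assoc; replace (- Ci * Ci)%C with (RtoC 1) by (apply C_eta; simpl; ring).
        now rewrite Cmult_1_l.
      * intros t _; apply Hc'; [apply Ccont_vertical|exact px].
    + intros t _; exact (Hd _ _ _ (Cder_vertical x t) px).
    + intros t _; apply Ccont_mult; [apply Ccont_const|].
      apply Hc'; [apply Ccont_vertical|exact px]. }
transitivity (CRInt (fun x => - Ci * (f (x, b) - f (x, a)))%C x0 x1).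
- symmetry; apply (CRInt_FTC (fun u => CRInt (fun t => f (u, t)) a b)).
  + exact le'.
  + intros x Hx; apply V; lra.
  + intros x Hx; apply Ccont_mult; [apply Ccont_const|apply Ccont_minus];
      (apply Hc; [apply Ccont_horizontal|simpl; lra]).
- assert (K : forall s x, x0 <= x <= x1 -> Ccont (fun v => f (v, s)) x).
  { intros s x Hx; apply Hc; [apply Ccont_horizontal|simpl; lra]. }
  rewrite CRInt_scal, CRInt_minus; auto.
  intros t Ht; apply Ccont_minus; auto.
Qed.

(** * The generating function of [frac_partition] *)

Lemma CSer_finite (a : nat -> C) (N : nat) :
  (forall n, (N <= n)%nat -> a n = 0) -> Csum a /\ CSer a = Csumn a N.
Proof.
intros Z.
assert (Z' : forall n, a (N + n)%nat = 0) by (intros; apply Z; lia).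
assert (A : Csum a).
{ apply (Csum_shift_n a N).
  apply (ex_series_ext (fun _ => 0)); [intros n; rewrite Z', Cmod_0; reflexivity|].
  exists 0; apply (is_series_Reals (fun _ => 0)); intros eps pos; exists 0%nat; intros n _.
  rewrite sum_eq_R0 by auto; unfold Rdist; rewrite Rminus_diag, Rabs_R0; exact pos. }
split; [exact A|].
rewrite (CSer_split a N A), (CSer_ext _ (fun _ => RtoC 0) Z'), CSer_RtoC, Series_0 by auto.
apply Cplus_0_r.
Qed.

Lemma CSer_delay (b : nat -> C) (i : nat) :
  Csum b ->
  Csum (fun n => if (n <? i)%nat then RtoC 0 else b (n - i)%nat) /\
  CSer (fun n => if (n <? i)%nat then RtoC 0 else b (n - i)%nat) = CSer b.
Proof.
intros B; set (c := fun n => if (n <? i)%nat then RtoC 0 else b (n - i)%nat).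
assert (E : forall n, c (i + n)%nat = b n).
{ intros n; unfold c; destruct (Nat.ltb_spec (i + n) i); [lia|f_equal; lia]. }
assert (A : Csum c).
{ apply (Csum_shift_n c i), (Csum_ext b); auto. }
split; [exact A|].
rewrite (CSer_split c i A), (CSer_ext _ b E).
rewrite (Csumn_ext c (fun _ => 0 * 0)%C).
- rewrite Csumn_scal, Cmult_0_l; apply Cplus_0_l.
- intros n lt; unfold c; destruct (Nat.ltb_spec n i); [now rewrite Cmult_0_l|lia].
Qed.

(** * Cauchy products and logarithmic differentiation of the infinite product *)

Definition conv (a b : nat -> C) (n : nat) : C := Csumn (fun i => a i * b (n - i)%nat)%C (S n).

(** Row [i] of the double array is [b] delayed by [i] places and multiplied by [a i]; its columns
    are the finite convolutions. *)
Lemma Cauchy_product (a b : nat -> C) :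
  Csum a -> Csum b -> CSer (conv a b) = (CSer a * CSer b)%C.
Proof.
intros A B.
set (F := fun i n : nat => if (n <? i)%nat then RtoC 0 else (a i * b (n - i)%nat)%C).
assert (FE : forall i n, F i n = (a i * (if (n <? i)%nat then RtoC 0 else b (n - i)%nat))%C).
{ intros i n; unfold F; destruct (n <? i)%nat; [now rewrite Cmult_0_r|reflexivity]. }
assert (S1 : forall i, Csum (F i)).
{ intros i; eapply Csum_ext; [intros n; symmetry; apply FE|].
  apply Csum_scal, CSer_delay, B. }
assert (Bd : CSer (fun i => CSer (F i)) = (CSer a * CSer b)%C).
{ rewrite (CSer_ext _ (fun i => CSer b * a i)%C).
  - rewrite CSer_scal by exact A; apply Cmult_comm.
  - intros i; rewrite (CSer_ext _ _ (FE i)), CSer_scal by apply CSer_delay, B.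
    rewrite (proj2 (CSer_delay b i B)); apply Cmult_comm. }
destruct (CSer_fubini F S1) as [_ [H _]].
- apply (ex_series_ext (fun i => Cmod (a i) * Series (fun n => Cmod (b n)))).
  + intros i; rewrite <- Series_scal_l.
    assert (X : Csum (fun n => RtoC (Cmod (a i * b n)%C))).
    { apply (Csum_le _ (fun n => Cmod (a i * b n)%C)); [|now apply (Csum_scal (a i) b)].
      intros n; rewrite Cmod_R, Rabs_pos_eq by apply Cmod_ge_0; apply Rle_refl. }
    assert (D := proj2 (CSer_delay _ i X)); rewrite CSer_RtoC in D.
    rewrite (CSer_ext _ (fun n => RtoC (Cmod (F i n)))), CSer_RtoC in D.
    * apply RtoC_inj in D; rewrite D; apply Series_ext; intros n; now rewrite Cmod_mult.
    * intros n; unfold F; destruct (n <? i)%nat; [now rewrite Cmod_0|reflexivity].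
  + now apply ex_series_scal_r.
- rewrite <- Bd, H; apply CSer_ext; intros n; unfold conv.
  rewrite (proj2 (CSer_finite (fun i => F i n) (S n)
    ltac:(intros i le; unfold F; destruct (Nat.ltb_spec n i); [reflexivity|lia]))).
  apply Csumn_ext; intros i lt; unfold F; destruct (Nat.ltb_spec n i); [lia|reflexivity].
Qed.

Lemma Csumn_rev (a : nat -> C) (n : nat) : Csumn a (S n) = Csumn (fun i => a (n - i)%nat) (S n).
Proof.
revert a; induction n as [|n IH]; intros a; [reflexivity|].
rewrite (Csumn_shift a (S n)), (IH (fun i => a (S i))); simpl Csumn at 2.
rewrite (Csumn_ext (fun i => a (S (n - i))) (fun i => a (S n - i)%nat))
  by (intros; f_equal; lia).
replace (n - n)%nat with 0%nat by lia; apply Cplus_comm.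
Qed.

Lemma Csumn_triangle (F : nat -> nat -> C) (n : nat) :
  Csumn (fun i => Csumn (fun j => F j (i - j)%nat) (S i)) (S n) =
  Csumn (fun j => Csumn (fun l => F j l) (S (n - j))) (S n).
Proof.
induction n as [|n IH]; [reflexivity|].
change (Csumn (fun i => Csumn (fun j => F j (i - j)%nat) (S i)) (S (S n)))
  with (Csumn (fun i => Csumn (fun j => F j (i - j)%nat) (S i)) (S n)
        + Csumn (fun j => F j (S n - j)%nat) (S (S n)))%C.
rewrite IH; clear IH.
change (Csumn (fun j => F j (S n - j)%nat) (S (S n)))
  with (Csumn (fun j => F j (S n - j)%nat) (S n) + F (S n) (S n - S n)%nat)%C.
change (Csumn (fun j => Csumn (fun l => F j l) (S (S n - j))) (S (S n)))
  with (Csumn (fun j => Csumn (fun l => F j l) (S (S n - j))) (S n)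
        + Csumn (fun l => F (S n) l) (S (S n - S n)))%C.
rewrite Nat.sub_diag, Cplus_assoc, <- Csumn_plus.
f_equal; [|symmetry; apply Cplus_0_l].
apply Csumn_ext; intros j lt; replace (S n - j)%nat with (S (n - j)) by lia; reflexivity.
Qed.

Lemma conv_ext (a a' b b' : nat -> C) (n : nat) :
  (forall i, (i <= n)%nat -> a i = a' i) -> (forall i, (i <= n)%nat -> b i = b' i) ->
  conv a b n = conv a' b' n.
Proof. intros E E'; apply Csumn_ext; intros i lt; rewrite E, E' by lia; reflexivity. Qed.

Lemma conv_comm (a b : nat -> C) (n : nat) : conv a b n = conv b a n.
Proof.
unfold conv; rewrite Csumn_rev; apply Csumn_ext; intros i lt.
replace (n - (n - i))%nat with i by lia; apply Cmult_comm.
Qed.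

Lemma conv_assoc (a b c : nat -> C) (n : nat) : conv (conv a b) c n = conv a (conv b c) n.
Proof.
unfold conv.
rewrite (Csumn_ext _ (fun i => Csumn (fun j => a j * b (i - j)%nat * c (n - j - (i - j))%nat) (S i))%C).
- rewrite (Csumn_triangle (fun j l => a j * b l * c (n - j - l)%nat)%C).
  apply Csumn_ext; intros j lt; rewrite <- Csumn_scal; apply Csumn_ext; intros l lt'.
  symmetry; apply Cmult_assoc.
- intros i lt; rewrite Cmult_comm, <- Csumn_scal; apply Csumn_ext; intros j lt'.
  replace (n - j - (i - j))%nat with (n - i)%nat by lia; apply Cmult_comm.
Qed.

Lemma conv_plus_l (a b c : nat -> C) (n : nat) :
  conv (fun i => a i + b i)%C c n = (conv a c n + conv b c n)%C.
Proof.
unfold conv; rewrite <- Csumn_plus; apply Csumn_ext; intros; apply Cmult_plus_distr_r.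
Qed.

Lemma conv_scal_l (k : C) (a b : nat -> C) (n : nat) :
  conv (fun i => k * a i)%C b n = (k * conv a b n)%C.
Proof.
unfold conv; rewrite <- Csumn_scal; apply Csumn_ext; intros; symmetry; apply Cmult_assoc.
Qed.

(** The Euler operator [x d/dx] on coefficients, a derivation for [conv]. *)
Definition theta (a : nat -> C) (n : nat) : C := (RtoC (INR n) * a n)%C.

Lemma theta_conv (a b : nat -> C) (n : nat) :
  theta (conv a b) n = (conv (theta a) b n + conv a (theta b) n)%C.
Proof.
unfold theta, conv; rewrite <- Csumn_plus, <- Csumn_scal; apply Csumn_ext; intros i lt.
rewrite minus_INR, RtoC_minus by lia; ring.
Qed.

Definition fpsC (f : fps) (n : nat) : C := RtoC (f n).

Lemma fpsC_mul (f g : fps) (n : nat) : fpsC (fps_mul f g) n = conv (fpsC f) (fpsC g) n.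
Proof.
unfold fpsC, fps_mul, conv.
assert (E : forall (u : nat -> R) N, RtoC (sum_n u N) = Csumn (fun i => RtoC (u i)) (S N)).
{ intros u N; induction N as [|N IH].
  - rewrite sum_O; symmetry; apply Cplus_0_l.
  - rewrite sum_Sn; change (plus (sum_n u N) (u (S N))) with (sum_n u N + u (S N)).
    rewrite RtoC_plus, IH; reflexivity. }
rewrite E; apply Csumn_ext; intros; apply RtoC_mult.
Qed.

(* Coefficients of [k x^k / (1 - x^k)]. *)
Definition geomk (k i : nat) : C :=
  if (Nat.eqb (i mod k) 0 && negb (Nat.eqb i 0))%bool then RtoC (INR k) else 0.

Lemma geomk_small (k i : nat) : (i < k)%nat -> geomk k i = 0.
Proof.
intros lt; unfold geomk; rewrite Nat.mod_small by exact lt; destruct i; reflexivity.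
Qed.

Lemma geomk_shift (k i : nat) : (0 < i)%nat -> geomk k (k + i) = geomk k i.
Proof.
intros lt; unfold geomk; rewrite Nat.add_comm, Nat.Div0.add_mod, Nat.Div0.mod_same, Nat.add_0_r,
  Nat.Div0.mod_mod.
destruct i; [lia|reflexivity].
Qed.

Lemma geomk_self (k : nat) : (0 < k)%nat -> geomk k k = RtoC (INR k).
Proof. intros lt; unfold geomk; rewrite Nat.Div0.mod_same; destruct k; [lia|reflexivity]. Qed.

(** This compares the coefficients of [x^(k + n)] in [(1 - x^k) x f' = - a k x^k f], the
    differential equation of [f = (1 - x^k)^a]. *)
Lemma factor_shift (a : R) (k n : nat) :
  (0 < k)%nat ->
  INR (k + n) * fps_factor a k (k + n)%nat = (INR n - a * INR k) * fps_factor a k n.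
Proof.
intros lt; unfold fps_factor.
replace ((k + n) mod k)%nat with (n mod k)
  by (rewrite Nat.add_comm, Nat.Div0.add_mod, Nat.Div0.mod_same, Nat.add_0_r, Nat.Div0.mod_mod; reflexivity).
destruct (Nat.eqb_spec (n mod k) 0) as [E|_]; [|ring].
replace (k + n)%nat with (n + 1 * k)%nat by lia; rewrite Nat.div_add by lia.
assert (En : n = (k * (n / k))%nat) by (apply Nat.Div0.div_exact; exact E).
set (m := (n / k)%nat) in *; rewrite Nat.add_1_r, En; clear En.
change (gbinom a (S m)) with (gbinom a m * (a - INR m) / INR (S m)).
rewrite plus_INR, !mult_INR, (S_INR m); simpl pow.
pose proof (pos_INR m); change (INR 1) with 1; field; lra.
Qed.

(** Induction in steps of [k]: [geomk] has period [k] away from [0], so the convolution at [k + m]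
    exceeds the one at [m] by the single term [k f(m)]. *)
Lemma theta_factor (a : R) (k n : nat) :
  (0 < k)%nat ->
  theta (fpsC (fps_factor a k)) n = (RtoC (- a) * conv (geomk k) (fpsC (fps_factor a k)) n)%C.
Proof.
intros lt; induction n as [n IH] using lt_wf_ind.
set (f := fpsC (fps_factor a k)) in *.
destruct (Nat.lt_ge_cases n k) as [small|big].
- unfold theta, f, fpsC; replace (conv _ _ n) with (RtoC 0).
  + rewrite Cmult_0_r; destruct n as [|n]; [apply Cmult_0_l|].
    unfold fps_factor; rewrite Nat.mod_small by exact small; apply Cmult_0_r.
  + unfold conv; rewrite (Csumn_ext _ (fun _ => 0 * 0)%C).
    * now rewrite Csumn_scal, Cmult_0_l.
    * intros i li; rewrite geomk_small by lia; now rewrite !Cmult_0_l.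
- replace n with (k + (n - k))%nat by lia; set (m := (n - k)%nat).
  assert (IHm := IH m ltac:(unfold m; lia)).
  assert (E : conv (geomk k) f (k + m) = (RtoC (INR k) * f m + conv (geomk k) f m)%C).
  { unfold conv; replace (S (k + m)) with (k + S m)%nat by lia; rewrite Csumn_split.
    rewrite (Csumn_ext _ (fun _ => 0 * 0)%C k)
      by (intros i li; rewrite geomk_small by exact li; now rewrite !Cmult_0_l).
    rewrite Csumn_scal, Cmult_0_l, Cplus_0_l, !Csumn_shift.
    rewrite (geomk_small k 0) by exact lt.
    rewrite Nat.add_0_r, geomk_self, Cmult_0_l, Cplus_0_l by exact lt.
    f_equal; [do 2 f_equal; lia|].
    apply Csumn_ext; intros i li; rewrite geomk_shift by lia; do 2 f_equal; lia. }
  rewrite E, Cmult_plus_distr_l, <- IHm; unfold theta, f, fpsC.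
  rewrite <- !RtoC_mult, factor_shift, <- RtoC_plus by exact lt; f_equal; ring.
Qed.

Definition divsum_upto (N : nat) (i : nat) : C := Csumn (fun k => geomk (S k) i) N.

(** The logarithmic derivative of a product is the sum of those of its factors. *)
Lemma theta_partial_prod (a : R) (N n : nat) :
  theta (fpsC (fps_partial_prod a N)) n =
  (RtoC (- a) * conv (divsum_upto N) (fpsC (fps_partial_prod a N)) n)%C.
Proof.
revert n; induction N as [|N IH]; intros n.
- replace (conv _ _ n) with (RtoC 0).
  + unfold theta, fpsC; simpl; unfold fps_one; rewrite Cmult_0_r.
    destruct n; [apply Cmult_0_l|apply Cmult_0_r].
  + unfold conv; rewrite (Csumn_ext _ (fun _ => 0 * 0)%C).
    * now rewrite Csumn_scal, Cmult_0_l.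
    * intros; unfold divsum_upto; simpl; now rewrite !Cmult_0_l.
- set (f := fpsC (fps_partial_prod a N)) in *; set (g := fpsC (fps_factor a (S N))).
  assert (E : forall m, fpsC (fps_partial_prod a (S N)) m = conv f g m)
    by (intros; apply fpsC_mul).
  transitivity (theta (conv f g) n); [unfold theta; now rewrite E|].
  rewrite theta_conv.
  rewrite (conv_ext (theta f) (fun i => RtoC (- a) * conv (divsum_upto N) f i)%C g g n) by auto.
  rewrite (conv_comm f), (conv_ext (theta g) (fun i => RtoC (- a) * conv (geomk (S N)) g i)%C f f n)
    by (auto; intros; apply theta_factor; lia).
  rewrite !conv_scal_l, !conv_assoc, <- Cmult_plus_distr_l; f_equal.
  rewrite (conv_ext (geomk (S N)) (geomk (S N)) (conv g f) (conv f g))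
    by (auto; intros; apply conv_comm).
  rewrite <- conv_plus_l; apply conv_ext; [reflexivity|intros; symmetry; apply E].
Qed.

(* The sum of the divisors of [i]; [divsum 0 = 0]. *)
Definition divsum (i : nat) : R := fst (divsum_upto i i).

Lemma geomk_real (k i : nat) : geomk k i = RtoC (fst (geomk k i)).
Proof. unfold geomk; now destruct (_ && _)%bool. Qed.

Lemma geomk_bound (k i : nat) : 0 <= fst (geomk k i) <= INR k.
Proof. unfold geomk; pose proof (pos_INR k); destruct (_ && _)%bool; simpl; lra. Qed.

Lemma divsum_upto_real (N i : nat) : divsum_upto N i = RtoC (fst (divsum_upto N i)).
Proof.
unfold divsum_upto; induction N as [|N IH]; simpl; [reflexivity|].
rewrite IH, (geomk_real (S N) i); apply C_eta; simpl; ring.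
Qed.

Lemma divsum_upto_divsum (N i : nat) : (i <= N)%nat -> divsum_upto N i = RtoC (divsum i).
Proof.
intros le; unfold divsum; rewrite <- divsum_upto_real.
induction le as [|N le IH]; [reflexivity|].
unfold divsum_upto in *; simpl; rewrite IH, geomk_small by lia; apply Cplus_0_r.
Qed.

Lemma divsum_bound (i : nat) : 0 <= divsum i <= INR i * INR i.
Proof.
assert (H : forall N, (N <= i)%nat -> 0 <= fst (divsum_upto N i) <= INR N * INR i).
{ intros N; unfold divsum_upto; induction N as [|N IH]; intros le; simpl fst; [simpl; lra|].
  pose proof (geomk_bound (S N) i).
  assert (INR (S N) <= INR i) by now apply le_INR.
  rewrite (S_INR N) at 1; assert (IH' := IH ltac:(lia)); lra. }
apply H; lia.
Qed.

Lemma frac_partition_0 (alpha : R) : frac_partition alpha 0 = 1.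
Proof. reflexivity. Qed.

(** The logarithmic derivative of the [n]-th partial product already suffices: a divisor of [i <= n]
    is at most [n], and coefficients up to [n] are final. As [divsum 0 = 0], the right-hand side
    involves only earlier coefficients. *)
Lemma frac_partition_rec (alpha : R) (n : nat) :
  (RtoC (INR n * frac_partition alpha n) =
   RtoC alpha * conv (fun i => RtoC (divsum i)) (fun i => RtoC (frac_partition alpha i)) n)%C.
Proof.
rewrite RtoC_mult.
assert (E := theta_partial_prod (- alpha) n n); rewrite Ropp_involutive in E.
unfold theta at 1, fpsC at 1 in E; fold (frac_partition alpha n) in E.
rewrite E; f_equal; apply conv_ext; intros i le.
- now apply divsum_upto_divsum.
- unfold fpsC; now rewrite fps_partial_prod_stable.
Qed.

Lemma fst_Csumn_pos (a : nat -> C) (N : nat) :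
  (forall i, (i < N)%nat -> 0 <= fst (a i)) -> 0 <= fst (Csumn a N).
Proof.
induction N as [|N IH]; intros H; simpl; [lra|].
assert (0 <= fst (a N)) by auto; assert (0 <= fst (Csumn a N)) by auto; lra.
Qed.

Lemma frac_partition_pos (alpha : R) (n : nat) : 0 <= alpha -> 0 <= frac_partition alpha n.
Proof.
intros pos; induction n as [n IH] using lt_wf_ind.
destruct n as [|n]; [rewrite frac_partition_0; lra|].
assert (E := f_equal fst (frac_partition_rec alpha (S n))).
unfold conv in E; rewrite Csumn_shift in E.
apply (Rmult_le_reg_l (INR (S n))); [apply lt_0_INR; lia|]; rewrite Rmult_0_r.
assert (E' : INR (S n) * frac_partition alpha (S n) =
  alpha * fst (Csumn (fun i => RtoC (divsum (S i)) * RtoC (frac_partition alpha (n - i)%nat))%C (S n))).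
{ change (INR (S n) * frac_partition alpha (S n))
    with (fst (RtoC (INR (S n) * frac_partition alpha (S n)))).
  rewrite E; change (divsum 0) with 0.
  rewrite Cmult_0_l, Cplus_0_l; apply re_scal_l. }
rewrite E'; apply Rmult_le_pos; [exact pos|].
apply fst_Csumn_pos; intros i lt; simpl; rewrite Rmult_0_l, Rminus_0_r.
apply Rmult_le_pos; [apply divsum_bound|apply IH; lia].
Qed.

(** * Coefficients of subexponential growth and power series in the unit disc *)

Definition geo (a : nat -> R) : Prop :=
  exists K r, 0 <= K /\ 0 <= r < 1 /\ forall n, Rabs (a n) <= K * r ^ n.

Lemma geo_ex (a : nat -> R) : geo a -> ex_series (fun n => Rabs (a n)).
Proof.
intros [K [r [pK [pr B]]]].
apply (ex_series_le (V := R_CompleteNormedModule) _ (fun n => K * r ^ n)).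
- intros n; unfold norm; simpl; unfold abs; simpl; rewrite Rabs_Rabsolu; apply B.
- apply (ex_series_scal_l (K := R_AbsRing) (V := R_NormedModule) K).
  apply ex_series_geom; rewrite Rabs_pos_eq; lra.
Qed.

Lemma geo_le (a b : nat -> R) : (forall n, Rabs (b n) <= Rabs (a n)) -> geo a -> geo b.
Proof.
intros le [K [r [pK [pr B]]]]; exists K, r; split; [exact pK|split; [exact pr|]].
intros n; eapply Rle_trans; [apply le|apply B].
Qed.

(** The powers [s^0, ..., s^n] are all at least [s^n], and their sum is below that of the whole
    geometric series. *)
Lemma pow_mult_bound (s : R) (n : nat) : 0 <= s < 1 -> INR (S n) * s ^ n <= / (1 - s).
Proof.
intros ps; apply (Rle_trans _ (sum_f_R0 (fun i => s ^ i) n)).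
- induction n as [|n IH]; [simpl; lra|].
  simpl sum_f_R0; rewrite (S_INR (S n)), Rmult_plus_distr_r, Rmult_1_l.
  apply Rplus_le_compat_r; eapply Rle_trans; [|exact IH].
  apply Rmult_le_compat_l; [apply pos_INR|]; simpl.
  pose proof (pow_le s n (proj1 ps)); nra.
- rewrite tech3 by lra.
  apply (Rmult_le_reg_r (1 - s)); [lra|]; unfold Rdiv.
  rewrite Rmult_assoc, Rinv_l, Rmult_1_r by lra.
  pose proof (pow_le s (S n) (proj1 ps)); lra.
Qed.

Lemma geo_mulS (a : nat -> R) : geo a -> geo (fun n => INR (S n) * a n).
Proof.
intros [K [r [pK [pr B]]]].
(* Since [r < s < 1], the linear factor is absorbed by [(r / s)^n] and the decay [s^n] remains. *)
set (s := (1 + r) / 2); assert (ps : 1 / 2 <= s < 1) by (unfold s; lra).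
assert (rs : 0 <= r / s < 1).
{ split; [apply Rdiv_le_0_compat; lra|].
  apply (Rmult_lt_reg_r s); [lra|]; unfold Rdiv; rewrite Rmult_assoc, Rinv_l; unfold s; lra. }
exists (K * / (1 - r / s)), s; split; [|split; [lra|]].
- apply Rmult_le_pos; [exact pK|]; apply Rlt_le, Rinv_0_lt_compat; lra.
- intros n; rewrite Rabs_mult, (Rabs_pos_eq _ (pos_INR _)).
  apply (Rle_trans _ (INR (S n) * (K * r ^ n))).
  + apply Rmult_le_compat_l; [apply pos_INR|apply B].
  + replace (INR (S n) * (K * r ^ n)) with (K * (INR (S n) * (r / s) ^ n) * s ^ n).
    * apply Rmult_le_compat_r; [apply pow_le; lra|].
      apply Rmult_le_compat_l; [exact pK|now apply pow_mult_bound].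
    * replace (r ^ n) with ((r / s) ^ n * s ^ n); [ring|].
      rewrite <- Rpow_mult_distr; f_equal; field; lra.
Qed.

Lemma geo_pow (r : R) : 0 <= r < 1 -> geo (fun n => r ^ n).
Proof.
intros pr; exists 1, r; split; [lra|split; [exact pr|]].
intros n; rewrite Rabs_pos_eq by (apply pow_le; lra); lra.
Qed.

(* Real coefficients of a power series with radius of convergence at least [1]. *)
Definition subexp (c : nat -> R) : Prop := forall r, 0 <= r < 1 -> geo (fun n => c n * r ^ n).

Lemma subexp_le (a b : nat -> R) : (forall n, Rabs (b n) <= Rabs (a n)) -> subexp a -> subexp b.
Proof.
intros le S r pr; apply (geo_le (fun n => a n * r ^ n)); [|now apply S].
intros n; rewrite !Rabs_mult; apply Rmult_le_compat_r; [apply Rabs_pos|apply le].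
Qed.

Lemma subexp_mulS (a : nat -> R) : subexp a -> subexp (fun n => INR (S n) * a n).
Proof.
intros S r pr; apply (geo_le (fun n => INR (Datatypes.S n) * (a n * r ^ n))).
- intros n; apply Req_le; f_equal; ring.
- now apply geo_mulS, S.
Qed.

Lemma subexp_1 : subexp (fun _ => 1).
Proof.
intros r pr; apply (geo_le (fun n => r ^ n)); [|now apply geo_pow].
intros n; rewrite Rmult_1_l; apply Rle_refl.
Qed.

Lemma subexp_shift (a : nat -> R) : subexp a -> subexp (fun n => a (S n)).
Proof.
intros H r pr.
(* Since [s >= 1 / 2], the missing factor [s] costs at most [2]. *)
set (s := (1 + r) / 2); assert (ps : 1 / 2 <= s < 1) by (unfold s; lra).
destruct (H s ltac:(lra)) as [K [u [pK [pu B]]]].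
exists (2 * K), u; split; [lra|split; [exact pu|]]; intros n.
specialize (B (S n)); rewrite Rabs_mult in *.
rewrite (Rabs_pos_eq (s ^ S n)) in B by (apply pow_le; lra).
rewrite (Rabs_pos_eq (r ^ n)) by (apply pow_le; lra).
assert (E : r ^ n <= s ^ n) by (apply pow_incr; unfold s; lra).
pose proof (Rabs_pos (a (S n))); pose proof (pow_le u n (proj1 pu)).
pose proof (pow_le s n ltac:(lra)); simpl in B.
apply (Rle_trans _ (Rabs (a (S n)) * s ^ n)); [now apply Rmult_le_compat_l|].
apply (Rle_trans _ (2 * (Rabs (a (S n)) * (s * s ^ n)))).
- assert (0 <= Rabs (a (S n)) * s ^ n) by nra; nra.
- assert (K * (u * u ^ n) <= K * u ^ n) by (apply Rmult_le_compat_l; nra); lra.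
Qed.

Definition PS (c : nat -> R) (w : C) : C := CSer (fun n => RtoC (c n) * w ^ n)%C.

Lemma Cmod_term (x : R) (w : C) (n : nat) : Cmod (RtoC x * w ^ n)%C = Rabs (x * Cmod w ^ n).
Proof.
rewrite Cmod_mult, Cmod_R, Cmod_pow, Rabs_mult; f_equal.
rewrite Rabs_pos_eq; [reflexivity|apply pow_le, Cmod_ge_0].
Qed.

Lemma Csum_PS (c : nat -> R) (w : C) :
  subexp c -> Cmod w < 1 -> Csum (fun n => RtoC (c n) * w ^ n)%C.
Proof.
intros S lt; pose proof (Cmod_ge_0 w).
eapply ex_series_ext; [intros n; symmetry; apply Cmod_term|].
apply geo_ex, S; lra.
Qed.

Lemma Cder_pow (f : R -> C) (t : R) (a : C) (n : nat) :
  Cder f t a -> Cder (fun x => f x ^ S n)%C t (RtoC (INR (S n)) * a * f t ^ n)%C.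
Proof.
intros D; induction n as [|n IH].
- eapply Cder_ext; [intros x; symmetry; apply Cpow_1_r|].
  eapply Cder_eq; [exact D|]; simpl Cpow; change (INR 1) with 1; now rewrite Cmult_1_l, Cmult_1_r.
- eapply Cder_ext; [intros x; symmetry; apply Cpow_S|].
  eapply Cder_eq; [exact (Cder_mult _ _ _ _ _ D IH)|].
  rewrite (S_INR (S n)), RtoC_plus, !Cpow_S; ring.
Qed.

Lemma Cder_PS (c : nat -> R) (g g' : R -> C) (a b t r B : R) :
  subexp c -> 0 <= r < 1 -> a < t < b ->
  (forall x, a < x < b -> Cder g x (g' x) /\ Cmod (g x) <= r /\ Cmod (g' x) <= B) ->
  Cder (fun x => PS c (g x)) t (g' t * PS (fun n => INR (S n) * c (S n))%R (g t))%C.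
Proof.
intros S pr It H.
pose (h := fun (n : nat) (x : R) => match n with O => RtoC 0 | Datatypes.S m =>
   (g' x * (RtoC (INR n * c n) * g x ^ m))%C end).
assert (pB : 0 <= B).
{ destruct (H t It) as [_ [_ X]]; pose proof (Cmod_ge_0 (g' t)); lra. }
assert (S' : subexp (fun n => INR (Datatypes.S n) * c (Datatypes.S n)))
  by apply subexp_mulS, subexp_shift, S.
assert (Bh : forall n x, a < x < b -> Cmod (h (Datatypes.S n) x) <=
   B * Rabs (INR (Datatypes.S n) * c (Datatypes.S n) * r ^ n)).
{ intros n x Ix; destruct (H x Ix) as [_ [B1 B2]]; unfold h.
  rewrite Cmod_mult, Cmod_term, !(Rabs_mult (INR (Datatypes.S n) * c (Datatypes.S n))).
  pose proof (Cmod_ge_0 (g x)) as p1; pose proof (Cmod_ge_0 (g' x)).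
  rewrite (Rabs_pos_eq (Cmod (g x) ^ n)) by (apply pow_le; lra).
  rewrite (Rabs_pos_eq (r ^ n)) by (apply pow_le; lra).
  pose proof (pow_incr (Cmod (g x)) r n (conj p1 B1)).
  pose proof (Rabs_pos (INR (Datatypes.S n) * c (Datatypes.S n))).
  pose proof (pow_le (Cmod (g x)) n p1).
  apply Rmult_le_compat; [lra| |lra|apply Rmult_le_compat_l; lra].
  now apply Rmult_le_pos. }
pose (M := fun n => match n with O => 0 | Datatypes.S m =>
   B * Rabs (INR (Datatypes.S m) * c (Datatypes.S m) * r ^ m) end).
assert (EM : ex_series M).
{ apply (ex_series_incr_1 (V := R_NormedModule) M); unfold M.
  apply (ex_series_scal_l (K := R_AbsRing) (V := R_NormedModule) B).
  now apply (geo_ex (fun m => INR (Datatypes.S m) * c (Datatypes.S m) * r ^ m)), S'. }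
assert (BM : forall n x, a < x < b -> Cmod (h n x) <= M n).
{ intros [|n] x Ix; [unfold h, M; rewrite Cmod_0; lra|now apply Bh]. }
eapply Cder_eq.
- apply (Cder_CSer (fun n x => RtoC (c n) * g x ^ n)%C h M a b t It); auto.
  + intros [|n] x Ix; unfold h.
    * eapply Cder_eq; [apply Cder_scal, (Cder_const 1)|ring].
    * eapply Cder_eq; [apply Cder_scal, Cder_pow, H, Ix|rewrite RtoC_mult; ring].
  + intros x Ix; apply Csum_PS; [exact S|]; destruct (H x Ix) as [_ [X _]]; lra.
- rewrite CSer_shift by (apply (Csum_le _ M); auto).
  unfold h at 1; rewrite Cplus_0_l; unfold h, PS; apply CSer_scal.
  apply Csum_PS; [exact S'|]; destruct (H t It) as [_ [X _]]; lra.
Qed.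

Lemma subexp_divsum : subexp divsum.
Proof.
apply (subexp_le (fun n => INR (S n) * (INR (S n) * 1))).
- intros n; pose proof (divsum_bound n); pose proof (pos_INR n).
  rewrite S_INR, !Rabs_pos_eq by nra; nra.
- apply (subexp_mulS (fun n => INR (S n) * 1)), (subexp_mulS (fun _ => 1)), subexp_1.
Qed.

Lemma Csumn_Series_le (a : nat -> C) (M : nat -> R) (N : nat) :
  (forall n, (n < N)%nat -> Cmod (a n) <= M n) -> (forall n, 0 <= M n) -> ex_series M ->
  Cmod (Csumn a N) <= Series M.
Proof.
intros B P E.
destruct (CSer_finite (fun n => if (n <? N)%nat then a n else RtoC 0) N) as [_ H].
{ intros n le; destruct (Nat.ltb_spec n N); [lia|reflexivity]. }
rewrite (Csumn_ext _ a) in H by (intros n lt; destruct (Nat.ltb_spec n N); [reflexivity|lia]).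
rewrite <- H; apply CSer_le; [|exact E].
intros n; destruct (Nat.ltb_spec n N); [auto|rewrite Cmod_0; auto].
Qed.

Lemma finite_bound (u : nat -> R) (N : nat) : exists K, 0 <= K /\ forall n, (n < N)%nat -> u n <= K.
Proof.
induction N as [|N [K [pK B]]]; [exists 0; split; [lra|lia]|].
exists (Rmax K (u N)); split; [eapply Rle_trans; [exact pK|apply Rmax_l]|].
intros n lt; destruct (Nat.eq_dec n N) as [->|ne]; [apply Rmax_r|].
eapply Rle_trans; [apply B; lia|apply Rmax_l].
Qed.

(* The recurrence gives [n u_n <= alpha S max_{m<n} u_m] for [u_n = p(n) r^n],
   [S = sum divsum(i) r^i]; so [u] stops growing once [n >= alpha S]. *)
Lemma frac_partition_bound (alpha r : R) :
  0 <= alpha -> 0 <= r < 1 ->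
  exists K, 0 <= K /\ forall n, frac_partition alpha n * r ^ n <= K.
Proof.
intros pa pr.
set (s := fun i => Rabs (divsum i * r ^ i)).
assert (Es : ex_series s) by now apply (geo_ex (fun i => divsum i * r ^ i)), subexp_divsum.
assert (Ps : forall i, 0 <= s i) by (intros; apply Rabs_pos).
set (u := fun n => frac_partition alpha n * r ^ n).
assert (Pu : forall n, 0 <= u n)
  by (intros; apply Rmult_le_pos; [now apply frac_partition_pos|apply pow_le; lra]).
destruct (INR_unbounded (alpha * Series s)) as [N HN].
destruct (finite_bound u (S N)) as [K [pK BK]].
exists K; split; [exact pK|]; fold u.
intros n; change (u n <= K); induction n as [n IH] using lt_wf_ind.
destruct (Nat.lt_ge_cases n (S N)) as [lt|ge]; [now apply BK|].
assert (pn : 0 < INR n) by (apply lt_0_INR; lia).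
assert (E : RtoC (INR n * u n) = (RtoC alpha * Csumn (fun i => RtoC (divsum i * r ^ i) * RtoC (u (n - i)%nat)) (S n))%C).
{ unfold u; rewrite <- Rmult_assoc, RtoC_mult, frac_partition_rec, <- Cmult_assoc.
  f_equal; unfold conv; rewrite Cmult_comm, <- Csumn_scal; apply Csumn_ext; intros i lt.
  replace (r ^ n) with (r ^ i * r ^ (n - i)) by (rewrite <- pow_add; f_equal; lia).
  rewrite !RtoC_mult; ring. }
assert (Bn : INR n * u n <= alpha * (Series s * K)).
{ rewrite <- (Rabs_pos_eq (INR n * u n)) by (apply Rmult_le_pos; [lra|apply Pu]).
  rewrite <- Cmod_R, E, Cmod_mult, Cmod_R, Rabs_pos_eq by exact pa.
  apply Rmult_le_compat_l; [exact pa|]; rewrite <- Series_scal_r.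
  apply Csumn_Series_le.
  - intros i lt; rewrite Cmod_mult, !Cmod_R, (Rabs_pos_eq (u _)) by apply Pu.
    destruct i as [|i].
    + unfold s; change (divsum 0) with 0; rewrite Rmult_0_l, Rabs_R0; lra.
    + apply Rmult_le_compat_l; [apply Rabs_pos|apply IH; lia].
  - intros i; apply Rmult_le_pos; auto.
  - now apply ex_series_scal_r. }
assert (INR N <= INR n) by (apply le_INR; lia).
apply (Rmult_le_reg_l (INR n)); [exact pn|]; nra.
Qed.

Lemma subexp_frac_partition (alpha : R) : 0 <= alpha -> subexp (frac_partition alpha).
Proof.
intros pa r pr.
(* Boundedness of [p(n) s^n] for a larger [s] yields geometric decay of [p(n) r^n], with ratio
   [r / s]. *)
set (s := (1 + r) / 2); assert (ps : 1 / 2 <= s < 1) by (unfold s; lra).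
destruct (frac_partition_bound alpha s pa ltac:(lra)) as [K [pK B]].
exists K, (r / s); split; [exact pK|split].
- split; [apply Rdiv_le_0_compat; lra|].
  apply (Rmult_lt_reg_r s); [lra|]; unfold Rdiv; rewrite Rmult_assoc, Rinv_l; unfold s; lra.
- intros n; rewrite Rabs_pos_eq
    by (apply Rmult_le_pos; [now apply frac_partition_pos|apply pow_le; lra]).
  replace (r ^ n) with (s ^ n * (r / s) ^ n)
    by (rewrite <- Rpow_mult_distr; f_equal; field; lra).
  rewrite <- Rmult_assoc; apply Rmult_le_compat_r; [|apply B].
  apply pow_le, Rdiv_le_0_compat; lra.
Qed.

Definition logP_coef (n : nat) : R := divsum n / INR n.

Lemma subexp_logP : subexp logP_coef.
Proof.
apply (subexp_le divsum); [|exact subexp_divsum].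
intros [|n]; unfold logP_coef.
- change (divsum 0) with 0; unfold Rdiv; rewrite Rmult_0_l; apply Rle_refl.
- unfold Rdiv; rewrite Rabs_mult; rewrite <- (Rmult_1_r (Rabs (divsum (S n)))) at 2.
  apply Rmult_le_compat_l; [apply Rabs_pos|].
  pose proof (pos_INR n); rewrite S_INR, Rabs_pos_eq.
  + rewrite <- Rinv_1; apply Rinv_le_contravar; lra.
  + apply Rlt_le, Rinv_0_lt_compat; lra.
Qed.

(* [prod (1 - q^k)^(-alpha) = exp (alpha * sum divsum(n) q^n / n)]: along the segment [t q] both
   sides satisfy the same linear differential equation. *)
Lemma PS_frac_partition (alpha : R) (q : C) :
  0 <= alpha -> Cmod q < 1 ->
  PS (frac_partition alpha) q = cexp (RtoC alpha * PS logP_coef q)%C.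
Proof.
intros pa lt; pose proof (Cmod_ge_0 q) as pq.
(* A number above [1] with [|q| R0 < 1]: the segment is followed on an open interval containing
   [[0, 1]] on which the argument stays well inside the unit disc. *)
set (R0 := 2 / (1 + Cmod q)).
assert (HR : 1 < R0 /\ Cmod q * R0 < 1).
{ unfold R0; split; apply (Rmult_lt_reg_r (1 + Cmod q)); try lra; unfold Rdiv.
  - rewrite Rmult_assoc, Rinv_l; lra.
  - replace (Cmod q * (2 * / (1 + Cmod q)) * (1 + Cmod q)) with (2 * Cmod q) by (field; lra); lra. }
set (p := frac_partition alpha).
assert (Sp : subexp p) by now apply subexp_frac_partition.
assert (D : forall c t, subexp c -> - R0 < t < R0 ->
  Cder (fun x => PS c (q * RtoC x)%C) t (q * PS (fun n => INR (S n) * c (S n))%R (q * RtoC t))%C).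
{ intros c t Sc It.
  apply (Cder_PS c (fun x => q * RtoC x)%C (fun _ => q) (- R0) R0 t (Cmod q * R0) (Cmod q)); auto.
  - split; [apply Rmult_le_pos; lra|lra].
  - intros x Ix; split; [|split; [|apply Rle_refl]].
    + eapply Cder_eq; [apply Cder_scal, Cder_id|apply Cmult_1_r].
    + rewrite Cmod_mult, Cmod_R; apply Rmult_le_compat_l; [exact pq|].
      apply Rabs_le; lra. }
assert (in01 : forall t, 0 <= t <= 1 -> - R0 < t < R0) by (intros; lra).
assert (inlt : forall t, 0 <= t <= 1 -> Cmod (q * RtoC t)%C < 1).
{ intros t Ht; rewrite Cmod_mult, Cmod_R, Rabs_pos_eq by lra; nra. }
(* The recurrence for the coefficients, read as the differential equation [P' = alpha L' P] between
   power series. *)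
assert (ODE : forall w, Cmod w < 1 ->
  PS (fun n => INR (S n) * p (S n)) w =
  (RtoC alpha * (PS (fun n => INR (S n) * logP_coef (S n))%R w * PS p w))%C).
{ intros w lw.
  assert (SL : subexp (fun n => INR (S n) * logP_coef (S n)))
    by apply subexp_mulS, subexp_shift, subexp_logP.
  unfold PS at 2 3; rewrite <- Cauchy_product by (apply Csum_PS; assumption).
  assert (E : forall n, (RtoC (INR (S n) * p (S n)) * w ^ n)%C =
    (RtoC alpha * conv (fun n0 => RtoC (INR (S n0) * logP_coef (S n0))%R * w ^ n0)
                  (fun n0 => RtoC (p n0) * w ^ n0) n)%C).
  { intros n; unfold p; rewrite frac_partition_rec, <- Cmult_assoc; f_equal; unfold conv.
    rewrite Cmult_comm, <- Csumn_scal, Csumn_shift.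
    change (divsum 0) with 0; rewrite Cmult_0_l, Cmult_0_r, Cplus_0_l.
    apply Csumn_ext; intros i li.
    replace (S n - S i)%nat with (n - i)%nat by lia.
    replace (w ^ n)%C with (w ^ i * w ^ (n - i))%C by (rewrite <- Cpow_add_r; f_equal; lia).
    replace (INR (S i) * logP_coef (S i)) with (divsum (S i)).
    - ring.
    - unfold logP_coef; field; apply not_0_INR; lia. }
  unfold PS; rewrite (CSer_ext _ _ E).
  destruct (Req_dec alpha 0) as [->|nz].
  - rewrite Cmult_0_l, (CSer_ext _ (fun _ => RtoC 0)) by (intros; apply Cmult_0_l).
    now rewrite CSer_RtoC, Series_0.
  - apply CSer_scal.
    apply (Csum_ext (fun n => / RtoC alpha * (RtoC (INR (S n) * p (S n)) * w ^ n))%C).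
    + intros n; rewrite E; field; intros X; apply nz, RtoC_inj, X.
    + apply Csum_scal, (Csum_PS (fun n => INR (S n) * p (S n))); [|exact lw].
      now apply subexp_mulS, subexp_shift. }
set (F := fun t => (PS p (q * RtoC t) * cexp (- RtoC alpha * PS logP_coef (q * RtoC t)))%C).
assert (DF : forall t, 0 <= t <= 1 -> Cder F t 0).
{ intros t Ht; eapply Cder_eq.
  - apply Cder_mult; [apply (D p); auto|].
    apply Cder_cexp, Cder_scal, (D logP_coef); [exact subexp_logP|auto].
  - rewrite ODE by auto; ring. }
assert (E : F 1 = F 0).
{ apply C_eta; symmetry; apply (eq_is_derive (V := R_NormedModule) (fun t => _ (F t))); try lra;
    intros t Ht; apply DF, Ht. }
assert (PS0 : forall c, subexp c -> PS c (q * RtoC 0)%C = RtoC (c 0%nat)).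
{ intros c Sc; unfold PS; rewrite Cmult_0_r, CSer_shift by (apply Csum_PS; [exact Sc|rewrite Cmod_0; lra]).
  rewrite (CSer_ext _ (fun _ => RtoC 0)), CSer_RtoC, Series_0 by (auto; intros; simpl Cpow; ring).
  simpl Cpow; ring. }
unfold F in E; rewrite !PS0 in E by (auto; exact subexp_logP).
unfold p in E at 2; rewrite frac_partition_0 in E.
unfold logP_coef in E at 2; change (divsum 0) with 0 in E.
unfold Rdiv in E; rewrite Rmult_0_l, Cmult_0_r, cexp_0, Cmult_1_r, Cmult_1_r in E.
replace (- RtoC alpha * PS logP_coef q)%C with (- (RtoC alpha * PS logP_coef q))%C in E by ring.
rewrite cexp_opp in E; fold p.
pose proof (cexp_neq_0 (RtoC alpha * PS logP_coef q)) as nz.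
transitivity (PS p q * / cexp (RtoC alpha * PS logP_coef q) * cexp (RtoC alpha * PS logP_coef q))%C;
  [field; exact nz|].
rewrite E; apply Cmult_1_l.
Qed.

(** * Partial fractions of the hyperbolic cotangent *)

Lemma ex_series_telescope (b : nat -> R) : is_lim_seq b 0 -> ex_series (fun n => b n - b (S n)).
Proof.
intros L; exists (b 0%nat - 0); unfold is_series.
apply (filterlim_ext (fun n => b 0%nat - b (S n))).
- intros n; induction n as [|n IH]; [now rewrite sum_O|].
  rewrite sum_Sn, <- IH; unfold plus; simpl; ring.
- apply (is_lim_seq_minus (fun _ => b 0%nat) (fun n => b (S n)) (b 0%nat) 0 (b 0%nat - 0)).
  + apply is_lim_seq_const.
  + now apply is_lim_seq_incr_1 in L.
  + reflexivity.
Qed.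

Lemma is_lim_seq_inv_INR : is_lim_seq (fun n => / INR (S n)) 0.
Proof.
apply (is_lim_seq_inv (fun n => INR (S n)) p_infty); [|discriminate].
apply (is_lim_seq_incr_1 INR), is_lim_seq_INR.
Qed.

Lemma ex_series_inv_sqr : ex_series (fun n => / INR (S n) ^ 2).
Proof.
apply (ex_series_incr_1 (V := R_NormedModule) (fun n => / INR (S n) ^ 2)).
apply (ex_series_le (V := R_CompleteNormedModule) _ (fun n => / INR (S n) - / INR (S (S n)))).
2:{ apply ex_series_telescope, is_lim_seq_inv_INR. }
intros n; unfold norm; simpl norm; unfold abs; cbv beta.
rewrite (S_INR (S n)), (S_INR n); pose proof (pos_INR n).
simpl; rewrite Rabs_pos_eq.
- apply (Rmult_le_reg_r ((INR n + 1 + 1) ^ 2 * (INR n + 1))); [nra|].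
  replace (/ ((INR n + 1 + 1) * ((INR n + 1 + 1) * 1)) * ((INR n + 1 + 1) ^ 2 * (INR n + 1)))
    with (INR n + 1) by (field; lra).
  replace ((/ (INR n + 1) - / (INR n + 1 + 1)) * ((INR n + 1 + 1) ^ 2 * (INR n + 1)))
    with (INR n + 1 + 1) by (field; lra); lra.
- apply Rlt_le, Rinv_0_lt_compat; nra.
Qed.

Definition iN (n : nat) : C := (Ci * RtoC (INR n))%C.

Lemma fst_iN (n : nat) : fst (iN n) = 0.
Proof. unfold iN; simpl; ring. Qed.

Definition PIC : C := RtoC PI.

Lemma PIC_neq_0 : PIC <> 0.
Proof. intros E; apply RtoC_inj in E; pose proof PI_RGT_0; lra. Qed.

Definition qexp (x : C) : C := cexp (- (2 * PIC * x))%C.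

Lemma fst_qexp_arg (x : C) : fst (- (2 * PIC * x))%C = - (2 * PI * fst x).
Proof. unfold PIC; simpl; ring. Qed.

Lemma Cmod_qexp (x : C) : Cmod (qexp x) = exp (- (2 * PI * fst x)).
Proof. unfold qexp; now rewrite Cmod_cexp, fst_qexp_arg. Qed.

Lemma Cmod_qexp_lt (x : C) : 0 < fst x -> Cmod (qexp x) < 1.
Proof.
intros pos; rewrite Cmod_qexp, <- exp_0; apply exp_increasing.
pose proof PI_RGT_0; nra.
Qed.

Lemma one_minus_neq_0 (q : C) : Cmod q < 1 -> (1 - q)%C <> 0.
Proof.
intros lt E; apply Ceq_minus in E; rewrite <- E, Cmod_1 in lt; lra.
Qed.

Lemma one_minus_qexp (x : C) : 0 < fst x -> (1 - qexp x)%C <> 0.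
Proof. intros pos; now apply one_minus_neq_0, Cmod_qexp_lt. Qed.

Lemma qexp_plus (x y : C) : qexp (x + y)%C = (qexp x * qexp y)%C.
Proof. unfold qexp; rewrite <- cexp_plus; f_equal; ring. Qed.

Lemma qexp_iZ (n : Z) : qexp (Ci * RtoC (IZR n))%C = 1.
Proof.
unfold qexp, PIC; replace (- (2 * PI * (Ci * IZR n)))%C with (RtoC (2 * PI * IZR (- n)) * Ci)%C.
- apply cexp_2PI.
- rewrite opp_IZR, !RtoC_mult, RtoC_opp; ring.
Qed.

Lemma qexp_iN (n : nat) : qexp (iN n) = 1.
Proof. unfold iN; rewrite INR_IZR_INZ; apply qexp_iZ. Qed.

Lemma qexp_periodic (x : C) (n : nat) : qexp (x + iN n)%C = qexp x.
Proof. rewrite qexp_plus, qexp_iN; apply Cmult_1_r. Qed.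

Lemma qexp_half : qexp (Ci / 2)%C = (- (1))%C.
Proof.
unfold qexp, PIC.
replace (- (2 * PI * (Ci / 2)))%C with (- (Ci * RtoC PI))%C
  by (field; intros E; apply RtoC_inj in E; lra).
apply C_eta; unfold cexp; simpl.
- replace (- (0 * PI - 1 * 0)) with 0 by ring; replace (- (0 * 0 + 1 * PI)) with (- PI) by ring.
  rewrite cos_neg, cos_PI, exp_0; ring.
- replace (- (0 * PI - 1 * 0)) with 0 by ring; replace (- (0 * 0 + 1 * PI)) with (- PI) by ring.
  rewrite sin_neg, sin_PI, exp_0; ring.
Qed.

(* [pi coth (pi x)] *)
Definition cothpi (x : C) : C := (PIC * (1 + qexp x) / (1 - qexp x))%C.

Lemma C2_neq_0 : RtoC 2 <> 0.
Proof. intros E; apply RtoC_inj in E; lra. Qed.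

(** With [e = exp (- PI x)], the shift by [Ci / 2] changes the sign of [e], and
    [1 - e^2 = (1 - e) (1 + e)] splits the fraction. Iterating this duplication formula writes
    [cothpi] as a sum of [2^N] shifted copies of itself on a finer scale. *)
Lemma cothpi_double (x : C) :
  0 < fst x -> cothpi x = ((cothpi (x / 2) + cothpi (x / 2 + Ci / 2)) / 2)%C.
Proof.
intros pos; set (e := qexp (x / 2)).
assert (E1 : qexp x = (e * e)%C).
{ unfold e; rewrite <- qexp_plus; f_equal; field; exact C2_neq_0. }
assert (E2 : qexp (x / 2 + Ci / 2)%C = (- e)%C).
{ rewrite qexp_plus, qexp_half; fold e; ring. }
assert (L : Cmod e < 1).
{ apply Cmod_qexp_lt; simpl.
  replace (_ - _) with (fst x / 2) by (field; lra); lra. }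
assert (n1 := one_minus_neq_0 _ L).
assert (n2 : (1 + e)%C <> 0).
{ replace (1 + e)%C with (1 - (- e))%C by ring; apply one_minus_neq_0; now rewrite Cmod_opp. }
assert (n3 : (1 - e * e)%C <> 0).
{ replace (1 - e * e)%C with ((1 - e) * (1 + e))%C by ring; now apply Cmult_neq_0. }
unfold cothpi; rewrite E1, E2; fold e.
replace (1 - - e)%C with (1 + e)%C by ring; field; auto using C2_neq_0.
Qed.

Definition cothpi_scaled (N : nat) (x : C) : C := (RtoC (/ 2 ^ N) * cothpi (RtoC (/ 2 ^ N) * x))%C.

Lemma cothpi_scaled_S (N : nat) (x : C) :
  0 < fst x ->
  cothpi_scaled N x = (cothpi_scaled (S N) x + cothpi_scaled (S N) (x + iN (2 ^ N)))%C.
Proof.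
intros pos; unfold cothpi_scaled.
assert (p2 : 0 < / 2 ^ N) by (apply Rinv_0_lt_compat, pow_lt; lra).
rewrite cothpi_double by (simpl; nra).
assert (E : / 2 ^ S N = / 2 ^ N * / 2) by (simpl; rewrite Rinv_mult; ring).
assert (E2 : RtoC (/ 2) = (/ 2)%C) by (apply RtoC_inv; lra).
rewrite E, !RtoC_mult, E2.
replace (RtoC (/ 2 ^ N) * / 2 * (x + iN (2 ^ N)))%C with (RtoC (/ 2 ^ N) * x / 2 + Ci / 2)%C.
- replace (RtoC (/ 2 ^ N) * / 2 * x)%C with (RtoC (/ 2 ^ N) * x / 2)%C
    by (field; exact C2_neq_0).
  field; exact C2_neq_0.
- unfold iN; rewrite pow_INR; change (INR 2) with 2.
  transitivity (RtoC (/ 2 ^ N) * x / 2 + (RtoC (/ 2 ^ N) * RtoC (2 ^ N)) * Ci / 2)%C.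
  + rewrite <- RtoC_mult, Rinv_l by (apply pow_nonzero; lra); field; exact C2_neq_0.
  + field; exact C2_neq_0.
Qed.

Lemma fst_plus_iN (x : C) (n : nat) : fst (x + iN n)%C = fst x.
Proof. simpl; ring. Qed.

Lemma iN_plus (m n : nat) : iN (m + n) = (iN m + iN n)%C.
Proof. unfold iN; rewrite plus_INR, RtoC_plus; ring. Qed.

Lemma cothpi_sum (N : nat) (x : C) :
  0 < fst x -> cothpi x = Csumn (fun j => cothpi_scaled N (x + iN j)%C) (2 ^ N).
Proof.
intros pos; induction N as [|N IH].
- simpl; unfold cothpi_scaled; simpl pow; rewrite Rinv_1, !Cmult_1_l.
  unfold iN; simpl INR; rewrite Cmult_0_r, Cplus_0_r; symmetry; apply Cplus_0_l.
- rewrite IH; replace (2 ^ S N)%nat with (2 ^ N + 2 ^ N)%nat by (simpl; lia).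
  rewrite Csumn_split, <- Csumn_plus; apply Csumn_ext; intros j lt.
  rewrite cothpi_scaled_S by (rewrite fst_plus_iN; exact pos).
  rewrite (Nat.add_comm (2 ^ N)), iN_plus, Cplus_assoc; reflexivity.
Qed.

Lemma cothpi_scaled_periodic (N : nat) (x : C) :
  cothpi_scaled N (x + iN (2 ^ N))%C = cothpi_scaled N x.
Proof.
unfold cothpi_scaled, cothpi; rewrite (Cmult_plus_distr_l (RtoC (/ 2 ^ N)) x).
replace (RtoC (/ 2 ^ N) * iN (2 ^ N))%C with (iN 1).
- now rewrite qexp_periodic.
- unfold iN; rewrite pow_INR; change (INR 2) with 2; change (INR 1) with 1.
  transitivity (Ci * (RtoC (/ 2 ^ N) * RtoC (2 ^ N)))%C; [|ring].
  rewrite <- RtoC_mult, Rinv_l by (apply pow_nonzero; lra); reflexivity.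
Qed.

(* Pairing the poles [- j i] and [(j + 1) i] makes the limit series absolutely convergent. *)
Lemma cothpi_sum_paired (M : nat) (x : C) :
  0 < fst x ->
  cothpi x = Csumn (fun j => cothpi_scaled (S M) (x + iN j) +
                             cothpi_scaled (S M) (x - iN (S j)))%C (2 ^ M).
Proof.
intros pos; rewrite (cothpi_sum (S M) x pos).
replace (2 ^ S M)%nat with (2 ^ M + 2 ^ M)%nat by (simpl; lia).
rewrite Csumn_split, Csumn_plus; f_equal.
assert (K : exists n, (2 ^ M = S n)%nat).
{ exists (pred (2 ^ M)); pose proof (Nat.pow_nonzero 2 M); lia. }
destruct K as [n Hn]; rewrite Hn, Csumn_rev; apply Csumn_ext; intros j lt.
rewrite <- (cothpi_scaled_periodic (S M) (x - iN (S j))%C).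
f_equal; replace (2 ^ S M)%nat with (S n + (n - j) + S j)%nat by (simpl; lia).
rewrite !(iN_plus _ (S j)); ring.
Qed.

(** The Taylor polynomial of degree seven bounds the sine from below. The range is half of the
    [42 / 10] of [one_minus_cexp_lower], where the sine of half the imaginary part occurs. *)
Lemma sin_lower (y : R) : 0 <= y <= 21 / 10 -> y / 4 <= sin y.
Proof.
intros Hy; pose proof PI_RGT_0.
assert (P3 : 3 <= PI) by (pose proof PI2_3_2; lra).
destruct (sin_bound y 1) as [L _]; [lra|lra|].
eapply Rle_trans; [|exact L]; unfold sin_approx, sin_term; simpl.
set (s := y * y); assert (Hs : 0 <= s <= 45 / 10) by (unfold s; nra).
match goal with |- _ <= ?r => replace r with (y * (1 - s / 6 + s * s / 120 - s * s * s / 5040))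
  by (unfold s; field) end.
assert (1 / 4 <= 1 - s / 6 + s * s / 120 - s * s * s / 5040) by nra.
nra.
Qed.

Lemma sin_sqr_lower (y : R) : Rabs y <= 21 / 10 -> (y / 4) ^ 2 <= sin y ^ 2.
Proof.
intros Hy; destruct (Rle_or_lt 0 y) as [p|n].
- rewrite Rabs_pos_eq in Hy by exact p; pose proof (sin_lower y (conj p Hy)); nra.
- rewrite Rabs_left in Hy by exact n.
  pose proof (sin_lower (- y) ltac:(lra)) as L; rewrite sin_neg in L; nra.
Qed.

(** For [w = a + i b] and [e = exp (- a)] one has [|1 - exp (- w)|^2 = (1 - e)^2 + 4 e sin(b /
    2)^2], and the two terms control [a] and [b] separately. The bound [42 / 10] is
    [8 (1 / 2 + 1 / 40)]: the imaginary parts met below are at most [2 PI (1 / 2 + 1 / 40)], and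
    [PI <= 4]. *)
Lemma one_minus_cexp_lower (w : C) :
  0 <= fst w <= 1 -> Rabs (snd w) <= 42 / 10 -> Cmod w / 8 <= Cmod (1 - cexp (- w))%C.
Proof.
destruct w as [a b]; simpl fst; simpl snd; intros Ha Hb.
assert (Cw := Cmod_ge_0 (a, b)).
apply Rsqr_incr_0_var; [|apply Cmod_ge_0]; unfold Rsqr.
replace (Cmod (a, b) / 8 * (Cmod (a, b) / 8)) with (Cmod (a, b) ^ 2 / 64) by field.
replace (Cmod (1 - cexp (- (a, b))) * Cmod (1 - cexp (- (a, b))))
  with (Cmod (1 - cexp (- (a, b))) ^ 2) by ring.
rewrite !Cmod2_alt; unfold Re, Im, cexp; simpl fst; simpl snd.
rewrite cos_neg, sin_neg.
set (e := exp (- a)).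
assert (He : 1 / 3 <= e <= 1 - a / 2).
{ unfold e; split.
  - apply (Rle_trans _ (exp (Ropp 1))).
    + rewrite exp_Ropp; pose proof exp_le_3; pose proof (exp_pos 1).
      unfold Rdiv; rewrite Rmult_1_l; apply Rinv_le_contravar; lra.
    + destruct (Req_dec a 1) as [->|ne]; [lra|].
      left; apply exp_increasing; lra.
  - rewrite exp_Ropp; apply (Rmult_le_reg_r (exp a)); [apply exp_pos|].
    rewrite Rinv_l by (apply Rgt_not_eq, exp_pos).
    assert (1 + a <= exp a).
    { destruct (Req_dec a 0) as [->|ne]; [rewrite exp_0; lra|].
      left; apply exp_ineq1; lra. }
    nra. }
assert (Hs : (b / 8) ^ 2 <= sin (b / 2) ^ 2).
{ replace (b / 8) with (b / 2 / 4) by field; apply sin_sqr_lower.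
  unfold Rdiv; rewrite Rabs_mult, (Rabs_pos_eq (/ 2)) by lra; lra. }
replace ((1 + - (e * cos b)) ^ 2 + (0 + - (e * - sin b)) ^ 2)
  with ((1 - e) ^ 2 + 4 * e * sin (b / 2) ^ 2).
- assert (a / 2 <= 1 - e) by lra; assert ((a / 2) ^ 2 <= (1 - e) ^ 2) by nra; nra.
- assert (Ec : cos b = 1 - 2 * sin (b / 2) * sin (b / 2))
    by (rewrite <- cos_2a_sin; f_equal; field).
  pose proof (sin2_cos2 b) as Q; unfold Rsqr in Q.
  transitivity (1 - 2 * e * cos b + e * e * (sin b * sin b + cos b * cos b)); [|ring].
  rewrite Q, Ec; ring.
Qed.

Lemma one_minus_cexp_upper (v : C) : Cmod (1 - cexp (- v))%C <= Cmod v * exp (Cmod v).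
Proof.
assert (D : forall t, 0 <= t <= 1 ->
  Cder (fun t => cexp (RtoC t * - v)%C) t (- v * cexp (RtoC t * - v))%C).
{ intros t _; apply Cder_cexp; eapply Cder_eq.
  - apply Cder_mult; [apply Cder_id|apply Cder_const].
  - cbv beta; ring. }
pose proof (C_mean_value _ _ 0 1 (Cmod v * exp (Cmod v)) Rle_0_1 D) as B; cbv beta in B.
rewrite Cmult_0_l, cexp_0, Cmult_1_l in B.
replace (1 - cexp (- v))%C with (- (cexp (- v) - 1))%C by ring; rewrite Cmod_opp.
rewrite Rminus_0_r, Rmult_1_r in B; apply B.
intros t Ht; rewrite Cmod_mult, Cmod_opp, Cmod_cexp.
apply Rmult_le_compat_l; [apply Cmod_ge_0|].
assert (Y : fst (RtoC t * - v)%C <= Cmod v).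
{ pose proof (fst_le_Cmod v) as F; pose proof (Cmod_ge_0 v).
  assert (Rabs (fst v) <= Cmod v) by exact F.
  apply Rabs_le_between in F; simpl; nra. }
destruct Y as [lt|E]; [left; now apply exp_increasing|rewrite E; apply Rle_refl].
Qed.

(** The real part controls [x], and then the imaginary part controls [t]. The constant makes all
    lower bounds for denominators uniform in the lattice point. *)
Lemma Cmod_line_lower (z : C) :
  0 < fst z -> exists c, 0 < c /\ forall x t : R, 0 <= x ->
    c * (x + Rabs t) <= Cmod (RtoC x * z + Ci * RtoC t)%C.
Proof.
intros pos; pose proof (Cmod_ge_0 z) as pz.
set (c := / (/ fst z + 1 + Cmod z / fst z)).
assert (pi : 0 < / fst z) by now apply Rinv_0_lt_compat.
assert (pq : 0 < / fst z + 1 + Cmod z / fst z).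
{ assert (0 <= Cmod z / fst z) by (apply Rdiv_le_0_compat; lra); lra. }
exists c; split; [now apply Rinv_0_lt_compat|]; intros x t px.
set (W := (RtoC x * z + Ci * RtoC t)%C).
assert (B1 : x * fst z <= Cmod W).
{ eapply Rle_trans; [|apply fst_le_Cmod]; eapply Rle_trans; [|apply Rle_abs].
  unfold W; simpl; lra. }
assert (B2 : Rabs t <= Cmod W + x * Cmod z).
{ replace (Rabs t) with (Cmod (W - RtoC x * z)%C).
  - eapply Rle_trans; [apply Cmod_triangle|]; rewrite Cmod_opp, Cmod_mult, Cmod_R, Rabs_pos_eq by exact px.
    apply Rle_refl.
  - unfold W; replace (_ - _)%C with (Ci * RtoC t)%C by ring.
    rewrite Cmod_mult, Cmod_Ci, Cmod_R; apply Rmult_1_l. }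
assert (B3 : x <= Cmod W * / fst z).
{ apply (Rmult_le_reg_r (fst z)); [exact pos|]; rewrite Rmult_assoc, Rinv_l; lra. }
apply (Rmult_le_reg_l (/ fst z + 1 + Cmod z / fst z)); [exact pq|].
unfold c; rewrite <- Rmult_assoc, Rinv_r, Rmult_1_l by lra.
unfold Rdiv; assert (x * Cmod z <= Cmod W * / fst z * Cmod z) by now apply Rmult_le_compat_r.
lra.
Qed.

Lemma is_lim_seq_half_pow : is_lim_seq (fun N => / 2 ^ N) 0.
Proof.
apply (is_lim_seq_ext (fun N => (/ 2) ^ N)); [intros; apply pow_inv|].
apply is_lim_seq_geom; rewrite Rabs_pos_eq; lra.
Qed.

Lemma Clim_half_pow (f : R -> C) (l : C) :
  Clim (locally' 0) f l -> Clim eventually (fun N => f (/ 2 ^ N)) l.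
Proof.
intros L eps; destruct (L eps) as [d Hd].
pose proof is_lim_seq_half_pow as H; apply is_lim_seq_spec in H; destruct (H d) as [N HN].
exists N; intros n le; apply Hd.
- exact (HN n le).
- apply Rinv_neq_0_compat, pow_nonzero; lra.
Qed.

(** This is the simple pole of [cothpi] at [0]: the denominator divided by [2^(- N)] tends to
    [2 PI x], a derivative of the exponential, while the numerator tends to [2 PI]. *)
Lemma cothpi_scaled_lim (x : C) :
  0 < fst x -> Clim eventually (fun N => cothpi_scaled N x) (/ x)%C.
Proof.
intros pos; pose proof (Cneq_fst _ pos) as nz.
set (X := (2 * PIC * x)%C).
assert (nX : X <> 0) by (repeat apply Cmult_neq_0; auto using C2_neq_0, PIC_neq_0).
assert (D : Cder (fun h => cexp (RtoC h * - X)%C) 0 (- X)%C).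
{ eapply Cder_eq; [apply Cder_cexp, Cder_mult; [apply Cder_id|apply Cder_const]|].
  cbv beta; rewrite !Cmult_0_l, cexp_0; ring. }
assert (E : forall N, qexp (RtoC (/ 2 ^ N) * x)%C = cexp (RtoC (/ 2 ^ N) * - X)%C).
{ intros N; unfold qexp, X; f_equal; ring. }
assert (L1 := Clim_half_pow _ _ (proj1 (Cder_Clim _ _ _) D)); cbv beta in L1.
assert (L2 : Clim eventually (fun N => qexp (RtoC (/ 2 ^ N) * x)%C) 1).
{ assert (K : Clim (locally' 0) (fun h => cexp (RtoC h * - X)%C) 1).
  { pose proof (proj1 (Ccont_Clim _ _) (Cder_Ccont _ _ _ D)) as K.
    cbv beta in K; rewrite Cmult_0_l, cexp_0 in K; intros eps; destruct (K eps) as [d Hd].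
    exists d; intros h Bh _; exact (Hd h Bh). }
  apply Clim_half_pow in K; revert K; apply Clim_ext; [apply eventually_filter|].
  intros N; symmetry; apply E. }
apply (Clim_ext _ (fun N => PIC * (1 + qexp (RtoC (/ 2 ^ N) * x)) *
   / (- ((cexp (RtoC (0 + / 2 ^ N) * - X) - cexp (RtoC 0 * - X)) / RtoC (/ 2 ^ N))))%C).
- intros N; rewrite Rplus_0_l, Cmult_0_l, cexp_0, <- E.
  assert (n1 : (1 - qexp (RtoC (/ 2 ^ N) * x))%C <> 0).
  { apply one_minus_qexp; simpl; assert (0 < / 2 ^ N) by (apply Rinv_0_lt_compat, pow_lt; lra); nra. }
  assert (n2 : RtoC (/ 2 ^ N) <> 0).
  { intros F; apply RtoC_inj in F; revert F; apply Rinv_neq_0_compat, pow_nonzero; lra. }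
  unfold cothpi_scaled, cothpi.
  set (q := qexp _) in *; set (r := RtoC (/ 2 ^ N)) in *.
  assert (n3 : (q - 1)%C <> 0).
  { intros F; apply n1; replace (1 - q)%C with (- (q - 1))%C by ring; rewrite F; ring. }
  field; auto.
- eapply Clim_eq.
  + apply Clim_mult; [apply eventually_filter| |].
    * apply Clim_scal; [apply eventually_filter|].
      apply Clim_plus; [apply eventually_filter|apply Clim_const, eventually_filter|exact L2].
    * apply Clim_inv; [apply eventually_filter| |].
      -- apply (Clim_ext _ (fun N => (-1) *
           ((cexp (RtoC (0 + / 2 ^ N) * - X) - cexp (RtoC 0 * - X)) / RtoC (/ 2 ^ N)))%C);
           [intros; ring|].
         apply Clim_scal; [apply eventually_filter|exact L1].
      -- intros F; apply nX; transitivity ((-1) * - X)%C; [ring|exact F].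
  + unfold X; field; auto using PIC_neq_0, C2_neq_0.
Qed.

Lemma Cmod_line_lower_N (u : C) :
  0 < fst u -> exists c, 0 < c /\ forall j : nat,
    c * INR (S j) <= Cmod (u + iN j)%C /\ c * INR (S j) <= Cmod (u - iN (S j))%C.
Proof.
intros pos; destruct (Cmod_line_lower u pos) as [c [pc H]].
exists c; split; [exact pc|]; intros j; pose proof (pos_INR j) as pj.
split.
- replace (u + iN j)%C with (RtoC 1 * u + Ci * RtoC (INR j))%C by (unfold iN; ring).
  eapply Rle_trans; [|apply (H 1 (INR j)); lra].
  rewrite S_INR, Rabs_pos_eq by exact pj; lra.
- replace (u - iN (S j))%C with (RtoC 1 * u + Ci * RtoC (- INR (S j)))%C
    by (unfold iN; rewrite RtoC_opp; ring).
  eapply Rle_trans; [|apply (H 1 (- INR (S j))); lra].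
  rewrite Rabs_Ropp, S_INR, Rabs_pos_eq by lra; nra.
Qed.

Lemma Cmod_line_neq (u : C) (t : C) : 0 < fst u -> fst t = 0 -> (u + t)%C <> 0.
Proof. intros pos E; apply Cneq_fst; simpl; lra. Qed.

Definition coth_pair (u : C) (j : nat) : C := (/ (u + iN j) + / (u - iN (S j)))%C.

Lemma Rinv_sqr_INR_pos (j : nat) : 0 < / INR (S j) ^ 2.
Proof. apply Rinv_0_lt_compat, pow_lt, lt_0_INR; lia. Qed.

Lemma coth_pair_bound (u : C) :
  0 < fst u -> exists K, forall j, Cmod (coth_pair u j) <= K * / INR (S j) ^ 2.
Proof.
intros pos; destruct (Cmod_line_lower_N u pos) as [c [pc H]].
exists (Cmod (2 * u - Ci)%C / c ^ 2); intros j; destruct (H j) as [H1 H2].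
assert (pj : 0 < INR (S j)) by (apply lt_0_INR; lia).
assert (n1 : (u + iN j)%C <> 0) by (apply Cmod_gt_0; nra).
assert (n2 : (u - iN (S j))%C <> 0) by (apply Cmod_gt_0; nra).
replace (coth_pair u j) with ((2 * u - Ci) * / ((u + iN j) * (u - iN (S j))))%C.
- rewrite Cmod_mult, Cmod_inv, Cmod_mult by now apply Cmult_neq_0.
  unfold Rdiv; rewrite Rmult_assoc; apply Rmult_le_compat_l; [apply Cmod_ge_0|].
  rewrite <- Rinv_mult; apply Rinv_le_contravar; [apply Rmult_lt_0_compat; apply pow_lt; lra|].
  replace (c ^ 2 * INR (S j) ^ 2) with (c * INR (S j) * (c * INR (S j))) by ring.
  apply Rmult_le_compat; nra.
- unfold coth_pair; field_simplify_eq; [|auto].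
  unfold iN; rewrite S_INR, RtoC_plus; ring.
Qed.

Lemma Csum_coth_pair (u : C) : 0 < fst u -> Csum (coth_pair u).
Proof.
intros pos; destruct (coth_pair_bound u pos) as [K B].
apply (Csum_le _ _ B), (ex_series_scal_l (K := R_AbsRing) (V := R_NormedModule) K), ex_series_inv_sqr.
Qed.

Lemma one_minus_qexp_scaled_lower (N : nat) (x : C) :
  0 < fst x -> 2 * PI * fst x <= 2 ^ N -> 2 * PI * Rabs (snd x) <= 2 ^ N * (42 / 10) ->
  Cmod x * PI / (4 * 2 ^ N) <= Cmod (1 - qexp (RtoC (/ 2 ^ N) * x))%C.
Proof.
intros pos B1 B2.
assert (p2 : 0 < 2 ^ N) by (apply pow_lt; lra).
assert (pi2 : 0 < / 2 ^ N) by now apply Rinv_0_lt_compat.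
pose proof PI_RGT_0 as pp.
set (w := (2 * PIC * (RtoC (/ 2 ^ N) * x))%C).
assert (F : fst w = 2 * PI * fst x * / 2 ^ N) by (unfold w, PIC; simpl; ring).
assert (S : snd w = 2 * PI * snd x * / 2 ^ N) by (unfold w, PIC; simpl; ring).
assert (M : Cmod w = 2 * PI * Cmod x * / 2 ^ N).
{ unfold w, PIC; rewrite !Cmod_mult, !Cmod_R, !Rabs_pos_eq by lra; ring. }
replace (Cmod x * PI / (4 * 2 ^ N)) with (Cmod w / 8) by (rewrite M; field; lra).
apply one_minus_cexp_lower.
- rewrite F; split; [apply Rmult_le_pos; nra|].
  apply (Rmult_le_reg_r (2 ^ N)); [exact p2|]; rewrite Rmult_assoc, Rinv_l; lra.
- rewrite S, !Rabs_mult, (Rabs_pos_eq (/ 2 ^ N)), (Rabs_pos_eq 2), (Rabs_pos_eq PI) by lra.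
  apply (Rmult_le_reg_r (2 ^ N)); [exact p2|]; rewrite Rmult_assoc, Rinv_l; lra.
Qed.

Lemma pow2_INR (n : nat) : INR (2 ^ n) = 2 ^ n.
Proof. rewrite pow_INR; reflexivity. Qed.

(** Over a common denominator the pair is a multiple of [2^(- M) (1 - q1 q2) / ((1 - q1) (1 - q2))].
    The sum of the two arguments is [2 u - i], whatever [j], so [1 - q1 q2] is [O(2^(- M))], while
    each factor of the denominator is at least a multiple of [(j + 1) / 2^M]. *)
Lemma cothpi_scaled_pair_bound (u : C) :
  0 < fst u -> exists K, eventually (fun M => forall j, (j < 2 ^ M)%nat ->
    Cmod (cothpi_scaled (S M) (u + iN j) + cothpi_scaled (S M) (u - iN (S j)))%C
      <= K * / INR (S j) ^ 2).
Proof.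
intros pos; destruct (Cmod_line_lower_N u pos) as [c [pc H]].
pose proof PI_RGT_0 as pp.
set (v := (2 * u - Ci)%C); set (V0 := 2 * PI * Cmod v).
exists (32 * V0 * exp V0 / (PI * c ^ 2)).
(* Once [2^(M + 1)] exceeds [40 |Im u|], and since [j < 2^M], the imaginary parts stay within
   [(1 / 2 + 1 / 40) 2^(M + 1)]. *)
destruct (Pow_x_infinity 2 ltac:(rewrite Rabs_pos_eq; lra) (2 * PI * fst u + 40 * Rabs (snd u) + 40))
  as [N0 HN].
exists N0; intros M le j lt.
assert (B := HN (S M) ltac:(lia)).
rewrite Rabs_pos_eq in B by (apply pow_le; lra).
set (P2 := 2 ^ S M) in *.
assert (p2 : 0 < P2) by (apply pow_lt; lra).
assert (lj : 2 * INR (S j) <= P2).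
{ unfold P2; simpl pow; rewrite <- pow2_INR; apply Rmult_le_compat_l; [lra|].
  apply le_INR; lia. }
pose proof (pos_INR j) as pj; pose proof (S_INR j) as Sj.
pose proof PI_4 as P4; pose proof (Rabs_pos (snd u)) as pa.
assert (pf : 0 < PI * fst u) by (apply Rmult_lt_0_compat; lra).
assert (L1 : Cmod (u + iN j) * PI / (4 * P2) <= Cmod (1 - qexp (RtoC (/ P2) * (u + iN j)))%C).
{ apply one_minus_qexp_scaled_lower; fold P2.
  - rewrite fst_plus_iN; exact pos.
  - rewrite fst_plus_iN; lra.
  - replace (snd (u + iN j)%C) with (snd u + INR j) by (simpl; ring).
    pose proof (Rabs_triang (snd u) (INR j)) as Tr; rewrite (Rabs_pos_eq (INR j)) in Tr by exact pj.
    assert (Rabs (snd u + INR j) <= P2 / 40 + P2 / 2) by lra; nra. }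
assert (L2 : Cmod (u - iN (S j)) * PI / (4 * P2) <= Cmod (1 - qexp (RtoC (/ P2) * (u - iN (S j))))%C).
{ assert (Fs : fst (u - iN (S j))%C = fst u) by (unfold iN; simpl; ring).
  apply one_minus_qexp_scaled_lower; fold P2; rewrite ?Fs; [exact pos|lra|].
  replace (snd (u - iN (S j))%C) with (snd u + - INR (S j)) by (unfold iN; cbn -[INR]; ring).
  pose proof (Rabs_triang (snd u) (- INR (S j))) as Tr.
  rewrite Rabs_Ropp, (Rabs_pos_eq (INR (S j))) in Tr by lra.
  assert (Rabs (snd u + - INR (S j)) <= P2 / 40 + P2 / 2) by lra; nra. }
destruct (H j) as [H1 H2].
set (x1 := (u + iN j)%C) in *; set (x2 := (u - iN (S j))%C) in *.
set (q1 := qexp (RtoC (/ P2) * x1)) in *; set (q2 := qexp (RtoC (/ P2) * x2)) in *.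
assert (pm1 : 0 < Cmod x1) by nra; assert (pm2 : 0 < Cmod x2) by nra.
assert (pk : forall m, 0 < m -> 0 < m * PI / (4 * P2)).
{ intros m pm; apply Rdiv_lt_0_compat; nra. }
assert (pq1 := pk _ pm1); assert (pq2 := pk _ pm2).
assert (n1 : (1 - q1)%C <> 0) by (apply Cmod_gt_0; lra).
assert (n2 : (1 - q2)%C <> 0) by (apply Cmod_gt_0; lra).
assert (Q12 : (q1 * q2)%C = cexp (- (2 * PIC * (RtoC (/ P2) * v)))%C).
{ unfold q1, q2; rewrite <- qexp_plus; unfold qexp; f_equal; unfold x1, x2, v, iN.
  rewrite Sj, RtoC_plus; ring. }
assert (MV : Cmod (2 * PIC * (RtoC (/ P2) * v))%C = V0 / P2).
{ unfold PIC; rewrite !Cmod_mult, !Cmod_R, !Rabs_pos_eq; [unfold V0; field; lra|..]; try lra.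
  left; now apply Rinv_0_lt_compat. }
assert (pV : 0 <= V0) by (unfold V0; pose proof (Cmod_ge_0 v); nra).
assert (U : Cmod (1 - q1 * q2)%C <= V0 / P2 * exp V0).
{ rewrite Q12; eapply Rle_trans; [apply one_minus_cexp_upper|]; rewrite MV.
  apply Rmult_le_compat_l; [apply Rdiv_le_0_compat; lra|].
  assert (Y : V0 / P2 <= V0).
  { apply (Rmult_le_reg_r P2); [exact p2|]; unfold Rdiv; rewrite Rmult_assoc, Rinv_l by lra.
    nra. }
  destruct Y as [Y|Y]; [left; now apply exp_increasing|rewrite Y; apply Rle_refl]. }
replace (cothpi_scaled (S M) x1 + cothpi_scaled (S M) x2)%C
  with (RtoC (/ P2) * (2 * PIC) * (1 - q1 * q2) * / ((1 - q1) * (1 - q2)))%C.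
2:{ unfold cothpi_scaled, cothpi; fold P2 q1 q2; field; auto. }
rewrite !Cmod_mult, Cmod_inv, Cmod_mult by now apply Cmult_neq_0.
unfold PIC; rewrite !Cmod_R, !Rabs_pos_eq by (try lra; left; now apply Rinv_0_lt_compat).
apply (Rle_trans _ (/ P2 * (2 * PI) * (V0 / P2 * exp V0) *
  / (Cmod x1 * PI / (4 * P2) * (Cmod x2 * PI / (4 * P2))))).
- assert (pi2 : 0 < / P2) by now apply Rinv_0_lt_compat.
  apply Rmult_le_compat.
  + apply Rmult_le_pos; [nra|apply Cmod_ge_0].
  + left; apply Rinv_0_lt_compat, Rmult_lt_0_compat; lra.
  + apply Rmult_le_compat_l; [nra|exact U].
  + apply Rinv_le_contravar; [now apply Rmult_lt_0_compat|].
    apply Rmult_le_compat; lra.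
- replace (/ P2 * (2 * PI) * (V0 / P2 * exp V0) *
    / (Cmod x1 * PI / (4 * P2) * (Cmod x2 * PI / (4 * P2))))
    with (32 * V0 * exp V0 / PI * / (Cmod x1 * Cmod x2)) by (field; lra).
  replace (32 * V0 * exp V0 / (PI * c ^ 2) * / INR (S j) ^ 2)
    with (32 * V0 * exp V0 / PI * / (c * INR (S j) * (c * INR (S j)))) by (field; lra).
  apply Rmult_le_compat_l.
  + apply Rdiv_le_0_compat; [|exact pp]; pose proof (exp_pos V0); nra.
  + assert (pS : 0 < c * INR (S j)) by (apply Rmult_lt_0_compat; lra).
    apply Rinv_le_contravar; [now apply Rmult_lt_0_compat|]; apply Rmult_le_compat; lra.
Qed.

(** The [2^M] paired terms, padded with zeros, have sum [cothpi u] for every [M], and the pair bound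
    allows the limit to be taken term by term. *)
Theorem cothpi_partial_fractions (u : C) : 0 < fst u -> cothpi u = CSer (coth_pair u).
Proof.
intros pos.
pose (a := fun M j : nat => if (j <? 2 ^ M)%nat
  then (cothpi_scaled (S M) (u + iN j) + cothpi_scaled (S M) (u - iN (S j)))%C else RtoC 0).
assert (Sa : forall M, CSer (a M) = cothpi u).
{ intros M; destruct (CSer_finite (a M) (2 ^ M)) as [_ E].
  - intros j le; unfold a; destruct (Nat.ltb_spec j (2 ^ M)); [lia|reflexivity].
  - rewrite E, (cothpi_sum_paired M u pos); apply Csumn_ext; intros j lt; unfold a.
    destruct (Nat.ltb_spec j (2 ^ M)); [reflexivity|lia]. }
destruct (cothpi_scaled_pair_bound u pos) as [K [M0 B]].
assert (L : Clim eventually (fun M => CSer (a M)) (CSer (coth_pair u))).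
{ apply (Tannery eventually a (coth_pair u) (fun j => Rabs K * / INR (S j) ^ 2)).
  - apply (ex_series_scal_l (K := R_AbsRing) (V := R_NormedModule) (Rabs K)), ex_series_inv_sqr.
  - exists M0; intros M le j; pose proof (Rinv_sqr_INR_pos j) as pj; unfold a.
    destruct (Nat.ltb_spec j (2 ^ M)) as [lt|ge].
    + eapply Rle_trans; [apply (B M le j lt)|].
      apply Rmult_le_compat_r; [lra|apply Rle_abs].
    + rewrite Cmod_0; apply Rmult_le_pos; [apply Rabs_pos|lra].
  - intros j; apply (Clim_ext_loc _ (fun M => cothpi_scaled (S M) (u + iN j) +
                                             cothpi_scaled (S M) (u - iN (S j)))%C).
    + exists j; intros M le; unfold a; destruct (Nat.ltb_spec j (2 ^ M)) as [lt|ge]; [reflexivity|].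
      pose proof (Nat.pow_gt_lin_r 2 M); lia.
    + assert (Sh : forall x, 0 < fst x -> Clim eventually (fun M => cothpi_scaled (S M) x) (/ x)%C).
      { intros x px eps; destruct (cothpi_scaled_lim x px eps) as [N HN].
        exists N; intros n le; apply HN; lia. }
      apply Clim_plus; [apply eventually_filter| |]; apply Sh; unfold iN; simpl; lra. }
symmetry; apply (Clim_unique eventually (fun M => CSer (a M))); [exact L|].
apply (Clim_ext _ (fun _ => cothpi u)); [intros; symmetry; apply Sa|].
apply Clim_const, eventually_filter.
Qed.

(* [pi^2 / sinh^2 (pi x)] *)
Definition csch2pi (x : C) : C :=
  (4 * PIC * PIC * qexp x / ((1 - qexp x) * (1 - qexp x)))%C.

Definition csch2_pair (u : C) (j : nat) : C :=
  (/ ((u + iN j) * (u + iN j)) + / ((u - iN (S j)) * (u - iN (S j))))%C.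

Lemma Cder_shift (u t : C) (x : R) : Cder (fun s => u + RtoC s + t)%C x 1.
Proof.
eapply Cder_eq.
- apply Cder_plus; [apply Cder_plus; [apply Cder_const|apply Cder_id]|apply Cder_const].
- ring.
Qed.

Lemma Cder_cothpi (u : C) : 0 < fst u -> Cder (fun t => cothpi (u + RtoC t)%C) 0 (- csch2pi u)%C.
Proof.
intros pos.
assert (Dq : Cder (fun t => qexp (u + RtoC t)%C) 0 (- (2 * PIC) * qexp u)%C).
{ unfold qexp; eapply Cder_eq.
  - apply Cder_cexp, Cder_opp, Cder_scal, Cder_plus; [apply Cder_const|apply Cder_id].
  - cbv beta; rewrite Cplus_0_r; ring. }
assert (nz := one_minus_qexp u pos).
unfold cothpi, Cdiv; eapply Cder_eq.
- apply Cder_mult; [apply Cder_scal, Cder_plus; [apply Cder_const|exact Dq]|].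
  apply Cder_inv; [apply Cder_minus; [apply Cder_const|exact Dq]|].
  cbv beta; now rewrite Cplus_0_r.
- cbv beta; rewrite Cplus_0_r; unfold csch2pi; field; exact nz.
Qed.

Lemma csch2_partial_fractions (u : C) :
  0 < fst u -> csch2pi u = CSer (csch2_pair u) /\ Csum (csch2_pair u).
Proof.
intros pos; destruct (Cmod_line_lower_N u pos) as [c [pc H]].
(* The expansion of [cothpi] is differentiated along [u + t]. For [|t| < d] each denominator keeps
   half of its lower bound, and the real part stays positive. *)
set (d := Rmin (c / 2) (fst u)).
assert (pd : 0 < d) by (apply Rmin_glb_lt; lra).
assert (Hd : d <= c / 2 /\ d <= fst u) by (split; [apply Rmin_l|apply Rmin_r]).
pose (M := fun j => 8 / c ^ 2 * / INR (S j) ^ 2).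
assert (EM : ex_series M).
{ apply (ex_series_scal_l (K := R_AbsRing) (V := R_NormedModule) (8 / c ^ 2)), ex_series_inv_sqr. }
assert (LB : forall t j, - d < t < d ->
  c / 2 * INR (S j) <= Cmod (u + RtoC t + iN j)%C /\
  c / 2 * INR (S j) <= Cmod (u + RtoC t - iN (S j))%C).
{ intros t j It; destruct (H j) as [H1 H2].
  assert (1 <= INR (S j)) by (rewrite S_INR; pose proof (pos_INR j); lra).
  assert (Ht : Rabs t <= c / 2) by (apply Rabs_le; lra).
  assert (X : forall w, c * INR (S j) <= Cmod w -> c / 2 * INR (S j) <= Cmod (w + RtoC t)%C).
  { intros w Hw; pose proof (Cmod_triangle (w + RtoC t) (- RtoC t)) as Tr.
    replace (w + RtoC t + - RtoC t)%C with w in Tr by ring.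
    rewrite Cmod_opp, Cmod_R in Tr; nra. }
  split; [replace (u + RtoC t + iN j)%C with (u + iN j + RtoC t)%C by ring
         |replace (u + RtoC t - iN (S j))%C with (u - iN (S j) + RtoC t)%C by ring]; now apply X. }
assert (Inv2 : forall j w, c / 2 * INR (S j) <= Cmod w -> Cmod (/ (w * w))%C <= 4 / c ^ 2 * / INR (S j) ^ 2).
{ intros j w Hw; assert (pj : 0 < INR (S j)) by (apply lt_0_INR; lia).
  assert (pw : 0 < Cmod w) by nra.
  assert (nw : w <> 0) by now apply Cmod_gt_0.
  rewrite Cmod_inv, Cmod_mult by now apply Cmult_neq_0.
  replace (4 / c ^ 2 * / INR (S j) ^ 2) with (/ (c / 2 * INR (S j) * (c / 2 * INR (S j))))
    by (field; lra).
  assert (pcj : 0 < c / 2 * INR (S j)) by (apply Rmult_lt_0_compat; lra).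
  apply Rinv_le_contravar; [now apply Rmult_lt_0_compat|apply Rmult_le_compat; lra]. }
assert (BM : forall j t, - d < t < d -> Cmod (csch2_pair (u + RtoC t) j) <= M j).
{ intros j t It; destruct (LB t j It) as [B1 B2].
  eapply Rle_trans; [apply Cmod_triangle|].
  pose proof (Inv2 j _ B1); pose proof (Inv2 j _ B2).
  unfold M; replace (8 / c ^ 2) with (4 / c ^ 2 + 4 / c ^ 2) by (field; lra); lra. }
assert (Z : (u + RtoC 0)%C = u) by ring.
assert (S0 : Csum (csch2_pair u)).
{ apply (Csum_le _ M); [|exact EM]; intros j; rewrite <- Z; apply BM; lra. }
split; [|exact S0].
assert (It0 : - d < 0 < d) by lra.
assert (D : Cder (fun t => CSer (fun j => coth_pair (u + RtoC t) j)) 0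
                 (CSer (fun j => - csch2_pair (u + RtoC 0) j)%C)).
{ apply (Cder_CSer (fun j t => coth_pair (u + RtoC t) j) (fun j t => - csch2_pair (u + RtoC t) j)%C
           M (- d) d 0 It0).
  - intros j t It; destruct (LB t j It) as [B1 B2].
    assert (pj : 0 < INR (S j)) by (apply lt_0_INR; lia).
    assert (pcj : 0 < c / 2 * INR (S j)) by (apply Rmult_lt_0_compat; lra).
    assert (n1 : (u + RtoC t + iN j)%C <> 0) by (apply Cmod_gt_0; lra).
    assert (n2 : (u + RtoC t + - iN (S j))%C <> 0) by (apply Cmod_gt_0; unfold Cminus in B2; lra).
    unfold coth_pair, csch2_pair, Cminus; eapply Cder_eq.
    + apply Cder_plus; apply Cder_inv; auto using Cder_shift.
    + cbv beta; field; auto.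
  - intros j t It; rewrite Cmod_opp; now apply BM.
  - exact EM.
  - intros t It; apply Csum_coth_pair; simpl; lra. }
assert (D2 : Cder (fun t => CSer (fun j => coth_pair (u + RtoC t) j)) 0 (- csch2pi u)%C).
{ assert (D3 := Cder_cothpi u pos); apply Cder_Clim; apply Cder_Clim in D3.
  revert D3; apply Clim_ext_loc; [apply locally'_filter|].
  exists (mkposreal _ pd); intros h Bh _.
  unfold ball in Bh; simpl in Bh; unfold AbsRing_ball, abs, minus, plus, opp in Bh; simpl in Bh.
  apply Rabs_def2 in Bh.
  rewrite !cothpi_partial_fractions by (simpl; lra); reflexivity. }
rewrite CSer_opp, Z in D.
assert (E : (- CSer (csch2_pair u))%C = (- csch2pi u)%C).
{ apply Cder_Clim in D; apply Cder_Clim in D2.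
  exact (@Clim_unique R (locally' 0) (Rbar_locally'_filter (Finite 0)) _ _ _ D D2). }
replace (csch2pi u) with (- - csch2pi u)%C by ring; rewrite <- E; ring.
Qed.

(** * The weight two Eisenstein series *)

Lemma CSer_fubini_prod (a : nat -> nat -> C) (A B : nat -> R) :
  (forall m n, Cmod (a m n) <= A m * B n) -> ex_series A -> ex_series B ->
  (forall m, Csum (a m)) /\ (forall n, Csum (fun m => a m n)) /\
  Csum (fun m => CSer (a m)) /\ Csum (fun n => CSer (fun m => a m n)) /\
  CSer (fun m => CSer (a m)) = CSer (fun n => CSer (fun m => a m n)).
Proof.
intros H EA EB.
assert (SB : forall m, ex_series (fun n => A m * B n))
  by (intros m; now apply (ex_series_scal_l (K := R_AbsRing) (V := R_NormedModule) (A m))).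
assert (SA : forall n, ex_series (fun m => A m * B n))
  by (intros n; now apply ex_series_scal_r).
assert (S1 : forall m, Csum (a m)) by (intros m; now apply (Csum_le _ _ (H m))).
assert (S2 : forall n, Csum (fun m => a m n)) by (intros n; apply (Csum_le _ _ (fun m => H m n)), SA).
assert (EAB : ex_series (fun m => A m * Series B)) by now apply ex_series_scal_r.
assert (EBA : ex_series (fun n => Series A * B n))
  by now apply (ex_series_scal_l (K := R_AbsRing) (V := R_NormedModule) (Series A)).
split; [exact S1|split; [exact S2|split; [|split]]].
- apply (Csum_le _ (fun m => A m * Series B)); [|exact EAB].
  intros m; rewrite <- Series_scal_l; apply CSer_le; auto.
- apply (Csum_le _ (fun n => Series A * B n)); [|exact EBA].
  intros n; rewrite <- Series_scal_r; apply CSer_le; auto.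
- apply CSer_fubini; [exact S1|].
  apply (ex_series_le (V := R_CompleteNormedModule) _ (fun m => A m * Series B)); [|exact EAB].
  intros m; unfold norm; simpl; unfold abs; simpl; rewrite Rabs_pos_eq.
  + rewrite <- Series_scal_l; apply Series_le; auto.
    intros n; split; [apply Cmod_ge_0|apply H].
  + eapply Rle_trans; [apply Cmod_ge_0|apply CSer_bound, S1].
Qed.

Lemma CSer_geom (w : C) :
  Cmod w < 1 -> Csum (fun n => w ^ n)%C /\ CSer (fun n => w ^ n)%C = (/ (1 - w))%C.
Proof.
intros lt.
assert (A : Csum (fun n => w ^ n)%C).
{ eapply Csum_ext; [|exact (Csum_PS _ w subexp_1 lt)]; intros n; apply Cmult_1_l. }
split; [exact A|].
assert (E := CSer_shift _ A); cbv beta in E; simpl (w ^ 0)%C in E.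
rewrite (CSer_ext (fun n => w ^ S n)%C (fun n => w * w ^ n)%C), CSer_scal in E
  by (auto; intros; apply Cpow_S).
set (S := CSer _) in *; assert (nz := one_minus_neq_0 w lt).
assert (F : (S * (1 - w))%C = 1) by (transitivity (S - w * S)%C; [ring|rewrite E at 1; ring]).
transitivity (S * (1 - w) * / (1 - w))%C; [field; exact nz|rewrite F; apply Cmult_1_l].
Qed.

Lemma CSer_geom_S (w : C) :
  Cmod w < 1 -> Csum (fun n => RtoC (INR (S n)) * w ^ S n)%C /\
  CSer (fun n => RtoC (INR (S n)) * w ^ S n)%C = (w / ((1 - w) * (1 - w)))%C.
Proof.
intros lt; destruct (CSer_geom w lt) as [G1 G2].
assert (S1 : subexp (fun n => INR (S n))).
{ apply (subexp_le (fun n => INR (S n) * 1)); [intros; rewrite Rmult_1_r; apply Rle_refl|].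
  apply (subexp_mulS (fun _ => 1)), subexp_1. }
assert (A := Csum_PS _ w S1 lt); cbv beta in A.
assert (E := CSer_shift _ A); cbv beta in E.
rewrite (CSer_ext (fun n => RtoC (INR (S (S n))) * w ^ S n)%C
  (fun n => w * (RtoC (INR (S n)) * w ^ n) + w * w ^ n)%C) in E
  by (intros n; rewrite (S_INR (S n)), RtoC_plus, Cpow_S; ring).
rewrite CSer_plus, (CSer_scal w (fun n => w ^ n)%C), G2, CSer_scal in E by auto using Csum_scal.
assert (Sc : forall n, (w * (RtoC (INR (S n)) * w ^ n))%C = (RtoC (INR (S n)) * w ^ S n)%C)
  by (intros; rewrite Cpow_S; ring).
split; [exact (Csum_ext _ _ Sc (Csum_scal w _ A))|].
rewrite <- (CSer_ext _ _ Sc), CSer_scal by exact A.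
set (U := CSer (fun n => RtoC (INR (S n)) * w ^ n)%C) in *; assert (nz := one_minus_neq_0 w lt).
change (INR 1) with 1 in E; simpl (w ^ 0)%C in E.
assert (F : (U * (1 - w))%C = (1 + w * / (1 - w))%C)
  by (transitivity (U - w * U)%C; [ring|rewrite E at 1; ring]).
transitivity (w * (U * (1 - w)) * / (1 - w))%C; [field; exact nz|rewrite F; field; exact nz].
Qed.

Lemma Cmod_pow_lt (q : C) (k : nat) : Cmod q < 1 -> Cmod (q ^ S k)%C < 1.
Proof.
intros lt; rewrite Cmod_pow; pose proof (Cmod_ge_0 q) as p.
simpl; pose proof (pow_le _ k p); assert (Cmod q ^ k <= 1).
{ replace 1 with (1 ^ k) by apply pow1; apply pow_incr; lra. }
nra.
Qed.

Lemma CSer_geomk (q : C) (k : nat) :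
  Cmod q < 1 -> Csum (fun n => geomk (S k) n * q ^ n)%C /\
  CSer (fun n => geomk (S k) n * q ^ n)%C = (RtoC (INR (S k)) * q ^ S k / (1 - q ^ S k))%C.
Proof.
intros lt; set (g := fun n => (geomk (S k) n * q ^ n)%C).
assert (A : Csum g).
{ apply (Csum_le _ (fun n => INR (S k) * Cmod q ^ n)).
  - intros n; unfold g; rewrite Cmod_mult, Cmod_pow; apply Rmult_le_compat_r.
    + apply pow_le, Cmod_ge_0.
    + pose proof (geomk_bound (S k) n).
      rewrite geomk_real, Cmod_R, Rabs_pos_eq; lra.
  - apply (ex_series_scal_l (K := R_AbsRing) (V := R_NormedModule) (INR (S k))).
    apply ex_series_geom; rewrite Rabs_pos_eq; [exact lt|apply Cmod_ge_0]. }
split; [exact A|].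
assert (E := CSer_split g (S k) A).
rewrite (Csumn_ext g (fun _ => 0 * 0)%C), Csumn_scal, Cmult_0_l, Cplus_0_l in E
  by (intros n ln; unfold g; rewrite geomk_small by exact ln; now rewrite !Cmult_0_l).
(* [geomk] vanishes at [0], although [0] is a multiple of the period; [d] restores the missing
   value, so that a shift by one period multiplies the series by [q ^ S k] exactly. *)
pose (d := fun n : nat => match n with O => RtoC (INR (S k)) | S _ => RtoC 0 end).
destruct (CSer_finite d 1) as [D1 D2]; [intros [|n] ln; [lia|reflexivity]|].
rewrite (CSer_ext (fun n => g (S k + n)%nat) (fun n => q ^ S k * (g n + d n))%C) in E.
- rewrite CSer_scal, CSer_plus, D2 in E by auto using Csum_plus.
  assert (D3 : Csumn d 1 = RtoC (INR (S k))) by apply Cplus_0_l.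
  rewrite D3 in E; set (s := CSer g) in *.
  assert (nz := one_minus_neq_0 _ (Cmod_pow_lt q k lt)).
  assert (F : (s * (1 - q ^ S k))%C = (RtoC (INR (S k)) * q ^ S k)%C)
    by (transitivity (s - q ^ S k * s)%C; [ring|rewrite E at 1; ring]).
  transitivity (s * (1 - q ^ S k) * / (1 - q ^ S k))%C; [field; exact nz|].
  rewrite F; reflexivity.
- intros n; unfold g; rewrite Cpow_add_r; destruct n as [|n].
  + rewrite Nat.add_0_r, geomk_self by lia; unfold d, geomk; rewrite Bool.andb_false_r; simpl (q ^ 0)%C; ring.
  + rewrite geomk_shift by lia; unfold d; ring.
Qed.

(** Both sides sum [k q^(k r)] over [k, r >= 1]: one groups by the product [n = k r], the other by
    [r]. *)
Lemma Lambert_divsum (q : C) :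
  Cmod q < 1 ->
  Csum (fun r => q ^ S r / ((1 - q ^ S r) * (1 - q ^ S r)))%C /\
  PS divsum q = CSer (fun r => q ^ S r / ((1 - q ^ S r) * (1 - q ^ S r)))%C.
Proof.
intros lt; pose proof (Cmod_ge_0 q) as pq.
(* Half of the decay of [|q|^n] goes to each of the two indices, which gives the product bound that
   [CSer_fubini_prod] asks for. *)
set (s := sqrt (Cmod q)).
assert (ps : 0 <= s) by apply sqrt_pos.
assert (ss : s * s = Cmod q) by now apply sqrt_sqrt.
assert (s1 : s < 1) by nra.
assert (Es : ex_series (fun n => s ^ n)) by (apply ex_series_geom; rewrite Rabs_pos_eq; lra).
assert (EsS : ex_series (fun k => INR (S k) * s ^ k)).
{ eapply ex_series_ext; [|exact (geo_ex _ (geo_mulS _ (geo_pow s (conj ps s1))))].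
  intros n; apply Rabs_pos_eq, Rmult_le_pos; [apply pos_INR|now apply pow_le]. }
destruct (CSer_fubini_prod (fun k n => geomk (S k) n * q ^ n)%C
  (fun k => INR (S k) * s ^ k) (fun n => s ^ n)) as [_ [_ [_ [_ F1]]]]; auto.
{ intros k n; destruct (Nat.lt_ge_cases n (S k)) as [small|big].
  - rewrite geomk_small, Cmult_0_l, Cmod_0 by exact small.
    apply Rmult_le_pos; [apply Rmult_le_pos; [apply pos_INR|]|]; now apply pow_le.
  - rewrite Cmod_mult, Cmod_pow, Rmult_assoc; apply Rmult_le_compat.
    + apply Cmod_ge_0.
    + now apply pow_le.
    + pose proof (geomk_bound (S k) n); rewrite geomk_real, Cmod_R, Rabs_pos_eq; lra.
    + rewrite <- ss, Rpow_mult_distr; apply Rmult_le_compat_r; [now apply pow_le|].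
      replace n with (k + (n - k))%nat by lia; rewrite pow_add.
      rewrite <- (Rmult_1_r (s ^ k)) at 2; apply Rmult_le_compat_l; [now apply pow_le|].
      replace 1 with (1 ^ (n - k)) by apply pow1; apply pow_incr; lra. }
destruct (CSer_fubini_prod (fun k r => RtoC (INR (S k)) * q ^ (S k * S r))%C
  (fun k => INR (S k) * s ^ k) (fun r => s ^ r)) as [_ [_ [_ [G0 G1]]]]; auto.
{ intros k r; rewrite Cmod_mult, Cmod_R, Cmod_pow, Rabs_pos_eq, Rmult_assoc by apply pos_INR.
  apply Rmult_le_compat_l; [apply pos_INR|]; rewrite <- pow_add, <- ss.
  replace (s * s) with (s ^ 2) by ring; rewrite <- pow_mult.
  replace (2 * (S k * S r))%nat with (k + r + (2 * k * r + k + r + 2))%nat by lia.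
  rewrite (pow_add s (k + r)); rewrite <- (Rmult_1_r (s ^ (k + r))) at 2.
  apply Rmult_le_compat_l; [now apply pow_le|].
  replace 1 with (1 ^ (2 * k * r + k + r + 2)) by apply pow1; apply pow_incr; lra. }
assert (R : forall r, CSer (fun k => RtoC (INR (S k)) * q ^ (S k * S r))%C =
  (q ^ S r / ((1 - q ^ S r) * (1 - q ^ S r)))%C).
{ intros r; rewrite <- (proj2 (CSer_geom_S _ (Cmod_pow_lt q r lt))).
  apply CSer_ext; intros k; rewrite Nat.mul_comm, Cpow_mult_r; reflexivity. }
split; [exact (Csum_ext _ _ R G0)|].
rewrite <- (CSer_ext _ _ R), <- G1; clear R G0 G1.
unfold PS; rewrite (CSer_ext _ (fun n => CSer (fun k => geomk (S k) n * q ^ n)%C)).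
- rewrite <- F1; apply CSer_ext; intros k; rewrite (proj2 (CSer_geomk q k lt)).
  assert (l2 := Cmod_pow_lt q k lt); destruct (CSer_geom _ l2) as [W1 W2].
  rewrite (CSer_ext _ (fun r => (RtoC (INR (S k)) * q ^ S k) * (q ^ S k) ^ r)%C).
  + rewrite (CSer_scal _ (fun r => (q ^ S k) ^ r)%C), W2 by exact W1; reflexivity.
  + intros r; rewrite Cpow_mult_r, Cpow_S; ring.
- intros n; destruct (CSer_finite (fun k => geomk (S k) n * q ^ n)%C n) as [_ W].
  + intros k le; rewrite geomk_small by lia; apply Cmult_0_l.
  + rewrite W, <- (divsum_upto_divsum n n) by apply Nat.le_refl; unfold divsum_upto.
    rewrite Cmult_comm, <- Csumn_scal; apply Csumn_ext; intros; apply Cmult_comm.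
Qed.

(** Up to normalisation and constant term, the weight two Eisenstein series: [E_2 = 1 - 24 Eis]. *)
Definition Eis (z : C) : C := PS divsum (qexp z).

Lemma qexp_pow (z : C) (n : nat) : (qexp z ^ n)%C = qexp (RtoC (INR n) * z)%C.
Proof. unfold qexp; rewrite <- cexp_nat; f_equal; ring. Qed.

Definition NS (n : nat) : C := RtoC (INR (S n)).

Lemma NS_neq_0 (n : nat) : NS n <> 0.
Proof. intros E; apply RtoC_inj in E; revert E; apply not_0_INR; lia. Qed.

Lemma fst_NS_mult (n : nat) (z : C) : 0 < fst z -> 0 < fst (NS n * z)%C.
Proof.
intros pos; replace (fst (NS n * z)%C) with (INR (S n) * fst z) by (unfold NS; cbn -[INR]; ring).
apply Rmult_lt_0_compat; [apply lt_0_INR; lia|exact pos].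
Qed.

Lemma Eis_csch2 (z : C) :
  0 < fst z -> Csum (fun m => csch2pi (NS m * z)%C) /\
  (4 * PIC * PIC * Eis z)%C = CSer (fun m => csch2pi (NS m * z)%C).
Proof.
intros pos; destruct (Lambert_divsum (qexp z) (Cmod_qexp_lt z pos)) as [A E].
assert (T : forall m, (4 * PIC * PIC * (qexp z ^ S m / ((1 - qexp z ^ S m) * (1 - qexp z ^ S m))))%C =
  csch2pi (NS m * z)%C).
{ intros m; unfold csch2pi, NS; rewrite <- qexp_pow; unfold Cdiv; ring. }
split; [exact (Csum_ext _ _ T (Csum_scal _ _ A))|].
unfold Eis; rewrite E, <- CSer_scal by exact A; now apply CSer_ext.
Qed.

(** The pairing of [i j] with [- i (j + 1)] becomes the symmetric one, of [i (j + 1)] with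
    [- i (j + 1)], on adding the telescoping differences of [1 / (u + i j)], whose total is
    [- 1 / u]. *)
Lemma coth_sym (u : C) :
  0 < fst u -> Csum (fun j => / (u + iN (S j)) + / (u - iN (S j)))%C /\
  CSer (fun j => / (u + iN (S j)) + / (u - iN (S j)))%C = (cothpi u - / u)%C.
Proof.
intros pos; destruct (Cmod_line_lower_N u pos) as [c [pc H]].
pose proof (Cneq_fst u pos) as nu.
pose (e := fun j => (/ (u + iN j))%C).
assert (nz : forall j, (u + iN j)%C <> 0) by (intros; apply Cmod_line_neq; [exact pos|apply fst_iN]).
assert (Se : Csum (fun j => e (S j) - e j)%C).
{ apply (Csum_le _ (fun j => / c ^ 2 * / INR (S j) ^ 2)).
  - intros j; destruct (H j) as [H1 _]; destruct (H (S j)) as [H2 _].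
    assert (pj : 0 < INR (S j)) by (apply lt_0_INR; lia).
    assert (le : INR (S j) <= INR (S (S j))) by (rewrite (S_INR (S j)); lra).
    replace (e (S j) - e j)%C with (- Ci * / ((u + iN j) * (u + iN (S j))))%C.
    + rewrite Cmod_mult, Cmod_opp, Cmod_Ci, Cmod_inv, Cmod_mult, Rmult_1_l by now apply Cmult_neq_0.
      rewrite <- Rinv_mult.
      replace (c ^ 2 * INR (S j) ^ 2) with (c * INR (S j) * (c * INR (S j))) by ring.
      assert (pcj : 0 < c * INR (S j)) by (apply Rmult_lt_0_compat; lra).
      assert (c * INR (S j) <= c * INR (S (S j))) by (apply Rmult_le_compat_l; lra).
      apply Rinv_le_contravar; [now apply Rmult_lt_0_compat|apply Rmult_le_compat; lra].
    + unfold e; field_simplify_eq; [|auto]; unfold iN; rewrite S_INR, RtoC_plus; ring.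
  - apply (ex_series_scal_l (K := R_AbsRing) (V := R_NormedModule) (/ c ^ 2)), ex_series_inv_sqr. }
assert (Le : CSer (fun j => e (S j) - e j)%C = (- / u)%C).
{ apply CSer_unique; [exact Se|].
  apply (Clim_ext _ (fun N => e N - e 0%nat)%C); [intros; symmetry; apply Csumn_telescope|].
  eapply Clim_eq.
  - apply Clim_minus; [apply eventually_filter| |apply Clim_const, eventually_filter].
    apply (Clim_squeeze _ _ 0 (fun N => / c * / INR (S N))).
    + exists 0%nat; intros N _; destruct (H N) as [H1 _].
      assert (pj : 0 < INR (S N)) by (apply lt_0_INR; lia).
      replace (e N - 0)%C with (e N) by ring; unfold e; rewrite Cmod_inv by auto.
      rewrite <- Rinv_mult; apply Rinv_le_contravar; [now apply Rmult_lt_0_compat|exact H1].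
    + assert (L := is_lim_seq_scal_l _ (/ c) _ is_lim_seq_inv_INR); simpl in L.
      rewrite Rmult_0_r in L; apply is_lim_seq_spec in L; intros eps.
      destruct (L eps) as [N HN]; exists N; intros n le; specialize (HN n le).
      rewrite Rminus_0_r in HN; apply Rabs_def2 in HN; exact (proj1 HN).
  - unfold e, iN; simpl INR; rewrite Cmult_0_r, Cplus_0_r; ring. }
assert (T : forall j, (coth_pair u j + (e (S j) - e j))%C = (/ (u + iN (S j)) + / (u - iN (S j)))%C).
{ intros j; unfold coth_pair, e; ring. }
pose proof (Csum_coth_pair u pos) as Sb.
split; [exact (Csum_ext _ _ T (Csum_plus _ _ Sb Se))|].
rewrite <- (CSer_ext _ _ T), CSer_plus, Le, <- cothpi_partial_fractions by assumption; reflexivity.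
Qed.

(** The same rearrangement; here the unpaired terms are absolutely summable, so their series is
    shifted by one index. *)
Lemma csch2_sym (u : C) :
  0 < fst u ->
  Csum (fun j => / ((u + iN (S j)) * (u + iN (S j))) + / ((u - iN (S j)) * (u - iN (S j))))%C /\
  CSer (fun j => / ((u + iN (S j)) * (u + iN (S j))) + / ((u - iN (S j)) * (u - iN (S j))))%C
    = (csch2pi u - / (u * u))%C.
Proof.
intros pos; destruct (csch2_partial_fractions u pos) as [E S0].
destruct (Cmod_line_lower_N u pos) as [c [pc H]].
pose (e := fun j => (/ ((u + iN j) * (u + iN j)))%C).
assert (Se : Csum e).
{ apply (Csum_le _ (fun j => / c ^ 2 * / INR (S j) ^ 2)).
  - intros j; destruct (H j) as [H1 _].
    assert (pj : 0 < INR (S j)) by (apply lt_0_INR; lia).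
    assert (pcj : 0 < c * INR (S j)) by (apply Rmult_lt_0_compat; lra).
    assert (nz : (u + iN j)%C <> 0) by (apply Cmod_gt_0; lra).
    unfold e; rewrite Cmod_inv, Cmod_mult by now apply Cmult_neq_0.
    rewrite <- Rinv_mult.
    replace (c ^ 2 * INR (S j) ^ 2) with (c * INR (S j) * (c * INR (S j))) by ring.
    apply Rinv_le_contravar; [now apply Rmult_lt_0_compat|apply Rmult_le_compat; lra].
  - apply (ex_series_scal_l (K := R_AbsRing) (V := R_NormedModule) (/ c ^ 2)), ex_series_inv_sqr. }
assert (Se' : Csum (fun j => e (S j))) by now apply Csum_shift in Se.
assert (T : forall j, (csch2_pair u j - e j + e (S j))%C =
  (/ ((u + iN (S j)) * (u + iN (S j))) + / ((u - iN (S j)) * (u - iN (S j))))%C).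
{ intros j; unfold csch2_pair, e; ring. }
split; [exact (Csum_ext _ _ T (Csum_plus _ _ (Csum_minus _ _ S0 Se) Se'))|].
rewrite <- (CSer_ext _ _ T), CSer_plus, CSer_minus, <- E, (CSer_shift e Se)
  by auto using Csum_minus.
unfold e at 1, iN at 1 2; simpl INR; rewrite Cmult_0_r, Cplus_0_r; ring.
Qed.

(** Kept symbolic until [zeta2_value] reads its value off the inversion formula. *)
Definition zeta2 : C := RtoC (Series (fun n => / INR (S n) ^ 2)).

Definition Chalf : C := (Ci / 2)%C.

Lemma Chalf_sqr : (Chalf * Chalf)%C = (- / 4)%C.
Proof.
unfold Chalf; transitivity ((Ci * Ci) / 4)%C; [field; exact C2_neq_0|].
replace (Ci * Ci)%C with (RtoC (-1)) by (apply C_eta; simpl; ring).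
replace (RtoC (-1)) with (- (1))%C by (apply C_eta; simpl; ring).
field; intros E; apply RtoC_inj in E; lra.
Qed.

Lemma Ci_Chalf : Ci = (2 * Chalf)%C.
Proof. unfold Chalf; field; exact C2_neq_0. Qed.

(* Up to terms of order four, [1 / W^2] is a difference of values of [i / W]
   half a step apart in the imaginary direction. *)
Definition eis_rem (W : C) : C := (/ (W * W) - Ci * (/ (W + Chalf) - / (W - Chalf)))%C.

(** As [(W + i / 2) (W - i / 2) = W^2 + 1 / 4], the remainder equals [1 / (4 W^2 (W^2 + 1 / 4))]. *)
Lemma eis_rem_bound (W : C) (k : R) :
  0 < k -> k <= Cmod W -> k <= Cmod (W + Chalf)%C -> k <= Cmod (W - Chalf)%C ->
  Cmod (eis_rem W) <= / k ^ 4.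
Proof.
intros pk B0 B1 B2.
assert (n0 : W <> 0) by (apply Cmod_gt_0; lra).
assert (n1 : (W + Chalf)%C <> 0) by (apply Cmod_gt_0; lra).
assert (n2 : (W - Chalf)%C <> 0) by (apply Cmod_gt_0; lra).
assert (n4 : RtoC 4 <> 0) by (intros E; apply RtoC_inj in E; lra).
replace (eis_rem W) with (/ 4 * / (W * W * ((W + Chalf) * (W - Chalf))))%C.
- rewrite Cmod_mult, !Cmod_inv, !Cmod_mult, Cmod_R, Rabs_pos_eq
    by (lra || auto; repeat apply Cmult_neq_0; auto).
  replace (k ^ 4) with (k * k * (k * k)) by ring.
  apply (Rle_trans _ (1 * / (k * k * (k * k)))); [|lra].
  assert (pk2 : 0 < k * k) by nra.
  apply Rmult_le_compat; [lra| |lra|].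
  + left; apply Rinv_0_lt_compat; repeat apply Rmult_lt_0_compat; lra.
  + apply Rinv_le_contravar; [nra|].
    apply Rmult_le_compat; try nra; apply Rmult_le_compat; lra.
- assert (Q : ((W + Chalf) * (W - Chalf))%C = (W * W + / 4)%C).
  { transitivity (W * W - Chalf * Chalf)%C; [ring|rewrite Chalf_sqr; ring]. }
  unfold eis_rem; rewrite Ci_Chalf.
  transitivity (/ (W * W) - 2 * (- 2 * (Chalf * Chalf)) / ((W + Chalf) * (W - Chalf)))%C.
  + rewrite Chalf_sqr.
    assert (nQ : (W * W + / 4)%C <> 0) by (rewrite <- Q; now apply Cmult_neq_0).
    rewrite Q.
    assert (nQ' : (W * W * 4 + 1)%C <> 0).
    { intros F; apply nQ; replace (W * W + / 4)%C with ((W * W * 4 + 1) / 4)%C by (field; auto).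
      rewrite F; unfold Cdiv; apply Cmult_0_l. }
    field; auto.
  + field; auto.
Qed.

Definition eis_term (z : C) (m n : nat) : C :=
  (/ ((NS m * z + iN (S n)) * (NS m * z + iN (S n))) +
   / ((NS m * z - iN (S n)) * (NS m * z - iN (S n))))%C.

Definition eis_pole (z : C) (m : nat) (x : R) : C :=
  (Ci * (/ (NS m * z + Ci * RtoC x) - / (NS m * z - Ci * RtoC x)))%C.

Definition half_int (n : nat) : R := INR n + 1 / 2.

Lemma RtoC_half : RtoC (1 / 2) = (/ 2)%C.
Proof. unfold Rdiv; rewrite Rmult_1_l; apply RtoC_inv; lra. Qed.

(** The weight two lattice sum is not absolutely convergent over both indices. Subtracting
    differences of [eis_pole] leaves terms of order four, which are absolutely summable; the
    dependence on the order of summation is confined to the telescoping part. *)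
Lemma eis_term_split (z : C) (m n : nat) :
  (eis_term z m n - (eis_pole z m (half_int (S n)) - eis_pole z m (half_int n)))%C =
  (eis_rem (NS m * z + iN (S n)) + eis_rem (NS m * z - iN (S n)))%C.
Proof.
unfold eis_term, eis_rem, eis_pole, half_int.
replace (NS m * z + Ci * RtoC (INR (S n) + 1 / 2))%C with (NS m * z + iN (S n) + Chalf)%C
  by (unfold iN, Chalf, Cdiv; rewrite RtoC_plus, RtoC_half; ring).
replace (NS m * z - Ci * RtoC (INR (S n) + 1 / 2))%C with (NS m * z - iN (S n) - Chalf)%C
  by (unfold iN, Chalf, Cdiv; rewrite RtoC_plus, RtoC_half; ring).
assert (E : RtoC (INR n + 1 / 2) = (RtoC (INR (S n)) - / 2)%C)
  by (rewrite S_INR, !RtoC_plus, RtoC_half; field; exact C2_neq_0).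
replace (NS m * z + Ci * RtoC (INR n + 1 / 2))%C with (NS m * z + iN (S n) - Chalf)%C
  by (rewrite E; unfold iN, Chalf, Cdiv; ring).
replace (NS m * z - Ci * RtoC (INR n + 1 / 2))%C with (NS m * z - iN (S n) + Chalf)%C
  by (rewrite E; unfold iN, Chalf, Cdiv; ring).
ring.
Qed.

Lemma eis_rem_sum_bound (z : C) :
  0 < fst z -> exists K, forall m n,
    Cmod (eis_rem (NS m * z + iN (S n)) + eis_rem (NS m * z - iN (S n)))%C
      <= (K * / INR (S m) ^ 2) * / INR (S n) ^ 2.
Proof.
intros pos; destruct (Cmod_line_lower z pos) as [c [pc H]].
exists (2 * / c ^ 4); intros m n.
assert (pm : 1 <= INR (S m)) by (rewrite S_INR; pose proof (pos_INR m); lra).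
assert (pn : 1 <= INR (S n)) by (rewrite S_INR; pose proof (pos_INR n); lra).
set (M := INR (S m)) in *; set (N := INR (S n)) in *.
(* As [M, N >= 1], [M + N - 1 / 2] is at least [(M + N) / 2], which leaves room for the half step.
   By the inequality of the means [k^4 >= c^4 M^2 N^2], a bound in product form. *)
set (k := c * ((M + N) / 2)).
assert (pk : 0 < k) by (apply Rmult_lt_0_compat; lra).
assert (L : forall t, N - 1 / 2 <= Rabs t -> k <= Cmod (NS m * z + Ci * RtoC t)%C).
{ intros t Ht; eapply Rle_trans; [|apply (H M t); lra].
  apply Rmult_le_compat_l; lra. }
assert (A : forall s, (s = 1 \/ s = -1) -> forall d, Rabs d <= 1 / 2 -> N - 1 / 2 <= Rabs (s * N + d)).
{ intros s [-> | ->] d Hd; apply Rabs_le_between in Hd.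
  - rewrite Rabs_pos_eq; lra.
  - rewrite Rabs_left; lra. }
assert (B : forall s, (s = 1 \/ s = -1) -> Cmod (eis_rem (NS m * z + Ci * RtoC (s * N))) <= / k ^ 4).
{ intros s Hs; apply eis_rem_bound; [exact pk|..].
  - apply L; rewrite <- (Rplus_0_r (s * N)); apply A; [exact Hs|rewrite Rabs_R0; lra].
  - replace (NS m * z + Ci * RtoC (s * N) + Chalf)%C with (NS m * z + Ci * RtoC (s * N + 1 / 2))%C
      by (unfold Chalf, Cdiv; rewrite (RtoC_plus (s * N)), RtoC_half; ring).
    apply L, A; [exact Hs|rewrite Rabs_pos_eq; lra].
  - replace (NS m * z + Ci * RtoC (s * N) - Chalf)%C with (NS m * z + Ci * RtoC (s * N + - (1 / 2)))%C
      by (unfold Chalf, Cdiv; rewrite (RtoC_plus (s * N)), RtoC_opp, RtoC_half; ring).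
    apply L, A; [exact Hs|rewrite Rabs_Ropp, Rabs_pos_eq; lra]. }
pose proof (B 1 (or_introl eq_refl)) as B1; pose proof (B (-1) (or_intror eq_refl)) as B2.
replace (NS m * z + Ci * RtoC (1 * N))%C with (NS m * z + iN (S n))%C in B1
  by (unfold iN; fold N; rewrite Rmult_1_l; reflexivity).
replace (NS m * z + Ci * RtoC (-1 * N))%C with (NS m * z - iN (S n))%C in B2
  by (unfold iN; fold N; replace (-1 * N) with (- N) by ring; rewrite RtoC_opp; ring).
eapply Rle_trans; [apply Cmod_triangle|].
assert (D : / k ^ 4 <= / c ^ 4 * / M ^ 2 * / N ^ 2).
{ rewrite <- !Rinv_mult; apply Rinv_le_contravar.
  - repeat apply Rmult_lt_0_compat; try apply pow_lt; lra.
  - unfold k; rewrite Rpow_mult_distr, Rmult_assoc.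
    apply Rmult_le_compat_l; [left; apply pow_lt; exact pc|].
    assert (G : M * N <= ((M + N) / 2) ^ 2) by (pose proof (pow2_ge_0 (M - N)); nra).
    replace (M ^ 2 * N ^ 2) with ((M * N) ^ 2) by ring.
    replace (((M + N) / 2) ^ 4) with ((((M + N) / 2) ^ 2) ^ 2) by ring.
    apply pow_incr; split; [nra|exact G]. }
lra.
Qed.

Lemma eis_pole_small (z : C) :
  0 < fst z -> exists K, forall m x, 0 <= x -> Cmod (eis_pole z m x) <= K * x * / INR (S m) ^ 2 /\
    (1 <= x -> Cmod (eis_pole z m x) <= K * / x).
Proof.
intros pos; destruct (Cmod_line_lower z pos) as [c [pc H]].
exists (2 * / c ^ 2 + 2 * / c); intros m x px.
assert (pm : 1 <= INR (S m)) by (rewrite S_INR; pose proof (pos_INR m); lra).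
set (M := INR (S m)) in *.
assert (pic : 0 < / c) by now apply Rinv_0_lt_compat.
assert (pic2 : 0 < / c ^ 2) by (apply Rinv_0_lt_compat, pow_lt, pc).
assert (L1 : c * (M + x) <= Cmod (NS m * z + Ci * RtoC x)%C).
{ eapply Rle_trans; [|apply (H M x); lra]; rewrite Rabs_pos_eq; lra. }
assert (L2 : c * (M + x) <= Cmod (NS m * z - Ci * RtoC x)%C).
{ replace (NS m * z - Ci * RtoC x)%C with (NS m * z + Ci * RtoC (- x))%C by (rewrite RtoC_opp; ring).
  eapply Rle_trans; [|apply (H M (- x)); lra]; rewrite Rabs_Ropp, Rabs_pos_eq; lra. }
assert (pk : 0 < c * (M + x)) by (apply Rmult_lt_0_compat; lra).
set (P := (NS m * z + Ci * RtoC x)%C) in *; set (Q := (NS m * z - Ci * RtoC x)%C) in *.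
assert (nP : P <> 0) by (apply Cmod_gt_0; lra).
assert (nQ : Q <> 0) by (apply Cmod_gt_0; lra).
unfold eis_pole; fold P Q; split.
- replace (Ci * (/ P - / Q))%C with (2 * RtoC x * / (P * Q))%C.
  + rewrite !Cmod_mult, !Cmod_R, Cmod_inv, Cmod_mult, !Rabs_pos_eq by (lra || now apply Cmult_neq_0).
    apply (Rle_trans _ (2 * x * (/ c ^ 2 * / M ^ 2))).
    * apply Rmult_le_compat_l; [lra|]; rewrite <- Rinv_mult.
      assert (pcM : 0 < c * M) by (apply Rmult_lt_0_compat; lra).
      assert (le : c * M <= c * (M + x)) by (apply Rmult_le_compat_l; lra).
      replace (c ^ 2 * M ^ 2) with (c * M * (c * M)) by ring.
      apply Rinv_le_contravar; [now apply Rmult_lt_0_compat|apply Rmult_le_compat; lra].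
    * assert (pM : 0 < / M ^ 2) by (apply Rinv_0_lt_compat, pow_lt; lra).
      assert (0 <= / c * x * / M ^ 2) by (repeat apply Rmult_le_pos; lra); nra.
  + transitivity (Ci * (Q - P) / (P * Q))%C; [|field; auto].
    unfold Cdiv; f_equal; unfold P, Q.
    transitivity (- (Ci * Ci) * (2 * RtoC x))%C; [|ring].
    replace (Ci * Ci)%C with (- (1))%C by (apply C_eta; simpl; ring); ring.
- intros x1; rewrite Cmod_mult, Cmod_Ci, Rmult_1_l.
  assert (R : forall W : C, W <> 0 -> c * (M + x) <= Cmod W -> Cmod (/ W)%C <= / c * / x).
  { intros W nW B; rewrite Cmod_inv, <- Rinv_mult by exact nW.
    apply Rinv_le_contravar; [apply Rmult_lt_0_compat; lra|].
    eapply Rle_trans; [|exact B]; apply Rmult_le_compat_l; lra. }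
  pose proof (R P nP L1); pose proof (R Q nQ L2).
  unfold Cminus; eapply Rle_trans; [apply Cmod_triangle|]; rewrite Cmod_opp.
  assert (0 < / x) by (apply Rinv_0_lt_compat; lra).
  assert (0 < / c ^ 2 * / x) by now apply Rmult_lt_0_compat.
  lra.
Qed.

Definition eis_lambda (z : C) (x : R) : C := CSer (fun m => eis_pole z m x).

Lemma Cinv_right (z : C) : 0 < fst z -> 0 < fst (/ z)%C.
Proof.
intros pos; rewrite fst_Cinv; apply Rdiv_lt_0_compat; [exact pos|].
apply Csqr_pos, Cneq_fst, pos.
Qed.

(** Dividing by [z] and factoring out [i] exchanges the two lattice directions: the sum over [m] is
    the symmetric partial fraction series of [cothpi] at [x / z]. *)
Lemma eis_lambda_coth (z : C) (x : R) :
  0 < fst z -> 0 < x ->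
  Csum (fun m => eis_pole z m x) /\
  eis_lambda z x = (/ z * (cothpi (RtoC x * / z) - z * / RtoC x))%C.
Proof.
intros pos px; pose proof (Cneq_fst z pos) as nz.
assert (nx : RtoC x <> 0) by (intros E; apply RtoC_inj in E; lra).
assert (pu : 0 < fst (RtoC x * / z)%C).
{ pose proof (Cinv_right z pos); replace (fst (RtoC x * / z)%C) with (x * fst (/ z)%C) by (simpl; ring).
  now apply Rmult_lt_0_compat. }
destruct (coth_sym _ pu) as [S E].
assert (T : forall m, (/ z * (/ (RtoC x * / z + iN (Datatypes.S m)) + / (RtoC x * / z - iN (Datatypes.S m))))%C =
  eis_pole z m x).
{ intros m; unfold eis_pole, iN; fold (NS m).
  assert (n1 : (NS m * z + Ci * RtoC x)%C <> 0).
  { apply Cneq_fst; pose proof (fst_NS_mult m z pos) as F.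
    replace (fst (NS m * z + Ci * RtoC x)%C) with (fst (NS m * z)%C) by (simpl; ring); exact F. }
  assert (n2 : (NS m * z - Ci * RtoC x)%C <> 0).
  { apply Cneq_fst; pose proof (fst_NS_mult m z pos) as F.
    replace (fst (NS m * z - Ci * RtoC x)%C) with (fst (NS m * z)%C) by (simpl; ring); exact F. }
  assert (I2 : (Ci * Ci)%C = (- (1))%C) by (apply C_eta; simpl; ring).
  replace (RtoC x * / z + Ci * NS m)%C with (Ci * (NS m * z - Ci * RtoC x) / z)%C.
  - replace (RtoC x * / z - Ci * NS m)%C with (- Ci * (NS m * z + Ci * RtoC x) / z)%C.
    + assert (IV : (/ Ci)%C = (- Ci)%C) by apply Ci_inv.
      transitivity (/ Ci * / (NS m * z - Ci * RtoC x) - / Ci * / (NS m * z + Ci * RtoC x))%C.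
      * field; repeat split; auto using Ci_nz.
      * rewrite IV; ring.
    + transitivity ((- (Ci * Ci) * RtoC x - Ci * NS m * z) / z)%C; [unfold Cdiv; ring|].
      rewrite I2; field; exact nz.
  - transitivity ((- (Ci * Ci) * RtoC x + Ci * NS m * z) / z)%C; [unfold Cdiv; ring|].
    rewrite I2; field; exact nz. }
split; [exact (Csum_ext _ _ T (Csum_scal (/ z)%C _ S))|].
unfold eis_lambda; rewrite <- (CSer_ext _ _ T), CSer_scal, E by exact S.
f_equal; unfold Cminus; do 2 f_equal; field; auto.
Qed.

(** Each single term tends to [0], but the sum over [m] does not, because [cothpi] tends to [PI] far
    to the right. This limit is the anomaly of the weight two series. *)
Lemma eis_lambda_lim (z : C) :
  0 < fst z -> Clim eventually (fun n => eis_lambda z (half_int n)) (PIC * / z)%C.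
Proof.
intros pos; pose proof (Cneq_fst z pos) as nz.
pose proof (Cinv_right z pos) as pi.
assert (ph : forall n, 0 < half_int n) by (intros n; unfold half_int; pose proof (pos_INR n); lra).
apply (Clim_ext _ (fun n => / z * (cothpi (RtoC (half_int n) * / z) - z * / RtoC (half_int n)))%C).
{ intros n; symmetry; now apply eis_lambda_coth. }
assert (Lh : is_lim_seq (fun n => / half_int n) 0).
{ apply (is_lim_seq_le_le (fun _ => 0) _ (fun n => 2 * / INR (S n))).
  - intros n; pose proof (pos_INR n); split; [left; now apply Rinv_0_lt_compat|].
    unfold half_int; rewrite S_INR; apply (Rmult_le_reg_r ((INR n + 1 / 2) * (INR n + 1))); [nra|].
    replace (/ (INR n + 1 / 2) * ((INR n + 1 / 2) * (INR n + 1))) with (INR n + 1) by (field; lra).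
    replace (2 * / (INR n + 1) * ((INR n + 1 / 2) * (INR n + 1))) with (2 * INR n + 1) by (field; lra).
    lra.
  - apply is_lim_seq_const.
  - assert (L := is_lim_seq_scal_l _ 2 _ is_lim_seq_inv_INR); simpl in L; now rewrite Rmult_0_r in L. }
assert (L1 : Clim eventually (fun n => / RtoC (half_int n))%C 0).
{ apply (Clim_ext _ (fun n => RtoC (/ half_int n))).
  - intros n; apply RtoC_inv, Rgt_not_eq, ph.
  - intros eps; apply is_lim_seq_spec in Lh; destruct (Lh eps) as [N HN]; exists N; intros n le.
    specialize (HN n le); rewrite Rminus_0_r in HN.
    replace (_ - _)%C with (RtoC (/ half_int n)) by ring; now rewrite Cmod_R. }
assert (L2 : Clim eventually (fun n => qexp (RtoC (half_int n) * / z)) 0).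
{ apply (Clim_squeeze _ _ _ (fun n => / (2 * PI * fst (/ z)%C) * / half_int n)).
  - exists 0%nat; intros n _; replace (qexp _ - 0)%C with (qexp (RtoC (half_int n) * / z)) by ring.
    rewrite Cmod_qexp.
    replace (fst (RtoC (half_int n) * / z)%C) with (half_int n * fst (/ z)%C) by (simpl; ring).
    revert pi; generalize (fst (/ z)%C); intros y py0.
    pose proof PI_RGT_0; specialize (ph n).
    assert (p2 : 0 < 2 * PI) by lra.
    assert (py : 0 < 2 * PI * (half_int n * y)) by (apply Rmult_lt_0_compat, Rmult_lt_0_compat; lra).
    rewrite exp_Ropp, <- Rinv_mult; apply Rinv_le_contravar.
    + apply Rmult_lt_0_compat; [apply Rmult_lt_0_compat|]; lra.
    + eapply Rle_trans; [|left; apply exp_ineq1; lra]; lra.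
  - assert (L := is_lim_seq_scal_l _ (/ (2 * PI * fst (/ z)%C)) _ Lh).
    simpl in L; rewrite Rmult_0_r in L; apply is_lim_seq_spec in L; intros eps.
    destruct (L eps) as [N HN]; exists N; intros n le; specialize (HN n le).
    rewrite Rminus_0_r in HN; apply Rabs_def2 in HN; exact (proj1 HN). }
eapply Clim_eq.
- apply Clim_scal; [apply eventually_filter|]; apply Clim_minus; [apply eventually_filter| |].
  + unfold cothpi, Cdiv; apply Clim_mult; [apply eventually_filter| |].
    * apply Clim_scal; [apply eventually_filter|].
      apply Clim_plus; [apply eventually_filter|apply Clim_const, eventually_filter|exact L2].
    * apply Clim_inv; [apply eventually_filter| |].
      -- apply Clim_minus; [apply eventually_filter|apply Clim_const, eventually_filter|exact L2].
      -- replace (1 - 0)%C with (RtoC 1) by ring; exact C1_nz.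
  + apply Clim_scal; [apply eventually_filter|exact L1].
- replace (1 - 0)%C with (RtoC 1) by ring; field; exact nz.
Qed.

Lemma zeta2_sum (w : C) :
  w <> 0 -> Csum (fun m => / ((NS m * w) * (NS m * w)))%C /\
  CSer (fun m => / ((NS m * w) * (NS m * w)))%C = (zeta2 * / (w * w))%C.
Proof.
intros nw.
assert (T : forall m, (/ (w * w) * RtoC (/ INR (S m) ^ 2))%C = (/ ((NS m * w) * (NS m * w)))%C).
{ intros m; pose proof (NS_neq_0 m) as nm.
  rewrite RtoC_inv, RtoC_pow by (apply pow_nonzero, not_0_INR; lia); fold (NS m).
  simpl Cpow; field; auto. }
assert (S : Csum (fun m => RtoC (/ INR (S m) ^ 2))).
{ eapply ex_series_ext; [|exact ex_series_inv_sqr]; intros n.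
  rewrite Cmod_R, Rabs_pos_eq; [reflexivity|left; apply Rinv_sqr_INR_pos]. }
split; [exact (Csum_ext _ _ T (Csum_scal _ _ S))|].
rewrite <- (CSer_ext _ _ T), CSer_scal, CSer_RtoC by exact S; apply Cmult_comm.
Qed.

(** The absolutely convergent part [e] is summed in both orders. By rows, telescoping leaves the
    pole terms at height [1 / 2]; by columns, it leaves these and also the limit [PIC * / z] of
    [eis_lambda]. The values at height [1 / 2] cancel and the limit remains. *)
Theorem Eis_inversion (z : C) :
  0 < fst z ->
  (4 * PIC * PIC * (Eis z + Eis (/ z) * / (z * z)))%C =
  (zeta2 * (1 + / (z * z)) - PIC * / z)%C.
Proof.
intros pos; pose proof (Cneq_fst z pos) as nz; pose proof (Cinv_right z pos) as pi.
set (e := fun m n => (eis_rem (NS m * z + iN (S n)) + eis_rem (NS m * z - iN (S n)))%C).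
set (l := fun m n => eis_pole z m (half_int n)).
assert (ph : forall n, 0 < half_int n) by (intros n; unfold half_int; pose proof (pos_INR n); lra).
destruct (eis_rem_sum_bound z pos) as [K HK].
destruct (CSer_fubini_prod e (fun m => K * / INR (S m) ^ 2) (fun n => / INR (S n) ^ 2))
  as [Se1 [Se2 [Te1 [Te2 F]]]].
{ exact HK. }
{ apply (ex_series_scal_l (K := R_AbsRing) (V := R_NormedModule) K), ex_series_inv_sqr. }
{ exact ex_series_inv_sqr. }
assert (SP : forall m n, eis_term z m n = (e m n + (l m (S n) - l m n))%C).
{ intros m n; unfold e; rewrite <- eis_term_split; unfold l; ring. }
assert (Row : forall m, Csum (eis_term z m) /\
  CSer (eis_term z m) = (csch2pi (NS m * z) - / ((NS m * z) * (NS m * z)))%C).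
{ intros m; exact (csch2_sym _ (fst_NS_mult m z pos)). }
assert (RowB : forall m, Csum (fun n => l m (S n) - l m n)%C /\
  CSer (fun n => l m (S n) - l m n)%C = (- l m 0%nat)%C).
{ intros m.
  assert (A : Csum (fun n => l m (S n) - l m n)%C).
  { apply (Csum_ext (fun n => eis_term z m n - e m n)%C).
    - intros n; rewrite SP; ring.
    - apply Csum_minus; [apply Row|apply Se1]. }
  split; [exact A|apply CSer_unique; [exact A|]].
  apply (Clim_ext _ (fun N => l m N - l m 0%nat)%C);
    [intros; symmetry; apply (Csumn_telescope (l m))|].
  eapply Clim_eq.
  - apply Clim_minus; [apply eventually_filter| |apply Clim_const, eventually_filter].
    destruct (eis_pole_small z pos) as [K' HK'].
    apply (Clim_squeeze _ _ 0 (fun N => Rabs K' * / INR N)).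
    + exists 1%nat; intros N le; replace (l m N - 0)%C with (l m N) by ring.
      assert (1 <= INR N) by (apply (le_INR 1), le).
      assert (h1 : 1 <= half_int N) by (unfold half_int; lra).
      eapply Rle_trans; [apply (HK' m (half_int N)); lra|].
      apply (Rle_trans _ (Rabs K' * / half_int N)).
      * apply Rmult_le_compat_r; [left; now apply Rinv_0_lt_compat|apply Rle_abs].
      * apply Rmult_le_compat_l; [apply Rabs_pos|].
        apply Rinv_le_contravar; [lra|unfold half_int; lra].
    + assert (L := is_lim_seq_scal_l _ (Rabs K') _ is_lim_seq_inv_INR); simpl in L.
      rewrite Rmult_0_r in L; apply is_lim_seq_spec in L; intros eps.
      destruct (L eps) as [N HN]; exists (S N); intros [|n] le; [lia|].
      specialize (HN n ltac:(lia)); rewrite Rminus_0_r in HN; apply Rabs_def2 in HN; exact (proj1 HN).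
  - ring. }
assert (Lam : forall n, Csum (fun m => l m n)) by (intros n; now apply eis_lambda_coth).
assert (E1 : CSer (fun m => CSer (e m)) =
  (4 * PIC * PIC * Eis z - zeta2 * / (z * z) + eis_lambda z (half_int 0))%C).
{ destruct (Eis_csch2 z pos) as [SA EA]; destruct (zeta2_sum z nz) as [SZ EZ].
  rewrite EA, <- EZ, <- CSer_minus by assumption.
  change (eis_lambda z (half_int 0)) with (CSer (fun m => l m 0%nat)).
  rewrite <- (CSer_plus _ _ (Csum_minus _ _ SA SZ) (Lam 0%nat)); apply CSer_ext; intros m.
  rewrite (CSer_ext _ (fun n => eis_term z m n - (l m (S n) - l m n))%C)
    by (intros n; rewrite SP; ring).
  destruct (Row m) as [R1 R2]; destruct (RowB m) as [R3 R4].
  rewrite CSer_minus, R4 by assumption.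
  change (CSer (fun n => eis_term z m n)) with (CSer (eis_term z m)); rewrite R2; unfold l; ring. }
(* [1 / (m z + i n)] is, up to the factor [i z], the value at [1 / z] *)
assert (Col : forall n, Csum (fun m => eis_term z m n) /\
  CSer (fun m => eis_term z m n) =
  (/ ((NS n * 1) * (NS n * 1)) - / (z * z) * csch2pi (NS n * / z))%C).
{ intros n; destruct (csch2_sym _ (fst_NS_mult n (/ z)%C pi)) as [S1 S2].
  assert (T : forall m, (- / (z * z) *
     (/ ((NS n * / z + iN (S m)) * (NS n * / z + iN (S m))) +
      / ((NS n * / z - iN (S m)) * (NS n * / z - iN (S m)))))%C = eis_term z m n).
  { intros m; unfold eis_term, iN; fold (NS m) (NS n).
    assert (I2 : (Ci * Ci)%C = (- (1))%C) by (apply C_eta; simpl; ring).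
    assert (nzs : forall s : R, (NS m * z + Ci * (RtoC s * NS n))%C <> 0).
    { intros s; apply Cneq_fst; pose proof (fst_NS_mult m z pos) as Q.
      replace (fst (NS m * z + Ci * (RtoC s * NS n))%C) with (fst (NS m * z)%C)
        by (unfold NS; cbn -[INR]; ring); exact Q. }
    assert (n1 := nzs 1); assert (n2 := nzs (-1)).
    replace (NS m * z + Ci * (1 * NS n))%C with (NS m * z + Ci * NS n)%C in n1 by ring.
    replace (NS m * z + Ci * (-1 * NS n))%C with (NS m * z - Ci * NS n)%C in n2 by ring.
    replace (NS n * / z + Ci * NS m)%C with (Ci * (NS m * z - Ci * NS n) * / z)%C.
    - replace (NS n * / z - Ci * NS m)%C with (- Ci * (NS m * z + Ci * NS n) * / z)%C.
      + transitivity (- / (Ci * Ci) * (/ ((NS m * z - Ci * NS n) * (NS m * z - Ci * NS n)) +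
          / ((NS m * z + Ci * NS n) * (NS m * z + Ci * NS n))))%C.
        * field; auto using Ci_nz.
        * rewrite I2; field; auto.
      + transitivity ((- (Ci * Ci) * NS n - Ci * NS m * z) * / z)%C; [ring|].
        rewrite I2; field; exact nz.
    - transitivity ((- (Ci * Ci) * NS n + Ci * NS m * z) * / z)%C; [ring|].
      rewrite I2; field; exact nz. }
  split; [exact (Csum_ext _ _ T (Csum_scal _ _ S1))|].
  rewrite <- (CSer_ext _ _ T), CSer_scal, S2 by exact S1.
  field; repeat split; auto using NS_neq_0. }
assert (E2 : CSer (fun n => CSer (fun m => e m n)) =
  (zeta2 - / (z * z) * (4 * PIC * PIC * Eis (/ z)) - (PIC * / z - eis_lambda z (half_int 0)))%C).
{ destruct (Eis_csch2 (/ z) pi) as [SA EA]; destruct (zeta2_sum 1 C1_nz) as [SZ EZ].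
  assert (EZ' : zeta2 = CSer (fun m => / (NS m * 1 * (NS m * 1)))%C).
  { rewrite EZ; field; exact C1_nz. }
  rewrite EZ', EA, <- CSer_scal, <- CSer_minus by auto using Csum_scal.
  assert (CE : forall n, CSer (fun m => e m n) =
    ((/ (NS n * 1 * (NS n * 1)) - / (z * z) * csch2pi (NS n * / z)) -
     (eis_lambda z (half_int (S n)) - eis_lambda z (half_int n)))%C).
  { intros n; destruct (Col n) as [C1 C2]; rewrite <- C2.
    unfold eis_lambda; rewrite <- CSer_minus, <- CSer_minus; auto using Csum_minus.
    - apply CSer_ext; intros m; rewrite SP; unfold l; ring.
    - apply Csum_minus; [apply (Lam (S n))|apply (Lam n)].
    - apply (Lam (S n)).
    - apply (Lam n). }
  assert (SL : Csum (fun n => eis_lambda z (half_int (S n)) - eis_lambda z (half_int n))%C).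
  { apply (Csum_ext (fun n => (/ (NS n * 1 * (NS n * 1)) - / (z * z) * csch2pi (NS n * / z)) -
      CSer (fun m => e m n))%C).
    - intros n; rewrite CE; ring.
    - apply Csum_minus; [apply Csum_minus; [exact SZ|now apply Csum_scal]|exact Te2]. }
  rewrite (CSer_ext _ _ CE), CSer_minus
    by first [exact SL | exact (Csum_minus _ _ SZ (Csum_scal _ _ SA))].
  f_equal; apply CSer_unique; [exact SL|].
  apply (Clim_ext _ (fun N => eis_lambda z (half_int N) - eis_lambda z (half_int 0))%C);
    [intros; symmetry; apply (Csumn_telescope (fun n => eis_lambda z (half_int n)))|].
  apply Clim_minus; [apply eventually_filter|now apply eis_lambda_lim|apply Clim_const, eventually_filter]. }
rewrite E1, E2 in F.
set (A1 := Eis z) in *; set (A2 := Eis (/ z)) in *.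
transitivity ((4 * PIC * PIC * A1 - zeta2 * / (z * z) + eis_lambda z (half_int 0)) +
  / (z * z) * (4 * PIC * PIC * A2) + zeta2 * / (z * z) - eis_lambda z (half_int 0))%C; [ring|].
rewrite F; ring.
Qed.

(** * The inversion formula for the logarithm of the generating function *)

(** Continuity of [g] and [g'] at [t] supplies, on a short interval, the uniform bounds that
    [Cder_PS] asks for. *)
Lemma Cder_PS_loc (c : nat -> R) (g g' : R -> C) (a b t : R) :
  subexp c -> a < t < b -> (forall x, a < x < b -> Cder g x (g' x)) ->
  Ccont g' t -> Cmod (g t) < 1 ->
  Cder (fun x => PS c (g x)) t (g' t * PS (fun n => INR (S n) * c (S n))%R (g t))%C.
Proof.
intros Sc It D K lt.
pose proof (Cmod_ge_0 (g t)) as pg.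
set (e := (1 - Cmod (g t)) / 2).
assert (pe : 0 < e) by (unfold e; lra).
pose proof (proj1 (Ccont_Clim _ _) (Cder_Ccont _ _ _ (D t It)) (mkposreal _ pe)) as [d1 H1].
pose proof (proj1 (Ccont_Clim _ _) K (mkposreal _ Rlt_0_1)) as [d2 H2].
simpl in H1, H2.
set (d := Rmin (Rmin d1 d2) (Rmin (t - a) (b - t))).
assert (pd : 0 < d).
{ apply Rmin_glb_lt; apply Rmin_glb_lt; try apply cond_pos; lra. }
assert (M1 : d <= Rmin d1 d2) by apply Rmin_l.
assert (M2 : d <= Rmin (t - a) (b - t)) by apply Rmin_r.
pose proof (Rmin_l d1 d2); pose proof (Rmin_r d1 d2).
pose proof (Rmin_l (t - a) (b - t)); pose proof (Rmin_r (t - a) (b - t)).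
assert (tri : forall u v : C, Cmod u <= Cmod (u - v)%C + Cmod v).
{ intros u v; replace u with ((u - v) + v)%C at 1 by ring; apply Cmod_triangle. }
apply (Cder_PS c g g' (t - d) (t + d) t (Cmod (g t) + e) (Cmod (g' t) + 1)).
- exact Sc.
- unfold e; lra.
- lra.
- intros x Ix.
  assert (B : forall r : posreal, d <= r -> ball t r x).
  { intros r Hr; unfold ball; simpl; unfold AbsRing_ball, abs, minus, plus, opp; simpl.
    apply Rabs_def1; lra. }
  split; [apply D; lra|].
  specialize (H1 x (B d1 ltac:(lra))); specialize (H2 x (B d2 ltac:(lra))).
  pose proof (tri (g x) (g t)); pose proof (tri (g' x) (g' t)); lra.
Qed.

Definition LP (z : C) : C := PS logP_coef (qexp z).

Lemma Cder_LP (z z' : R -> C) (a b t : R) :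
  a < t < b -> (forall x, a < x < b -> Cder z x (z' x)) -> Ccont z' t -> 0 < fst (z t) ->
  Cder (fun x => LP (z x)) t (- (2 * PIC) * z' t * Eis (z t))%C.
Proof.
intros It D K pos.
assert (Dq : forall x, a < x < b -> Cder (fun y => qexp (z y)) x (- (2 * PIC) * z' x * qexp (z x))%C).
{ intros x Ix; unfold qexp; eapply Cder_eq; [apply Cder_cexp, Cder_opp, Cder_scal, D, Ix|cbv beta; ring]. }
unfold LP; eapply Cder_eq.
- apply (Cder_PS_loc logP_coef (fun x => qexp (z x)) (fun x => - (2 * PIC) * z' x * qexp (z x))%C a b t).
  + exact subexp_logP.
  + exact It.
  + exact Dq.
  + apply Ccont_mult; [apply Ccont_mult; [apply Ccont_const|exact K]|].
    exact (Cder_Ccont _ _ _ (Dq t It)).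
  + now apply Cmod_qexp_lt.
- unfold Eis, PS at 2; rewrite CSer_shift by apply (Csum_PS _ _ subexp_divsum (Cmod_qexp_lt _ pos)).
  change (divsum 0) with 0; rewrite Cmult_0_l, Cplus_0_l.
  assert (A : Csum (fun n => RtoC (divsum (S n)) * qexp (z t) ^ n)%C).
  { apply (Csum_PS (fun n => divsum (S n))); [apply subexp_shift, subexp_divsum|].
    now apply Cmod_qexp_lt. }
  transitivity (- (2 * PIC) * z' t * (qexp (z t) *
    CSer (fun n => RtoC (divsum (S n)) * qexp (z t) ^ n)))%C.
  + unfold PS; rewrite (CSer_ext (fun n => RtoC (INR (S n) * logP_coef (S n)) * qexp (z t) ^ n)%C
      (fun n => RtoC (divsum (S n)) * qexp (z t) ^ n)%C); [ring|].
    intros n; do 2 f_equal; unfold logP_coef; field; apply not_0_INR; lia.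
  + rewrite <- CSer_scal by exact A; f_equal; apply CSer_ext; intros n; rewrite Cpow_S; ring.
Qed.

(** Along the segment from [1] to [z] the difference of the two sides has derivative zero by
    [Eis_inversion], and it vanishes at [1], which the inversion fixes. *)
Lemma LP_inversion_zeta2 (z : C) :
  0 < fst z ->
  LP z = (LP (/ z) + / 2 * clog z + zeta2 / (2 * PIC) * (/ z - z))%C.
Proof.
intros pos; pose proof PIC_neq_0 as nP; pose proof C2_neq_0 as n2.
set (kappa := (zeta2 / (2 * PIC))%C).
set (w := fun t : R => (1 + RtoC t * (z - 1))%C).
set (F := fun t : R => (LP (w t) - LP (/ w t) - / 2 * clog (w t) - kappa * (/ w t - w t))%C).
assert (fw : forall t, fst (w t) = 1 + t * (fst z - 1)) by (intros t; unfold w; simpl; ring).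
set (m := Rmin 1 (fst z)); assert (pm : 0 < m) by (apply Rmin_glb_lt; lra).
assert (ml : m <= 1 /\ m <= fst z) by (split; [apply Rmin_l|apply Rmin_r]).
(* A margin around [[0, 1]]: the real part of [w] is at least [m] on the segment and drops by at
   most [d |fst z - 1| < m] beyond it. *)
set (d := m / (1 + Rabs (fst z - 1))).
pose proof (Rabs_pos (fst z - 1)) as pa.
assert (pd : 0 < d) by (apply Rdiv_lt_0_compat; lra).
assert (dm : d * (1 + Rabs (fst z - 1)) = m) by (unfold d; field; lra).
assert (pw : forall t, - d < t < 1 + d -> 0 < fst (w t)).
{ intros t It; rewrite fw; pose proof (Rabs_le_between (fst z - 1) (Rabs (fst z - 1))) as [Q _].
  specialize (Q (Rle_refl _)).
  assert (X : Rabs (fst z - 1) * d < m) by nra.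
  destruct (Rle_or_lt t 0); [nra|]; destruct (Rle_or_lt t 1); nra. }
assert (Dw : forall t, Cder w t (z - 1)%C).
{ intros t; unfold w; eapply Cder_eq.
  - apply Cder_plus; [apply Cder_const|apply Cder_mult; [apply Cder_id|apply Cder_const]].
  - cbv beta; ring. }
assert (Di : forall t, - d < t < 1 + d -> Cder (fun s => / w s)%C t (- (z - 1) / (w t * w t))%C).
{ intros t It; apply Cder_inv; [apply Dw|apply Cneq_fst, pw, It]. }
assert (DF : forall t, 0 <= t <= 1 -> Cder F t 0).
{ intros t Ht; assert (It : - d < t < 1 + d) by lra.
  pose proof (pw t It) as pt; pose proof (Cneq_fst _ pt) as nt.
  eapply Cder_eq.
  - apply Cder_minus; [apply Cder_minus; [apply Cder_minus|]|].
    + apply (Cder_LP w (fun _ => z - 1)%C (- d) (1 + d) t It); auto using Ccont_const.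
    + apply (Cder_LP (fun s => / w s)%C (fun t => - (z - 1) / (w t * w t))%C (- d) (1 + d) t It).
      * exact Di.
      * assert (Kw : Ccont w t) by exact (Cder_Ccont _ _ _ (Dw t)).
        apply Ccont_div; [apply Ccont_const|now apply Ccont_mult|now apply Cmult_neq_0].
      * now apply Cinv_right.
    + apply Cder_scal, Cder_clog; [apply Dw|exact pt].
    + apply Cder_scal, Cder_minus; [apply Di, It|apply Dw].
  - cbv beta.
    assert (E := Eis_inversion (w t) pt).
    set (W := w t) in *; set (e1 := Eis W) in *; set (e2 := Eis (/ W)) in *.
    transitivity ((z - 1) * (- (4 * PIC * PIC * (e1 + e2 * / (W * W))) / (2 * PIC) - / 2 * / W
                   + kappa * (1 + / (W * W))))%C.
    + field; auto.
    + rewrite E; unfold kappa; field; auto. }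
assert (E : F 1 = F 0).
{ apply C_eta; symmetry; apply (eq_is_derive (V := R_NormedModule) (fun t => _ (F t))); try lra;
    intros t Ht; apply DF, Ht. }
assert (W1 : w 1 = z) by (unfold w; ring).
assert (W0 : w 0 = RtoC 1) by (unfold w; ring).
unfold F in E; rewrite W1, W0, clog_R in E.
rewrite Rabs_R1, ln_1 in E.
assert (i1 : (/ RtoC 1)%C = RtoC 1) by (field; exact C1_nz).
rewrite i1 in E.
transitivity ((LP z - LP (/ z) - / 2 * clog z - kappa * (/ z - z)) +
  (LP (/ z) + / 2 * clog z + kappa * (/ z - z)))%C; [ring|].
rewrite E; ring.
Qed.

Lemma LP_periodic (z : C) (n : Z) : LP (z + Ci * RtoC (IZR n))%C = LP z.
Proof. unfold LP; now rewrite qexp_plus, qexp_iZ, Cmult_1_r. Qed.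

(* At the fixed point [z = exp (- i pi / 6)] one has [1 / z = z + i], so the two values of [LP]
   agree and the constant is determined. *)
Lemma zeta2_value : (zeta2 / (2 * PIC))%C = (PIC / 12)%C.
Proof.
pose proof PIC_neq_0 as nP; pose proof C2_neq_0 as n2.
set (z := cexp (0, - (PI / 6))).
assert (Ez : z = (cos (PI / 6), - / 2)).
{ apply C_eta; unfold z, cexp; simpl; rewrite exp_0.
  - rewrite cos_neg; ring.
  - rewrite sin_neg, sin_PI6; field. }
assert (pc : 0 < cos (PI / 6)).
{ pose proof PI_RGT_0; apply cos_gt_0; lra. }
assert (pos : 0 < fst z) by (rewrite Ez; exact pc).
pose proof (Cneq_fst z pos) as nz.
assert (Iz : (/ z)%C = (z + Ci * RtoC (IZR 1))%C).
{ unfold z; rewrite <- cexp_opp; fold z; rewrite Ez; apply C_eta; unfold cexp; simpl;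
    rewrite Ropp_0, exp_0, Ropp_involutive.
  - ring.
  - rewrite sin_PI6; field. }
assert (Lz : clog z = (0, - (PI / 6))).
{ apply cexp_inj; [now rewrite cexp_clog|].
  pose proof (snd_clog_bound z) as B; pose proof PI_RGT_0; simpl snd in *.
  apply Rabs_def1; simpl in *; lra. }
assert (E := LP_inversion_zeta2 z pos).
set (l := (0, - (PI / 6)) : C) in *.
rewrite Iz, LP_periodic, Lz in E; set (k := (zeta2 / (2 * PIC))%C) in *.
assert (E2 : (k * Ci)%C = (- (/ 2 * l))%C).
{ transitivity ((LP z + / 2 * l + k * (z + Ci * RtoC (IZR 1) - z)) - (LP z + / 2 * l))%C; [ring|].
  rewrite <- E; ring. }
transitivity (k * Ci * / Ci)%C; [field; exact Ci_nz|].
rewrite E2, Ci_inv.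
replace l with (- (RtoC (PI / 6) * Ci))%C by (apply C_eta; unfold l; simpl; ring).
transitivity (- (/ 2 * RtoC (PI / 6) * (Ci * Ci)))%C; [ring|].
replace (Ci * Ci)%C with (- (1))%C by (apply C_eta; simpl; ring).
unfold PIC; replace (RtoC (PI / 6)) with (RtoC PI / 6)%C.
- field; split; intros F; apply RtoC_inj in F; lra.
- rewrite RtoC_div by lra; reflexivity.
Qed.

Theorem LP_inversion (z : C) :
  0 < fst z -> LP z = (LP (/ z) + / 2 * clog z + PIC / 12 * (/ z - z))%C.
Proof. intros pos; rewrite <- zeta2_value; now apply LP_inversion_zeta2. Qed.

(** * Dedekind sums *)

(** A fold over [seq], so that reindexing reduces to [Permutation]. *)
Definition zsum (f : nat -> Z) (n : nat) : Z :=
  fold_right (fun r acc => (f r + acc)%Z) 0%Z (seq 0 n).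

Section ZSum.
Local Open Scope Z_scope.

Let lsum (f : nat -> Z) (l : list nat) : Z := fold_right (fun r acc => f r + acc) 0 l.

Lemma zsum_S (f : nat -> Z) (n : nat) : zsum f (S n) = zsum f n + f n.
Proof.
unfold zsum; rewrite seq_S, fold_right_app; simpl.
assert (E : forall l a, fold_right (fun r acc => f r + acc) a l =
  fold_right (fun r acc => f r + acc) 0 l + a).
{ intros l; induction l as [|x l IH]; intros a; simpl; [lia|rewrite IH; lia]. }
rewrite E; lia.
Qed.

Lemma zsum_0 (f : nat -> Z) : zsum f 0 = 0.
Proof. reflexivity. Qed.

Lemma zsum_ext (f g : nat -> Z) (n : nat) :
  (forall r, (r < n)%nat -> f r = g r) -> zsum f n = zsum g n.
Proof. induction n as [|n IH]; intros H; [reflexivity|]; rewrite !zsum_S, IH, H; auto. Qed.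

Lemma zsum_add (f g : nat -> Z) (n : nat) : zsum (fun r => f r + g r) n = zsum f n + zsum g n.
Proof. induction n as [|n IH]; [reflexivity|]; rewrite !zsum_S, IH; lia. Qed.

Lemma zsum_mul (c : Z) (f : nat -> Z) (n : nat) : zsum (fun r => c * f r) n = c * zsum f n.
Proof. induction n as [|n IH]; [rewrite !zsum_0; lia|]; rewrite !zsum_S, IH; lia. Qed.

Lemma zsum_swap (f : nat -> nat -> Z) (n m : nat) :
  zsum (fun r => zsum (fun j => f r j) m) n = zsum (fun j => zsum (fun r => f r j) n) m.
Proof.
induction n as [|n IH].
- rewrite zsum_0; induction m as [|m IH]; [reflexivity|]; rewrite zsum_S, <- IH; reflexivity.
- rewrite zsum_S, IH, <- zsum_add; apply zsum_ext; intros; now rewrite zsum_S.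
Qed.

Lemma zsum_permute (p : nat -> nat) (f : nat -> Z) (n : nat) :
  (forall r, (r < n)%nat -> (p r < n)%nat) ->
  (forall r s, (r < n)%nat -> (s < n)%nat -> p r = p s -> r = s) ->
  zsum (fun r => f (p r)) n = zsum f n.
Proof.
intros into inj.
assert (P : Permutation (map p (seq 0 n)) (seq 0 n)).
{ apply NoDup_Permutation_bis.
  - apply NoDup_map_NoDup_ForallPairs; [|apply seq_NoDup].
    intros r s Hr Hs; apply in_seq in Hr; apply in_seq in Hs; apply inj; lia.
  - now rewrite length_map.
  - intros x Hx; apply in_map_iff in Hx; destruct Hx as [r [<- Hr]].
    apply in_seq in Hr; apply in_seq; specialize (into r); lia. }
assert (L : forall l, lsum (fun r => f (p r)) l = lsum f (map p l))
  by (intros l; induction l as [|x l IH]; simpl; [reflexivity|now rewrite IH]).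
assert (Q : forall l l', Permutation l l' -> lsum f l = lsum f l')
  by (intros l l' H; induction H; simpl; lia).
change (lsum (fun r => f (p r)) (seq 0 n) = lsum f (seq 0 n)); rewrite L; now apply Q.
Qed.

Lemma zsum_id (n : nat) : 2 * zsum Z.of_nat n = Z.of_nat n * (Z.of_nat n - 1).
Proof. induction n as [|n IH]; [reflexivity|]; rewrite zsum_S, Nat2Z.inj_succ; lia. Qed.

Lemma zsum_sqr (n : nat) :
  6 * zsum (fun r => Z.of_nat r * Z.of_nat r) n =
  (Z.of_nat n - 1) * Z.of_nat n * (2 * Z.of_nat n - 1).
Proof. induction n as [|n IH]; [reflexivity|]; rewrite zsum_S, Nat2Z.inj_succ; lia. Qed.

(** Multiplication by a unit permutes the residues modulo [k]. *)
Lemma zsum_permute_mod (h : Z) (k : nat) (f : Z -> Z) :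
  (0 < k)%nat -> Z.gcd h (Z.of_nat k) = 1 ->
  zsum (fun r => f ((h * Z.of_nat r) mod Z.of_nat k)) k = zsum (fun r => f (Z.of_nat r)) k.
Proof.
intros pk cop; assert (pkz : 0 < Z.of_nat k) by lia.
rewrite <- (zsum_permute (fun r => Z.to_nat ((h * Z.of_nat r) mod Z.of_nat k)) (fun r => f (Z.of_nat r))).
- apply zsum_ext; intros r lt; rewrite Z2Nat.id; [reflexivity|].
  apply Z.mod_pos_bound, pkz.
- intros r lt; pose proof (Z.mod_pos_bound (h * Z.of_nat r) _ pkz); lia.
- intros r s lr ls E.
  pose proof (Z.mod_pos_bound (h * Z.of_nat r) _ pkz).
  pose proof (Z.mod_pos_bound (h * Z.of_nat s) _ pkz).
  apply Z2Nat.inj in E; try lia.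
  assert (D : (Z.of_nat k | h * (Z.of_nat r - Z.of_nat s))).
  { apply Z.mod_divide; [lia|]; rewrite Z.mul_sub_distr_l, Zminus_mod, E, Z.sub_diag.
    apply Z.mod_0_l; lia. }
  apply Z.gauss in D; [|now rewrite Z.gcd_comm].
  destruct D as [c Hc]; assert (c = 0) by nia; lia.
Qed.

(** Since the fractional part of [h r / k] is [(h r mod k) / k], the Dedekind sum is this integer
    over [k^2], minus [(k - 1) / 4]. Reciprocity becomes an identity between integers. *)
Definition dedekind_num (h : Z) (k : nat) : Z :=
  zsum (fun r => Z.of_nat r * ((h * Z.of_nat r) mod Z.of_nat k)) k.

Lemma floor_count (f h : Z) (n : nat) :
  0 <= f < Z.of_nat n ->
  f * (f + 1) = 2 * zsum (fun j => if Z.of_nat j <=? f then Z.of_nat j else 0) n.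
Proof.
intros Hf.
assert (H : forall m, 2 * zsum (fun j => if Z.of_nat j <=? f then Z.of_nat j else 0) m =
  Z.min (f + 1) (Z.of_nat m) * (Z.min (f + 1) (Z.of_nat m) - 1)).
{ intros m; induction m as [|m IH]; [rewrite zsum_0; simpl; lia|].
  rewrite zsum_S, Z.mul_add_distr_l, IH, Nat2Z.inj_succ.
  destruct (Z.leb_spec (Z.of_nat m) f).
  - rewrite !Z.min_r by lia; lia.
  - rewrite !Z.min_l by lia; lia. }
rewrite H, Z.min_l by lia; lia.
Qed.

Lemma count_above (g : Z) (k : nat) :
  0 <= g < Z.of_nat k -> zsum (fun r => if g <? Z.of_nat r then 1 else 0) k = Z.of_nat k - 1 - g.
Proof.
intros Hg.
assert (H : forall m, zsum (fun r => if g <? Z.of_nat r then 1 else 0) m = Z.max 0 (Z.of_nat m - 1 - g)).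
{ intros m; induction m as [|m IH]; [rewrite zsum_0; lia|].
  rewrite zsum_S, IH, Nat2Z.inj_succ; destruct (Z.ltb_spec g (Z.of_nat m)); lia. }
rewrite H; lia.
Qed.

(* Both sides count the lattice points [(r, j)], with weight [j], below the line of slope [h / k];
   coprimality excludes points on the line. *)
Lemma floor_reciprocity (h k : nat) :
  (0 < h)%nat -> (0 < k)%nat -> Z.gcd (Z.of_nat h) (Z.of_nat k) = 1 ->
  let H := Z.of_nat h in let K := Z.of_nat k in
  zsum (fun r => (H * Z.of_nat r / K) * (H * Z.of_nat r / K + 1)) k =
  2 * zsum (fun j => Z.of_nat j * (K - 1 - K * Z.of_nat j / H)) h.
Proof.
intros ph pk cop H K.
transitivity (zsum (fun r => zsum (fun j =>
    2 * (if Z.of_nat j <=? H * Z.of_nat r / K then Z.of_nat j else 0)) h) k).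
- apply zsum_ext; intros r lr; rewrite zsum_mul; apply floor_count; [exact 0|].
  split; [apply Z.div_pos; lia|apply Z.div_lt_upper_bound; nia].
- rewrite zsum_swap, <- zsum_mul; apply zsum_ext; intros j lj.
  rewrite zsum_mul; f_equal.
  assert (Hg : 0 <= K * Z.of_nat j / H < Z.of_nat k)
    by (split; [apply Z.div_pos; lia|apply Z.div_lt_upper_bound; nia]).
  assert (CA := count_above _ _ Hg); fold K in CA; rewrite <- CA, <- zsum_mul; apply zsum_ext; intros r lr.
  destruct j as [|j].
  { destruct (_ <=? _); simpl; reflexivity. }
  set (J := Z.of_nat (S j)) in *; set (R := Z.of_nat r).
  assert (E1 : J <= H * R / K <-> J * K <= H * R).
  { split; intros L.
    - pose proof (Z.mul_div_le (H * R) K ltac:(lia)); nia.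
    - apply Z.div_le_lower_bound; lia. }
  assert (E2 : R <= K * J / H <-> H * R <= J * K).
  { split; intros L.
    - pose proof (Z.mul_div_le (K * J) H ltac:(lia)); nia.
    - apply Z.div_le_lower_bound; lia. }
  assert (ne : J * K <> H * R).
  { intros E; assert (D : (H | J * K)) by (exists R; lia).
    rewrite Z.mul_comm in D; apply Z.gauss in D; [|exact cop].
    destruct D as [c Hc]; assert (0 < c) by nia; unfold J, H in *; nia. }
  destruct (Z.leb_spec J (H * R / K)) as [L1|L1]; destruct (Z.ltb_spec (K * J / H) R) as [L2|L2]; lia.
Qed.

(** The residues [H r mod K] permute those of [r], so their sum and their sum of squares are known;
    substituting [H r mod K = H r - K (H r / K)] turns these two facts into the first two
    identities. *)
Lemma floor_sum (h k : nat) :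
  (0 < k)%nat -> Z.gcd (Z.of_nat h) (Z.of_nat k) = 1 ->
  let H := Z.of_nat h in let K := Z.of_nat k in
  2 * zsum (fun r => H * Z.of_nat r / K) k = (H - 1) * (K - 1) /\
  (H * H - 1) * zsum (fun r => Z.of_nat r * Z.of_nat r) k
    = 2 * H * K * zsum (fun r => Z.of_nat r * (H * Z.of_nat r / K)) k
      - K * K * zsum (fun r => (H * Z.of_nat r / K) * (H * Z.of_nat r / K)) k /\
  dedekind_num H k = H * zsum (fun r => Z.of_nat r * Z.of_nat r) k
      - K * zsum (fun r => Z.of_nat r * (H * Z.of_nat r / K)) k.
Proof.
intros pk cop H K.
assert (D : forall r, H * r mod K = H * r + (- K) * (H * r / K))
  by (intros r; rewrite Z.mod_eq by lia; lia).
assert (P1 := zsum_permute_mod H k (fun x => x) pk cop).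
assert (P2 := zsum_permute_mod H k (fun x => x * x) pk cop).
pose proof (zsum_id k) as I; fold K in I, P1, P2.
split; [|split].
- rewrite (zsum_ext _ (fun r => H * Z.of_nat r + (- K) * (H * Z.of_nat r / K))) in P1 by auto.
  rewrite zsum_add, !zsum_mul in P1.
  change (zsum (fun r => Z.of_nat r) k) with (zsum Z.of_nat k) in P1; nia.
- rewrite (zsum_ext _ (fun r => H * H * (Z.of_nat r * Z.of_nat r) +
     ((- 2 * H * K) * (Z.of_nat r * (H * Z.of_nat r / K)) +
      (K * K) * ((H * Z.of_nat r / K) * (H * Z.of_nat r / K))))) in P2
    by (intros; rewrite D; ring).
  rewrite !zsum_add, !zsum_mul in P2; lia.
- unfold dedekind_num; fold K.
  rewrite (zsum_ext _ (fun r => H * (Z.of_nat r * Z.of_nat r) + (- K) * (Z.of_nat r * (H * Z.of_nat r / K))))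
    by (intros; rewrite D; ring).
  rewrite zsum_add, !zsum_mul; lia.
Qed.

(** Elimination: [floor_sum] trades the mixed sum of [r (H r / K)] for squares of floors,
    [floor_reciprocity] trades these for the mixed sum with [h] and [k] exchanged, and the latter is
    [dedekind_num K h] up to a sum of squares. *)
Lemma dedekind_num_reciprocity (h k : nat) :
  (0 < h)%nat -> (0 < k)%nat -> Z.gcd (Z.of_nat h) (Z.of_nat k) = 1 ->
  let H := Z.of_nat h in let K := Z.of_nat k in
  12 * H * H * dedekind_num H k + 12 * K * K * dedekind_num K h =
  3 * H * H * K * K * (H + K) - 9 * H * H * K * K + H * K * (H * H + K * K + 1).
Proof.
intros ph pk cop H K.
destruct (floor_sum h k pk cop) as [A1 [A2 A3]]; fold H K in A1, A2, A3.
destruct (floor_sum k h ph ltac:(rewrite Z.gcd_comm; exact cop)) as [_ [_ B3]]; fold H K in B3.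
assert (R := floor_reciprocity h k ph pk cop); cbv zeta in R; fold H K in R.
rewrite (zsum_ext (fun r => (H * Z.of_nat r / K) * (H * Z.of_nat r / K + 1))
  (fun r => (H * Z.of_nat r / K) * (H * Z.of_nat r / K) + H * Z.of_nat r / K)), zsum_add in R
  by (intros; ring).
rewrite (zsum_ext (fun j => Z.of_nat j * (K - 1 - K * Z.of_nat j / H))
  (fun j => (K - 1) * Z.of_nat j + (-1) * (Z.of_nat j * (K * Z.of_nat j / H)))), zsum_add, !zsum_mul in R
  by (intros; ring).
pose proof (zsum_id h) as Ih; pose proof (zsum_sqr h) as Qh; pose proof (zsum_sqr k) as Qk.
change (zsum (fun j => Z.of_nat j) h) with (zsum Z.of_nat h) in R.
fold H K in Ih, Qh, Qk.
rewrite A3, B3.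
set (F := zsum (fun r => Z.of_nat r * (H * Z.of_nat r / K)) k) in *.
set (G := zsum (fun r => Z.of_nat r * (K * Z.of_nat r / H)) h) in *.
set (F1 := zsum (fun r => H * Z.of_nat r / K) k) in *.
set (F2 := zsum (fun r => (H * Z.of_nat r / K) * (H * Z.of_nat r / K)) k) in *.
set (qk := zsum (fun r => Z.of_nat r * Z.of_nat r) k) in *.
set (qh := zsum (fun r => Z.of_nat r * Z.of_nat r) h) in *.
set (ih := zsum Z.of_nat h) in *.
clearbody F G F1 F2 qk qh ih.
transitivity (12 * H * H * H * qk - 6 * H * (2 * H * K * F) + 12 * K * K * K * qh - 12 * H * K * K * G);
  [ring|].
replace (2 * H * K * F) with ((H * H - 1) * qk + K * K * F2) by lia.
replace F2 with (2 * ((K - 1) * ih + -1 * G) - F1) by lia.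
transitivity (H * H * H * (6 * qk) + H * (6 * qk) + 2 * K * K * K * (6 * qh)
  - 6 * H * K * K * (K - 1) * (2 * ih) + 3 * H * K * K * (2 * F1)); [ring|].
rewrite Qk, Qh, Ih, A1; ring.
Qed.

(** For [0 < r < k] coprimality keeps [h r] nonzero modulo [k], so the residues of [h r] and [- h r]
    add up to [k]. *)
Lemma dedekind_num_opp (h : Z) (k : nat) :
  (0 < k)%nat -> Z.gcd h (Z.of_nat k) = 1 ->
  dedekind_num (- h) k + dedekind_num h k = Z.of_nat k * zsum Z.of_nat k.
Proof.
intros pk cop; unfold dedekind_num.
rewrite <- zsum_add, <- zsum_mul.
apply zsum_ext; intros r lr.
destruct r as [|r]; [simpl; lia|].
assert (nz : (h * Z.of_nat (S r)) mod Z.of_nat k <> 0).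
{ intros E; apply Z.mod_divide in E; [|lia].
  apply Z.gauss in E; [|now rewrite Z.gcd_comm].
  destruct E as [c Hc]; assert (0 < c) by nia; nia. }
replace (- h * Z.of_nat (S r)) with (- (h * Z.of_nat (S r))) by ring.
rewrite Z.mod_opp_l_nz by (lia || exact nz); ring.
Qed.

Lemma dedekind_num_period (h h' : Z) (k : nat) :
  (0 < k)%nat -> (h mod Z.of_nat k = h' mod Z.of_nat k)%Z -> dedekind_num h k = dedekind_num h' k.
Proof.
intros pk E; apply zsum_ext; intros r lr; f_equal.
rewrite Z.mul_mod, E, <- Z.mul_mod by lia; reflexivity.
Qed.

End ZSum.

(** Integer [h] is allowed because the Euclidean step meets the sum at [- k] modulo [h]. *)
Definition dedekindZ (h : Z) (k : nat) : R :=
  IZR (dedekind_num h k) / INR k ^ 2 - (INR k - 1) / 4.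

Lemma dedekindZ_period (h h' : Z) (k : nat) :
  (0 < k)%nat -> (h mod Z.of_nat k = h' mod Z.of_nat k)%Z -> dedekindZ h k = dedekindZ h' k.
Proof. intros pk E; unfold dedekindZ; now rewrite (dedekind_num_period h h'). Qed.

Lemma dedekindZ_1 (h : Z) : dedekindZ h 1 = 0.
Proof.
unfold dedekindZ, dedekind_num; rewrite zsum_S, zsum_0; simpl; field.
Qed.

Lemma dedekindZ_opp (h : Z) (k : nat) :
  (0 < k)%nat -> Z.gcd h (Z.of_nat k) = 1%Z -> dedekindZ (- h) k = - dedekindZ h k.
Proof.
intros pk cop; assert (E := dedekind_num_opp h k pk cop).
assert (I := zsum_id k).
apply (f_equal (Z.mul 2)) in E.
replace (2 * (Z.of_nat k * zsum Z.of_nat k))%Z with (Z.of_nat k * (2 * zsum Z.of_nat k))%Z in E by ring.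
rewrite I in E; apply (f_equal IZR) in E.
rewrite !mult_IZR, plus_IZR, minus_IZR, <- INR_IZR_INZ in E.
assert (nk : INR k <> 0) by (apply not_0_INR; lia).
unfold dedekindZ; apply (Rmult_eq_reg_r (2 * INR k ^ 2)); [|apply Rmult_integral_contrapositive; split; [lra|now apply pow_nonzero]].
field_simplify; [|exact nk|exact nk].
nra.
Qed.

Theorem dedekind_reciprocity (h k : nat) :
  (0 < h)%nat -> (0 < k)%nat -> Z.gcd (Z.of_nat h) (Z.of_nat k) = 1%Z ->
  dedekindZ (Z.of_nat h) k + dedekindZ (Z.of_nat k) h =
  - / 4 + (INR h / INR k + INR k / INR h + / (INR h * INR k)) / 12.
Proof.
intros ph pk cop; assert (E := dedekind_num_reciprocity h k ph pk cop); cbv zeta in E.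
apply (f_equal IZR) in E.
repeat rewrite ?plus_IZR, ?minus_IZR, ?mult_IZR in E; rewrite <- !INR_IZR_INZ in E.
assert (nh : INR h <> 0) by (apply not_0_INR; lia).
assert (nk : INR k <> 0) by (apply not_0_INR; lia).
unfold dedekindZ.
set (a := IZR (dedekind_num (Z.of_nat h) k)) in *; set (b := IZR (dedekind_num (Z.of_nat k) h)) in *.
set (x := INR h) in *; set (y := INR k) in *.
apply (Rmult_eq_reg_r (12 * x * x * y * y)).
- transitivity ((12 * x * x * a + 12 * y * y * b) - 3 * x * x * y * y * (y - 1 + (x - 1))).
  + field; auto.
  + rewrite E; field; auto.
- repeat apply Rmult_integral_contrapositive_currified; auto; lra.
Qed.

Lemma Int_part_div (a k : nat) :
  (0 < k)%nat -> Int_part (INR a / INR k) = (Z.of_nat a / Z.of_nat k)%Z.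
Proof.
intros pk; assert (pk' : 0 < INR k) by (apply lt_0_INR; lia).
symmetry; apply Int_part_spec.
pose proof (Z.div_mod (Z.of_nat a) (Z.of_nat k) ltac:(lia)) as E.
pose proof (Z.mod_pos_bound (Z.of_nat a) (Z.of_nat k) ltac:(lia)) as B.
set (q := (Z.of_nat a / Z.of_nat k)%Z) in *; set (m := (Z.of_nat a mod Z.of_nat k)%Z) in *.
apply (f_equal IZR) in E; rewrite plus_IZR, mult_IZR, <- !INR_IZR_INZ in E.
assert (Bm : 0 <= IZR m < INR k) by (rewrite INR_IZR_INZ; split; [apply IZR_le|apply IZR_lt]; lia).
rewrite E; replace ((INR k * IZR q + IZR m) / INR k) with (IZR q + IZR m / INR k) by (field; lra).
assert (0 <= IZR m / INR k < 1).
{ split; [apply Rdiv_le_0_compat; lra|].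
  apply (Rmult_lt_reg_r (INR k)); [exact pk'|]; unfold Rdiv; rewrite Rmult_assoc, Rinv_l; lra. }
lra.
Qed.

Lemma dedekind_sum_Z (h k : nat) : (0 < k)%nat -> dedekind_sum h k = dedekindZ (Z.of_nat h) k.
Proof.
intros pk; assert (pk' : 0 < INR k) by (apply lt_0_INR; lia).
destruct k as [|k]; [lia|].
assert (T : forall r, INR r / INR (S k) * (INR (h * r) / INR (S k)
    - IZR (Int_part (INR (h * r) / INR (S k))) - 1 / 2) =
  IZR (Z.of_nat r * ((Z.of_nat h * Z.of_nat r) mod Z.of_nat (S k))) / INR (S k) ^ 2
    - INR r / (2 * INR (S k))).
{ intros r; rewrite Int_part_div by lia; rewrite Z.mod_eq by lia.
  rewrite !mult_IZR, minus_IZR, !mult_IZR, Nat2Z.inj_mul, mult_INR, <- !INR_IZR_INZ; field; lra. }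
assert (S : forall m, (m <= k)%nat -> sum_n_m (fun r => INR r / INR (S k) * (INR (h * r) / INR (S k)
    - IZR (Int_part (INR (h * r) / INR (S k))) - 1 / 2)) 1 m =
  IZR (zsum (fun r => Z.of_nat r * ((Z.of_nat h * Z.of_nat r) mod Z.of_nat (S k)))%Z (S m)) / INR (S k) ^ 2
    - INR m * (INR m + 1) / 2 / (2 * INR (S k))).
{ intros m; induction m as [|m IH]; intros le.
  - rewrite sum_n_m_zero by lia; rewrite zsum_S, zsum_0; unfold zero; simpl; field.
    pose proof (pos_INR k); destruct k; simpl in *; lra.
  - rewrite sum_n_Sm by lia; rewrite IH by lia; rewrite T, (zsum_S _ (S m)), plus_IZR.
    match goal with |- plus ?a ?b = ?c => change (@eq R (a + b) c) end.
    rewrite (S_INR m); field; lra. }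
unfold dedekind_sum; rewrite Nat.sub_1_r; simpl pred; rewrite S by lia.
unfold dedekindZ, dedekind_num; rewrite S_INR in pk'; rewrite !(S_INR k); field; lra.
Qed.

(** * The transformation law under the modular group *)

Definition iZ (h : Z) : C := (Ci * RtoC (IZR h))%C.

Lemma Ci_sqr : (Ci * Ci)%C = (- (1))%C.
Proof. apply C_eta; simpl; ring. Qed.

(** The exponentials agree because [exp (- i PI / 2) = - i]. The imaginary part lies in [(- PI, PI)]
    on the left and in [(- PI, 0)] on the right, so the two differ by less than a period. *)
Lemma clog_quarter_turn (a b z : C) :
  0 < fst a -> 0 < fst b -> 0 < fst z -> (a * b)%C = (- Ci * z)%C ->
  (clog a + clog b)%C = (clog z - PIC / 2 * Ci)%C.
Proof.
intros pa pb pz E.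
assert (Eq : (PIC / 2 * Ci)%C = (0, PI / 2)).
{ unfold PIC; rewrite <- RtoC_div by lra; apply C_eta; simpl; field. }
rewrite Eq; apply cexp_inj.
- unfold Cminus; rewrite !cexp_plus, !cexp_clog by assumption; rewrite E, Cmult_comm; f_equal.
  apply C_eta; unfold cexp; simpl; rewrite Ropp_0, exp_0, ?cos_neg, ?sin_neg, ?cos_PI2, ?sin_PI2; ring.
- pose proof (snd_clog_bound a); pose proof (snd_clog_bound b); pose proof (snd_clog_bound z).
  pose proof PI_RGT_0; unfold Cminus; cbn [snd Cplus Copp fst].
  apply Rabs_def1; simpl in *; lra.
Qed.

Lemma LP_shift (z : C) (k : nat) (h c : Z) :
  (0 < k)%nat ->
  LP ((z - iZ (h + Z.of_nat k * c)) / RtoC (INR k))%C = LP ((z - iZ h) / RtoC (INR k))%C.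
Proof.
intros pk; assert (nk : RtoC (INR k) <> 0)
  by (intros E; apply RtoC_inj in E; revert E; apply not_0_INR; lia).
rewrite <- (LP_periodic ((z - iZ h) / RtoC (INR k)) (- c)); f_equal.
unfold iZ; rewrite plus_IZR, mult_IZR, opp_IZR, <- INR_IZR_INZ, RtoC_plus, RtoC_mult, RtoC_opp.
field; exact nk.
Qed.

(* Euclidean induction: with [z0 = (z - i h) / k] the inversion formula replaces the fraction
   [h / k] by [- k / h], and the reciprocity law collects the constants. *)
Lemma LP_transformation (k : nat) (h H : Z) (z : C) :
  (0 < k)%nat -> Z.gcd h (Z.of_nat k) = 1%Z -> (Z.of_nat k | h * H + 1)%Z -> 0 < fst z ->
  LP ((z - iZ h) / RtoC (INR k))%C =
  (LP ((/ z - iZ H) / RtoC (INR k)) + PIC * Ci * RtoC (dedekindZ h k) + / 2 * clog z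
   + PIC / (12 * RtoC (INR k)) * (/ z - z))%C.
Proof.
revert h H z; induction k as [k IH] using lt_wf_ind; intros h H z pk cop dvd pos.
pose proof (Cneq_fst z pos) as nz.
assert (n12 : RtoC 12 <> 0) by (intros E; apply RtoC_inj in E; lra).
destruct (Nat.eq_dec k 1) as [->|k1].
(* For [k = 1] all rotations are periods, and the inversion formula alone remains. *)
{ assert (E0 : iZ 0 = 0) by (unfold iZ; apply Cmult_0_r).
  change (INR 1) with 1.
  assert (S0 : forall (u : C) (c : Z), LP ((u - iZ c) / 1)%C = LP u).
  { intros u c; replace c with (0 + Z.of_nat 1 * c)%Z by lia.
    change (RtoC 1) with (RtoC (INR 1)); rewrite LP_shift by lia.
    f_equal; rewrite E0; change (INR 1) with 1; field; exact C1_nz. }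
  rewrite !S0, dedekindZ_1, LP_inversion by exact pos; field; auto using C1_nz. }
assert (pkz : (0 < Z.of_nat k)%Z) by lia.
pose (h0 := Z.to_nat (h mod Z.of_nat k)).
pose proof (Z.mod_pos_bound h _ pkz) as Bh.
assert (Eh0 : Z.of_nat h0 = (h mod Z.of_nat k)%Z) by (apply Z2Nat.id; lia).
pose proof (Z.div_mod h (Z.of_nat k) ltac:(lia)) as Eh; rewrite <- Eh0 in Eh.
assert (cop0 : Z.gcd (Z.of_nat h0) (Z.of_nat k) = 1%Z).
{ rewrite Eh0, Z.gcd_mod, Z.gcd_comm by lia; exact cop. }
assert (ph0 : (0 < h0)%nat).
{ destruct h0; [|lia]; simpl in cop0; rewrite Z.abs_eq in cop0 by lia; lia. }
assert (dvd0 : (Z.of_nat k | Z.of_nat h0 * H + 1)%Z).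
{ destruct dvd as [c Hc]; exists (c - h / Z.of_nat k * H)%Z; rewrite Eh in Hc at 1; lia. }
rewrite (dedekindZ_period h (Z.of_nat h0) k pk)
  by (rewrite Eh0, Z.mod_mod by lia; reflexivity).
rewrite Eh, Z.add_comm, LP_shift by exact pk.
clear Eh dvd; destruct dvd0 as [K HK].
assert (lt : (h0 < k)%nat) by lia.
set (hr := INR h0); set (kr := INR k).
assert (ph : 0 < hr) by (apply lt_0_INR, ph0).
assert (pk' : 0 < kr) by (apply lt_0_INR, pk).
assert (nh : RtoC hr <> 0) by (intros E; apply RtoC_inj in E; lra).
assert (nk : RtoC kr <> 0) by (intros E; apply RtoC_inj in E; lra).
set (z0 := ((z - iZ (Z.of_nat h0)) / RtoC kr)%C).
assert (Ez0 : z0 = ((z - Ci * RtoC hr) / RtoC kr)%C).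
{ unfold z0, iZ; rewrite <- INR_IZR_INZ; reflexivity. }
assert (pz0 : 0 < fst z0).
{ replace (fst z0) with (fst z / kr); [now apply Rdiv_lt_0_compat|].
  rewrite Ez0; unfold Cdiv; rewrite <- RtoC_inv by lra; simpl; field; lra. }
assert (nz1 : (z - Ci * RtoC hr)%C <> 0).
{ apply Cneq_fst; replace (fst (z - Ci * RtoC hr)%C) with (fst z) by (simpl; ring); exact pos. }
(* [w = 1 / v] is the variable attached to the fraction [- k / h0]: it satisfies
   [(w + i k) / h0 = 1 / z0]. With [h0 H + 1 = K k], its transform [(1 / w - i K) / h0] is the
   wanted [(1 / z - i H) / k]. *)
set (v := (RtoC hr / (RtoC kr * z) + Ci / RtoC kr)%C).
assert (pv : 0 < fst v).
{ assert (E : v = (RtoC (hr / kr) * / z + RtoC (/ kr) * Ci)%C)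
    by (unfold v; rewrite RtoC_div, RtoC_inv by lra; field; auto).
  rewrite E; pose proof (Cinv_right z pos) as Q.
  replace (fst _) with (hr / kr * fst (/ z)%C) by (simpl; ring).
  apply Rmult_lt_0_compat; [now apply Rdiv_lt_0_compat|exact Q]. }
assert (nv : v <> 0) by now apply Cneq_fst.
assert (Ev : v = (Ci * (z - Ci * RtoC hr) / (RtoC kr * z))%C).
{ transitivity ((Ci * z - (Ci * Ci) * RtoC hr) / (RtoC kr * z))%C.
  - rewrite Ci_sqr; unfold v; field; auto.
  - field; auto. }
set (w := (/ v)%C).
assert (pw : 0 < fst w) by now apply Cinv_right.
assert (Ew : w = (- Ci * (RtoC kr * z) / (z - Ci * RtoC hr))%C).
{ unfold w; rewrite Ev, <- Ci_inv; field; auto using Ci_nz. }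
assert (Iw : (/ w)%C = v) by (unfold w; field; exact nv).
assert (nw : w <> 0) by now apply Cneq_fst.
assert (nz0 : z0 <> 0) by now apply Cneq_fst.
assert (R := IH h0 lt (- Z.of_nat k)%Z K w ph0).
rewrite Z.gcd_opp_l, Z.gcd_comm in R.
specialize (R cop0 ltac:(exists (- H)%Z; lia) pw); fold hr in R.
assert (A1 : ((w - iZ (- Z.of_nat k)) / RtoC hr)%C = (/ z0)%C).
{ unfold iZ; rewrite opp_IZR, <- INR_IZR_INZ, RtoC_opp; fold kr; rewrite Ew, Ez0.
  transitivity ((- (Ci * Ci) * RtoC hr * RtoC kr) / (RtoC hr * (z - Ci * RtoC hr)))%C; [field; auto|].
  rewrite Ci_sqr; field; auto. }
assert (A2 : ((/ w - iZ K) / RtoC hr)%C = ((/ z - iZ H) / RtoC kr)%C).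
{ rewrite Iw; unfold v, iZ.
  assert (EK : (RtoC hr * RtoC (IZR H) + 1)%C = (RtoC (IZR K) * RtoC kr)%C).
  { apply (f_equal IZR) in HK; rewrite plus_IZR, !mult_IZR, <- !INR_IZR_INZ in HK.
    fold hr kr in HK; rewrite <- !RtoC_mult, <- RtoC_plus; f_equal; exact HK. }
  replace (RtoC (IZR K)) with ((RtoC hr * RtoC (IZR H) + 1) / RtoC kr)%C
    by (rewrite EK; field; exact nk).
  field; auto. }
rewrite A1, A2 in R.
rewrite (LP_inversion z0 pz0), R.
(* [z0 w = - i z]; half of the quarter turn is [- i PI / 4], which the constant [1 / 4] of the
   reciprocity law compensates. *)
assert (L : (clog z0 + clog w)%C = (clog z - PIC / 2 * Ci)%C).
{ apply clog_quarter_turn; auto; rewrite Ez0, Ew; field; auto. }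
assert (D : (RtoC (dedekindZ (- Z.of_nat k) h0) =
   RtoC (dedekindZ (Z.of_nat h0) k) + / 4
   - (RtoC hr / RtoC kr + RtoC kr / RtoC hr + / (RtoC hr * RtoC kr)) / 12)%C).
{ rewrite dedekindZ_opp by (auto; rewrite Z.gcd_comm; exact cop0).
  pose proof (dedekind_reciprocity h0 k ph0 pk cop0) as Q; fold hr kr in Q.
  assert (nhk : hr * kr <> 0) by nra.
  replace (- dedekindZ (Z.of_nat k) h0)
    with (dedekindZ (Z.of_nat h0) k + / 4 - (hr / kr + kr / hr + / (hr * kr)) / 12) by lra.
  rewrite RtoC_minus, RtoC_plus, (RtoC_div (_ + _)), !RtoC_plus, !RtoC_div, !RtoC_inv, RtoC_mult by (lra || auto).
  reflexivity. }
rewrite D.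
(* The imaginary part left over here is the sum of fractions in the reciprocity law, and cancels the
   one in [D]. *)
assert (B : (/ z0 - z0 + (/ w - w) / RtoC hr)%C =
  (/ (RtoC kr * z) - z / RtoC kr + Ci * (RtoC hr / RtoC kr + RtoC kr / RtoC hr + / (RtoC hr * RtoC kr)))%C).
{ rewrite <- A1, Iw; unfold v.
  unfold iZ; rewrite opp_IZR, <- INR_IZR_INZ, RtoC_opp, Ez0; fold kr; field; auto. }
assert (n4 : RtoC 4 <> 0) by (intros E; apply RtoC_inj in E; lra).
transitivity (LP ((/ z - iZ H) / RtoC kr) + PIC * Ci * (RtoC (dedekindZ (Z.of_nat h0) k) + / 4 -
   (RtoC hr / RtoC kr + RtoC kr / RtoC hr + / (RtoC hr * RtoC kr)) / 12) + / 2 * (clog z0 + clog w)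
   + PIC / 12 * (/ z0 - z0 + (/ w - w) / RtoC hr))%C; [field; repeat split; auto using C2_neq_0|].
rewrite L, B; field; auto using C2_neq_0.
Qed.

(** * Integrals over vertical lines *)

(** A majorant of [|w|^(-2)] with a rational primitive, from [(x + |t|)^2 <= 2 (x^2 + t^2)]. The
    offset [d] is [0] on vertical tails and [|t|] on a horizontal ray at height [t]. *)
Definition tail_fun (d x : R) : R := 2 / (1 + x + d) ^ 2.

Lemma is_RInt_tail (d x0 a b : R) :
  0 <= d -> x0 <= a <= b ->
  is_RInt (fun x => tail_fun d (x - x0)) a b (2 / (1 + (a - x0) + d) - 2 / (1 + (b - x0) + d)).
Proof.
intros pd Hab.
replace (2 / (1 + (a - x0) + d) - 2 / (1 + (b - x0) + d))
  with (minus (- 2 / (1 + (b - x0) + d)) (- 2 / (1 + (a - x0) + d)))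
  by (unfold minus, plus, opp; simpl; field; lra).
apply (is_RInt_derive (V := R_CompleteNormedModule) (fun x => - 2 / (1 + (x - x0) + d))).
- intros x Hx; rewrite Rmin_left, Rmax_right in Hx by lra.
  unfold tail_fun; auto_derive; [lra|field; lra].
- intros x Hx; rewrite Rmin_left, Rmax_right in Hx by lra.
  apply (ex_derive_continuous (V := R_NormedModule)); unfold tail_fun; auto_derive.
  assert (0 < (1 + (x - x0) + d) ^ 2) by (apply pow_lt; lra); simpl in *; lra.
Qed.

Lemma CRInt_tail_right (f : R -> C) (M d x0 a b : R) :
  0 <= d -> x0 <= a <= b -> 0 <= M -> (forall t, a <= t <= b -> Ccont f t) ->
  (forall t, a <= t <= b -> Cmod (f t) <= M * tail_fun d (t - x0)) ->
  Cmod (CRInt f a b) <= M * (2 / (1 + (a - x0) + d)).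
Proof.
intros pd Hab pM K B.
eapply Rle_trans.
- apply (CRInt_bound f _ a b _ (proj2 Hab) K B).
  apply (is_RInt_scal (V := R_NormedModule) _ _ _ M), is_RInt_tail; assumption.
- unfold scal; simpl; unfold mult; simpl; apply Rmult_le_compat_l; [exact pM|].
  assert (0 < 2 / (1 + (b - x0) + d)) by (apply Rdiv_lt_0_compat; lra); lra.
Qed.

Lemma CRInt_reflect (f : R -> C) (a b : R) :
  a <= b -> (forall t, Ccont f t) -> CRInt f (- b) (- a) = CRInt (fun t => f (- t)) a b.
Proof.
intros le K.
assert (E : forall r : R -> R, ex_RInt r (- b) (- a) -> RInt r (- b) (- a) = RInt (fun t => r (- t)) a b).
{ intros r [l Hl]; rewrite (is_RInt_unique _ _ _ _ Hl); symmetry; apply is_RInt_unique.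
  apply is_RInt_swap in Hl.
  assert (Hc := is_RInt_comp_opp (V := R_NormedModule) r a b _ Hl).
  apply (is_RInt_opp (V := R_NormedModule)) in Hc.
  unfold opp in Hc; simpl in Hc; rewrite Ropp_involutive in Hc.
  eapply is_RInt_ext; [|exact Hc]; intros x _; simpl; ring. }
destruct (Ccont_ex_RInt f (- b) (- a)) as [A1 A2]; [lra|auto|].
apply C_eta; unfold CRInt; simpl; rewrite E by assumption; reflexivity.
Qed.

Lemma Ccont_reflect (f : R -> C) (t : R) : (forall t, Ccont f t) -> Ccont (fun t => f (- t)) t.
Proof.
intros K; destruct (K (- t)) as [K1 K2].
assert (O : continuous (fun t : R => - t) t)
  by apply (continuous_opp (V := R_NormedModule) (fun t => t)), continuous_id.
split; [apply (continuous_comp (fun t : R => - t) (fun t => fst (f t)))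
       |apply (continuous_comp (fun t : R => - t) (fun t => snd (f t)))]; assumption.
Qed.

Lemma CRInt_tails (f : R -> C) (M1 M2 a a' b' b : R) :
  0 <= M1 -> 0 <= M2 -> (forall t, Ccont f t) ->
  (forall t, t <= a' -> Cmod (f t) <= M1 * tail_fun 0 (Rabs t)) ->
  (forall t, b' <= t -> Cmod (f t) <= M2 * tail_fun 0 (Rabs t)) ->
  a <= a' -> a' <= 0 -> 0 <= b' -> b' <= b ->
  Cmod (CRInt f a b - CRInt f a' b')%C <= M1 * (2 / (1 - a')) + M2 * (2 / (1 + b')).
Proof.
intros pM1 pM2 K B1 B2 l1 l2 l3 l4.
rewrite (CRInt_Chasles f a a' b) by (try lra; auto).
rewrite (CRInt_Chasles f a' b' b) by (try lra; auto).
replace (_ - _)%C with (CRInt f a a' + CRInt f b' b)%C by ring.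
eapply Rle_trans; [apply Cmod_triangle|].
apply Rplus_le_compat.
- replace (CRInt f a a') with (CRInt (fun t => f (- t)) (- a') (- a)).
  + replace (1 - a') with (1 + (- a' - 0) + 0) by ring.
    apply (CRInt_tail_right _ M1 0 0 (- a') (- a)); auto; try lra.
    * intros; now apply Ccont_reflect.
    * intros t Ht; rewrite Rminus_0_r.
      eapply Rle_trans; [apply B1; lra|]; rewrite Rabs_Ropp, Rabs_pos_eq by lra; apply Rle_refl.
  + rewrite <- CRInt_reflect by (auto; lra); now rewrite !Ropp_involutive.
- replace (1 + b') with (1 + (b' - 0) + 0) by ring.
  apply (CRInt_tail_right f M2 0 0 b' b); auto; try lra.
  intros t Ht; rewrite Rminus_0_r; specialize (B2 t); rewrite Rabs_pos_eq in B2 by lra; apply B2; lra.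
Qed.

(** Symmetric integer bounds suffice, since [is_line_bound] compares the limit with integrals
    between any bounds of opposite sign. *)
Definition is_line (f : R -> C) (l : C) : Prop :=
  Clim eventually (fun N => CRInt f (- INR N) (INR N)) l.

Lemma is_lim_seq_tail (M : R) : is_lim_seq (fun N => M * (2 / (1 + INR N))) 0.
Proof.
assert (L : is_lim_seq (fun n => M * 2 * / INR (S n)) (Rbar_mult (M * 2) 0))
  by apply is_lim_seq_scal_l, is_lim_seq_inv_INR.
replace (Rbar_mult (M * 2) 0) with (Finite 0) in L by (simpl; now rewrite Rmult_0_r).
revert L; apply is_lim_seq_ext; intros n; rewrite S_INR; unfold Rdiv; rewrite (Rplus_comm (INR n)); ring.
Qed.

Lemma eventually_tail_small (M : R) (eps : posreal) :
  eventually (fun N => M * (2 / (1 + INR N)) < eps).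
Proof.
pose proof (is_lim_seq_tail M) as L; apply is_lim_seq_spec in L; destruct (L eps) as [N HN].
exists N; intros n le; specialize (HN n le); rewrite Rminus_0_r in HN.
apply Rabs_def2 in HN; exact (proj1 HN).
Qed.

Lemma line_integral_ex (f : R -> C) (M : R) :
  0 <= M -> (forall t, Ccont f t) -> (forall t, Cmod (f t) <= M * tail_fun 0 (Rabs t)) ->
  exists l, is_line f l.
Proof.
intros pM K B.
set (u := fun N => CRInt f (- INR N) (INR N)).
assert (CS : forall eps : posreal, exists N, forall n m, (N <= n)%nat -> (N <= m)%nat -> Cmod (u n - u m)%C < eps).
{ intros eps; destruct (eventually_tail_small (2 * M) eps) as [N HN]; exists N.
  assert (W : forall n m, (N <= m)%nat -> (m <= n)%nat -> Cmod (u n - u m)%C < eps).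
  { intros n m le1 le2; eapply Rle_lt_trans; [|exact (HN m le1)].
    pose proof (pos_INR m); assert (INR m <= INR n) by now apply le_INR.
    eapply Rle_trans; [apply (CRInt_tails f M M); auto; lra|].
    unfold Rminus; rewrite Ropp_involutive; lra. }
  intros n m l1 l2; destruct (Nat.le_ge_cases m n) as [le|le]; [now apply W|].
  replace (u n - u m)%C with (- (u m - u n))%C by ring; rewrite Cmod_opp; now apply W. }
assert (E : forall g : C -> R, (forall z, Rabs (g z) <= Cmod z) ->
  (forall x y, g (x - y)%C = g x - g y) -> ex_finite_lim_seq (fun N => g (u N))).
{ intros g Hg Hm; apply ex_lim_seq_cauchy_corr; intros eps; destruct (CS eps) as [N HN].
  exists N; intros n m l1 l2; rewrite <- Hm; eapply Rle_lt_trans; [apply Hg|now apply HN]. }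
destruct (E fst fst_le_Cmod (fun x y => eq_refl)) as [l1 L1].
destruct (E snd snd_le_Cmod (fun x y => eq_refl)) as [l2 L2].
exists (l1, l2); apply Clim_components; [apply eventually_filter|]; split; assumption.
Qed.

(** The two ends carry separate constants because the endpoints of a Farey arc lie at different
    heights. *)
Lemma is_line_bound (f : R -> C) (M1 M2 t1 t2 : R) (l : C) :
  0 <= M1 -> 0 <= M2 -> (forall t, Ccont f t) ->
  (forall t, t <= t1 -> Cmod (f t) <= M1 * tail_fun 0 (Rabs t)) ->
  (forall t, t2 <= t -> Cmod (f t) <= M2 * tail_fun 0 (Rabs t)) ->
  is_line f l -> t1 <= 0 -> 0 <= t2 ->
  Cmod (CRInt f t1 t2 - l)%C <= M1 * (2 / (1 - t1)) + M2 * (2 / (1 + t2)).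
Proof.
intros p1 p2 K B1 B2 L h1 h2.
replace (CRInt f t1 t2 - l)%C with (- (l - CRInt f t1 t2))%C by ring; rewrite Cmod_opp.
apply (Clim_le eventually (fun N => CRInt f (- INR N) (INR N) - CRInt f t1 t2)%C).
- apply Clim_minus; [apply eventually_filter|exact L|apply Clim_const, eventually_filter].
- destruct (INR_unbounded (Rabs t1 + Rabs t2)) as [N HN]; exists N; intros n le.
  assert (INR N <= INR n) by now apply le_INR.
  pose proof (Rle_abs t2); pose proof (Rle_abs (- t1)); rewrite Rabs_Ropp in *.
  pose proof (Rabs_pos t1); pose proof (Rabs_pos t2).
  apply (CRInt_tails f M1 M2); auto; lra.
Qed.

(* Contour shift to [Re w = + infinity]: only the two horizontal rays contribute. *)
Lemma CRInt_right_shift (f f' : C -> C) (x0 t1 t2 K M1 M2 : R) :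
  Chol f f' -> 0 < x0 -> t1 <= t2 -> 0 <= M1 -> 0 <= M2 -> 0 <= K ->
  (forall x t, x0 <= x -> Cmod (f (x, t)) <= K * (2 / (1 + (x - x0)))) ->
  (forall x, x0 <= x -> Cmod (f (x, t1)) <= M1 * tail_fun (Rabs t1) (x - x0)) ->
  (forall x, x0 <= x -> Cmod (f (x, t2)) <= M2 * tail_fun (Rabs t2) (x - x0)) ->
  Cmod (CRInt (fun t => f (x0, t)) t1 t2) <= M1 * (2 / (1 + Rabs t1)) + M2 * (2 / (1 + Rabs t2)).
Proof.
intros Hf px le p1 p2 pK Far R1 R2.
assert (KH : forall t x, 0 < x -> Ccont (fun v => f (v, t)) x).
{ intros t x Hx; apply (Chol_cont _ _ Hf); [apply Ccont_horizontal|exact Hx]. }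
assert (KV : forall x t, 0 < x -> Ccont (fun v => f (x, v)) t).
{ intros x t Hx; apply (Chol_cont _ _ Hf); [apply Ccont_vertical|exact Hx]. }
assert (B : forall N : nat, Cmod (CRInt (fun t => f (x0, t)) t1 t2) <=
  (t2 - t1) * K * (2 / (1 + INR N)) + (M1 * (2 / (1 + Rabs t1)) + M2 * (2 / (1 + Rabs t2)))).
{ intros N; pose proof (pos_INR N) as pN.
  assert (E := Cauchy_rectangle f f' t1 t2 x0 (x0 + INR N) Hf le ltac:(lra)).
  set (V := CRInt (fun t => f (x0 + INR N, t)) t1 t2) in *.
  set (V0 := CRInt (fun t => f (x0, t)) t1 t2) in *.
  set (H2 := CRInt (fun x => f (x, t2)) x0 (x0 + INR N)) in *.
  set (H1 := CRInt (fun x => f (x, t1)) x0 (x0 + INR N)) in *.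
  assert (E' : V0 = (V + Ci * (H2 - H1))%C).
  { transitivity (V - (V - V0))%C; [ring|rewrite E; ring]. }
  assert (BV : Cmod V <= (t2 - t1) * (K * (2 / (1 + INR N)))).
  { apply CRInt_bound_const; [exact le|intros t _; apply KV; lra|].
    intros t _; eapply Rle_trans; [apply (Far (x0 + INR N)); lra|].
    replace (x0 + INR N - x0) with (INR N) by ring; apply Rle_refl. }
  assert (BH1 : Cmod H1 <= M1 * (2 / (1 + Rabs t1))).
  { replace (1 + Rabs t1) with (1 + (x0 - x0) + Rabs t1) by ring.
    apply CRInt_tail_right; try lra; try apply Rabs_pos; intros t Ht; [apply KH; lra|apply R1; lra]. }
  assert (BH2 : Cmod H2 <= M2 * (2 / (1 + Rabs t2))).
  { replace (1 + Rabs t2) with (1 + (x0 - x0) + Rabs t2) by ring.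
    apply CRInt_tail_right; try lra; try apply Rabs_pos; intros t Ht; [apply KH; lra|apply R2; lra]. }
  rewrite E'; eapply Rle_trans; [apply Cmod_triangle|].
  rewrite Cmod_mult, Cmod_Ci, Rmult_1_l; unfold Cminus.
  pose proof (Cmod_triangle H2 (- H1)) as Tr; rewrite Cmod_opp in Tr; lra. }
apply le_epsilon; intros eps pe.
destruct (eventually_tail_small ((t2 - t1) * K) (mkposreal eps pe)) as [N HN].
specialize (HN N (Nat.le_refl N)); specialize (B N); simpl in HN; lra.
Qed.

(** * The integrands [w^(-s) exp (b w + c / w)] *)

Definition Fk (s b c : R) (w : C) : C :=
  cexp (RtoC (- s) * clog w + RtoC b * w + RtoC c * / w)%C.

Definition Fk' (s b c : R) (w : C) : C :=
  ((RtoC (- s) / w + RtoC b - RtoC c / (w * w)) * Fk s b c w)%C.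

Lemma Chol_Fk (s b c : R) : Chol (Fk s b c) (Fk' s b c).
Proof.
assert (K : forall (U : UniformSpace) (g : U -> C) (x : U),
  Ccont g x -> 0 < fst (g x) -> Ccont (fun u => Fk s b c (g u)) x).
{ intros U g x A pos; apply Ccont_cexp, Ccont_plus; [apply Ccont_plus|];
    apply Ccont_mult; try apply Ccont_const.
  - now apply Ccont_clog.
  - exact A.
  - apply Ccont_inv; [exact A|now apply Cneq_fst]. }
split.
- intros g t l D pos; pose proof (Cneq_fst _ pos) as nz; unfold Fk, Fk'; eapply Cder_eq.
  + apply Cder_cexp, Cder_plus; [apply Cder_plus|]; apply Cder_scal.
    * apply Cder_clog; eassumption.
    * exact D.
    * apply Cder_inv; [exact D|exact nz].
  + cbv beta; unfold Fk; field; exact nz.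
- exact K.
- intros U g x A pos; pose proof (Cneq_fst _ pos) as nz; unfold Fk'.
  apply Ccont_mult; [|now apply K].
  apply Ccont_minus; [apply Ccont_plus|]; try apply Ccont_const;
    apply Ccont_div; auto using Ccont_const, Ccont_mult, Cmult_neq_0.
Qed.

Lemma Ccont_Fk_line (s b c t : R) : Ccont (fun v => Fk s b c (1, v)) t.
Proof. apply (Chol_cont _ _ (Chol_Fk s b c)); [apply Ccont_vertical|simpl; lra]. Qed.

Lemma Cmod_Fk (s b c : R) (w : C) :
  Cmod (Fk s b c w) = exp (- s * ln (Cmod w) + b * fst w + c * fst (/ w)%C).
Proof.
unfold Fk; rewrite Cmod_cexp; f_equal.
transitivity (fst (RtoC (- s) * clog w)%C + fst (RtoC b * w)%C + fst (RtoC c * / w)%C); [reflexivity|].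
unfold clog; simpl; ring.
Qed.

Lemma exp_le (x y : R) : x <= y -> exp x <= exp y.
Proof. intros [lt| ->]; [left; now apply exp_increasing|apply Rle_refl]. Qed.

Lemma fst_inv_bound (w : C) : 1 <= fst w -> 0 <= fst (/ w)%C <= 1.
Proof.
intros H; rewrite fst_Cinv.
assert (0 < fst w ^ 2 + snd w ^ 2) by nra.
split; [apply Rdiv_le_0_compat; lra|].
apply (Rmult_le_reg_r (fst w ^ 2 + snd w ^ 2)); [assumption|].
unfold Rdiv; rewrite Rmult_assoc, Rinv_l by lra; nra.
Qed.

Lemma Cmod_ge_fst (w : C) : 1 <= fst w -> 1 <= Cmod w.
Proof.
intros H; eapply Rle_trans; [|apply fst_le_Cmod]; rewrite Rabs_pos_eq; lra.
Qed.

(** [|w|^(- s)] splits into [|w|^(- (s - 2))], bounded through [R0 <= |w|], and [|w|^(-2)], kept for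
    integrability. On [Re w >= 1] the real part of [1 / w] is at most [1]. *)
Lemma Cmod_Fk_le (s b c B R0 : R) (w : C) :
  2 <= s -> 0 <= c -> 1 <= fst w -> b * fst w <= B -> 0 < R0 <= Cmod w ->
  Cmod (Fk s b c w) <= exp (B + c) * Rpower R0 (- (s - 2)) * / Cmod w ^ 2.
Proof.
intros Hs Hc Hw HB HR; rewrite Cmod_Fk.
pose proof (fst_inv_bound w Hw) as I; pose proof (Cmod_ge_fst w Hw) as Q.
assert (Lp : ln R0 <= ln (Cmod w)).
{ destruct (proj2 HR) as [lt| ->]; [left; apply ln_increasing; lra|apply Rle_refl]. }
replace (/ Cmod w ^ 2) with (exp (- (2 * ln (Cmod w)))).
- unfold Rpower; rewrite <- !exp_plus; apply exp_le.
  assert (c * fst (/ w)%C <= c) by nra.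
  assert ((s - 2) * ln R0 <= (s - 2) * ln (Cmod w)) by (apply Rmult_le_compat_l; lra).
  lra.
- rewrite exp_Ropp; f_equal.
  replace (2 * ln (Cmod w)) with (ln (Cmod w) + ln (Cmod w)) by ring.
  rewrite exp_plus, exp_ln by lra; ring.
Qed.

Lemma inv_sqr_tail (x t : R) : 1 <= x -> / Cmod (x, t) ^ 2 <= tail_fun (Rabs t) (x - 1).
Proof.
intros Hx; unfold tail_fun; rewrite Cmod2_alt; unfold Re, Im; simpl fst; simpl snd.
replace (1 + (x - 1) + Rabs t) with (x + Rabs t) by ring.
pose proof (Rabs_pos t) as pt.
assert (E : Rabs t * Rabs t = t * t) by (rewrite <- Rabs_mult; apply Rabs_pos_eq; nra).
assert (p1 : 0 < x ^ 2 + t ^ 2) by nra.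
assert (p2 : 0 < (x + Rabs t) ^ 2) by (apply pow_lt; lra).
apply (Rmult_le_reg_r ((x ^ 2 + t ^ 2) * (x + Rabs t) ^ 2)); [now apply Rmult_lt_0_compat|].
replace (/ (x ^ 2 + t ^ 2) * ((x ^ 2 + t ^ 2) * (x + Rabs t) ^ 2)) with ((x + Rabs t) ^ 2)
  by (field; lra).
replace (2 / (x + Rabs t) ^ 2 * ((x ^ 2 + t ^ 2) * (x + Rabs t) ^ 2)) with (2 * (x ^ 2 + t ^ 2))
  by (field; lra).
pose proof (pow2_ge_0 (x - Rabs t)); nra.
Qed.

Lemma tail_fun_le (d x : R) : 0 <= d -> 0 <= x -> tail_fun d x <= 2 / (1 + x).
Proof.
intros pd px; unfold tail_fun, Rdiv; apply Rmult_le_compat_l; [lra|].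
apply Rinv_le_contravar; [lra|]; nra.
Qed.

Lemma Cmod_Fk_line (s b c t : R) :
  2 <= s -> 0 <= c -> Cmod (Fk s b c (1, t)) <= exp (b + c) * tail_fun 0 (Rabs t).
Proof.
intros Hs Hc.
pose proof (Cmod_ge_fst (1, t) (Rle_refl 1)) as Q.
eapply Rle_trans; [apply (Cmod_Fk_le s b c b 1); simpl; lra|].
unfold Rpower; rewrite ln_1, Rmult_0_r, exp_0, Rmult_1_r.
apply Rmult_le_compat_l; [left; apply exp_pos|].
eapply Rle_trans; [apply inv_sqr_tail; lra|]; unfold tail_fun.
replace (1 + (1 - 1) + Rabs t) with (1 + Rabs t + 0) by ring; apply Rle_refl.
Qed.

Lemma Fk_line_ex (s b c : R) : 2 <= s -> 0 <= c -> exists l, is_line (fun t => Fk s b c (1, t)) l.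
Proof.
intros Hs Hc; apply (line_integral_ex _ (exp (b + c))).
- left; apply exp_pos.
- intros; apply Ccont_Fk_line.
- intros; now apply Cmod_Fk_line.
Qed.

(* Size of the tails of the line integral of [Fk s b c], and of its horizontal rays. *)
Definition tailw (s t : R) : R := Rpower (Cmod (1, t)) (- (s - 2)) * (2 / (1 + Rabs t)).

Lemma Cmod_vertical_mono (x t t' : R) : 1 <= x -> Rabs t' <= Rabs t -> 0 < Cmod (1, t') <= Cmod (x, t).
Proof.
intros Hx Ht; split; [pose proof (Cmod_ge_fst (1, t') (Rle_refl 1)); lra|].
unfold Cmod; simpl fst; simpl snd; apply sqrt_le_1_alt.
assert (S : t' ^ 2 <= t ^ 2) by (rewrite <- (pow2_abs t'), <- (pow2_abs t); apply pow_incr; split; [apply Rabs_pos|exact Ht]).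
nra.
Qed.

Lemma Fk_line_tail (s b c t t' : R) :
  2 <= s -> 0 <= c -> Rabs t' <= Rabs t ->
  Cmod (Fk s b c (1, t)) <= exp (b + c) * Rpower (Cmod (1, t')) (- (s - 2)) * tail_fun 0 (Rabs t).
Proof.
intros Hs Hc Ht.
eapply Rle_trans; [apply (Cmod_Fk_le s b c b (Cmod (1, t'))); simpl fst; try lra|].
- now apply Cmod_vertical_mono; [apply Rle_refl|].
- apply Rmult_le_compat_l; [apply Rmult_le_pos; left; apply exp_pos|].
  eapply Rle_trans; [apply inv_sqr_tail; lra|]; unfold tail_fun.
  replace (1 + (1 - 1) + Rabs t) with (1 + Rabs t + 0) by ring; apply Rle_refl.
Qed.

Lemma Fk_line_bound (s b c t1 t2 : R) (l : C) :
  2 <= s -> 0 <= c -> is_line (fun t => Fk s b c (1, t)) l -> t1 <= 0 -> 0 <= t2 ->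
  Cmod (CRInt (fun t => Fk s b c (1, t)) t1 t2 - l)%C <= exp (b + c) * (tailw s t1 + tailw s t2).
Proof.
intros Hs Hc L h1 h2.
assert (P : forall t, 0 <= exp (b + c) * Rpower (Cmod (1, t)) (- (s - 2)))
  by (intros; apply Rmult_le_pos; left; apply exp_pos).
eapply Rle_trans; [apply (is_line_bound _ _ _ t1 t2 l (P t1) (P t2) (Ccont_Fk_line s b c)); auto|].
- intros t Ht; apply Fk_line_tail; auto; rewrite !Rabs_left1; lra.
- intros t Ht; apply Fk_line_tail; auto; rewrite !Rabs_pos_eq; lra.
- unfold tailw; rewrite (Rabs_left1 t1), (Rabs_pos_eq t2) by lra.
  unfold Rminus; apply Req_le; ring.
Qed.

Lemma Fk_right_shift (s b c t1 t2 : R) :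
  2 <= s -> b <= 0 -> 0 <= c -> t1 <= t2 ->
  Cmod (CRInt (fun t => Fk s b c (1, t)) t1 t2) <= exp (b + c) * (tailw s t1 + tailw s t2).
Proof.
intros Hs Hb Hc le.
assert (P : forall t, 0 <= exp (b + c) * Rpower (Cmod (1, t)) (- (s - 2)))
  by (intros; apply Rmult_le_pos; left; apply exp_pos).
assert (R : forall x t, 1 <= x -> Cmod (Fk s b c (x, t)) <=
  exp (b + c) * Rpower (Cmod (1, t)) (- (s - 2)) * tail_fun (Rabs t) (x - 1)).
{ intros x t Hx.
  eapply Rle_trans; [apply (Cmod_Fk_le s b c b (Cmod (1, t))); simpl fst; try lra; try nra|].
  - apply Cmod_vertical_mono; [exact Hx|apply Rle_refl].
  - apply Rmult_le_compat_l; [apply P|now apply inv_sqr_tail]. }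
eapply Rle_trans; [apply (CRInt_right_shift (Fk s b c) (Fk' s b c) 1 t1 t2 (exp (b + c)) _ _
  (Chol_Fk s b c) Rlt_0_1 le (P t1) (P t2))|].
- left; apply exp_pos.
- intros x t Hx.
  eapply Rle_trans; [apply (Cmod_Fk_le s b c b 1); simpl fst; try lra; try nra|].
  + split; [lra|apply Cmod_ge_fst; exact Hx].
  + unfold Rpower; rewrite ln_1, Rmult_0_r, exp_0, Rmult_1_r.
    apply Rmult_le_compat_l; [left; apply exp_pos|].
    eapply Rle_trans; [now apply inv_sqr_tail|]; apply tail_fun_le; [apply Rabs_pos|lra].
- intros; now apply R.
- intros; now apply R.
- unfold tailw; apply Req_le; ring.
Qed.

(** * The inverse Laplace transform of a power *)

Lemma tailw_le (s : R) (N : nat) : 2 <= s -> tailw s (INR N) <= 2 / (1 + INR N).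
Proof.
intros Hs; unfold tailw; pose proof (pos_INR N) as pN; rewrite Rabs_pos_eq by exact pN.
assert (P : 0 <= 2 / (1 + INR N)) by (apply Rdiv_le_0_compat; lra).
rewrite <- (Rmult_1_l (2 / (1 + INR N))) at 2; apply Rmult_le_compat_r; [exact P|].
pose proof (Cmod_ge_fst (1, INR N) (Rle_refl 1)) as Q.
apply (Rle_trans _ (exp 0)); [|rewrite exp_0; apply Rle_refl]; apply exp_le.
assert (0 <= ln (Cmod (1, INR N))).
{ rewrite <- ln_1; destruct Q as [lt|E]; [left; apply ln_increasing; lra|rewrite <- E; lra]. }
assert (P2 : 0 <= (s - 2) * ln (Cmod (1, INR N))) by (apply Rmult_le_pos; lra).
rewrite Ropp_mult_distr_l_reverse; apply Rge_le, Ropp_0_le_ge_contravar, P2.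
Qed.

Lemma tailw_opp (s t : R) : tailw s (- t) = tailw s t.
Proof.
unfold tailw; rewrite Rabs_Ropp; f_equal; f_equal.
unfold Cmod; simpl fst; simpl snd; f_equal; ring.
Qed.

Lemma Fk_line_right (s b c : R) :
  2 <= s -> b <= 0 -> 0 <= c -> is_line (fun t => Fk s b c (1, t)) 0.
Proof.
intros Hs Hb Hc.
apply (Clim_squeeze _ _ _ (fun N => exp (b + c) * 2 * (2 / (1 + INR N)))).
- exists 0%nat; intros N _; pose proof (pos_INR N).
  replace (_ - 0)%C with (CRInt (fun t => Fk s b c (1, t)) (- INR N) (INR N)) by ring.
  eapply Rle_trans; [apply Fk_right_shift; lra|].
  rewrite tailw_opp, Rmult_assoc; apply Rmult_le_compat_l; [left; apply exp_pos|].
  pose proof (tailw_le s N Hs); lra.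
- intros eps; apply eventually_tail_small.
Qed.

Lemma CRInt_comp_scal (f : R -> C) (u a b : R) :
  0 < u -> a <= b -> (forall t, Ccont f t) ->
  CRInt f (u * a) (u * b) = (RtoC u * CRInt (fun t => f (u * t)%R) a b)%C.
Proof.
intros pu le K.
assert (E : forall r : R -> R, ex_RInt r (u * a) (u * b) ->
  RInt r (u * a) (u * b) = u * RInt (fun t => r (u * t)) a b).
{ intros r X; replace (u * a) with (u * a + 0) in * by ring; replace (u * b) with (u * b + 0) in * by ring.
  rewrite <- (RInt_comp_lin (V := R_CompleteNormedModule) r u 0 a b X).
  assert (X2 := ex_RInt_comp_lin (V := R_NormedModule) r u 0 a b X).
  transitivity (RInt (fun t => scal u (r (u * t))) a b).
  - apply RInt_ext; intros t _; now rewrite Rplus_0_r.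
  - apply (RInt_scal (V := R_CompleteNormedModule)).
    apply (ex_RInt_scal (V := R_NormedModule) _ _ _ (/ u)) in X2.
    eapply ex_RInt_ext; [|exact X2]; intros t _; unfold scal; simpl; unfold mult; simpl.
    rewrite Rplus_0_r; field; lra. }
destruct (Ccont_ex_RInt f (u * a) (u * b)) as [A1 A2]; [apply Rmult_le_compat_l; lra|auto|].
apply C_eta; unfold CRInt; simpl; rewrite !E by assumption; ring.
Qed.

Lemma Fk_scale (s b t : R) :
  0 < b -> Fk s 1 0 (b, b * t) = (RtoC (Rpower b (- s)) * Fk s b 0 (1, t))%C.
Proof.
intros pb; unfold Fk, Rpower.
replace ((b, b * t) : C) with (RtoC b * (1, t))%C by (apply C_eta; simpl; ring).
rewrite clog_scal by (simpl; lra); rewrite <- cexp_R, <- cexp_plus; f_equal.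
rewrite RtoC_mult; ring.
Qed.

(** On the horizontal sides, at height [|t| = b N], one has [|w|^(- s) <= 1 / |t|]; these sides
    vanish in the limit, so both vertical lines carry the same integral. *)
Lemma Fk_vertical_shift (s x0 x1 b : R) :
  2 <= s -> 0 < x0 <= x1 -> 0 < b ->
  Clim eventually (fun N => CRInt (fun u => Fk s 1 0 (x1, u)) (b * - INR N) (b * INR N) -
                            CRInt (fun u => Fk s 1 0 (x0, u)) (b * - INR N) (b * INR N))%C 0.
Proof.
intros Hs Hx pb.
assert (Bh : forall t x, x0 <= x <= x1 -> 1 <= Rabs t -> Cmod (Fk s 1 0 (x, t)) <= exp x1 * / Rabs t).
{ intros t x Ix Ht.
  assert (Mt : Rabs t <= Cmod (x, t)) by exact (snd_le_Cmod (x, t)).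
  rewrite Cmod_Fk; simpl fst at 1; rewrite Rmult_0_l, Rplus_0_r, Rmult_1_l, exp_plus, Rmult_comm.
  assert (Lp : ln (Rabs t) <= ln (Cmod (x, t))).
  { destruct Mt as [lt|E]; [left; apply ln_increasing; lra|rewrite <- E; lra]. }
  assert (L0 : 0 <= ln (Rabs t)).
  { rewrite <- ln_1; destruct Ht as [lt|E]; [left; apply ln_increasing; lra|rewrite <- E; lra]. }
  apply Rmult_le_compat; try (left; apply exp_pos).
  - apply exp_le; lra.
  - apply (Rle_trans _ (exp (- ln (Rabs t)))); [apply exp_le; nra|].
    rewrite exp_Ropp, exp_ln by lra; apply Rle_refl. }
apply (Clim_squeeze _ _ _ (fun N => (2 * (x1 - x0) * exp x1 / b) * (2 / (1 + INR N)))).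
2:{ intros eps; apply eventually_tail_small. }
assert (pib : 0 < / b) by now apply Rinv_0_lt_compat.
destruct (INR_unbounded (/ b + 1)) as [N0 HN]; exists N0; intros N le.
assert (HN' : / b + 1 < INR N) by (pose proof (le_INR _ _ le); lra).
assert (b1 : 1 <= b * INR N).
{ apply (Rmult_le_reg_l (/ b)); [exact pib|]; rewrite <- Rmult_assoc, Rinv_l by lra; lra. }
match goal with |- Cmod (?d - RtoC 0)%C <= _ => replace (d - 0)%C with d by ring end.
rewrite (Cauchy_rectangle (Fk s 1 0) (Fk' s 1 0)); [|apply Chol_Fk|nra|exact Hx].
rewrite Cmod_mult, Cmod_opp, Cmod_Ci, Rmult_1_l.
eapply Rle_trans; [apply Cmod_triangle|]; rewrite Cmod_opp.
assert (B : forall t, Rabs t = b * INR N ->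
  Cmod (CRInt (fun x => Fk s 1 0 (x, t)) x0 x1) <= (x1 - x0) * (exp x1 * / (b * INR N))).
{ intros t Et; apply CRInt_bound_const; [lra| |].
  - intros x Ix; apply (Chol_cont _ _ (Chol_Fk s 1 0)); [apply Ccont_horizontal|simpl; lra].
  - intros x Ix; rewrite <- Et; apply Bh; [exact Ix|rewrite Et; exact b1]. }
pose proof (B (b * INR N) ltac:(rewrite Rabs_pos_eq; lra)).
pose proof (B (b * - INR N) ltac:(rewrite Ropp_mult_distr_r_reverse, Rabs_Ropp, Rabs_pos_eq; lra)).
apply (Rle_trans _ (2 * ((x1 - x0) * (exp x1 * / (b * INR N))))); [lra|].
replace (2 * ((x1 - x0) * (exp x1 * / (b * INR N)))) with (2 * (x1 - x0) * exp x1 / b * / INR N)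
  by (field; lra).
apply Rmult_le_compat_l.
- apply Rdiv_le_0_compat; [|exact pb]; pose proof (exp_pos x1).
  apply Rmult_le_pos; lra.
- apply (Rmult_le_reg_r (INR N * (1 + INR N))); [apply Rmult_lt_0_compat; lra|].
  replace (/ INR N * (INR N * (1 + INR N))) with (1 + INR N) by (field; lra).
  replace (2 / (1 + INR N) * (INR N * (1 + INR N))) with (2 * INR N) by (field; lra); lra.
Qed.

(** Multiplication of the variable by [b] carries the line [Re w = 1] to [Re w = b], and
    [Fk_vertical_shift] moves it back. The Jacobian and [b^(- s)] account for the power of [b]. *)
Lemma Fk_line_scale (s b : R) (l : C) :
  2 <= s -> 0 < b -> is_line (fun t => Fk s 1 0 (1, t)) l ->
  is_line (fun t => Fk s b 0 (1, t)) (RtoC (Rpower b (s - 1)) * l)%C.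
Proof.
intros Hs pb L.
assert (L1 : Clim eventually (fun N => CRInt (fun t => Fk s 1 0 (1, t)) (b * - INR N) (b * INR N)) l).
{ apply (Clim_squeeze _ _ _ (fun N => (exp 1 * (4 / b + 4)) * (2 / (1 + INR N)))).
  2:{ intros eps; apply eventually_tail_small. }
  exists 0%nat; intros N _; pose proof (pos_INR N) as pN.
  assert (pbN : 0 <= b * INR N) by (apply Rmult_le_pos; lra).
  replace (b * - INR N) with (- (b * INR N)) by ring.
  eapply Rle_trans.
  - apply (is_line_bound _ (exp (1 + 0)) (exp (1 + 0)) _ _ l); try (left; apply exp_pos); try lra.
    + apply Ccont_Fk_line.
    + intros; apply Cmod_Fk_line; lra.
    + intros; apply Cmod_Fk_line; lra.
    + exact L.
  - rewrite Rplus_0_r; unfold Rminus; rewrite Ropp_involutive.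
    rewrite Rmult_assoc, <- Rmult_plus_distr_l; apply Rmult_le_compat_l; [left; apply exp_pos|].
    apply (Rmult_le_reg_r ((1 + b * INR N) * (1 + INR N) * b)); [repeat apply Rmult_lt_0_compat; lra|].
    replace ((2 / (1 + b * INR N) + 2 / (1 + b * INR N)) * ((1 + b * INR N) * (1 + INR N) * b))
      with (4 * (1 + INR N) * b) by (field; lra).
    replace ((4 / b + 4) * (2 / (1 + INR N)) * ((1 + b * INR N) * (1 + INR N) * b))
      with ((4 + 4 * b) * 2 * (1 + b * INR N)) by (field; lra).
    nra. }
assert (L2 : Clim eventually (fun N => CRInt (fun u => Fk s 1 0 (b, u)) (b * - INR N) (b * INR N)) l).
{ destruct (Rle_or_lt 1 b) as [le|lt].
  - assert (D := Fk_vertical_shift s 1 b b Hs ltac:(lra) pb).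
    assert (P := Clim_plus _ _ _ _ _ D L1); rewrite Cplus_0_l in P.
    revert P; apply Clim_ext; [apply eventually_filter|intros N; simpl; ring].
  - assert (D := Fk_vertical_shift s b 1 b Hs ltac:(lra) pb).
    assert (P := Clim_minus _ _ _ _ _ L1 D); replace (l - 0)%C with l in P by ring.
    revert P; apply Clim_ext; [apply eventually_filter|intros N; simpl; ring]. }
unfold is_line; apply (Clim_ext _ (fun N => RtoC (Rpower b (s - 1)) *
  CRInt (fun u => Fk s 1 0 (b, u)) (b * - INR N) (b * INR N))%C).
- intros N; pose proof (pos_INR N).
  rewrite CRInt_comp_scal; [|exact pb|lra|].
  2:{ intros t; apply (Chol_cont _ _ (Chol_Fk s 1 0)); [apply Ccont_vertical|exact pb]. }
  rewrite (CRInt_ext _ (fun t => RtoC (Rpower b (- s)) * Fk s b 0 (1, t))%C)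
    by (try lra; intros; now apply Fk_scale).
  rewrite CRInt_scal by (try lra; intros; apply Ccont_Fk_line).
  rewrite !Cmult_assoc, <- !RtoC_mult.
  replace (Rpower b (s - 1) * b * Rpower b (- s)) with 1; [apply Cmult_1_l|].
  rewrite <- (Rpower_1 b pb) at 2; rewrite <- !Rpower_plus.
  replace (s - 1 + 1 + - s) with 0 by ring; symmetry; now apply Rpower_O.
- apply Clim_scal; [apply eventually_filter|exact L2].
Qed.

Lemma rpow_pos (x p : R) : 0 < x -> rpow x p = Rpower x p.
Proof. intros px; unfold rpow; destruct (Rlt_dec 0 x); [reflexivity|lra]. Qed.

Lemma rpow_nonpos (x p : R) : x <= 0 -> p <> 0 -> rpow x p = 0.
Proof.
intros nx np; unfold rpow; destruct (Rlt_dec 0 x); [lra|].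
destruct (Req_EM_T p 0); [contradiction|reflexivity].
Qed.

Lemma rpow_nonneg (x p : R) : 0 <= rpow x p.
Proof.
unfold rpow; destruct (Rlt_dec 0 x); [left; apply exp_pos|].
destruct (Req_EM_T p 0); lra.
Qed.

Lemma rpow_small (x p : R) : 1 <= p -> x <= 1 -> rpow x p <= Rabs x.
Proof.
intros Hp Hx; destruct (Rlt_dec 0 x) as [px|nx].
- rewrite rpow_pos, Rabs_pos_eq by lra; unfold Rpower.
  rewrite <- (exp_ln x) at 2 by exact px; apply exp_le.
  assert (ln x <= 0).
  { rewrite <- ln_1; destruct Hx as [lt| ->]; [left; now apply ln_increasing|lra]. }
  nra.
- rewrite rpow_nonpos by lra; apply Rabs_pos.
Qed.

(** [x^p] has to be integrated from [0], where [Rpower] jumps; [rpow] is continuous there because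
    [0 <= rpow x p <= |x|] for [x <= 1]. *)
Lemma continuous_rpow (p x : R) : 1 <= p -> continuous (fun x => rpow x p) x.
Proof.
intros Hp.
destruct (Rtotal_order x 0) as [neg|[->|pos]].
- apply (continuous_ext_loc _ (fun _ => 0)); [|apply continuous_const].
  assert (pd : 0 < - x) by lra; exists (mkposreal _ pd); intros y By.
  unfold ball in By; simpl in By; unfold AbsRing_ball, abs, minus, plus, opp in By; simpl in By.
  apply Rabs_def2 in By; symmetry; apply rpow_nonpos; lra.
- apply filterlim_locally; intros eps.
  assert (pd : 0 < Rmin 1 eps) by (apply Rmin_glb_lt; [lra|apply cond_pos]).
  exists (mkposreal _ pd); intros y By.
  unfold ball in *; simpl in *; unfold AbsRing_ball, abs, minus, plus, opp in *; simpl in *.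
  pose proof (Rmin_l 1 eps); pose proof (Rmin_r 1 eps).
  rewrite Ropp_0, Rplus_0_r in By.
  rewrite (rpow_nonpos 0) by lra; rewrite Ropp_0, Rplus_0_r, Rabs_pos_eq by apply rpow_nonneg.
  pose proof (Rle_abs y); eapply Rle_lt_trans; [apply rpow_small; lra|lra].
- apply (continuous_ext_loc _ (fun x => exp (p * ln x))).
  + exists (mkposreal _ pos); intros y By.
    unfold ball in By; simpl in By; unfold AbsRing_ball, abs, minus, plus, opp in By; simpl in By.
    apply Rabs_def2 in By; symmetry; apply rpow_pos; lra.
  + apply (continuous_comp_R exp); [|apply continuous_exp].
    apply continuous_Rmult; [apply continuous_const|apply continuous_ln, pos].
Qed.

(** The case [b = 0] belongs to the formula: the line integral vanishes by a shift to the right, and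
    [rpow 0 (s - 1) = 0]. *)
Lemma Fk_line_rpow (s b : R) (l : C) :
  2 < s -> 0 <= b -> is_line (fun t => Fk s 1 0 (1, t)) l ->
  is_line (fun t => Fk s b 0 (1, t)) (RtoC (rpow b (s - 1)) * l)%C.
Proof.
intros Hs [pb|<-] L.
- rewrite rpow_pos by exact pb; apply Fk_line_scale; [lra|exact pb|exact L].
- rewrite rpow_nonpos, Cmult_0_l by lra; apply Fk_line_right; lra.
Qed.

Lemma Ccont_comp_R {U : UniformSpace} (g : R -> C) (r : U -> R) (x : U) :
  (forall t, Ccont g t) -> continuous r x -> Ccont (fun u => g (r u)) x.
Proof.
intros K A; destruct (K (r x)) as [K1 K2]; split;
  [apply (continuous_comp r (fun t => fst (g t)))|apply (continuous_comp r (fun t => snd (g t)))]; assumption.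
Qed.

Lemma CRInt_RtoC (r : R -> R) (a b : R) : CRInt (fun x => RtoC (r x)) a b = RtoC (RInt r a b).
Proof.
apply C_eta; unfold CRInt; simpl; [reflexivity|].
rewrite RInt_const; apply Rmult_0_r.
Qed.

Lemma CRInt_sym_bound (f : R -> C) (g : R -> R) (N lg : R) :
  0 <= N -> (forall t, Ccont f t) -> (forall t, Cmod (f t) <= g (Rabs t)) ->
  is_RInt g 0 N lg -> Cmod (CRInt f (- N) N) <= 2 * lg.
Proof.
intros pN K B I.
rewrite (CRInt_Chasles f (- N) 0 N) by (try lra; auto).
eapply Rle_trans; [apply Cmod_triangle|].
assert (B1 : Cmod (CRInt f 0 N) <= lg).
{ apply (CRInt_bound f g); auto; intros t Ht.
  specialize (B t); now rewrite Rabs_pos_eq in B by lra. }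
assert (B2 : Cmod (CRInt f (- N) 0) <= lg).
{ rewrite <- Ropp_0 at 1; rewrite CRInt_reflect by auto.
  apply (CRInt_bound _ g); auto; [intros; now apply Ccont_reflect|].
  intros t Ht; specialize (B (- t)); now rewrite Rabs_Ropp, Rabs_pos_eq in B by lra. }
lra.
Qed.

Lemma is_RInt_tail_0 (N : R) : 0 <= N -> is_RInt (tail_fun 0) 0 N (2 - 2 / (1 + N)).
Proof.
intros pN.
assert (I := is_RInt_tail 0 0 0 N (Rle_refl 0) (conj (Rle_refl 0) pN)).
replace (2 / (1 + (0 - 0) + 0) - 2 / (1 + (N - 0) + 0)) with (2 - 2 / (1 + N)) in I by (field; lra).
eapply is_RInt_ext; [|exact I]; intros x _; simpl; now rewrite Rminus_0_r.
Qed.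

Lemma CRInt_tail_bound (f : R -> C) (M : R) (N : R) :
  0 <= M -> 0 <= N -> (forall t, Ccont f t) -> (forall t, Cmod (f t) <= M * tail_fun 0 (Rabs t)) ->
  Cmod (CRInt f (- N) N) <= M * 4.
Proof.
intros pM pN K B.
eapply Rle_trans; [apply (CRInt_sym_bound f (fun t => M * tail_fun 0 t)); auto|].
- apply (is_RInt_scal (V := R_NormedModule) _ _ _ M), is_RInt_tail_0, pN.
- unfold scal; simpl; unfold mult; simpl.
  assert (0 <= 2 / (1 + N)) by (apply Rdiv_le_0_compat; lra); nra.
Qed.

Section LaplaceInversion.

Variables (s : R) (Hs : 2 < s).

Let W0 (t : R) : C := Fk s 0 0 (1, t).

Let W0_cont (t : R) : Ccont W0 t.
Proof. apply Ccont_Fk_line. Qed.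

Let W0_bound (t : R) : Cmod (W0 t) <= tail_fun 0 (Rabs t).
Proof.
pose proof (Cmod_Fk_line s 0 0 t ltac:(lra) (Rle_refl 0)) as B.
rewrite Rplus_0_r, exp_0, Rmult_1_l in B; exact B.
Qed.

(* [y - w] on the line [w = 1 + i t], with [y = 1 + d]. *)
Let gap (d t : R) : C := (d, - t).

Let gap_neq (d t : R) : 0 < d -> gap d t <> 0.
Proof. intros pd; apply Cneq_fst; exact pd. Qed.

Let gap_cont (d t : R) : Ccont (gap d) t.
Proof.
apply Ccont_pair; [apply continuous_const|].
apply (continuous_opp (V := R_NormedModule) (fun t : R => t)), continuous_id.
Qed.

Let Cmod_gap (d t : R) : 0 < d -> d <= Cmod (gap d t).
Proof. intros pd; eapply Rle_trans; [|apply fst_le_Cmod]; simpl; apply Rle_abs. Qed.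

Let ker (d x t : R) : C := (W0 t * cexp (RtoC (- x) * gap d t))%C.

Let ker_eq (d x t : R) :
  ker d x t = (RtoC (exp (- (x * (1 + d)))) * Fk s x 0 (1, t))%C.
Proof.
unfold ker, W0, Fk; rewrite <- cexp_R, <- !cexp_plus; f_equal.
unfold gap; apply C_eta; simpl; ring.
Qed.

Let Ccont_2d_snd (g : R -> C) (p : R * R) :
  (forall t, Ccont g t) ->
  Ccont (U := prod_UniformSpace R_UniformSpace R_UniformSpace) (fun p => g (snd p)) p.
Proof.
intros K; apply (Ccont_comp_R (U := prod_UniformSpace R_UniformSpace R_UniformSpace) g); auto.
apply continuous_snd.
Qed.

Let Ccont_2d_fst (p : R * R) :
  Ccont (U := prod_UniformSpace R_UniformSpace R_UniformSpace) (fun p => RtoC (- fst p)) p.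
Proof.
apply Ccont_RtoC; apply (continuous_opp (U := prod_UniformSpace R_UniformSpace R_UniformSpace)
  (V := R_NormedModule) (fun p => fst p)), continuous_fst.
Qed.

Let ker_cont (d x t : R) : Ccont (ker d x) t.
Proof.
unfold ker; apply Ccont_mult; [apply W0_cont|].
apply Ccont_cexp, Ccont_mult; [apply Ccont_const|apply gap_cont].
Qed.

Let ker_cont_2d (d : R) (p : R * R) :
  Ccont (U := prod_UniformSpace R_UniformSpace R_UniformSpace) (fun p => ker d (fst p) (snd p)) p.
Proof.
unfold ker; apply Ccont_mult; [now apply (Ccont_2d_snd W0)|].
apply Ccont_cexp, Ccont_mult; [apply Ccont_2d_fst|now apply (Ccont_2d_snd (gap d))].
Qed.

Let Cder_ker (d x t : R) : Cder (fun v => ker d v t) x (- gap d t * ker d x t)%C.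
Proof.
unfold ker; eapply Cder_eq.
- apply Cder_scal, Cder_cexp, Cder_mult; [|apply Cder_const].
  apply (Cder_RtoC (fun v => - v)), (is_derive_opp (V := R_NormedModule) (fun v : R => v)).
  exact (is_derive_id (K := R_AbsRing) x).
- cbv beta; change (opp one) with (- (1)); rewrite RtoC_opp; ring.
Qed.

(** The exchange of the integrals in [t] and [x] is proved by differentiating in the upper limit:
    the left-hand side vanishes at [B = 0] and its derivative is the inner integral on the right. *)
Lemma laplace_fubini (d N B : R) :
  0 < d -> 0 <= N -> 0 <= B ->
  CRInt (fun t => W0 t * ((1 - cexp (RtoC (- B) * gap d t)) / gap d t))%C (- N) N =
  CRInt (fun x => CRInt (ker d x) (- N) N) 0 B /\
  (forall x, Ccont (fun x => CRInt (ker d x) (- N) N) x).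
Proof.
intros pd pN pB.
assert (le : - N <= N) by lra.
assert (Kc : forall x, Ccont (fun x => CRInt (ker d x) (- N) N) x).
{ intros x; eapply Cder_Ccont.
  apply (Cder_CRInt_param (fun p => ker d (fst p) (snd p))
    (fun p => - gap d (snd p) * ker d (fst p) (snd p))%C (- N) N (x - 1) (x + 1) x le); simpl.
  - lra.
  - intros; apply Cder_ker.
  - intros; apply ker_cont.
  - intros t _; apply Ccont_mult; [|apply (ker_cont_2d d (x, t))].
    apply Ccont_opp; apply (Ccont_2d_snd (gap d)); intros; apply gap_cont.
  - intros; apply Cder_ker. }
split; [|exact Kc].
set (f := fun p : R * R =>
  (W0 (snd p) * ((1 - cexp (RtoC (- fst p) * gap d (snd p))) / gap d (snd p)))%C).
assert (Df : forall x t, Cder (fun v => f (v, t)) x (ker d x t)).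
{ intros x t; unfold f; simpl fst; simpl snd.
  assert (D : Cder (fun v => cexp (RtoC (- v) * gap d t)%C) x (- gap d t * cexp (RtoC (- x) * gap d t))%C).
  { eapply Cder_eq.
    - apply Cder_cexp, Cder_mult; [|apply Cder_const].
      apply (Cder_RtoC (fun v => - v)), (is_derive_opp (V := R_NormedModule) (fun v : R => v)).
      exact (is_derive_id (K := R_AbsRing) x).
    - cbv beta; change (opp one) with (- (1)); rewrite RtoC_opp; ring. }
  eapply Cder_eq.
  - apply Cder_scal; unfold Cdiv; apply Cder_mult; [|apply Cder_const].
    apply Cder_minus; [apply Cder_const|exact D].
  - cbv beta; unfold ker; field; now apply gap_neq. }
assert (F := CRInt_FTC (fun x => CRInt (fun t => f (x, t)) (- N) N) (fun x => CRInt (ker d x) (- N) N) 0 B pB).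
rewrite F.
- simpl.
  assert (Z : CRInt (fun t => f (0, t)) (- N) N = 0).
  { rewrite (CRInt_ext _ (fun _ => RtoC 0)); [rewrite CRInt_RtoC, RInt_const; unfold scal; simpl; unfold mult; simpl; now rewrite Rmult_0_r|exact le|].
    intros t _; unfold f; simpl fst; simpl snd; rewrite Ropp_0, Cmult_0_l, cexp_0.
    unfold Cdiv; replace (1 - 1)%C with (RtoC 0) by ring; ring. }
  rewrite Z; unfold f; simpl; ring.
- intros x _; apply (Cder_CRInt_param f (fun p => ker d (fst p) (snd p)) (- N) N (x - 1) (x + 1) x le).
  + lra.
  + intros; apply Df.
  + intros u t _ _; unfold f; simpl fst; simpl snd; apply Ccont_mult; [apply W0_cont|].
    apply Ccont_div; [|apply gap_cont|now apply gap_neq].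
    apply Ccont_minus; [apply Ccont_const|].
    apply Ccont_cexp, Ccont_mult; [apply Ccont_const|apply gap_cont].
  + intros t _; apply ker_cont_2d.
  + intros; apply Df.
- intros; apply Kc.
Qed.

(** For each [x] the inner integral tends to [exp (- (1 + d) x) x^(s - 1) J1] by scaling, uniformly
    on [[0, B]]. This brings in the truncated Euler integral. *)
Lemma laplace_lim (d B : R) (J1 : C) :
  0 < d -> 0 <= B -> is_line (fun t => Fk s 1 0 (1, t)) J1 ->
  Clim eventually
    (fun N => CRInt (fun t => W0 t * ((1 - cexp (RtoC (- B) * gap d t)) / gap d t))%C (- INR N) (INR N))
    (J1 * RtoC (RInt (fun x => exp (- (x * (1 + d))) * rpow x (s - 1))%R 0 B))%C.
Proof.
intros pd pB L.
set (r := fun x => exp (- (x * (1 + d))) * rpow x (s - 1)).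
assert (Kr : forall x, continuous r x).
{ intros x; apply continuous_Rmult; [|apply continuous_rpow; lra].
  apply (continuous_comp_R exp); [|apply continuous_exp].
  apply (continuous_opp (V := R_NormedModule) (fun x => x * (1 + d))), continuous_Rmult;
    [apply continuous_id|apply continuous_const]. }
assert (E : (J1 * RtoC (RInt r 0 B))%C = CRInt (fun x => J1 * RtoC (r x))%C 0 B).
{ rewrite <- CRInt_RtoC, CRInt_scal; [reflexivity|exact pB|].
  intros t _; apply Ccont_RtoC, Kr. }
rewrite E.
apply (Clim_squeeze _ _ _ (fun N => B * 2 * (2 / (1 + INR N)))).
2:{ intros eps; apply eventually_tail_small. }
exists 0%nat; intros N _; pose proof (pos_INR N) as pN.
destruct (laplace_fubini d (INR N) B pd pN pB) as [F K]; rewrite F.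
assert (KJ : forall x, Ccont (fun x => J1 * RtoC (r x))%C x)
  by (intros; apply Ccont_mult; [apply Ccont_const|apply Ccont_RtoC, Kr]).
rewrite <- CRInt_minus by auto.
rewrite Rmult_assoc; replace B with (B - 0) at 2 by ring.
apply CRInt_bound_const; auto.
- intros; apply Ccont_minus; auto.
- intros x Hx.
  rewrite (CRInt_ext (ker d x) (fun t => RtoC (exp (- (x * (1 + d)))) * Fk s x 0 (1, t))%C)
    by (try lra; intros; apply ker_eq).
  rewrite CRInt_scal by (try lra; intros; apply Ccont_Fk_line).
  unfold r; rewrite RtoC_mult.
  replace (_ - _)%C with (RtoC (exp (- (x * (1 + d)))) *
    (CRInt (fun t => Fk s x 0 (1, t)) (- INR N) (INR N) - RtoC (rpow x (s - 1)) * J1))%C by ring.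
  rewrite Cmod_mult, Cmod_R, Rabs_pos_eq by (left; apply exp_pos).
  assert (Lx := Fk_line_rpow s x J1 Hs (proj1 Hx) L).
  assert (Bx := Fk_line_bound s x 0 (- INR N) (INR N) _ ltac:(lra) (Rle_refl 0) Lx ltac:(lra) pN).
  rewrite tailw_opp in Bx; pose proof (tailw_le s N ltac:(lra)) as T.
  (* The error of truncating the line at height [N] may grow like [exp x]; the Laplace factor
     compensates it uniformly in [x]. *)
  assert (Q : exp (- (x * (1 + d))) * exp (x + 0) <= 1).
  { rewrite <- exp_plus; apply (Rle_trans _ (exp 0)); [apply exp_le; nra|rewrite exp_0; apply Rle_refl]. }
  apply (Rle_trans _ (exp (- (x * (1 + d))) * (exp (x + 0) * (tailw s (INR N) + tailw s (INR N))))).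
  + apply Rmult_le_compat_l; [left; apply exp_pos|exact Bx].
  + assert (T0 : 0 <= tailw s (INR N)).
    { apply Rmult_le_pos; [left; apply exp_pos|].
      apply Rdiv_le_0_compat; [lra|]; rewrite Rabs_pos_eq; lra. }
    rewrite <- Rmult_assoc.
    apply (Rle_trans _ (1 * (tailw s (INR N) + tailw s (INR N)))); [apply Rmult_le_compat_r; lra|lra].
Qed.

(** The translation that moves the pole [w = 1 - d] to the origin; the line [Re w = 1] becomes
    [Re v = d]. *)
Let shift (d : R) (v : C) : C := (v + RtoC (1 - d))%C.

Let shiftF (d : R) (v : C) : C := (Fk s 0 0 (shift d v) / v)%C.

Let shiftF' (d : R) (v : C) : C :=
  ((Fk' s 0 0 (shift d v) - Fk s 0 0 (shift d v) / v) / v)%C.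

Let shift_pos (d : R) (v : C) : d < 1 -> 0 < fst v -> 0 < fst (shift d v).
Proof. intros; unfold shift; simpl; lra. Qed.

Let Chol_shiftF (d : R) : d < 1 -> Chol (shiftF d) (shiftF' d).
Proof.
intros Hd; destruct (Chol_Fk s 0 0) as [D K K'].
assert (Ks : forall (U : UniformSpace) (g : U -> C) (x : U), Ccont g x -> Ccont (fun u => shift d (g u)) x)
  by (intros; apply Ccont_plus; [assumption|apply Ccont_const]).
split.
- intros g t l Dg pos; unfold shiftF, shiftF', Cdiv; eapply Cder_eq.
  + apply Cder_mult.
    * apply (D (fun x => shift d (g x))); [|now apply shift_pos].
      unfold shift; apply Cder_plus; [exact Dg|apply Cder_const].
    * apply Cder_inv; [exact Dg|now apply Cneq_fst].
  + cbv beta; field; now apply Cneq_fst.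
- intros U g x Kg pos; apply Ccont_div; [|exact Kg|now apply Cneq_fst].
  apply (K U (fun u => shift d (g u))); auto.
- intros U g x Kg pos; apply Ccont_div; [|exact Kg|now apply Cneq_fst].
  apply Ccont_minus.
  + apply (K' U (fun u => shift d (g u))); auto.
  + apply Ccont_div; [|exact Kg|now apply Cneq_fst].
    apply (K U (fun u => shift d (g u))); auto.
Qed.

(* The pole [w = 1 - d] lies to the left of the line. *)
Lemma left_pole_lim (d : R) :
  0 < d < 1 ->
  Clim eventually (fun N => CRInt (fun t => W0 t / Cconj (gap d t))%C (- INR N) (INR N)) 0.
Proof.
intros Hd.
assert (pid : 0 < / d) by (apply Rinv_0_lt_compat; lra).
assert (B : forall x t, d <= x -> Cmod (shiftF d (x, t)) <= / d * tail_fun (Rabs t) (x - d)).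
{ intros x t Hx; unfold shiftF.
  replace (shift d (x, t)) with ((x + (1 - d), t) : C) by (apply C_eta; unfold shift; simpl; ring).
  assert (nv : ((x, t) : C) <> 0) by (apply Cneq_fst; simpl; lra).
  assert (Mv : d <= Cmod (x, t)).
  { eapply Rle_trans; [|apply fst_le_Cmod]; simpl; eapply Rle_trans; [|apply Rle_abs]; lra. }
  rewrite Cmod_div by exact nv; unfold Rdiv; rewrite Rmult_comm.
  apply Rmult_le_compat; [left; apply Rinv_0_lt_compat; lra|apply Cmod_ge_0|apply Rinv_le_contravar; lra|].
  eapply Rle_trans; [apply (Cmod_Fk_le s 0 0 0 1); simpl fst; try lra|].
  - split; [lra|apply Cmod_ge_fst; simpl; lra].
  - unfold Rpower; rewrite ln_1, Rmult_0_r, Rplus_0_r, exp_0, !Rmult_1_l.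
    eapply Rle_trans; [apply inv_sqr_tail; lra|].
    replace (x + (1 - d) - 1) with (x - d) by ring; apply Rle_refl. }
apply (Clim_squeeze _ _ _ (fun N => / d * 2 * (2 / (1 + INR N)))).
2:{ intros eps; apply eventually_tail_small. }
exists 0%nat; intros N _; pose proof (pos_INR N) as pN.
rewrite (CRInt_ext _ (fun t => shiftF d (d, t))).
- match goal with |- Cmod (?u - RtoC 0)%C <= _ => replace (u - 0)%C with u by ring end.
  eapply Rle_trans; [apply (CRInt_right_shift (shiftF d) (shiftF' d) d (- INR N) (INR N) (/ d) (/ d) (/ d));
    auto; try lra|].
  + apply Chol_shiftF; lra.
  + intros x t Hx; eapply Rle_trans; [now apply B|].
    apply Rmult_le_compat_l; [lra|]; apply tail_fun_le; [apply Rabs_pos|lra].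
  + rewrite Rabs_Ropp, Rabs_pos_eq by exact pN; apply Req_le; ring.
- lra.
- intros t _; unfold shiftF, W0, gap; f_equal; [|f_equal; apply C_eta; simpl; ring].
  f_equal; apply C_eta; unfold shift; simpl; ring.
Qed.

(** The sum of the inverses of [gap d t] and of its conjugate: a positive kernel of total mass
    [2 PI], which concentrates at [t = 0] as [d] tends to [0]. *)
Let poisson (d t : R) : R := 2 * d / (d ^ 2 + t ^ 2).

Let poisson_pos (d t : R) : 0 < d -> 0 <= poisson d t.
Proof. intros pd; apply Rdiv_le_0_compat; [lra|]; assert (0 < d ^ 2) by (now apply pow_lt); nra. Qed.

Let is_RInt_poisson (d N : R) : 0 < d -> is_RInt (poisson d) 0 N (2 * atan (N / d)).
Proof.
intros pd.
replace (2 * atan (N / d)) with (minus (2 * atan (N / d)) (2 * atan (0 / d))).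
- assert (P : forall x, 0 < d ^ 2 + x ^ 2) by (intros x; assert (0 < d ^ 2) by (now apply pow_lt); nra).
  apply (is_RInt_derive (V := R_CompleteNormedModule) (fun t => 2 * atan (t / d))).
  + intros x _; unfold poisson; auto_derive; [exact I|].
    specialize (P x); unfold Rsqr; field; repeat split; nra.
  + intros x _; apply (ex_derive_continuous (V := R_NormedModule)); unfold poisson; auto_derive.
    specialize (P x); simpl in P |- *; lra.
- unfold minus, plus, opp; simpl; unfold Rdiv; rewrite Rmult_0_l, atan_0; ring.
Qed.

Let poisson_cont (d t : R) : 0 < d -> continuous (poisson d) t.
Proof.
intros pd; apply (ex_derive_continuous (V := R_NormedModule)); unfold poisson; auto_derive.
assert (0 < d ^ 2) by (now apply pow_lt); simpl in *; nra.
Qed.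

Lemma atan_le_id (x : R) : 0 <= x -> atan x <= x.
Proof.
intros px.
assert (B := C_mean_value (fun t => RtoC (atan t)) (fun t => RtoC (/ (1 + t²))) 0 x 1 px); cbv beta in B.
rewrite atan_0, <- RtoC_minus, Cmod_R, Rminus_0_r, Rmult_1_l in B.
eapply Rle_trans; [apply Rle_abs|]; rewrite Rminus_0_r in B; apply B.
- intros t _; apply Cder_RtoC; exact (is_derive_atan t).
- intros t _; rewrite Cmod_R; pose proof (Rle_0_sqr t).
  rewrite Rabs_pos_eq by (left; apply Rinv_0_lt_compat; lra).
  rewrite <- Rinv_1; apply Rinv_le_contravar; lra.
Qed.

Lemma poisson_lim (eta : R) :
  0 < eta -> exists d, 0 < d < 1 /\ d <= eta /\
    eventually (fun N => Cmod (CRInt (fun t => W0 t * RtoC (poisson d t))%C (- INR N) (INR N)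
                               - RtoC (2 * PI))%C <= eta).
Proof.
intros pe.
assert (W00 : W0 0 = 1).
{ unfold W0, Fk; change ((1, 0) : C) with (RtoC 1); rewrite clog_R, Rabs_R1, ln_1.
  rewrite <- cexp_0; f_equal; ring. }
assert (pe32 : 0 < eta / 32) by lra.
pose proof (proj1 (Ccont_Clim _ _) (W0_cont 0) (mkposreal _ pe32)) as [[r pr] Hr]; simpl in Hr.
rewrite W00 in Hr.
(* For [|t| >= r] the ratio [(1 + |t|) / |t|] is at most [(1 + r) / r], so there the kernel is at
   most [d q] times [tail_fun 0 |t|]. *)
set (q := ((1 + r) / r) ^ 2).
assert (pq : 0 < q) by (apply pow_lt, Rdiv_lt_0_compat; lra).
(* The first bound keeps [d] below [1], the second is part of the conclusion, and the third makes
   the contribution of [|t| >= r], at most [12 d q], smaller than [eta / 4]. *)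
set (d := Rmin (1 / 2) (Rmin eta (eta / (48 * q)))).
assert (pd : 0 < d).
{ apply Rmin_glb_lt; [lra|apply Rmin_glb_lt; [lra|apply Rdiv_lt_0_compat; lra]]. }
assert (d1 : d <= 1 / 2) by apply Rmin_l.
assert (d2 : d <= eta) by (eapply Rle_trans; [apply Rmin_r|apply Rmin_l]).
assert (d3 : d <= eta / (48 * q)) by (eapply Rle_trans; [apply Rmin_r|apply Rmin_r]).
assert (d4 : 12 * (d * q) <= eta / 4).
{ assert (d * (48 * q) <= eta); [|lra].
  apply (Rmult_le_reg_r (/ (48 * q))); [apply Rinv_0_lt_compat; lra|].
  rewrite Rmult_assoc, Rinv_r; unfold Rdiv in d3; lra. }
exists d; split; [lra|split; [exact d2|]].
pose proof PI_RGT_0 as pp; pose proof PI_4 as P4.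
assert (KP : forall t, Ccont (fun t => RtoC (poisson d t)) t)
  by (intros; apply Ccont_RtoC, poisson_cont, pd).
assert (K1 : forall t, Ccont (fun t => (W0 t - 1) * RtoC (poisson d t))%C t)
  by (intros; apply Ccont_mult; auto; apply Ccont_minus; [apply W0_cont|apply Ccont_const]).
assert (Bd : forall t, Cmod ((W0 t - 1) * RtoC (poisson d t))%C <=
  eta / 32 * poisson d (Rabs t) + 3 * d * q * tail_fun 0 (Rabs t)).
{ intros t; rewrite Cmod_mult, Cmod_R, Rabs_pos_eq by (apply poisson_pos, pd).
  replace (poisson d (Rabs t)) with (poisson d t) by (unfold poisson; now rewrite pow2_abs).
  pose proof (poisson_pos d t pd) as P0.
  assert (T0 : 0 <= tail_fun 0 (Rabs t)).
  { apply Rdiv_le_0_compat; [lra|apply pow_lt; pose proof (Rabs_pos t); lra]. }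
  destruct (Rlt_or_le (Rabs t) r) as [lt|ge].
  - assert (X : Cmod (W0 t - 1)%C < eta / 32).
    { apply Hr; unfold ball; simpl; unfold AbsRing_ball, abs, minus, plus, opp; simpl.
      now rewrite Ropp_0, Rplus_0_r. }
    assert (0 <= 3 * d * q * tail_fun 0 (Rabs t))
      by (apply Rmult_le_pos; [apply Rmult_le_pos; lra|exact T0]).
    assert (Cmod (W0 t - 1)%C * poisson d t <= eta / 32 * poisson d t)
      by (apply Rmult_le_compat_r; lra).
    lra.
  - assert (X : Cmod (W0 t - 1)%C <= 3).
    { unfold Cminus; eapply Rle_trans; [apply Cmod_triangle|].
      rewrite Cmod_opp, Cmod_1; pose proof (W0_bound t) as B.
      assert (tail_fun 0 (Rabs t) <= 2 / (1 + Rabs t)) by (apply tail_fun_le; [lra|apply Rabs_pos]).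
      assert (2 / (1 + Rabs t) <= 2).
      { apply (Rmult_le_reg_r (1 + Rabs t)); [lra|]; unfold Rdiv.
        rewrite Rmult_assoc, Rinv_l; lra. }
      lra. }
    assert (Y : poisson d t <= d * q * tail_fun 0 (Rabs t)).
    { unfold poisson, tail_fun, q; rewrite <- (pow2_abs t); set (a := Rabs t) in *.
      rewrite Rplus_0_r.
      apply (Rle_trans _ (2 * d / a ^ 2)).
      - unfold Rdiv; apply Rmult_le_compat_l; [lra|]; apply Rinv_le_contravar; [apply pow_lt; lra|].
        pose proof (pow2_ge_0 d); lra.
      - replace (d * ((1 + r) / r) ^ 2 * (2 / (1 + a) ^ 2))
          with (2 * d * ((1 + r) / (r * (1 + a))) ^ 2) by (field; lra).
        unfold Rdiv at 1; apply Rmult_le_compat_l; [lra|].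
        rewrite <- pow_inv; apply pow_incr; split; [left; apply Rinv_0_lt_compat; lra|].
        apply (Rmult_le_reg_r (a * (r * (1 + a)))); [repeat apply Rmult_lt_0_compat; lra|].
        replace (/ a * (a * (r * (1 + a)))) with (r * (1 + a)) by (field; lra).
        replace ((1 + r) / (r * (1 + a)) * (a * (r * (1 + a)))) with ((1 + r) * a) by (field; lra).
        nra. }
    assert (Cmod (W0 t - 1)%C * poisson d t <= 3 * (d * q * tail_fun 0 (Rabs t)))
      by (apply Rmult_le_compat; auto using Cmod_ge_0).
    assert (0 <= eta / 32 * poisson d t) by (apply Rmult_le_pos; lra).
    lra. }
assert (pe16 : 0 < eta / 32) by lra.
destruct (eventually_tail_small (2 * d) (mkposreal _ pe16)) as [N0 HN]; simpl in HN.
exists (S N0); intros N le; pose proof (pos_INR N) as pN.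
assert (pN1 : 1 <= INR N) by (apply (le_INR 1); lia).
specialize (HN N ltac:(lia)).
assert (I1 : Cmod (CRInt (fun t => (W0 t - 1) * RtoC (poisson d t))%C (- INR N) (INR N)) <=
  2 * (eta / 32 * (2 * atan (INR N / d)) + 3 * d * q * (2 - 2 / (1 + INR N)))).
{ apply (CRInt_sym_bound _ (fun t => eta / 32 * poisson d t + 3 * d * q * tail_fun 0 t)); auto.
  apply (is_RInt_plus (V := R_NormedModule)); apply (is_RInt_scal (V := R_NormedModule)).
  - now apply is_RInt_poisson.
  - now apply is_RInt_tail_0. }
assert (I2 : CRInt (fun t => RtoC (poisson d t)) (- INR N) (INR N) = RtoC (4 * atan (INR N / d))).
{ rewrite (CRInt_Chasles _ (- INR N) 0 (INR N)) by (try lra; auto).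
  replace (CRInt (fun t => RtoC (poisson d t)) (- INR N) 0)
    with (CRInt (fun t => RtoC (poisson d t)) (- INR N) (- 0)) by (now rewrite Ropp_0).
  rewrite CRInt_reflect by auto.
  rewrite (CRInt_ext (fun t => RtoC (poisson d (- t))) (fun t => RtoC (poisson d t))); [|exact pN|].
  - rewrite CRInt_RtoC, (is_RInt_unique _ _ _ _ (is_RInt_poisson d (INR N) pd)), <- RtoC_plus.
    f_equal; ring.
  - intros t _; f_equal; unfold poisson; f_equal; f_equal; ring. }
assert (At : PI / 2 - d / INR N <= atan (INR N / d) <= PI / 2).
{ split; [|left; apply atan_bound].
  assert (pNd : 0 < INR N / d) by (apply Rdiv_lt_0_compat; lra).
  pose proof (atan_inv (INR N / d) pNd) as E.
  replace (/ (INR N / d)) with (d / INR N) in E by (field; lra).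
  assert (0 <= d / INR N) by (apply Rdiv_le_0_compat; lra).
  pose proof (atan_le_id (d / INR N) H); lra. }
rewrite (CRInt_ext _ (fun t => (W0 t - 1) * RtoC (poisson d t) + RtoC (poisson d t))%C)
  by (try lra; intros; ring).
rewrite CRInt_plus by (try lra; auto).
rewrite I2; set (X := CRInt (fun t => (W0 t - 1) * RtoC (poisson d t))%C (- INR N) (INR N)) in *.
replace (X + RtoC (4 * atan (INR N / d)) - RtoC (2 * PI))%C
  with (X + RtoC (4 * atan (INR N / d) - 2 * PI))%C by (rewrite RtoC_minus; ring).
eapply Rle_trans; [apply Cmod_triangle|]; rewrite Cmod_R.
assert (A : Rabs (4 * atan (INR N / d) - 2 * PI) <= eta / 4).
{ rewrite Rabs_left1 by lra.
  assert (d / INR N <= 2 * d * (2 / (1 + INR N))).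
  { apply (Rmult_le_reg_r (INR N * (1 + INR N))); [nra|].
    replace (d / INR N * (INR N * (1 + INR N))) with (d * (1 + INR N)) by (field; lra).
    replace (2 * d * (2 / (1 + INR N)) * (INR N * (1 + INR N))) with (4 * d * INR N) by (field; lra).
    nra. }
  lra. }
assert (0 <= 2 / (1 + INR N)) by (apply Rdiv_le_0_compat; lra).
assert (pdq : 0 < d * q) by now apply Rmult_lt_0_compat.
assert (T1 : 3 * d * q * (2 - 2 / (1 + INR N)) <= 6 * (d * q)) by nra.
assert (T2 : eta / 32 * (2 * atan (INR N / d)) <= eta / 32 * 4) by (apply Rmult_le_compat_l; lra).
lra.
Qed.

(** Adding the vanishing integral of [left_pole_lim] turns [1 / gap] into the Poisson kernel. What
    is left is the truncation term containing [exp (- B gap)], of size [4 exp (- B d) / d]. *)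
Lemma laplace_poisson_bound (d B eta : R) (J1 : C) :
  0 < d < 1 -> 0 <= B -> is_line (fun t => Fk s 1 0 (1, t)) J1 ->
  eventually (fun N => Cmod (CRInt (fun t => W0 t * RtoC (poisson d t))%C (- INR N) (INR N)
                             - RtoC (2 * PI))%C <= eta) ->
  Cmod (J1 * RtoC (RInt (fun x => exp (- (x * (1 + d))) * rpow x (s - 1))%R 0 B) - RtoC (2 * PI))%C
    <= eta + 4 * exp (- (B * d)) / d.
Proof.
intros Hd pB L [N0 HN].
assert (pd : 0 < d) by lra.
assert (A := laplace_lim d B J1 pd pB L); assert (Z := left_pole_lim d Hd).
assert (AZ := Clim_minus _ _ _ _ _ (Clim_plus _ _ _ _ _ A Z) (Clim_const eventually (RtoC (2 * PI)))).
rewrite Cplus_0_r in AZ.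
apply (Clim_le eventually _ _ _ AZ); exists N0; intros N le; pose proof (pos_INR N) as pN.
specialize (HN N le).
assert (Kg : forall t, Ccont (fun t => Cconj (gap d t)) t).
{ intros t; apply Ccont_pair; [apply continuous_const|].
  apply (continuous_ext (fun t : R => t)); [intros x; symmetry; apply Ropp_involutive|apply continuous_id]. }
assert (ng : forall t, Cconj (gap d t) <> 0) by (intros t; apply Cneq_fst; exact pd).
assert (Kc : forall t, Ccont (fun t => cexp (RtoC (- B) * gap d t)%C) t).
{ intros t; apply Ccont_cexp, Ccont_mult; [apply Ccont_const|apply gap_cont]. }
assert (KE : forall t, Ccont (fun t => W0 t * (cexp (RtoC (- B) * gap d t) / gap d t))%C t).
{ intros t; apply Ccont_mult; [apply W0_cont|]; apply Ccont_div; auto using gap_cont, gap_neq. }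
rewrite <- CRInt_plus.
- rewrite (CRInt_ext _ (fun t => W0 t * RtoC (poisson d t) -
    W0 t * (cexp (RtoC (- B) * gap d t) / gap d t))%C).
  + assert (KP : forall t, Ccont (fun t => W0 t * RtoC (poisson d t))%C t)
      by (intros t; apply Ccont_mult; [apply W0_cont|apply Ccont_RtoC, poisson_cont, pd]).
    rewrite CRInt_minus by (try lra; auto).
    set (X := CRInt (fun t => W0 t * RtoC (poisson d t))%C (- INR N) (INR N)) in *.
    set (Y := CRInt (fun t => W0 t * (cexp (RtoC (- B) * gap d t) / gap d t))%C (- INR N) (INR N)).
    replace (X - Y - RtoC (2 * PI))%C with ((X - RtoC (2 * PI)) + - Y)%C by ring.
    eapply Rle_trans; [apply Cmod_triangle|]; rewrite Cmod_opp; apply Rplus_le_compat; [exact HN|].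
    replace (4 * exp (- (B * d)) / d) with (exp (- (B * d)) / d * 4) by (field; lra).
    apply CRInt_tail_bound; auto.
    * apply Rdiv_le_0_compat; [left; apply exp_pos|exact pd].
    * intros t; rewrite Cmod_mult, Cmod_div, Cmod_cexp by now apply gap_neq.
      rewrite Rmult_comm.
      replace (fst (RtoC (- B) * gap d t)%C) with (- (B * d)) by (unfold gap; simpl; ring).
      apply Rmult_le_compat; [|apply Cmod_ge_0| |apply W0_bound].
      -- pose proof (Cmod_gap d t pd); apply Rdiv_le_0_compat; [left; apply exp_pos|lra].
      -- unfold Rdiv; apply Rmult_le_compat_l; [left; apply exp_pos|].
         apply Rinv_le_contravar; [exact pd|now apply Cmod_gap].
  + lra.
  + intros t _.
    assert (P : RtoC (poisson d t) = (/ gap d t + / Cconj (gap d t))%C).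
    { assert (pq : 0 < d ^ 2 + t ^ 2) by (assert (0 < d ^ 2) by (now apply pow_lt); nra).
      unfold poisson, gap; apply C_eta; simpl in pq |- *; field; nra. }
    rewrite P; field; split; auto.
- lra.
- intros t _; apply Ccont_mult; [apply W0_cont|].
  apply Ccont_div; auto using gap_cont, gap_neq; apply Ccont_minus; auto using Ccont_const.
- intros t _; apply Ccont_div; auto.
Qed.

End LaplaceInversion.

Lemma C_zero_of_small (z : C) (K : R) : (forall e, 0 < e < 1 -> Cmod z <= K * e) -> z = 0.
Proof.
intros H; apply Cmod_eq_0, Rle_antisym; [|apply Cmod_ge_0].
apply le_epsilon; intros eps pe; rewrite Rplus_0_l.
set (e := Rmin (1 / 2) (eps / (Rabs K + 1))).
pose proof (Rabs_pos K) as pK; pose proof (Rle_abs K) as aK.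
assert (pe' : 0 < eps / (Rabs K + 1)) by (apply Rdiv_lt_0_compat; lra).
assert (He : 0 < e) by (apply Rmin_glb_lt; lra).
assert (e1 : e <= 1 / 2) by apply Rmin_l.
assert (e2 : e <= eps / (Rabs K + 1)) by apply Rmin_r.
eapply Rle_trans; [apply (H e); lra|].
apply (Rle_trans _ (Rabs K * (eps / (Rabs K + 1)))); [nra|].
apply (Rmult_le_reg_r (Rabs K + 1)); [lra|].
replace (Rabs K * (eps / (Rabs K + 1)) * (Rabs K + 1)) with (Rabs K * eps) by (field; lra); nra.
Qed.

Section GammaLine.

Variables (s : R) (J : C).
Hypotheses (Hs : 2 < s) (HJ : is_line (fun t => Fk s 1 0 (1, t)) J).

Let g (x : R) : R := exp (- x) * rpow x (s - 1).

Let g_cont (x : R) : continuous g x.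
Proof.
apply continuous_Rmult; [|apply continuous_rpow; lra].
apply (continuous_comp_R exp); [|apply continuous_exp].
apply (continuous_opp (V := R_NormedModule) (fun x : R => x)), continuous_id.
Qed.

Let g_pos (x : R) : 0 <= g x.
Proof. apply Rmult_le_pos; [left; apply exp_pos|apply rpow_nonneg]. Qed.

Let G0 (X : R) : R := RInt g 0 X.

Let g_ex (a b : R) : ex_RInt g a b.
Proof. apply (ex_RInt_continuous (V := R_CompleteNormedModule)); intros; apply g_cont. Qed.

Let G0_diff (a b : R) : RInt g a b = G0 b - G0 a.
Proof.
assert (E := RInt_Chasles (V := R_CompleteNormedModule) g 0 a b (g_ex _ _) (g_ex _ _)).
change (RInt g 0 a + RInt g a b = RInt g 0 b) in E; unfold G0; lra.
Qed.

Let G0_mono (a b : R) : a <= b -> G0 a <= G0 b.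
Proof.
intros le; pose proof (RInt_ge_0 g a b le (g_ex a b) (fun x _ => g_pos x)) as P.
rewrite G0_diff in P; lra.
Qed.

Let G0_nonneg (a : R) : 0 <= a -> 0 <= G0 a.
Proof. intros pa; exact (RInt_ge_0 g 0 a pa (g_ex 0 a) (fun x _ => g_pos x)). Qed.

Let G0_scale (y B : R) :
  0 < y -> 0 <= B ->
  RInt (fun x => exp (- (x * y)) * rpow x (s - 1)) 0 B = Rpower y (- s) * G0 (y * B).
Proof.
intros py pB.
assert (E := RInt_comp_lin (V := R_CompleteNormedModule) g y 0 0 B (g_ex _ _)).
replace (y * 0 + 0) with 0 in E by ring; replace (y * B + 0) with (y * B) in E by ring.
fold (G0 (y * B)) in E; rewrite <- E.
assert (X : RInt (fun x => Rpower y (- s) * (y * g (y * x + 0))) 0 B =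
            Rpower y (- s) * RInt (fun x => y * g (y * x + 0)) 0 B).
{ apply (RInt_scal (V := R_CompleteNormedModule)), (ex_RInt_comp_lin (V := R_NormedModule)), g_ex. }
change (fun x => scal y (g (y * x + 0))) with (fun x => y * g (y * x + 0)); rewrite <- X.
apply RInt_ext; intros x Hx; rewrite Rmin_left, Rmax_right in Hx by exact pB.
unfold g; rewrite Rplus_0_r, !rpow_pos by nra.
rewrite <- Rpower_mult_distr by lra.
replace (- (y * x)) with (- (x * y)) by ring.
match goal with |- ?a = ?b => change (@eq R a b) end.
transitivity (exp (- (x * y)) * Rpower x (s - 1) * (Rpower y (- s) * Rpower y 1 * Rpower y (s - 1))).
- rewrite <- !Rpower_plus; replace (- s + 1 + (s - 1)) with 0 by ring; rewrite Rpower_O by lra; ring.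
- rewrite Rpower_1 by lra; ring.
Qed.

(** Rescaling by [1 + d] turns the Laplace integral into the truncated Euler integral [G0], at the
    cost of the factor [(1 + d)^(- s)]. *)
Let key (eta : R) : 0 < eta -> exists d, 0 < d < 1 /\ d <= eta /\ forall X, 0 <= X ->
  Cmod (J * RtoC (Rpower (1 + d) (- s) * G0 X) - RtoC (2 * PI))%C
    <= eta + 4 * exp (- (X / (1 + d) * d)) / d.
Proof.
intros pe; destruct (poisson_lim s Hs eta pe) as [d [Hd [le H]]].
exists d; split; [exact Hd|split; [exact le|]]; intros X pX.
assert (pB : 0 <= X / (1 + d)) by (apply Rdiv_le_0_compat; lra).
assert (E := laplace_poisson_bound s Hs d (X / (1 + d)) eta J Hd pB HJ H).
rewrite G0_scale in E by lra.
replace ((1 + d) * (X / (1 + d))) with X in E by (field; lra); exact E.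
Qed.

Let exp_small (d e : R) : 0 < d < 1 -> 0 < e ->
  exists X0, 0 < X0 /\ forall X, X0 <= X -> 4 * exp (- (X / (1 + d) * d)) / d <= e.
Proof.
intros Hd pe.
exists (4 * (1 + d) / (d * d * e)); split.
- apply Rdiv_lt_0_compat; [lra|]; repeat apply Rmult_lt_0_compat; lra.
- intros X HX.
  assert (pX : 0 < X).
  { eapply Rlt_le_trans; [|exact HX]; apply Rdiv_lt_0_compat; [lra|].
    repeat apply Rmult_lt_0_compat; lra. }
  assert (pv : 0 < X / (1 + d) * d) by (apply Rmult_lt_0_compat; [apply Rdiv_lt_0_compat|]; lra).
  rewrite exp_Ropp.
  apply (Rle_trans _ (4 * / (X / (1 + d) * d) / d)).
  + unfold Rdiv; apply Rmult_le_compat_r; [left; apply Rinv_0_lt_compat; lra|].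
    apply Rmult_le_compat_l; [lra|]; apply Rinv_le_contravar; [exact pv|].
    left; eapply Rlt_trans; [|apply exp_ineq1; unfold Rdiv in pv; lra]; unfold Rdiv; lra.
  + apply (Rmult_le_reg_r (d * d * X)); [repeat apply Rmult_lt_0_compat; lra|].
    replace (4 * / (X / (1 + d) * d) / d * (d * d * X)) with (4 * (1 + d)) by (field; lra).
    apply (Rmult_le_compat_l (d * d * e)) in HX; [|repeat apply Rmult_le_pos; lra].
    replace (d * d * e * (4 * (1 + d) / (d * d * e))) with (4 * (1 + d)) in HX by (field; lra).
    lra.
Qed.

(** A single [d] already shows that [J] is nonzero and that [G0] is bounded, so the monotone [G0]
    has a limit [G]. Letting [d] tend to [0] then gives [J G = 2 PI], and [G] is identified with the
    generalised integral [Gamma s]. *)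
Lemma gamma_line : (J * RtoC (Gamma s))%C = RtoC (2 * PI).
Proof.
assert (P3 : 3 <= PI) by (pose proof PI2_3_2; lra).
destruct (key 1 Rlt_0_1) as [d [Hd [_ HK]]].
(* If [J] were [0], the estimate with [eta = 1] would give [2 PI <= 2] for large [X]. *)
assert (nJ : 0 < Cmod J).
{ apply Cmod_gt_0; intros E.
  destruct (exp_small d 1 Hd Rlt_0_1) as [X0 [pX HX]].
  specialize (HK X0 ltac:(lra)); specialize (HX X0 (Rle_refl _)).
  rewrite E, Cmult_0_l in HK.
  replace (0 - RtoC (2 * PI))%C with (- RtoC (2 * PI))%C in HK by ring.
  rewrite Cmod_opp, Cmod_R, Rabs_pos_eq in HK by lra; lra. }
set (c := Rpower (1 + d) (- s)) in *.
assert (pc : 0 < c) by apply exp_pos.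
assert (Bd : forall X, 0 <= X -> G0 X <= (2 * PI + 1 + 4 / d) / (Cmod J * c)).
{ intros X pX; specialize (HK X pX).
  assert (T : Cmod (J * RtoC (c * G0 X))%C <= 2 * PI + (1 + 4 * exp (- (X / (1 + d) * d)) / d)).
  { replace (J * RtoC (c * G0 X))%C with ((J * RtoC (c * G0 X) - RtoC (2 * PI)) + RtoC (2 * PI))%C by ring.
    eapply Rle_trans; [apply Cmod_triangle|]; rewrite Cmod_R, Rabs_pos_eq by lra; lra. }
  assert (Q : 4 * exp (- (X / (1 + d) * d)) / d <= 4 / d).
  { unfold Rdiv at 1 3; apply Rmult_le_compat_r; [left; apply Rinv_0_lt_compat; lra|].
    assert (exp (- (X / (1 + d) * d)) <= 1); [|lra].
    apply (Rle_trans _ (exp 0)); [apply exp_le|rewrite exp_0; lra].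
    assert (0 <= X / (1 + d) * d) by (apply Rmult_le_pos; [apply Rdiv_le_0_compat|]; lra); lra. }
  rewrite Cmod_mult, Cmod_R, Rabs_pos_eq in T by (apply Rmult_le_pos; [lra|now apply G0_nonneg]).
  apply (Rmult_le_reg_r (Cmod J * c)); [now apply Rmult_lt_0_compat|].
  unfold Rdiv at 1; rewrite Rmult_assoc, Rinv_l by (apply Rgt_not_eq; now apply Rmult_lt_0_compat).
  lra. }
destruct (ex_finite_lim_seq_incr (fun n => G0 (INR n)) ((2 * PI + 1 + 4 / d) / (Cmod J * c))) as [G LG].
{ intros n; apply G0_mono; rewrite S_INR; lra. }
{ intros n; apply Bd, pos_INR. }
assert (LeG : forall X, G0 X <= G).
{ intros X; destruct (INR_unbounded X) as [n Hn].
  apply (Rle_trans _ (G0 (INR n))); [apply G0_mono; lra|].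
  apply (is_lim_seq_incr_compare _ _ LG); intros k; apply G0_mono; rewrite S_INR; lra. }
assert (pG : 0 <= G) by (eapply Rle_trans; [apply (G0_nonneg 0); lra|apply LeG]).
assert (E : (J * RtoC G)%C = RtoC (2 * PI)).
{ apply Ceq_minus; apply (C_zero_of_small _ (2 + Cmod J * G * s)); intros e He.
  destruct (key e (proj1 He)) as [d' [Hd' [le HK']]].
  set (c' := Rpower (1 + d') (- s)) in *.
  assert (pc' : 0 < c') by apply exp_pos.
  (* [(1 + d')^(- s) >= 1 - s ln (1 + d')], and [ln (1 + d') <= d' <= e]. *)
  assert (c1 : 1 - s * e <= c' <= 1).
  { assert (l0 : 0 <= ln (1 + d') <= d').
    { split; [rewrite <- ln_1; left; apply ln_increasing; lra|].
      apply (Rle_trans _ (ln (exp d'))); [|rewrite ln_exp; lra].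
      left; apply ln_increasing; [lra|apply exp_ineq1; lra]. }
    unfold c', Rpower; split.
    - destruct (Req_dec (s * ln (1 + d')) 0) as [Z|NZ].
      + replace (- s * ln (1 + d')) with 0 by lra; rewrite exp_0; nra.
      + left; eapply Rle_lt_trans; [|apply exp_ineq1; lra].
        assert (s * ln (1 + d') <= s * e) by (apply Rmult_le_compat_l; lra); lra.
    - apply (Rle_trans _ (exp 0)); [apply exp_le|rewrite exp_0; lra].
      assert (0 <= s * ln (1 + d')) by (apply Rmult_le_pos; lra); lra. }
  assert (B : Cmod (J * RtoC (c' * G) - RtoC (2 * PI))%C <= 2 * e).
  { apply (Clim_le eventually (fun n => J * RtoC (c' * G0 (INR n)) - RtoC (2 * PI))%C).
    - apply Clim_minus; [apply eventually_filter| |apply Clim_const, eventually_filter].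
      apply Clim_scal; [apply eventually_filter|].
      apply Clim_components; [apply eventually_filter|]; simpl; split; [|apply filterlim_const].
      exact (is_lim_seq_scal_l _ c' _ LG).
    - destruct (exp_small d' e Hd' (proj1 He)) as [X0 [pX HX]].
      destruct (INR_unbounded X0) as [N HN]; exists N; intros n len.
      pose proof (le_INR _ _ len).
      specialize (HK' (INR n) (pos_INR n)); specialize (HX (INR n) ltac:(lra)); lra. }
  replace (J * RtoC G - RtoC (2 * PI))%C
    with ((J * RtoC (c' * G) - RtoC (2 * PI)) + J * RtoC ((1 - c') * G))%C
    by (rewrite !RtoC_mult, RtoC_minus; ring).
  eapply Rle_trans; [apply Cmod_triangle|].
  rewrite (Cmod_mult J), Cmod_R, Rabs_pos_eq by (apply Rmult_le_pos; lra).
  assert (Cmod J * ((1 - c') * G) <= Cmod J * (s * e * G)).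
  { apply Rmult_le_compat_l; [lra|]; apply Rmult_le_compat_r; lra. }
  lra. }
rewrite <- E; do 2 f_equal; unfold Gamma; apply is_RInt_gen_unique.
intros P [eps HP].
destruct (proj2 (is_lim_seq_spec _ _) LG (mkposreal _ (is_pos_div_2 eps))) as [N HN].
assert (pe : 0 < Rmin 1 (eps / 2)) by (apply Rmin_glb_lt; [lra|apply is_pos_div_2]).
apply (Filter_prod _ _ _ (fun a => 0 < a < Rmin 1 (eps / 2)) (fun b => INR N + 1 < b)).
- exists (mkposreal _ pe); intros a Ba pa; split; [exact pa|].
  unfold ball in Ba; simpl in Ba; unfold AbsRing_ball, abs, minus, plus, opp in Ba; simpl in Ba.
  apply Rabs_def2 in Ba; lra.
- exists (INR N + 1); intros b Hb; exact Hb.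
- intros a b [pa Ha] Hb; simpl fst; simpl snd.
  pose proof (Rmin_l 1 (eps / 2)); pose proof (Rmin_r 1 (eps / 2)); pose proof (pos_INR N).
  exists (G0 b - G0 a); split.
  + rewrite <- G0_diff; apply (is_RInt_ext g); [|apply (RInt_correct (V := R_CompleteNormedModule)), g_ex].
    intros x Hx; rewrite Rmin_left in Hx by lra.
    unfold g; rewrite rpow_pos by lra; apply Rmult_comm.
  + apply HP; unfold ball; simpl; unfold AbsRing_ball, abs, minus, plus, opp; simpl.
    specialize (HN N (Nat.le_refl N)); simpl in HN; apply Rabs_def2 in HN.
    assert (Gb : G0 (INR N) <= G0 b) by (apply G0_mono; lra).
    pose proof (LeG b).
    (* Near [0] the integrand is at most [1], so a lower bound [a < eps / 2] loses less than
       [eps / 2]. *)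
    assert (Ga : 0 <= G0 a <= a).
    { split; [apply G0_nonneg; lra|].
      replace a with (a - 0) at 2 by ring.
      pose proof (RInt_le g (fun _ => 1) 0 a ltac:(lra) (g_ex 0 a) (ex_RInt_const _ _ _)) as Q.
      rewrite RInt_const in Q; unfold scal in Q; simpl in Q; unfold mult in Q; simpl in Q.
      rewrite Rmult_1_r in Q; apply Q; intros x Hx.
      unfold g; assert (E1 : exp (- x) <= 1) by (apply (Rle_trans _ (exp 0)); [apply exp_le|rewrite exp_0]; lra).
      pose proof (rpow_small x (s - 1) ltac:(lra) ltac:(lra)) as R.
      rewrite Rabs_pos_eq in R by lra.
      pose proof (exp_pos (- x)); pose proof (rpow_nonneg x (s - 1)); nra. }
    apply Rabs_def1; lra.
Qed.

End GammaLine.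

(** The identity [J * Gamma s = 2 PI] itself shows that [Gamma s] is nonzero, which allows division
    by it. *)
Lemma Gamma_line (s b : R) :
  2 < s -> 0 <= b ->
  Gamma s <> 0 /\ is_line (fun t => Fk s b 0 (1, t)) (RtoC (2 * PI * rpow b (s - 1) / Gamma s)).
Proof.
intros Hs pb; destruct (Fk_line_ex s 1 0 ltac:(lra) (Rle_refl 0)) as [J HJ].
pose proof (gamma_line s J Hs HJ) as E.
assert (nG : Gamma s <> 0).
{ intros Z; rewrite Z, Cmult_0_r in E; apply RtoC_inj in E; pose proof PI_RGT_0; lra. }
split; [exact nG|].
assert (nGC : RtoC (Gamma s) <> 0) by (intros Z; apply nG, RtoC_inj, Z).
replace (RtoC (2 * PI * rpow b (s - 1) / Gamma s)) with (RtoC (rpow b (s - 1)) * J)%C.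
- now apply Fk_line_rpow.
- rewrite RtoC_div, (RtoC_mult (2 * PI)), <- E by exact nG; field; exact nGC.
Qed.

(** * Bessel functions as line integrals *)

Lemma ex_series_exp (x : R) : ex_series (fun j => x ^ j / INR (fact j)).
Proof.
exists (exp x); eapply is_series_ext; [|exact (is_exp_Reals x)].
intros n; unfold scal; simpl; unfold mult; simpl; rewrite pow_n_pow; unfold Rdiv; ring.
Qed.

Lemma Cmod_exp_term (u : C) (j : nat) : Cmod (RtoC (/ INR (fact j)) * u ^ j)%C = Cmod u ^ j / INR (fact j).
Proof.
rewrite Cmod_mult, Cmod_pow, Cmod_R, Rabs_pos_eq; [unfold Rdiv; ring|].
left; apply Rinv_0_lt_compat, INR_fact_lt_0.
Qed.

Lemma Csum_exp (u : C) : Csum (fun j => RtoC (/ INR (fact j)) * u ^ j)%C.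
Proof.
apply (Csum_le _ (fun j => Cmod u ^ j / INR (fact j))); [|apply ex_series_exp].
intros j; rewrite Cmod_exp_term; lra.
Qed.

Lemma cexp_series (u : C) : cexp u = CSer (fun j => RtoC (/ INR (fact j)) * u ^ j)%C.
Proof.
set (f := fun (n : nat) (t : R) => (RtoC (/ INR (fact n)) * (RtoC t * u) ^ n)%C).
set (g := fun (n : nat) (t : R) =>
            match n with O => RtoC 0 | S m => (u * f m t)%C end).
(* Majorants of the differentiated series for [|t| < 2], an open interval containing [[0, 1]]. *)
set (M := fun n : nat => match n with O => 0 | S m => Cmod u * ((2 * Cmod u) ^ m / INR (fact m)) end).
assert (D : forall n t, Cder (f n) t (g n t)).
{ intros [|n] t.
  - apply (Cder_ext (fun _ => RtoC 1)); [|apply Cder_const].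
    intros x; unfold f; simpl; rewrite Rinv_1; ring.
  - eapply Cder_eq.
    + apply Cder_scal, (Cder_pow (fun x => RtoC x * u)%C t u).
      eapply Cder_eq; [apply Cder_mult; [apply Cder_id|apply Cder_const]|]; cbv beta; ring.
    + unfold g, f; cbv beta.
      assert (nz : INR (fact n) <> 0) by apply INR_fact_neq_0.
      assert (nz' : INR (S n) <> 0) by (apply not_0_INR; lia).
      change (fact (S n)) with (S n * fact n)%nat; rewrite mult_INR, Rinv_mult, RtoC_mult.
      assert (E : (RtoC (/ INR (S n)) * RtoC (INR (S n)) = 1)%C).
      { rewrite <- RtoC_mult, Rinv_l by exact nz'; reflexivity. }
      transitivity (RtoC (/ INR (S n)) * RtoC (INR (S n)) * (u * (RtoC (/ INR (fact n)) * (RtoC t * u) ^ n)))%C; [ring|].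
      rewrite E; ring. }
assert (EM : ex_series M).
{ apply ex_series_incr_1; exact (ex_series_scal (Cmod u) _ (ex_series_exp (2 * Cmod u))). }
assert (BM : forall n t, -2 < t < 2 -> Cmod (g n t) <= M n).
{ intros [|n] t Ht; unfold g, M; [rewrite Cmod_0; lra|].
  rewrite Cmod_mult; apply Rmult_le_compat_l; [apply Cmod_ge_0|].
  unfold f; rewrite Cmod_exp_term; unfold Rdiv; apply Rmult_le_compat_r;
    [left; apply Rinv_0_lt_compat, INR_fact_lt_0|].
  apply pow_incr; split; [apply Cmod_ge_0|]; rewrite Cmod_mult, Cmod_R.
  apply Rmult_le_compat_r; [apply Cmod_ge_0|]; left; apply Rabs_def1; lra. }
set (E := fun t => CSer (fun n => f n t)).
assert (DE : forall t, -2 < t < 2 -> Cder E t (u * E t)%C).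
{ intros t Ht; eapply Cder_eq.
  - apply (Cder_CSer f g M (-2) 2 t Ht); [intros; apply D|exact BM|exact EM|].
    intros x _; apply Csum_exp.
  - assert (Sg : Csum (fun n => g n t)) by (apply (Csum_le _ M); [intros n; now apply BM|exact EM]).
    rewrite CSer_shift by exact Sg; unfold g at 1 2; unfold E; rewrite CSer_scal by apply Csum_exp; ring. }
assert (K : Cmod (E 1 * cexp (- (RtoC 1 * u)) - E 0 * cexp (- (RtoC 0 * u)))%C <= 0 * (1 - 0)).
{ apply (C_mean_value (fun t => E t * cexp (- (RtoC t * u)))%C (fun _ => RtoC 0) 0 1 0); [lra| |].
  - intros t Ht; eapply Cder_eq.
    + apply Cder_mult; [apply DE; lra|apply Cder_cexp, Cder_opp, Cder_mult; [apply Cder_id|apply Cder_const]].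
    + cbv beta; ring.
  - intros; rewrite Cmod_0; lra. }
assert (E0 : E 0 = 1).
{ unfold E; rewrite CSer_shift by apply Csum_exp.
  rewrite (CSer_ext _ (fun _ => RtoC 0)).
  - rewrite (CSer_RtoC (fun _ => 0)), Series_0 by reflexivity; unfold f; simpl; rewrite Rinv_1; ring.
  - intros n; unfold f; simpl; ring. }
rewrite E0 in K.
replace (- (RtoC 0 * u))%C with (RtoC 0) in K by ring; rewrite cexp_0 in K.
assert (Q : (E 1 * cexp (- u) = 1)%C).
{ apply Ceq_minus, Cmod_eq_0, Rle_antisym; [|apply Cmod_ge_0].
  replace (E 1 * cexp (- u) - 1)%C with (E 1 * cexp (- (1 * u)) - 1 * 1)%C; [lra|].
  replace (- (1 * u))%C with (- u)%C by ring; ring. }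
transitivity (E 1).
- transitivity (E 1 * cexp (- u) * cexp u)%C; [rewrite Q; ring|].
  rewrite <- Cmult_assoc, <- cexp_plus; replace (- u + u)%C with (RtoC 0) by ring; rewrite cexp_0; ring.
- unfold E; apply CSer_ext; intros n; unfold f; f_equal; f_equal; ring.
Qed.

Lemma two_div_le (x : R) : 1 <= x -> 2 / x <= 2.
Proof.
intros H; apply (Rmult_le_reg_r x); [lra|]; unfold Rdiv; rewrite Rmult_assoc, Rinv_l by lra; lra.
Qed.

Lemma tailw_le_2 (s : R) : 2 <= s -> tailw s 0 <= 2.
Proof. intros H; pose proof (tailw_le s 0 H) as E; simpl in E; lra. Qed.

Lemma CRInt_point (f : R -> C) (a : R) : CRInt f a a = 0.
Proof. unfold CRInt; rewrite !RInt_point; reflexivity. Qed.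

(** The degenerate segment [t1 = t2 = 0] of [Fk_line_bound]. *)
Lemma Fk_line_le (s b c : R) (l : C) :
  2 <= s -> 0 <= c -> is_line (fun t => Fk s b c (1, t)) l -> Cmod l <= 4 * exp (b + c).
Proof.
intros Hs Hc Hl.
pose proof (Fk_line_bound s b c 0 0 l Hs Hc Hl (Rle_refl _) (Rle_refl _)) as B.
rewrite CRInt_point in B; replace (0 - l)%C with (- l)%C in B by ring; rewrite Cmod_opp in B.
pose proof (tailw_le_2 s Hs); pose proof (exp_pos (b + c)); nra.
Qed.

(** Uniform in [s] and in [N], hence a majorant for all terms [s + j] of the expansion of
    [exp (c / w)]. *)
Lemma CRInt_Fk_sym_le (s b c : R) (N : nat) :
  2 <= s -> 0 <= c -> Cmod (CRInt (fun t => Fk s b c (1, t)) (- INR N) (INR N)) <= 8 * exp (b + c).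
Proof.
intros Hs Hc; destruct (Fk_line_ex s b c Hs Hc) as [l Hl].
pose proof (pos_INR N) as pN.
pose proof (Fk_line_bound s b c (- INR N) (INR N) l Hs Hc Hl ltac:(lra) pN) as B.
rewrite tailw_opp in B; pose proof (tailw_le s N Hs) as T.
assert (2 / (1 + INR N) <= 2).
{ apply two_div_le; lra. }
pose proof (Fk_line_le s b c l Hs Hc Hl) as L; pose proof (exp_pos (b + c)).
set (I := CRInt _ _ _) in *.
replace I with ((I - l) + l)%C by ring.
eapply Rle_trans; [apply Cmod_triangle|]; nra.
Qed.

Lemma Fk_series (s b c t : R) :
  Fk s b c (1, t) = CSer (fun j => RtoC (c ^ j / INR (fact j)) * Fk (s + INR j) b 0 (1, t))%C.
Proof.
set (w := (1, t) : C).
assert (nw : w <> 0) by (intros E; apply (f_equal fst) in E; simpl in E; lra).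
assert (Ew : cexp (clog w) = w) by (apply cexp_clog; simpl; lra).
unfold Fk; rewrite cexp_plus, (cexp_series (RtoC c * / w)), <- CSer_scal by apply Csum_exp.
apply CSer_ext; intros j.
unfold Rdiv; rewrite (RtoC_mult (c ^ j)), RtoC_pow.
assert (E : cexp (RtoC (- (s + INR j)) * clog w + RtoC b * w + RtoC 0 * / w) =
            (cexp (RtoC (- s) * clog w + RtoC b * w) * (/ w) ^ j)%C).
{ replace (RtoC (- (s + INR j)) * clog w + RtoC b * w + RtoC 0 * / w)%C
    with ((RtoC (- s) * clog w + RtoC b * w) + RtoC (INR j) * (- clog w))%C
    by (rewrite !RtoC_opp, RtoC_plus; ring).
  rewrite cexp_plus, cexp_nat; do 2 f_equal.
  assert (Q : (w * cexp (- clog w) = 1)%C).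
  { transitivity (cexp (clog w) * cexp (- clog w))%C; [rewrite Ew; reflexivity|].
    rewrite <- cexp_plus; replace (clog w + - clog w)%C with (RtoC 0) by ring; apply cexp_0. }
  transitivity (/ w * (w * cexp (- clog w)))%C; [field; exact nw|rewrite Q; ring]. }
rewrite E, Cpow_mult_l; ring.
Qed.

(** Two exchanges: on [[- N, N]] the expansion converges uniformly and is integrated term by term;
    then [N] tends to infinity by [Tannery], with the majorant [8 exp b c^j / j!]. *)
Lemma Fk_line_Bessel (nu b c : R) :
  1 < nu -> 0 <= b -> 0 <= c ->
  is_line (fun t => Fk (nu + 1) b c (1, t))
    (CSer (fun j => RtoC (c ^ j / INR (fact j)) *
                    RtoC (2 * PI * rpow b (nu + INR j) / Gamma (nu + INR j + 1)))%C).
Proof.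
intros Hnu Hb Hc.
pose (J := fun (j : nat) (N : nat) => CRInt (fun t => Fk (nu + 1 + INR j) b 0 (1, t)) (- INR N) (INR N)).
assert (pT : forall j, 0 <= c ^ j / INR (fact j)).
{ intros j; apply Rdiv_le_0_compat; [now apply pow_le|apply INR_fact_lt_0]. }
assert (CM : forall j z, Cmod (RtoC (c ^ j / INR (fact j)) * z)%C = c ^ j / INR (fact j) * Cmod z).
{ intros j z; rewrite Cmod_mult, Cmod_R, Rabs_pos_eq by apply pT; reflexivity. }
assert (Sj : forall j, 2 <= nu + 1 + INR j) by (intros j; pose proof (pos_INR j); lra).
apply (Clim_ext _ (fun N => CSer (fun j => RtoC (c ^ j / INR (fact j)) * J j N)%C)).
{ intros N; pose proof (pos_INR N) as pN.
  rewrite (CRInt_ext (fun t => Fk (nu + 1) b c (1, t))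
     (fun t => CSer (fun j => RtoC (c ^ j / INR (fact j)) * Fk (nu + 1 + INR j) b 0 (1, t))%C))
    by (lra || (intros; apply Fk_series)).
  destruct (CRInt_CSer (fun j t => RtoC (c ^ j / INR (fact j)) * Fk (nu + 1 + INR j) b 0 (1, t))%C
     (fun j => 2 * exp b * (c ^ j / INR (fact j))) (- INR N) (INR N)) as [_ E]; [lra| | | |].
  - intros j t; apply Ccont_mult; [apply Ccont_const|apply Ccont_Fk_line].
  - intros j t; rewrite CM.
    pose proof (Cmod_Fk_line (nu + 1 + INR j) b 0 t (Sj j) (Rle_refl 0)) as B.
    rewrite Rplus_0_r in B.
    assert (tail_fun 0 (Rabs t) <= 2).
    { apply two_div_le; pose proof (Rabs_pos t); nra. }
    pose proof (exp_pos b); pose proof (pT j).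
    rewrite (Rmult_comm (2 * exp b)); apply Rmult_le_compat_l; nra.
  - exact (ex_series_scal (2 * exp b) _ (ex_series_exp c)).
  - rewrite E; apply CSer_ext; intros j; symmetry; apply CRInt_scal; [lra|].
    intros; apply Ccont_Fk_line. }
apply (Tannery eventually) with (M := fun j => 8 * exp b * (c ^ j / INR (fact j))).
- exact (ex_series_scal (8 * exp b) _ (ex_series_exp c)).
- exists O; intros N _ j; rewrite CM.
  pose proof (CRInt_Fk_sym_le (nu + 1 + INR j) b 0 N (Sj j) (Rle_refl 0)) as B.
  rewrite Rplus_0_r in B; rewrite (Rmult_comm (8 * exp b)); apply Rmult_le_compat_l; [apply pT|exact B].
- intros j; apply Clim_scal; [apply eventually_filter|].
  pose proof (pos_INR j).
  destruct (Gamma_line (nu + 1 + INR j) b ltac:(lra) Hb) as [_ L].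
  replace (nu + INR j) with (nu + 1 + INR j - 1) by ring.
  replace (nu + 1 + INR j - 1 + 1) with (nu + 1 + INR j) by ring; exact L.
Qed.

(** The choice [c = z^2 / (4 b)] makes [b c = (z / 2)^2], so [b^j c^j] is the power in the Bessel
    series. *)
Lemma Fk_line_BesselI (nu b z : R) :
  1 < nu -> 0 < b -> 0 < z ->
  is_line (fun t => Fk (nu + 1) b (z ^ 2 / (4 * b)) (1, t))
    (RtoC (2 * PI * Rpower b nu * Rpower (z / 2) (- nu) * BesselI nu z)).
Proof.
intros Hnu Hb Hz.
assert (pc : 0 <= z ^ 2 / (4 * b)) by (apply Rdiv_le_0_compat; nra).
pose proof (Fk_line_Bessel nu b (z ^ 2 / (4 * b)) Hnu (Rlt_le _ _ Hb) pc) as L.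
eapply Clim_eq; [exact L|].
rewrite (CSer_ext _ (fun j => RtoC (2 * PI * Rpower b nu *
     ((z / 2) ^ (2 * j) / (INR (fact j) * Gamma (nu + INR j + 1)))))).
- rewrite CSer_RtoC, Series_scal_l; f_equal; unfold BesselI; rewrite rpow_pos by lra.
  transitivity (2 * PI * Rpower b nu * (Rpower (z / 2) (- nu) * Rpower (z / 2) nu) *
    Series (fun j => (z / 2) ^ (2 * j) / (INR (fact j) * Gamma (nu + INR j + 1)))); [|ring].
  rewrite <- Rpower_plus, Rplus_opp_l, Rpower_O by lra; ring.
- intros j; rewrite <- RtoC_mult; f_equal; rewrite rpow_pos by exact Hb.
  rewrite Rpower_plus, Rpower_pow by exact Hb.
  pose proof (pos_INR j).
  destruct (Gamma_line (nu + INR j + 1) b ltac:(lra) (Rlt_le _ _ Hb)) as [nG _].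
  pose proof (INR_fact_neq_0 j).
  rewrite pow_mult; replace ((z / 2) ^ 2) with (z ^ 2 / (4 * b) * b) by (field; lra).
  rewrite Rpow_mult_distr; field; auto.
Qed.

Lemma BesselI_0 (nu : R) : nu <> 0 -> BesselI nu 0 = 0.
Proof.
intros H; unfold BesselI, rpow; rewrite Rdiv_0_l.
destruct (Rlt_dec 0 0) as [L|_]; [lra|]; destruct (Req_EM_T nu 0) as [E|_]; [contradiction|ring].
Qed.

(** * Farey fractions *)

(** Pairs are numerator and denominator. Determinant one expresses neighbourhood, and the last
    inequality says that the mediant is not yet present at order [N]. *)
Definition farey_adj (N : nat) (a b : nat * nat) : Prop :=
  ((1 <= snd a <= N) /\ (1 <= snd b <= N) /\
   fst b * snd a = fst a * snd b + 1 /\ N < snd a + snd b)%nat.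

Fixpoint farey_chain (N : nat) (a : nat * nat) (l : list (nat * nat)) : Prop :=
  match l with
  | nil => True
  | b :: l' => farey_adj N a b /\ farey_chain N b l'
  end.

(** Passing to order [N + 1] inserts the mediant exactly when its denominator is [N + 1]. *)
Lemma farey_adj_step (N : nat) (a b : nat * nat) :
  farey_adj N a b ->
  farey_adj (S N) a b \/
  (farey_adj (S N) a (fst a + fst b, snd a + snd b) /\
   farey_adj (S N) (fst a + fst b, snd a + snd b) b)%nat.
Proof.
unfold farey_adj; intros (Ha & Hb & D & HN); cbn [fst snd].
destruct (Nat.eq_dec (snd a + snd b) (S N)) as [E|NE]; [right|left].
- repeat split; nia.
- repeat split; lia.
Qed.

Lemma farey_chain_step (N : nat) (z : nat * nat) (l : list (nat * nat)) (a : nat * nat) :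
  farey_chain N a (l ++ z :: nil) -> exists l', farey_chain (S N) a (l' ++ z :: nil).
Proof.
revert a; induction l as [|b l IH]; intros a; simpl; intros [A Hc].
- destruct (farey_adj_step N a z A) as [A'|[A1 A2]].
  + exists nil; simpl; auto.
  + eexists (_ :: nil); simpl; split; [exact A1|split; [exact A2|exact I]].
- destruct (IH b Hc) as [l' Hl'].
  destruct (farey_adj_step N a b A) as [A'|[A1 A2]].
  + exists (b :: l'); simpl; auto.
  + exists ((fst a + fst b, snd a + snd b)%nat :: b :: l'); simpl; auto.
Qed.

Lemma farey_chain_exists (N : nat) :
  (1 <= N)%nat -> exists l, farey_chain N (0, 1)%nat (l ++ (1, 1)%nat :: nil).
Proof.
induction N as [|N IH]; intros H; [lia|].
destruct (Nat.eq_dec N 0) as [->|NE].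
- exists nil; simpl; unfold farey_adj; simpl; lia.
- destruct (IH ltac:(lia)) as [l Hl]; exact (farey_chain_step N _ l _ Hl).
Qed.

Lemma farey_chain_denom (N : nat) (l : list (nat * nat)) (a x : nat * nat) :
  farey_chain N a l -> In x l -> (1 <= snd x <= N)%nat.
Proof.
revert a; induction l as [|b l IH]; intros a; simpl; [easy|].
intros [A Hc] [<-|Hx]; [unfold farey_adj in A; lia|now apply (IH b)].
Qed.

Lemma farey_chain_lt (N : nat) (l : list (nat * nat)) (a x : nat * nat) :
  farey_chain N a l -> In x l -> (fst a * snd x < fst x * snd a)%nat.
Proof.
revert a; induction l as [|b l IH]; intros a; simpl; [easy|].
intros [A Hc] [<-|Hx]; [unfold farey_adj in A; lia|].
pose proof (IH b Hc Hx); pose proof (farey_chain_denom N l b x Hc Hx).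
unfold farey_adj in A.
apply (Nat.mul_lt_mono_pos_r (snd b)); [lia|]; nia.
Qed.

Lemma farey_chain_NoDup (N : nat) (l : list (nat * nat)) (a : nat * nat) :
  farey_chain N a l -> NoDup (a :: l).
Proof.
revert a; induction l as [|b l IH]; intros a Hc.
- constructor; [easy|constructor].
- constructor; [|apply IH, Hc].
  intros Hx; pose proof (farey_chain_lt N _ a a Hc Hx); lia.
Qed.

Lemma gcd_det (h k h' k' : nat) : (h' * k = h * k' + 1)%nat -> Nat.gcd h k = 1%nat /\ Nat.gcd h' k' = 1%nat.
Proof.
intros D; split.
- apply Nat.divide_1_r; destruct (Nat.gcd_divide h k) as [d1 d2].
  apply (Nat.divide_add_cancel_r _ (h * k')); [now apply Nat.divide_mul_l|].
  rewrite <- D; now apply Nat.divide_mul_r.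
- apply Nat.divide_1_r; destruct (Nat.gcd_divide h' k') as [d1 d2].
  apply (Nat.divide_add_cancel_r _ (h * k')); [now apply Nat.divide_mul_r|].
  rewrite <- D; now apply Nat.divide_mul_l.
Qed.

Lemma farey_chain_gcd (N : nat) (l : list (nat * nat)) (a x : nat * nat) :
  farey_chain N a l -> In x l -> Nat.gcd (fst x) (snd x) = 1%nat.
Proof.
revert a; induction l as [|b l IH]; intros a; simpl; [easy|].
intros [A Hc] [<-|Hx]; [|now apply (IH b)].
destruct A as (_ & _ & D & _); exact (proj2 (gcd_det _ _ _ _ D)).
Qed.

Lemma fraction_eq (h k h' k' : nat) :
  (1 <= k)%nat -> (1 <= k')%nat -> Nat.gcd h k = 1%nat -> Nat.gcd h' k' = 1%nat ->
  (h * k' = h' * k)%nat -> h = h' /\ k = k'.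
Proof.
intros pk pk' G G' E.
assert (d1 : Nat.divide k k').
{ apply (Nat.gauss _ h); [|rewrite Nat.gcd_comm; exact G]; exists h'; lia. }
assert (d2 : Nat.divide k' k).
{ apply (Nat.gauss _ h'); [|rewrite Nat.gcd_comm; exact G']; exists h; lia. }
assert (k = k') by (apply Nat.divide_antisym; auto); subst k'; split; nia.
Qed.

Lemma farey_chain_complete (N : nat) (l : list (nat * nat)) (a z x : nat * nat) :
  farey_chain N a (l ++ z :: nil) -> Nat.gcd (fst a) (snd a) = 1%nat ->
  (1 <= snd x <= N)%nat -> Nat.gcd (fst x) (snd x) = 1%nat ->
  (fst a * snd x <= fst x * snd a)%nat -> (fst x * snd z < fst z * snd x)%nat -> In x (a :: l).
Proof.
assert (F : forall a b : nat * nat, farey_adj N a b -> Nat.gcd (fst a) (snd a) = 1%nat ->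
  (1 <= snd x <= N)%nat -> Nat.gcd (fst x) (snd x) = 1%nat ->
  (fst a * snd x <= fst x * snd a)%nat -> (fst x * snd b < fst b * snd x)%nat -> a = x).
{ intros [h k] [h' k'] (Ha & Hb & D & HN) Ga Hx Gx L1 L2; destruct x as [u v]; cbn [fst snd] in *.
  destruct (Nat.eq_dec (h * v) (u * k)) as [E|NE].
  - destruct (fraction_eq h k u v) as [-> ->]; auto; lia.
  - exfalso; assert (k + k' <= v)%nat; [|lia].
    (* A fraction [u / v] strictly between the neighbours is a combination of their denominators
       with positive integer coefficients, which forces [v >= k + k' > N]. *)
    assert (X : (v = (u * k - h * v) * k' + (h' * v - u * k') * k)%nat).
    { rewrite !Nat.mul_sub_distr_r; assert (h * v <= u * k)%nat by lia; assert (u * k' <= h' * v)%nat by lia. nia. }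
    assert (1 <= u * k - h * v)%nat by lia; assert (1 <= h' * v - u * k')%nat by lia; nia. }
revert a; induction l as [|b l IH]; intros a; simpl; intros [A Hc] Ga Hx Gx L1 L2.
- left; now apply (F a z).
- destruct (Nat.lt_ge_cases (fst x * snd b) (fst b * snd x)) as [lt|ge].
  + left; now apply (F a b).
  + right; apply IH; auto.
    destruct A as (_ & _ & D & _); exact (proj2 (gcd_det _ _ _ _ D)).
Qed.

(** * Sums over the reduced fractions in [[0, 1)] *)

Definition list_sum {G : AbelianMonoid} {A : Type} (f : A -> G) (l : list A) : G :=
  fold_right (fun x s => plus (f x) s) zero l.

Lemma list_sum_app {G : AbelianMonoid} {A : Type} (f : A -> G) (l l' : list A) :
  list_sum f (l ++ l') = plus (list_sum f l) (list_sum f l').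
Proof.
induction l as [|x l IH]; simpl; [now rewrite plus_zero_l|now rewrite IH, plus_assoc].
Qed.

Lemma list_sum_Permutation {G : AbelianMonoid} {A : Type} (f : A -> G) (l l' : list A) :
  Permutation l l' -> list_sum f l = list_sum f l'.
Proof.
intros P; induction P as [|x l l' P IH|x y l|l l' l'' P IH P' IH']; simpl; [easy|now rewrite IH| |congruence].
now rewrite !plus_assoc, (plus_comm (f y)).
Qed.

Definition reduced_fractions (N : nat) : list (nat * nat) :=
  flat_map (fun k => map (fun h => (h, k)) (filter (fun h => Nat.eqb (Nat.gcd h k) 1) (seq 0 k))) (seq 1 N).

Lemma In_reduced_fractions (N : nat) (x : nat * nat) :
  In x (reduced_fractions N) <->
  ((1 <= snd x <= N) /\ Nat.gcd (fst x) (snd x) = 1 /\ fst x < snd x)%nat.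
Proof.
unfold reduced_fractions; rewrite in_flat_map; split.
- intros [k [Hk Hx]]; apply in_map_iff in Hx as [h [<- Hh]].
  apply filter_In in Hh as [Hh G]; apply in_seq in Hk, Hh; apply Nat.eqb_eq in G; simpl; lia.
- intros (Hk & G & lt); exists (snd x); split; [apply in_seq; lia|].
  apply in_map_iff; exists (fst x); split; [now destruct x|].
  apply filter_In; split; [apply in_seq; lia|now apply Nat.eqb_eq].
Qed.

Lemma NoDup_reduced_fractions (N : nat) : NoDup (reduced_fractions N).
Proof.
unfold reduced_fractions; induction N as [|N IH]; [constructor|].
rewrite seq_S, flat_map_app; apply NoDup_app; [exact IH| |].
- unfold flat_map; rewrite app_nil_r; apply FinFun.Injective_map_NoDup;
    [intros u v E; congruence|apply NoDup_filter, seq_NoDup].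
- intros x Hx Hx'; apply (In_reduced_fractions N) in Hx; unfold flat_map in Hx'; rewrite app_nil_r in Hx'.
  apply in_map_iff in Hx' as [h [<- _]]; simpl in Hx; lia.
Qed.

Lemma list_sum_row {G : AbelianMonoid} (f : nat * nat -> G) (k n : nat) :
  list_sum f (map (fun h => (h, k)) (filter (fun h => Nat.eqb (Nat.gcd h k) 1) (seq 0 (S n)))) =
  sum_n_m (fun h => if Nat.eqb (Nat.gcd h k) 1 then f (h, k) else zero) 0 n.
Proof.
assert (R : forall (h : nat),
  list_sum f (map (fun h => (h, k)) (filter (fun h => Nat.eqb (Nat.gcd h k) 1) (h :: nil))) =
  if Nat.eqb (Nat.gcd h k) 1 then f (h, k) else zero).
{ intros h; simpl; destruct (Nat.eqb_spec (Nat.gcd h k) 1); simpl; [apply plus_zero_r|reflexivity]. }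
induction n as [|n IH].
- rewrite sum_n_n; exact (R O).
- rewrite seq_S, filter_app, map_app, list_sum_app, IH, sum_n_Sm by lia; f_equal; exact (R (S n)).
Qed.

Lemma list_sum_reduced_fractions {G : AbelianMonoid} (f : nat * nat -> G) (N : nat) :
  list_sum f (reduced_fractions N) =
  sum_n_m (fun k => sum_n_m (fun h => if Nat.eqb (Nat.gcd h k) 1 then f (h, k) else zero) 0 (k - 1)) 1 N.
Proof.
unfold reduced_fractions; induction N as [|N IH]; [rewrite sum_n_m_zero; [reflexivity|lia]|].
rewrite seq_S, flat_map_app, list_sum_app, IH, sum_n_Sm by lia; f_equal.
change (1 + N)%nat with (S N); unfold flat_map; rewrite app_nil_r, list_sum_row.
replace (S N - 1)%nat with N by lia; reflexivity.
Qed.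

(* [V j x] stands for the value at the endpoint shared by the arc at the
   fraction [x] and the arc at its left neighbour, whose denominator is [j]. *)
Lemma farey_telescope (N : nat) (V : nat -> nat * nat -> C) (L : nat * nat -> C) (e : nat * nat -> R) :
  (1 <= N)%nat ->
  (forall j a b, Nat.gcd (fst a) (snd a) = 1%nat -> (fst a < snd a)%nat -> (1 <= j <= N)%nat ->
     (N < j + snd a)%nat -> farey_adj N a b -> Cmod (V (snd a) b - V j a - L a) <= e a) ->
  Cmod (V N (1, 1)%nat - V N (0, 1)%nat
        - sum_n_m (fun k => sum_n_m (fun h => if Nat.eqb (Nat.gcd h k) 1 then L (h, k) else RtoC 0) 0 (k - 1)) 1 N)
  <= sum_n_m (fun k => sum_n_m (fun h => if Nat.eqb (Nat.gcd h k) 1 then e (h, k) else 0) 0 (k - 1)) 1 N.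
Proof.
intros pN Hstep.
destruct (farey_chain_exists N pN) as [l Hl].
(* Without its last element [1 / 1], the Farey chain lists every reduced fraction of [[0, 1)]
   exactly once, so the sum over it is the double sum over [k] and [h]. *)
assert (Hperm : Permutation ((0, 1)%nat :: l) (reduced_fractions N)).
{ apply NoDup_Permutation; [|apply NoDup_reduced_fractions|].
  - pose proof (farey_chain_NoDup _ _ _ Hl) as D; rewrite app_comm_cons in D.
    exact (NoDup_app_remove_r _ _ D).
  - intros x; rewrite In_reduced_fractions; split.
    + intros Hx.
      assert (lt : (fst x < snd x)%nat).
      { clear -Hl Hx; revert Hl Hx; generalize (0, 1)%nat; induction l as [|b l IH]; intros a Hl Hx.
        - destruct Hx as [<-|[]]; simpl in Hl; unfold farey_adj in Hl; simpl in Hl; lia.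
        - destruct Hx as [<-|Hx]; [|now apply (IH b); [apply Hl|]].
          assert (I : In (1, 1)%nat ((b :: l) ++ (1, 1)%nat :: nil)) by (apply in_or_app; right; now left).
          pose proof (farey_chain_lt N _ a _ Hl I) as Q; simpl in Q; lia. }
      destruct Hx as [<-|Hx]; [simpl in *; lia|].
      assert (Hx' : In x (l ++ (1, 1)%nat :: nil)) by (apply in_or_app; now left).
      split; [exact (farey_chain_denom _ _ _ _ Hl Hx')|split; [exact (farey_chain_gcd _ _ _ _ Hl Hx')|exact lt]].
    + intros (Hk & G & lt); apply (farey_chain_complete N l (0, 1)%nat (1, 1)%nat); auto; simpl; lia. }
pose proof (list_sum_reduced_fractions (G := C_AbelianMonoid) L N) as EL.
pose proof (list_sum_reduced_fractions (G := R_AbelianMonoid) e N) as Ee.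
rewrite <- (list_sum_Permutation _ _ _ Hperm) in EL; rewrite <- (list_sum_Permutation _ _ _ Hperm) in Ee.
change (@zero C_AbelianMonoid) with (RtoC 0) in EL; change (@zero R_AbelianMonoid) with 0 in Ee.
match goal with |- Cmod (_ - _ - ?x) <= ?y =>
  change x with (@sum_n_m C_AbelianMonoid (fun k => sum_n_m (fun h => if Nat.eqb (Nat.gcd h k) 1 then L (h, k) else RtoC 0) 0 (k - 1)) 1 N) end.
rewrite <- EL; eapply Rle_trans; [|right; exact Ee].
assert (Hsub : forall x, In x ((0, 1)%nat :: l) -> Nat.gcd (fst x) (snd x) = 1%nat /\ (fst x < snd x)%nat).
{ intros x Hx; apply (Permutation_in _ Hperm), In_reduced_fractions in Hx; tauto. }
clear Hperm EL Ee.
assert (Q : forall l a j, farey_chain N a (l ++ (1, 1)%nat :: nil) -> (1 <= j <= N)%nat -> (N < j + snd a)%nat ->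
  (forall x, In x (a :: l) -> Nat.gcd (fst x) (snd x) = 1%nat /\ (fst x < snd x)%nat) ->
  Cmod (V N (1, 1)%nat - V j a - list_sum (G := C_AbelianMonoid) L (a :: l))
    <= list_sum (G := R_AbelianMonoid) e (a :: l)).
{ clear l Hl Hsub; induction l as [|b l IH]; intros a j Hc Hj Hj' Hs.
  - simpl in Hc; destruct Hc as [A _]; destruct (Hs a (or_introl eq_refl)) as [G lt].
    pose proof (Hstep j a _ G lt Hj Hj' A) as B.
    (* The left neighbour of [1 / 1] has denominator [N], because it is at most [N] and exceeds
       [N - 1]. *)
    unfold farey_adj in A; simpl in A; replace (snd a) with N in B by lia.
    unfold list_sum; simpl fold_right; rewrite plus_zero_r, plus_zero_r; exact B.
  - destruct Hc as [A Hc]; destruct (Hs a (or_introl eq_refl)) as [G lt].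
    pose proof (Hstep j a b G lt Hj Hj' A) as B.
    assert (B' := IH b (snd a) Hc ltac:(unfold farey_adj in A; lia) ltac:(unfold farey_adj in A; lia)
                    (fun x Hx => Hs x (or_intror Hx))).
    change (list_sum (G := C_AbelianMonoid) L (a :: b :: l))
      with (L a + list_sum (G := C_AbelianMonoid) L (b :: l))%C.
    change (list_sum (G := R_AbelianMonoid) e (a :: b :: l))
      with (e a + list_sum (G := R_AbelianMonoid) e (b :: l)).
    set (X := list_sum (G := C_AbelianMonoid) L (b :: l)) in *.
    replace (V N (1, 1)%nat - V j a - (L a + X))%C
      with ((V (snd a) b - V j a - L a) + (V N (1, 1)%nat - V (snd a) b - X))%C by ring.
    eapply Rle_trans; [apply Cmod_triangle|]; lra. }
apply Q; auto; simpl; lia.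
Qed.

(** * Integration along the Ford circles *)

Definition primitive_coef (alpha : R) (n j : nat) : R :=
  if Nat.eqb j n then 0 else frac_partition alpha j / (INR j - INR n).

Lemma subexp_primitive_coef (alpha : R) (n : nat) : 0 <= alpha -> subexp (primitive_coef alpha n).
Proof.
intros pa; apply (subexp_le (frac_partition alpha)); [|now apply subexp_frac_partition].
intros j; unfold primitive_coef; destruct (Nat.eqb_spec j n) as [_|NE].
- rewrite Rabs_R0; apply Rabs_pos.
- assert (D : 1 <= Rabs (INR j - INR n)).
  { rewrite !INR_IZR_INZ, <- minus_IZR, <- abs_IZR; apply IZR_le; lia. }
  assert (nz : INR j - INR n <> 0) by (intros Z; rewrite Z, Rabs_R0 in D; lra).
  rewrite Rabs_div by exact nz.
  pose proof (Rabs_pos (frac_partition alpha j)).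
  apply (Rmult_le_reg_r (Rabs (INR j - INR n))); [lra|].
  unfold Rdiv; rewrite Rmult_assoc, Rinv_l by lra; nra.
Qed.

Lemma PS_derivative_shift (c : nat -> R) (w : C) :
  subexp c -> Cmod w < 1 ->
  (w * PS (fun n => INR (S n) * c (S n))%R w = PS (fun n => INR n * c n)%R w)%C /\
  subexp (fun n => INR n * c n).
Proof.
intros Sc lt.
assert (S1 : subexp (fun n => INR (S n) * c n)) by now apply subexp_mulS.
assert (S2 : subexp (fun n => INR n * c n)).
{ apply (subexp_le (fun n => INR (S n) * c n)); [|exact S1].
  intros n; rewrite !Rabs_mult; apply Rmult_le_compat_r; [apply Rabs_pos|].
  rewrite !Rabs_pos_eq by apply pos_INR; apply le_INR; lia. }
assert (S3 : subexp (fun n => INR (S n) * c (S n))) by exact (subexp_shift _ S2).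
split; [|exact S2]; unfold PS at 2; rewrite CSer_shift by exact (Csum_PS _ _ S2 lt).
unfold PS; rewrite <- CSer_scal by exact (Csum_PS _ _ S3 lt).
change (INR 0) with 0; rewrite Rmult_0_l, Cmult_0_l, Cplus_0_l.
apply CSer_ext; intros n; rewrite Cpow_S; ring.
Qed.

(* An antiderivative in [x] of [exp (2 pi n x) * sum_j p(j) exp (- 2 pi j x)]. The linear term
   comes from [j = n], and makes a translation by the period produce [p(n)]. *)
Definition primitive_series (alpha : R) (n : nat) (x : C) : C :=
  (RtoC (frac_partition alpha n) * x
   - / (2 * PIC) * (PS (primitive_coef alpha n) (qexp x) * qexp (- (INR n * x))))%C.

(** In the variable [x = - i tau], the period [tau -> tau + 1] is [x -> x - i]; only the linear term
    is not periodic. *)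
Lemma primitive_series_shift (alpha : R) (n : nat) (x : C) :
  primitive_series alpha n (x - Ci)%C = (primitive_series alpha n x - Ci * frac_partition alpha n)%C.
Proof.
unfold primitive_series.
assert (E1 : qexp (x - Ci)%C = qexp x).
{ replace (x - Ci)%C with (x + Ci * IZR (-1))%C by (change (IZR (-1)) with (- (1)); rewrite RtoC_opp; ring).
  rewrite qexp_plus, qexp_iZ; ring. }
assert (E2 : qexp (- (INR n * (x - Ci)))%C = qexp (- (INR n * x))%C).
{ replace (- (INR n * (x - Ci)))%C with (- (INR n * x) + Ci * IZR (Z.of_nat n))%C
    by (rewrite <- INR_IZR_INZ; ring).
  rewrite qexp_plus, qexp_iZ; ring. }
rewrite E1, E2; ring.
Qed.

Lemma Cder_primitive_series (alpha : R) (n : nat) (x x' : R -> C) (a b t : R) :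
  0 <= alpha -> a < t < b -> (forall y, a < y < b -> Cder x y (x' y)) -> Ccont x' t -> 0 < fst (x t) ->
  Cder (fun y => primitive_series alpha n (x y)) t
    (x' t * (PS (frac_partition alpha) (qexp (x t)) * qexp (- (INR n * x t))))%C.
Proof.
intros pa It D K pos; pose proof PIC_neq_0 as nP; pose proof C2_neq_0 as n2.
set (c := primitive_coef alpha n); set (q := qexp (x t)); set (e := qexp (- (INR n * x t))%C).
assert (Sc : subexp c) by now apply subexp_primitive_coef.
assert (lt : Cmod q < 1) by now apply Cmod_qexp_lt.
assert (Dq : forall y, a < y < b -> Cder (fun y => qexp (x y)) y (- (2 * PIC) * x' y * qexp (x y))%C).
{ intros y Iy; unfold qexp; eapply Cder_eq; [apply Cder_cexp, Cder_opp, Cder_scal, D, Iy|cbv beta; ring]. }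
assert (De : Cder (fun y => qexp (- (INR n * x y))%C) t ((2 * PIC) * INR n * x' t * e)%C).
{ unfold qexp; eapply Cder_eq;
    [apply Cder_cexp, Cder_opp, Cder_scal, Cder_opp, Cder_scal, D, It|cbv beta; unfold e, qexp; ring]. }
assert (DP : Cder (fun y => PS c (qexp (x y))) t
  (- (2 * PIC) * x' t * q * PS (fun n => INR (S n) * c (S n))%R q)%C).
{ apply (Cder_PS_loc c (fun y => qexp (x y)) (fun y => - (2 * PIC) * x' y * qexp (x y))%C a b t Sc It Dq); [|exact lt].
  apply Ccont_mult; [apply Ccont_mult; [apply Ccont_const|exact K]|].
  exact (Cder_Ccont _ _ _ (Dq t It)). }
destruct (PS_derivative_shift c q Sc lt) as [E S2].
unfold primitive_series; eapply Cder_eq.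
- apply Cder_minus; [apply Cder_scal, D, It|]; apply Cder_scal, Cder_mult; [exact DP|exact De].
- cbv beta; fold c q e.
  assert (qe : (q ^ n * e = 1)%C).
  { unfold q, e; rewrite qexp_pow, <- qexp_plus.
    replace (INR n * x t + - (INR n * x t))%C with (RtoC 0) by ring.
    unfold qexp; replace (- (2 * PIC * 0))%C with (RtoC 0) by ring; apply cexp_0. }
  set (p := frac_partition alpha) in *.
  assert (Sp : subexp p) by now apply subexp_frac_partition.
  (* Multiplying the coefficient [p(j) / (j - n)] by [j - n] restores [p(j)] for every [j] except
     [n], whose term is subtracted. *)
  assert (Sum : (PS p q - RtoC (p n) * q ^ n = PS (fun j => INR j * c j)%R q - INR n * PS c q)%C).
  { assert (F : forall j, (S n <= j)%nat -> (if Nat.eqb j n then RtoC (p n) * q ^ n else RtoC 0)%C = 0).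
    { intros j Hj; destruct (Nat.eqb_spec j n); [lia|reflexivity]. }
    destruct (CSer_finite _ _ F) as [SF EF].
    assert (EF' : CSer (fun j => if Nat.eqb j n then RtoC (p n) * q ^ n else RtoC 0)%C = (RtoC (p n) * q ^ n)%C).
    { rewrite EF; simpl Csumn; rewrite Nat.eqb_refl.
      rewrite (Csumn_ext _ (fun _ => RtoC 0)).
      - assert (Z : forall N, Csumn (fun _ => RtoC 0) N = 0) by (induction N as [|N IH]; simpl; [reflexivity|rewrite IH; ring]).
        rewrite Z; ring.
      - intros j Hj; destruct (Nat.eqb_spec j n); [lia|reflexivity]. }
    rewrite <- EF'; unfold PS.
    rewrite <- CSer_minus by (exact SF || exact (Csum_PS _ _ Sp lt)).
    rewrite <- CSer_scal by exact (Csum_PS _ _ Sc lt).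
    rewrite <- CSer_minus by (try apply Csum_scal; now apply Csum_PS).
    apply CSer_ext; intros j; unfold c, primitive_coef; fold p.
    destruct (Nat.eqb_spec j n) as [->|NE]; [rewrite Rmult_0_r; ring|].
    assert (nz : INR j - INR n <> 0) by (intros Z; apply NE, INR_eq; lra).
    replace (p j) with (INR j * (p j / (INR j - INR n)) - INR n * (p j / (INR j - INR n))) at 1
      by (field; exact nz).
    rewrite RtoC_minus, (RtoC_mult (INR n)); ring. }
  replace (- (2 * PIC) * x' t * q * PS (fun n0 => INR (S n0) * c (S n0))%R q)%C
    with (- (2 * PIC) * x' t * (q * PS (fun n0 => INR (S n0) * c (S n0))%R q))%C by ring.
  rewrite E.
  transitivity (x' t * (RtoC (p n) * (q ^ n * e) + (PS (fun j => INR j * c j)%R q - INR n * PS c q) * e))%C.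
  + rewrite qe; field; exact nP.
  + rewrite <- Sum; ring.
Qed.

(** The majorant of the [m]-th coefficient and exponential on [Re w = 1], where
    [|exp (b w)| = exp b]. *)
Definition frac_weight (alpha : R) (m : nat) : R :=
  frac_partition alpha m * exp (2 * PI * (alpha / 24 - INR m)).

Lemma ex_series_frac_weight (alpha : R) : 0 <= alpha -> ex_series (frac_weight alpha).
Proof.
intros pa.
assert (e1 : 0 <= exp (- (2 * PI)) < 1).
{ split; [left; apply exp_pos|]; apply (Rlt_le_trans _ (exp 0)); [apply exp_increasing; pose proof PI_RGT_0; lra|rewrite exp_0; lra]. }
pose proof (geo_ex _ (subexp_frac_partition alpha pa _ e1)) as E.
eapply ex_series_ext; [|exact (ex_series_scal (exp (2 * PI * (alpha / 24))) _ E)].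
intros m; unfold frac_weight, scal; simpl; unfold mult; simpl.
rewrite Rabs_pos_eq by (apply Rmult_le_pos; [now apply frac_partition_pos|apply pow_le; lra]).
replace (exp (- (2 * PI)) ^ m) with (exp (- (2 * PI * INR m))).
- replace (2 * PI * (alpha / 24 - INR m)) with (2 * PI * (alpha / 24) + - (2 * PI * INR m)) by ring.
  rewrite exp_plus; ring.
- rewrite <- Rpower_pow by apply exp_pos; unfold Rpower; rewrite ln_exp; f_equal; ring.
Qed.

(* Replacing every segment by the full line; the terms with [b m <= 0] disappear in the limit,
   as their line integral is [0] by [Fk_line_right]. *)
Lemma CRInt_Fk_series (s c t1 t2 : R) (b : nat -> R) (u l : nat -> C) :
  2 <= s -> 0 <= c -> t1 <= 0 -> 0 <= t2 ->
  ex_series (fun m => Cmod (u m) * exp (b m)) ->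
  (forall m, is_line (fun t => Fk s (b m) c (1, t)) (l m)) ->
  Cmod (CRInt (fun t => CSer (fun m => u m * Fk s (b m) c (1, t))%C) t1 t2 - CSer (fun m => u m * l m)%C)
  <= exp c * (tailw s t1 + tailw s t2) * Series (fun m => Cmod (u m) * exp (b m)).
Proof.
intros Hs Hc H1 H2 Hu Hl.
destruct (CRInt_CSer (fun m t => u m * Fk s (b m) c (1, t))%C
  (fun m => exp c * 2 * (Cmod (u m) * exp (b m))) t1 t2) as [_ E]; [lra| | | |].
- intros m t; apply Ccont_mult; [apply Ccont_const|apply Ccont_Fk_line].
- intros m t; rewrite Cmod_mult.
  pose proof (Cmod_Fk_line s (b m) c t Hs Hc) as B; rewrite exp_plus in B.
  assert (T : tail_fun 0 (Rabs t) <= 2) by (apply two_div_le; pose proof (Rabs_pos t); nra).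
  pose proof (Cmod_ge_0 (u m)); pose proof (exp_pos (b m)); pose proof (exp_pos c).
  replace (exp c * 2 * (Cmod (u m) * exp (b m))) with (Cmod (u m) * (exp (b m) * exp c * 2)) by ring.
  apply Rmult_le_compat_l; [assumption|]; eapply Rle_trans; [exact B|].
  apply Rmult_le_compat_l; [apply Rmult_le_pos; lra|exact T].
- exact (ex_series_scal (exp c * 2) _ Hu).
- assert (S1 : Csum (fun m => u m * l m)%C).
  { apply (Csum_le _ (fun m => 4 * exp c * (Cmod (u m) * exp (b m)))); [|exact (ex_series_scal (4 * exp c) _ Hu)].
    intros m; rewrite Cmod_mult.
    pose proof (Fk_line_le s (b m) c (l m) Hs Hc (Hl m)) as B; rewrite exp_plus in B.
    replace (4 * exp c * (Cmod (u m) * exp (b m))) with (Cmod (u m) * (4 * (exp (b m) * exp c))) by ring.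
    apply Rmult_le_compat_l; [apply Cmod_ge_0|exact B]. }
  assert (B : forall m, Cmod (u m * CRInt (fun t => Fk s (b m) c (1, t)) t1 t2 - u m * l m)%C <=
                   exp c * (tailw s t1 + tailw s t2) * (Cmod (u m) * exp (b m))).
  { intros m; pose proof (Fk_line_bound s (b m) c t1 t2 (l m) Hs Hc (Hl m) H1 H2) as B.
    rewrite exp_plus in B.
    replace (u m * CRInt (fun t => Fk s (b m) c (1, t)) t1 t2 - u m * l m)%C
      with (u m * (CRInt (fun t => Fk s (b m) c (1, t)) t1 t2 - l m))%C by ring.
    rewrite Cmod_mult.
    replace (exp c * (tailw s t1 + tailw s t2) * (Cmod (u m) * exp (b m)))
      with (Cmod (u m) * (exp (b m) * exp c * (tailw s t1 + tailw s t2))) by ring.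
    apply Rmult_le_compat_l; [apply Cmod_ge_0|exact B]. }
  set (K := exp c * (tailw s t1 + tailw s t2)) in *.
  assert (S2 : Csum (fun m => u m * CRInt (fun t => Fk s (b m) c (1, t)) t1 t2)%C).
  { apply (Csum_ext (fun m => (u m * CRInt (fun t => Fk s (b m) c (1, t)) t1 t2 - u m * l m) + u m * l m)%C);
      [intros m; ring|].
    apply Csum_plus; [|exact S1]; apply (Csum_le _ _ B); exact (ex_series_scal K _ Hu). }
  rewrite E, (CSer_ext _ (fun m => u m * CRInt (fun t => Fk s (b m) c (1, t)) t1 t2)%C).
  + rewrite <- CSer_minus by assumption; rewrite <- Series_scal_l.
    apply CSer_le; [exact B|exact (ex_series_scal K _ Hu)].
  + intros m; apply CRInt_scal; [lra|]; intros; apply Ccont_Fk_line.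
Qed.

(* With [x = - i tau], this is [tau = h / k + i / (k ^ 2 w)]; the line [Re w = 1] is mapped to
   the Ford circle at [h / k]. *)
Definition circle_point (h k : nat) (w : C) : C := ((/ (INR k * w) - iZ (Z.of_nat h)) / INR k)%C.

Lemma expi_cexp (t : R) : expi t = cexp (RtoC t * Ci)%C.
Proof.
unfold expi, cexp; simpl; rewrite !Rmult_0_r, Rmult_0_l, Rmult_1_r, Rminus_0_r, Rplus_0_r, exp_0.
f_equal; ring.
Qed.

Definition multiplier (alpha : R) (n h k : nat) (H : Z) (m : nat) : C :=
  expi (alpha * PI * dedekind_sum h k + 2 * PI / INR k * (INR m * IZR H - INR n * INR h)).

Lemma Z_gcd_coprime (h k : nat) : Nat.gcd h k = 1%nat -> Z.gcd (Z.of_nat h) (Z.of_nat k) = 1%Z.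
Proof.
intros G; apply Z.gcd_unique; [lia|apply Z.divide_1_l|apply Z.divide_1_l|].
intros d [u Eu] [v Ev].
assert (D : Nat.divide (Z.abs_nat d) 1).
{ rewrite <- G; apply Nat.gcd_greatest; [exists (Z.abs_nat u)|exists (Z.abs_nat v)];
    rewrite <- Zabs2Nat.inj_mul; [rewrite <- Eu|rewrite <- Ev]; symmetry; apply Zabs2Nat.id. }
apply Nat.divide_1_r in D; apply Z.divide_abs_l.
replace (Z.abs d) with 1%Z by lia; apply Z.divide_refl.
Qed.

Lemma fst_circle_point (h k : nat) (w : C) : (0 < k)%nat -> 0 < fst w -> 0 < fst (circle_point h k w).
Proof.
intros pk pw; assert (kR : 0 < INR k) by (apply lt_0_INR; lia).
assert (nk : RtoC (INR k) <> 0) by (intros E; apply RtoC_inj in E; lra).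
unfold circle_point; set (z := (/ (INR k * w))%C).
assert (pz : 0 < fst z).
{ apply Cinv_right; simpl; rewrite Rmult_0_l, Rminus_0_r; now apply Rmult_lt_0_compat. }
replace ((z - iZ (Z.of_nat h)) / INR k)%C with (RtoC (/ INR k) * (z - iZ (Z.of_nat h)))%C
  by (rewrite RtoC_inv by lra; field; exact nk).
replace (fst (RtoC (/ INR k) * (z - iZ (Z.of_nat h)))%C) with (/ INR k * fst z)
  by (unfold iZ; destruct z as [z1 z2]; simpl; ring).
apply Rmult_lt_0_compat; [now apply Rinv_0_lt_compat|exact pz].
Qed.

(** The transformation law is applied at [z = 1 / (k w)]. The transformed point is [w - i H / k],
    whose [m]-th power of [qexp] gives [exp (- 2 PI m w)] and the phase of [m H]; the factor
    [qexp (- n x)] gives [exp (2 PI n / (k^2 w))] and the phase of [- n h]. *)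
Lemma circle_integrand (alpha : R) (n h k : nat) (H : Z) (w : C) :
  0 <= alpha -> (0 < k)%nat -> Nat.gcd h k = 1%nat ->
  (Z.of_nat k | Z.of_nat h * H + 1)%Z -> 0 < fst w ->
  (/ (INR k * INR k * (w * w)) *
   (PS (frac_partition alpha) (qexp (circle_point h k w)) * qexp (- (INR n * circle_point h k w))) =
   RtoC (Rpower (INR k) (- (alpha / 2 + 2))) *
   CSer (fun m => RtoC (frac_partition alpha m) * multiplier alpha n h k H m *
      Fk (alpha / 2 + 2) (2 * PI * (alpha / 24 - INR m))
         (2 * PI * (INR n - alpha / 24) / (INR k * INR k)) w))%C.
Proof.
intros pa pk G Hd pw.
assert (kR : 0 < INR k) by (apply lt_0_INR; lia).
assert (nk : RtoC (INR k) <> 0) by (intros E; apply RtoC_inj in E; lra).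
assert (nw : w <> 0) by (intros E; rewrite E in pw; simpl in pw; lra).
set (kw := (INR k * w)%C).
assert (pkw : 0 < fst kw).
{ unfold kw; simpl; rewrite Rmult_0_l, Rminus_0_r; now apply Rmult_lt_0_compat. }
assert (nkw : kw <> 0) by (now apply Cmult_neq_0).
set (z := (/ kw)%C).
assert (pz : 0 < fst z) by (now apply Cinv_right).
assert (iz : (/ z)%C = kw) by (unfold z; field; exact nkw).
pose proof (LP_transformation k (Z.of_nat h) H z pk) as T.
rewrite <- dedekind_sum_Z in T by exact pk.
assert (G' : Z.gcd (Z.of_nat h) (Z.of_nat k) = 1%Z) by now apply Z_gcd_coprime.
specialize (T G' Hd pz).
change ((z - iZ (Z.of_nat h)) / INR k)%C with (circle_point h k w) in T.
set (x := circle_point h k w) in *.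
set (y := ((/ z - iZ H) / INR k)%C) in *.
assert (px : 0 < fst x) by now apply fst_circle_point.
assert (py : 0 < fst y).
{ unfold y; rewrite iz; unfold kw.
  assert (E : ((INR k * w - iZ H) / INR k)%C = (w - RtoC (/ INR k) * iZ H)%C)
    by (rewrite RtoC_inv by lra; field; exact nk).
  rewrite E; replace (fst (w - RtoC (/ INR k) * iZ H)%C) with (fst w)
    by (unfold iZ; simpl; ring).
  exact pw. }
rewrite PS_frac_partition by (exact pa || now apply Cmod_qexp_lt).
change (PS logP_coef (qexp x)) with (LP x); rewrite T.
set (r := (PIC * Ci * dedekind_sum h k + / 2 * clog z + PIC / (12 * INR k) * (/ z - z))%C).
replace (RtoC alpha * (LP y + PIC * Ci * dedekind_sum h k + / 2 * clog z + PIC / (12 * INR k) * (/ z - z)))%C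
  with (RtoC alpha * LP y + RtoC alpha * r)%C by (unfold r; ring).
rewrite cexp_plus; change (LP y) with (PS logP_coef (qexp y)).
rewrite <- PS_frac_partition by (exact pa || now apply Cmod_qexp_lt).
assert (Sp : Csum (fun m => RtoC (frac_partition alpha m) * qexp y ^ m)%C).
{ apply Csum_PS; [now apply subexp_frac_partition|now apply Cmod_qexp_lt]. }
transitivity ((/ (INR k * INR k * (w * w)) * (cexp (RtoC alpha * r) * qexp (- (INR n * x)))) *
   PS (frac_partition alpha) (qexp y))%C; [ring|].
set (c := 2 * PI * (INR n - alpha / 24) / (INR k * INR k)).
assert (Er : (RtoC alpha * r = RtoC (alpha * PI * dedekind_sum h k) * Ci - RtoC (alpha / 2) * (ln (INR k) + clog w)
            + 2 * PIC * RtoC (alpha / 24) * (w - / (INR k * INR k * w)))%C).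
{ unfold r, z; rewrite clog_inv by exact pkw; unfold kw at 1; rewrite clog_scal by assumption.
  assert (A1 : (RtoC alpha * (PIC / (12 * INR k)) = 2 * PIC * RtoC (alpha / 24) / INR k)%C).
  { transitivity (RtoC (alpha * (PI / (12 * INR k)))).
    - rewrite (RtoC_mult alpha), (RtoC_div PI), (RtoC_mult 12) by nra; reflexivity.
    - replace (alpha * (PI / (12 * INR k))) with (2 * PI * (alpha / 24) / INR k) by (field; lra).
      rewrite RtoC_div, (RtoC_mult (2 * PI)), (RtoC_mult 2) by lra; reflexivity. }
  assert (A2 : (RtoC alpha * / 2 = RtoC (alpha / 2))%C) by (rewrite RtoC_div by lra; reflexivity).
  rewrite RtoC_mult, (RtoC_mult alpha).
  transitivity (RtoC alpha * PIC * dedekind_sum h k * Ci + (RtoC alpha * / 2) * (- (ln (INR k) + clog w)) +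
    (RtoC alpha * (PIC / (12 * INR k))) * (/ / kw - / kw))%C; [ring|].
  rewrite A1, A2; unfold kw, PIC; field; auto. }
assert (E2 : (/ (INR k * INR k * (w * w)))%C = cexp (- (2 * (ln (INR k) + clog w)))%C).
{ rewrite cexp_opp; f_equal.
  replace (2 * (ln (INR k) + clog w))%C with ((ln (INR k) + clog w) + (ln (INR k) + clog w))%C by ring.
  rewrite !cexp_plus, cexp_R, exp_ln, cexp_clog by assumption; ring. }
assert (E3 : RtoC (Rpower (INR k) (- (alpha / 2 + 2))) = cexp (RtoC (- (alpha / 2 + 2) * ln (INR k)))).
{ rewrite cexp_R; reflexivity. }
set (K1 := (/ (INR k * INR k * (w * w)) * (cexp (RtoC alpha * r) * qexp (- (INR n * x))))%C).
set (K2 := RtoC (Rpower (INR k) (- (alpha / 2 + 2)))).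
assert (nK : K2 <> 0).
{ intros Z; apply RtoC_inj in Z; pose proof (exp_pos (- (alpha / 2 + 2) * ln (INR k))); unfold Rpower in Z; lra. }
(* Every factor is an exponential, so the identity becomes one between exponents. *)
assert (Tm : forall m, (RtoC (frac_partition alpha m) * multiplier alpha n h k H m *
  Fk (alpha / 2 + 2) (2 * PI * (alpha / 24 - INR m)) c w =
  K1 * / K2 * (RtoC (frac_partition alpha m) * qexp y ^ m))%C).
{ intros m.
  transitivity (/ K2 * (K2 * (RtoC (frac_partition alpha m) * multiplier alpha n h k H m *
    Fk (alpha / 2 + 2) (2 * PI * (alpha / 24 - INR m)) c w)))%C; [field; exact nK|].
  transitivity (/ K2 * (K1 * (RtoC (frac_partition alpha m) * qexp y ^ m)))%C; [f_equal|ring].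
  unfold K1, K2; rewrite E2, E3.
  unfold Fk, multiplier; rewrite expi_cexp, qexp_pow; unfold qexp; rewrite Er.
  match goal with |- (?E * (?P * ?F * ?J) = ?A * (?B * ?D) * (?P * ?Q))%C =>
    transitivity (P * (E * F * J))%C; [ring|transitivity (P * (A * B * D * Q))%C; [|ring]] end.
  rewrite <- !cexp_plus; do 2 f_equal.
  unfold x, y; rewrite iz; unfold circle_point, kw, iZ, c.
  rewrite <- !INR_IZR_INZ.
  assert (Ec : RtoC (2 * PI * (INR n - alpha / 24) / (INR k * INR k)) =
               (2 * PIC * (INR n - RtoC (alpha / 24)) / (INR k * INR k))%C).
  { unfold PIC; rewrite <- RtoC_minus, <- !RtoC_mult, <- RtoC_div by nra; reflexivity. }
  assert (Ea : RtoC (- (alpha / 2 + 2)) = (- (RtoC (alpha / 2) + 2))%C).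
  { rewrite <- RtoC_plus, <- RtoC_opp; reflexivity. }
  assert (Eb : RtoC (2 * PI * (alpha / 24 - INR m)) = (2 * PIC * (RtoC (alpha / 24) - INR m))%C).
  { unfold PIC; rewrite <- RtoC_minus, <- !RtoC_mult; reflexivity. }
  assert (Et : RtoC (alpha * PI * dedekind_sum h k + 2 * PI / INR k * (INR m * IZR H - INR n * INR h)) =
    (RtoC (alpha * PI * dedekind_sum h k) + 2 * PIC / INR k * (INR m * IZR H - INR n * INR h))%C).
  { unfold PIC; rewrite <- !RtoC_mult, <- RtoC_minus, <- RtoC_div, <- RtoC_mult, <- RtoC_plus by lra; reflexivity. }
  rewrite Ec, Eb, Et, (RtoC_mult (- (alpha / 2 + 2)) (ln (INR k))), Ea.
  field; auto. }
rewrite (CSer_ext _ _ Tm), CSer_scal by exact Sp; unfold PS; field; exact nK.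
Qed.

Lemma multiplier_Cmod (alpha : R) (n h k : nat) (H : Z) (m : nat) : Cmod (multiplier alpha n h k H m) = 1.
Proof.
unfold multiplier; rewrite expi_cexp, Cmod_cexp.
set (t := alpha * PI * _ + _); replace (fst (RtoC t * Ci)%C) with 0 by (simpl; ring); apply exp_0.
Qed.

Lemma Cder_circle_point (h k : nat) (t : R) :
  (0 < k)%nat ->
  Cder (fun v => circle_point h k (1, v)) t (- Ci * / (INR k * INR k * ((1, t) * (1, t))))%C.
Proof.
intros pk; assert (kR : 0 < INR k) by (apply lt_0_INR; lia).
assert (nk : RtoC (INR k) <> 0) by (intros E; apply RtoC_inj in E; lra).
assert (nw : (1, t) <> RtoC 0) by (intros E; apply (f_equal fst) in E; simpl in E; lra).
unfold circle_point, Cdiv; eapply Cder_eq.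
- apply Cder_mult; [|apply Cder_const]; apply Cder_minus; [|apply Cder_const].
  apply Cder_inv; [apply Cder_scal, Cder_vertical|]; now apply Cmult_neq_0.
- cbv beta; set (w := (1, t) : C) in *; field; auto.
Qed.

Lemma arc_bound (alpha : R) (n h k : nat) (H : Z) (t1 t2 : R) (l : nat -> C) :
  0 <= alpha -> alpha / 24 <= INR n -> (0 < k)%nat -> Nat.gcd h k = 1%nat ->
  (Z.of_nat k | Z.of_nat h * H + 1)%Z -> t1 <= 0 -> 0 <= t2 ->
  (forall m, is_line (fun t => Fk (alpha / 2 + 2) (2 * PI * (alpha / 24 - INR m))
                                  (2 * PI * (INR n - alpha / 24) / (INR k * INR k)) (1, t)) (l m)) ->
  Cmod (Ci * primitive_series alpha n (circle_point h k (1, t2)) - Ci * primitive_series alpha n (circle_point h k (1, t1))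
        - RtoC (Rpower (INR k) (- (alpha / 2 + 2)))
          * CSer (fun m => RtoC (frac_partition alpha m) * multiplier alpha n h k H m * l m))%C
  <= Rpower (INR k) (- (alpha / 2 + 2)) *
     (exp (2 * PI * (INR n - alpha / 24) / (INR k * INR k)) *
      (tailw (alpha / 2 + 2) t1 + tailw (alpha / 2 + 2) t2) * Series (frac_weight alpha)).
Proof.
intros pa pn pk G Hd H1 H2 Hl.
assert (kR : 0 < INR k) by (apply lt_0_INR; lia).
assert (nk : RtoC (INR k) <> 0) by (intros E; apply RtoC_inj in E; lra).
pose proof PI_RGT_0 as pP.
set (s := alpha / 2 + 2) in *; set (c := 2 * PI * (INR n - alpha / 24) / (INR k * INR k)) in *.
set (b := fun m => 2 * PI * (alpha / 24 - INR m)).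
set (u := fun m => (RtoC (frac_partition alpha m) * multiplier alpha n h k H m)%C).
assert (pc : 0 <= c) by (apply Rdiv_le_0_compat; [apply Rmult_le_pos; lra|nra]).
assert (Hs : 2 <= s) by (unfold s; lra).
assert (Cu : forall m, Cmod (u m) = frac_partition alpha m).
{ intros m; unfold u; rewrite Cmod_mult, multiplier_Cmod, Cmod_R, Rmult_1_r.
  apply Rabs_pos_eq; now apply frac_partition_pos. }
assert (Wu : forall m, Cmod (u m) * exp (b m) = frac_weight alpha m).
{ intros m; rewrite Cu; reflexivity. }
assert (Eu : ex_series (fun m => Cmod (u m) * exp (b m))).
{ eapply ex_series_ext; [intros m; symmetry; apply Wu|now apply ex_series_frac_weight]. }
set (K := RtoC (Rpower (INR k) (- s))).
set (S := fun t => CSer (fun m => u m * Fk s (b m) c (1, t))%C).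
assert (CS : forall t, Ccont S t).
{ intros t; apply (Ccont_CSer _ (fun m => exp c * 2 * (Cmod (u m) * exp (b m)))).
  - exact (ex_series_scal (exp c * 2) _ Eu).
  - apply filter_forall; intros v m; rewrite Cmod_mult.
    pose proof (Cmod_Fk_line s (b m) c v Hs pc) as B; rewrite exp_plus in B.
    assert (T : tail_fun 0 (Rabs v) <= 2) by (apply two_div_le; pose proof (Rabs_pos v); nra).
    pose proof (exp_pos (b m)); pose proof (exp_pos c).
    replace (exp c * 2 * (Cmod (u m) * exp (b m))) with (Cmod (u m) * (exp (b m) * exp c * 2)) by ring.
    apply Rmult_le_compat_l; [apply Cmod_ge_0|]; eapply Rle_trans; [exact B|].
    apply Rmult_le_compat_l; [apply Rmult_le_pos; lra|exact T].
  - intros m; apply Ccont_mult; [apply Ccont_const|apply Ccont_Fk_line]. }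
(* The tangent of the circle contributes [- Ci / (k^2 w^2)]; the factor [Ci] in front of the
   primitive removes its phase. *)
assert (D : forall t, Cder (fun v => Ci * primitive_series alpha n (circle_point h k (1, v)))%C t (K * S t)%C).
{ intros t; assert (nw : (1, t) <> RtoC 0) by (intros E; apply (f_equal fst) in E; simpl in E; lra).
  eapply Cder_eq.
  - apply Cder_scal, (Cder_primitive_series alpha n (fun v => circle_point h k (1, v))
      (fun v => - Ci * / (INR k * INR k * ((1, v) * (1, v))))%C (t - 1) (t + 1) t pa); [lra| | |].
    + intros y _; now apply Cder_circle_point.
    + apply Ccont_mult; [apply Ccont_const|apply Ccont_inv].
      * apply Ccont_mult; [apply Ccont_const|apply Ccont_mult; apply Ccont_vertical].
      * repeat apply Cmult_neq_0; assumption.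
    + apply fst_circle_point; [exact pk|simpl; lra].
  - pose proof (circle_integrand alpha n h k H (1, t) pa pk G Hd ltac:(simpl; lra)) as E.
    cbv beta; transitivity (/ (INR k * INR k * ((1, t) * (1, t))) *
      (PS (frac_partition alpha) (qexp (circle_point h k (1, t))) * qexp (- (INR n * circle_point h k (1, t)))))%C.
    + assert (I : (Ci * Ci = - (1))%C) by (unfold Ci; apply injective_projections; simpl; ring).
      match goal with |- (Ci * (- Ci * ?X * ?Y) = ?X * ?Y)%C =>
        transitivity (- (Ci * Ci) * (X * Y))%C; [ring|rewrite I; ring] end.
    + exact E. }
assert (F := CRInt_FTC _ (fun t => K * S t)%C t1 t2 ltac:(lra) (fun t _ => D t)
  (fun t _ => Ccont_mult _ _ _ (Ccont_const _ _) (CS t))).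
rewrite <- F, CRInt_scal by (lra || (intros; apply CS)).
replace (K * CRInt S t1 t2 - K * CSer (fun m => RtoC (frac_partition alpha m) * multiplier alpha n h k H m * l m))%C
  with (K * (CRInt S t1 t2 - CSer (fun m => u m * l m)))%C by (unfold u; ring).
rewrite Cmod_mult; unfold K; rewrite Cmod_R, Rabs_pos_eq by (left; apply exp_pos).
apply Rmult_le_compat_l; [left; apply exp_pos|].
rewrite <- (Series_ext _ _ Wu).
now apply CRInt_Fk_series.
Qed.

Lemma Rpower_anti (x y a : R) : 0 < x -> x <= y -> 0 <= a -> Rpower y (- a) <= Rpower x (- a).
Proof.
intros px le pa; rewrite !Rpower_Ropp; apply Rinv_le_contravar; [apply exp_pos|].
now apply Rle_Rpower_l.
Qed.

(** [|1 + i t|] is at least both [1] and [t], hence at least [x / 2]. It is applied with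
    [x = N / k]: the height at an end of an arc is the denominator of the neighbour over [k], and
    the two denominators add up to more than [N]. *)
Lemma tailw_arc (a t x : R) : 0 <= a -> 0 < x -> x <= 1 + t -> 0 <= t -> tailw (a + 2) t <= Rpower (2 / x) (a + 1).
Proof.
intros pa px le pt; unfold tailw; rewrite (Rabs_pos_eq t) by exact pt.
replace (a + 2 - 2) with a by ring.
assert (B : x / 2 <= Cmod (1, t)).
{ pose proof (fst_le_Cmod (1, t)) as B1; pose proof (snd_le_Cmod (1, t)) as B2; simpl in B1, B2.
  rewrite Rabs_R1 in B1; rewrite Rabs_pos_eq in B2 by exact pt; lra. }
rewrite Rpower_plus, Rpower_1 by (apply Rdiv_lt_0_compat; lra).
apply Rmult_le_compat; [left; apply exp_pos|apply Rdiv_le_0_compat; lra| |].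
- eapply Rle_trans; [apply (Rpower_anti (x / 2)); [lra|exact B|exact pa]|right].
  unfold Rpower; f_equal; rewrite !ln_div by lra; ring.
- unfold Rdiv; apply Rmult_le_compat_l; [lra|]; apply Rinv_le_contravar; lra.
Qed.

(** Neighbouring Ford circles touch at this point. There [k w = k + i k'] on one circle and
    [k' w = k' - i k = - i (k + i k')] on the other; the determinant relation does the rest. *)
Lemma circle_point_tangency (h k h' k' : nat) :
  (0 < k)%nat -> (0 < k')%nat -> (h' * k = h * k' + 1)%nat ->
  circle_point h' k' (1, - (INR k / INR k')) = circle_point h k (1, INR k' / INR k).
Proof.
intros pk pk' D.
assert (kR : 0 < INR k) by (apply lt_0_INR; lia).
assert (kR' : 0 < INR k') by (apply lt_0_INR; lia).
apply (f_equal INR) in D; rewrite plus_INR, !mult_INR in D; simpl (INR 1) in D.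
unfold circle_point, iZ; rewrite <- !INR_IZR_INZ.
set (A := INR k) in *; set (B := INR k') in *.
assert (nA : RtoC A <> 0) by (intros E; apply RtoC_inj in E; lra).
assert (nB : RtoC B <> 0) by (intros E; apply RtoC_inj in E; lra).
assert (E1 : (RtoC B * (1, (- (A / B))%R) = - Ci * (A + Ci * B))%C).
{ apply injective_projections; simpl; field; lra. }
assert (E2 : (RtoC A * (1, (B / A)%R) = A + Ci * B)%C).
{ apply injective_projections; simpl; field; lra. }
rewrite E1, E2.
assert (nz : (A + Ci * B)%C <> 0).
{ intros E; apply (f_equal fst) in E; simpl in E; lra. }
assert (nI : (- Ci)%C <> 0) by (intros E; apply (f_equal snd) in E; simpl in E; lra).
assert (I : (/ (- Ci * (A + Ci * B)) = Ci * / (A + Ci * B))%C).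
{ assert (I2 : (Ci * Ci = - (1))%C) by (unfold Ci; apply injective_projections; simpl; ring).
  transitivity (- (Ci * Ci) * / (- Ci * (A + Ci * B)))%C; [rewrite I2; ring|].
  assert (nI' : Ci <> 0) by (intros E; apply (f_equal snd) in E; simpl in E; lra).
  field; auto. }
rewrite I.
assert (D' : (INR h' * A = INR h * B + 1)%C).
{ rewrite <- !RtoC_mult, <- RtoC_plus, D; reflexivity. }
assert (Z : forall u v : C, (u * (A * B) = v * (A * B) -> u = v)%C).
{ intros u v E; transitivity (u * (A * B) * / (A * B))%C; [field; auto|rewrite E; field; auto]. }
apply Z.
transitivity ((Ci * (A + Ci * B)) * / (A + Ci * B) + B * / (A + Ci * B) - Ci * (INR h' * A)
  + (- (Ci * Ci) - 1) * (B * / (A + Ci * B)))%C; [field; auto|].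
rewrite D'.
assert (I2 : (Ci * Ci = - (1))%C) by (unfold Ci; apply injective_projections; simpl; ring).
rewrite I2; field; auto.
Qed.

(** * The limit *)

Lemma Clim_Rpower_bound (f : nat -> C) (l : C) (K a : R) :
  0 < a -> (forall N, (1 <= N)%nat -> Cmod (l - f N)%C <= K * Rpower (2 / INR N) a) -> Clim eventually f l.
Proof.
intros pa B eps.
set (K' := Rabs K + 1).
assert (pK : 0 < K') by (unfold K'; pose proof (Rabs_pos K); lra).
set (d := Rpower (eps / K') (/ a)).
assert (pd : 0 < d) by apply exp_pos.
destruct (INR_unbounded (2 / d)) as [N0 HN].
exists (S N0); intros N HN'.
assert (HN0 : INR N0 + 1 <= INR N) by (rewrite <- S_INR; now apply le_INR).
pose proof (pos_INR N0) as p0.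
assert (pe : 0 < eps / K') by (apply Rdiv_lt_0_compat; [apply cond_pos|exact pK]).
assert (lt : Rpower (2 / INR N) a < eps / K').
{ replace (eps / K') with (Rpower d a).
  - apply Rlt_Rpower_l; [exact pa|]; split; [apply Rdiv_lt_0_compat; lra|].
    apply (Rmult_lt_reg_r (INR N)); [lra|]; unfold Rdiv; rewrite Rmult_assoc, Rinv_l, Rmult_1_r by lra.
    apply (Rmult_lt_reg_r (/ d)); [now apply Rinv_0_lt_compat|].
    replace (d * INR N * / d) with (INR N) by (field; lra); unfold Rdiv in HN; lra.
  - unfold d; rewrite Rpower_mult, Rinv_l, Rpower_1 by lra; reflexivity. }
replace (f N - l)%C with (- (l - f N))%C by ring; rewrite Cmod_opp.
eapply Rle_lt_trans; [apply B; lia|].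
apply (Rle_lt_trans _ (K' * Rpower (2 / INR N) a)).
- apply Rmult_le_compat_r; [left; apply exp_pos|]; unfold K'; pose proof (Rle_abs K); lra.
- apply (Rmult_lt_compat_l K') in lt; [|exact pK].
  replace (K' * (eps / K')) with (pos eps) in lt by (field; lra); exact lt.
Qed.

Definition farey_term (alpha : R) (n : nat) (H : nat -> nat -> Z) (l : nat -> nat -> C) (x : nat * nat) : C :=
  (RtoC (Rpower (INR (snd x)) (- (alpha / 2 + 2))) *
   CSer (fun m => RtoC (frac_partition alpha m)
                  * multiplier alpha n (fst x) (snd x) (H (snd x) (fst x)) m * l (snd x) m))%C.

Lemma farey_limit (alpha : R) (n : nat) (H : nat -> nat -> Z) (l : nat -> nat -> C) :
  0 < alpha -> alpha / 24 <= INR n ->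
  (forall k h : nat, (h < k)%nat -> Nat.gcd h k = 1%nat -> (Z.of_nat k | Z.of_nat h * H k h + 1)%Z) ->
  (forall k m, (0 < k)%nat ->
     is_line (fun t => Fk (alpha / 2 + 2) (2 * PI * (alpha / 24 - INR m))
                          (2 * PI * (INR n - alpha / 24) / (INR k * INR k)) (1, t)) (l k m)) ->
  Clim eventually
    (fun N => sum_n_m (fun k => sum_n_m (fun h =>
       if Nat.eqb (Nat.gcd h k) 1 then farey_term alpha n H l (h, k) else RtoC 0) 0 (k - 1)) 1 N)
    (RtoC (frac_partition alpha n)).
Proof.
intros pa pn HH Hl; pose proof PI_RGT_0 as pP.
set (a := alpha / 2); set (c1 := 2 * PI * (INR n - alpha / 24)).
assert (pc1 : 0 <= c1) by (apply Rmult_le_pos; lra).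
set (W := Series (frac_weight alpha)).
assert (pW : 0 <= W).
{ rewrite <- (Series_0 (fun _ => 0)) by reflexivity; apply Series_le; [|now apply ex_series_frac_weight, Rlt_le].
  intros m; split; [lra|]; apply Rmult_le_pos; [now apply frac_partition_pos, Rlt_le|left; apply exp_pos]. }
apply (Clim_Rpower_bound _ _ (4 * exp c1 * W) a); [unfold a; lra|]; intros N pN.
assert (NR : 1 <= INR N) by (change 1 with (INR 1); now apply le_INR).
set (E := 2 * exp c1 * W * Rpower (2 / INR N) (a + 1)).
assert (pE : 0 <= E).
{ unfold E; apply Rmult_le_pos; [apply Rmult_le_pos; [pose proof (exp_pos c1); lra|exact pW]|left; apply exp_pos]. }
(* The value at the left end of the arc: by tangency with the left neighbour, of denominator [j],
   its parameter is [- j / k]. *)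
set (V := fun (j : nat) (x : nat * nat) =>
  (Ci * primitive_series alpha n (circle_point (fst x) (snd x) (1, (- (INR j / INR (snd x)))%R)))%C).
pose proof (farey_telescope N V (farey_term alpha n H l) (fun x => E / INR (snd x)) pN) as T.
(* The two extreme points differ by one period, as both [0 / 1] and [1 / 1] have a left neighbour of
   denominator [N], for [0 / 1] the fraction [- 1 / N]. *)
assert (EV : (V N (1, 1)%nat - V N (0, 1)%nat)%C = RtoC (frac_partition alpha n)).
{ unfold V; cbn [fst snd].
  replace (circle_point 1 1 (1, (- (INR N / INR 1))%R)) with (circle_point 0 1 (1, (- (INR N / INR 1))%R) - Ci)%C.
  - rewrite primitive_series_shift.
    assert (I : (Ci * Ci = - (1))%C) by (unfold Ci; apply injective_projections; simpl; ring).
    set (q := primitive_series _ _ _).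
    transitivity (- (Ci * Ci) * RtoC (frac_partition alpha n))%C; [ring|rewrite I; ring].
  - unfold circle_point, iZ; change (IZR (Z.of_nat 0)) with 0; change (IZR (Z.of_nat 1)) with 1.
    change (INR 1) with 1.
    set (u := (/ _)%C); field. }
rewrite EV in T; eapply Rle_trans; [apply T|].
- intros j [h k] [h' k'] G lt Hj Hjk A; cbn [fst snd] in *.
  destruct A as (_ & Hk' & D & HN); cbn [fst snd] in *.
  assert (pk : (0 < k)%nat) by lia.
  assert (kR : 1 <= INR k) by (change 1 with (INR 1); apply le_INR; lia).
  assert (jR : 0 <= INR j) by apply pos_INR.
  assert (kR' : 0 <= INR k') by apply pos_INR.
  assert (N1 : INR N <= INR j + INR k) by (rewrite <- plus_INR; apply le_INR; lia).
  assert (N2 : INR N <= INR k + INR k') by (rewrite <- plus_INR; apply le_INR; lia).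
  assert (t1 : 0 <= INR j / INR k) by (apply Rdiv_le_0_compat; lra).
  assert (t2 : 0 <= INR k' / INR k) by (apply Rdiv_le_0_compat; lra).
  unfold V; cbn [fst snd]; rewrite (circle_point_tangency h k h' k') by lia.
  unfold farey_term; cbn [fst snd].
  eapply Rle_trans; [apply (arc_bound alpha n h k (H k h) (- (INR j / INR k)) (INR k' / INR k) (l k));
    auto; try lra; now apply Rlt_le|].
  fold a W; rewrite tailw_opp.
  assert (pX : 0 < INR N / INR k) by (apply Rdiv_lt_0_compat; lra).
  assert (div : forall y, INR N <= y + INR k -> INR N / INR k <= 1 + y / INR k).
  { intros y Hy; apply (Rmult_le_reg_r (INR k)); [lra|].
    replace (INR N / INR k * INR k) with (INR N) by (field; lra).
    replace ((1 + y / INR k) * INR k) with (y + INR k) by (field; lra); exact Hy. }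
  assert (T1 := tailw_arc a (INR j / INR k) (INR N / INR k) ltac:(unfold a; lra) pX (div _ N1) t1).
  assert (T2 := tailw_arc a (INR k' / INR k) (INR N / INR k) ltac:(unfold a; lra) pX (div (INR k') ltac:(lra)) t2).
  set (X := Rpower (2 / (INR N / INR k)) (a + 1)) in *.
  assert (C1 : exp (2 * PI * (INR n - alpha / 24) / (INR k * INR k)) <= exp c1).
  { apply exp_le; fold c1; apply (Rmult_le_reg_r (INR k * INR k)); [nra|].
    replace (c1 / (INR k * INR k) * (INR k * INR k)) with c1 by (field; lra).
    assert (1 <= INR k * INR k) by nra; nra. }
  apply (Rle_trans _ (Rpower (INR k) (- (a + 2)) * (exp c1 * (X + X) * W))).
  + apply Rmult_le_compat_l; [left; apply exp_pos|]; apply Rmult_le_compat_r; [exact pW|].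
    apply Rmult_le_compat; [left; apply exp_pos| |exact C1|lra].
    apply Rplus_le_le_0_compat; apply Rmult_le_pos; try (left; apply exp_pos);
      apply Rdiv_le_0_compat; pose proof (Rabs_pos (INR j / INR k)); pose proof (Rabs_pos (INR k' / INR k)); lra.
  + right; unfold E.
    (* [k^(- a - 2) (2 k / N)^(a + 1) = (2 / N)^(a + 1) / k]: all powers of [k] but one cancel. *)
    assert (X1 : Rpower (INR k) (- (a + 2)) * X = Rpower (2 / INR N) (a + 1) / INR k).
    { transitivity (Rpower (2 / INR N) (a + 1) * exp (- ln (INR k)));
        [|rewrite exp_Ropp, exp_ln by lra; reflexivity].
      unfold X, Rpower; rewrite <- !exp_plus; f_equal.
      rewrite !ln_div by lra; ring. }
    transitivity (2 * exp c1 * W * (Rpower (INR k) (- (a + 2)) * X)); [ring|rewrite X1; unfold Rdiv; ring].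
(* At most [k] numerators at cost [E / k] each give at most [E] for every [k <= N]. *)
- apply (Rle_trans _ (sum_n_m (fun _ => E) 1 N)).
  + apply sum_n_m_le; intros k; cbn [snd].
    destruct k as [|k]; [simpl; rewrite sum_n_n; simpl; exact pE|].
    assert (kR : 0 < INR (S k)) by (apply lt_0_INR; lia).
    apply (Rle_trans _ (sum_n_m (fun _ => E / INR (S k)) 0 (S k - 1))).
    * apply sum_n_m_le; intros h; destruct (Nat.eqb _ _); [lra|]; apply Rdiv_le_0_compat; lra.
    * rewrite sum_n_m_const; replace (S (S k - 1) - 0)%nat with (S k) by lia; right; field; lra.
  + rewrite sum_n_m_const; replace (S N - 1)%nat with N by lia; right.
    unfold E; rewrite Rpower_plus, Rpower_1 by (apply Rdiv_lt_0_compat; lra); field; lra.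
Qed.

(** Comparison with the telescoping series of [x^(- (s - 1)) / (s - 1)]. The inequality needed is
    [(y / x)^(s - 1) >= 1 + (s - 1) / y] for [y = x + 1], which follows from
    [ln y - ln x >= 1 / y]. *)
Lemma ex_series_Rpower (s : R) : 1 < s -> ex_series (fun j => Rpower (INR (S j)) (- s)).
Proof.
intros Hs; apply ex_series_incr_1.
set (b := fun j : nat => / (s - 1) * Rpower (INR (S j)) (- (s - 1))).
assert (Lb : is_lim_seq b 0).
{ replace (Finite 0) with (Rbar_mult (/ (s - 1)) (Finite 0)) by (simpl; f_equal; ring).
  apply is_lim_seq_scal_l.
  assert (L : Clim eventually (fun j => RtoC (Rpower (INR (S j)) (- (s - 1)))) 0).
  { apply (Clim_Rpower_bound _ _ 1 (s - 1)); [lra|]; intros N pN.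
    assert (NR : 1 <= INR N) by (change 1 with (INR 1); now apply le_INR).
    match goal with |- Cmod (RtoC 0 - ?x)%C <= _ => replace (RtoC 0 - x)%C with (- x)%C by ring end.
    rewrite Cmod_opp, Cmod_R, Rabs_pos_eq, Rmult_1_l by (left; apply exp_pos).
    rewrite S_INR, Rpower_Ropp.
    replace (/ Rpower (INR N + 1) (s - 1)) with (Rpower (/ (INR N + 1)) (s - 1)).
    - apply Rle_Rpower_l; [lra|]; split; [apply Rinv_0_lt_compat; lra|].
      apply (Rmult_le_reg_r (INR N * (INR N + 1))); [nra|].
      replace (/ (INR N + 1) * (INR N * (INR N + 1))) with (INR N) by (field; lra).
      replace (2 / INR N * (INR N * (INR N + 1))) with (2 * (INR N + 1)) by (field; lra); lra.
    - unfold Rpower; rewrite <- exp_Ropp, ln_Rinv by lra; f_equal; ring. }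
  apply Clim_components in L; [|apply eventually_filter]; exact (proj1 L). }
apply (ex_series_le (V := R_CompleteNormedModule) _ (fun j => b j - b (S j))); [|now apply ex_series_telescope].
intros j; change (norm (Rpower (INR (S (S j))) (- s))) with (Rabs (Rpower (INR (S (S j))) (- s))).
rewrite Rabs_pos_eq by (left; apply exp_pos); unfold b.
rewrite (S_INR (S j)); set (x := INR (S j)).
assert (px : 1 <= x) by (unfold x; change 1 with (INR 1); apply le_INR; lia).
set (y := x + 1).
assert (L1 : / y <= ln y - ln x).
{ assert (L : ln (x / y) <= x / y - 1).
  { apply Rminus_le_0; pose proof (exp_ineq1_le (ln (x / y))) as Q.
    rewrite exp_ln in Q by (apply Rdiv_lt_0_compat; unfold y; lra); lra. }
  rewrite ln_div in L by (unfold y; lra).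
  replace (x / y - 1) with (- / y) in L by (unfold y; field; lra); lra. }
assert (L2 : Rpower y (- (s - 1)) * (1 + (s - 1) * / y) <= Rpower x (- (s - 1))).
{ replace (Rpower x (- (s - 1))) with (Rpower y (- (s - 1)) * exp ((s - 1) * (ln y - ln x)))
    by (unfold Rpower; rewrite <- exp_plus; f_equal; ring).
  apply Rmult_le_compat_l; [left; apply exp_pos|].
  eapply Rle_trans; [|apply exp_ineq1_le]; apply Rplus_le_compat_l, Rmult_le_compat_l; lra. }
replace (Rpower y (- s)) with (Rpower y (- (s - 1)) * / y).
- apply (Rmult_le_reg_l (s - 1)); [lra|].
  replace ((s - 1) * (/ (s - 1) * Rpower x (- (s - 1)) - / (s - 1) * Rpower y (- (s - 1))))
    with (Rpower x (- (s - 1)) - Rpower y (- (s - 1))) by (field; lra); lra.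
- rewrite <- (Rpower_1 y) at 2 by (unfold y; lra); rewrite <- Rpower_Ropp, <- Rpower_plus; f_equal; ring.
Qed.

Lemma Csum_is_series (a : nat -> C) : Csum a -> @is_series C_AbsRing C_NormedModule a (CSer a).
Proof.
intros Sa; unfold is_series.
apply (filterlim_locally_ball_norm (K := C_AbsRing) (U := C_NormedModule)); intros eps.
destruct (CSer_Clim a Sa eps) as [N HN]; exists N; intros k lek.
rewrite <- Csumn_sum_n; exact (HN (S k) ltac:(lia)).
Qed.

Lemma Clim_sum_n {T : Type} (F : (T -> Prop) -> Prop) {FF : ProperFilter F} (f : nat -> T -> C) (l : nat -> C) (q : nat) :
  (forall m, (m <= q)%nat -> Clim F (f m) (l m)) -> Clim F (fun x => sum_n (fun m => f m x) q) (sum_n l q).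
Proof.
induction q as [|q IH]; intros H.
- apply (Clim_ext _ (f O)); [intros x; now rewrite sum_O|rewrite sum_O; now apply H].
- apply (Clim_ext _ (fun x => sum_n (fun m => f m x) q + f (S q) x)%C); [intros x; now rewrite sum_Sn|].
  rewrite sum_Sn; apply Clim_plus; [apply FF|apply IH; intros m Hm; apply H; lia|apply H; lia].
Qed.

Lemma Cmod_kloosterman (alpha : R) (k : nat) (H : nat -> Z) (n m : nat) :
  (0 < k)%nat -> Cmod (kloosterman alpha k H n m) <= INR k.
Proof.
intros pk; unfold kloosterman.
match goal with |- Cmod (sum_n_m ?f 0 _) <= _ => change (Cmod (sum_n f (k - 1)) <= INR k); set (g := f) end.
rewrite <- Csumn_sum_n; replace (S (k - 1)) with k by lia.
rewrite <- (Rmult_1_r (INR k)); apply Csumn_Cmod_le.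
intros h _; unfold g; destruct (Nat.eqb _ _); [|rewrite Cmod_0; lra].
rewrite expi_cexp, Cmod_cexp; set (t := alpha * PI * _ + _).
replace (fst (RtoC t * Ci)%C) with 0 by (simpl; ring); rewrite exp_0; lra.
Qed.

(** [D] and [B] stand for the factor of the line integral free of [k] and for the Bessel factor; the
    remaining power of [k] cancels the one in [farey_term]. *)
Lemma farey_term_BesselI (alpha : R) (n h k : nat) (H : nat -> nat -> Z) (q : nat) (D : nat -> R) (B : nat -> nat -> R) :
  0 < alpha -> (0 < k)%nat -> Nat.gcd h k = 1%nat ->
  farey_term alpha n H (fun k m => if Nat.leb m q
    then RtoC (D m * Rpower (INR k) (alpha / 2 + 2) * B k m) else RtoC 0) (h, k) =
  sum_n (fun m => RtoC (D m * frac_partition alpha m) * (RtoC (B k m) * multiplier alpha n h k (H k h) m))%C q.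
Proof.
intros pa pk G; unfold farey_term; cbn [fst snd].
set (K := Rpower (INR k) (alpha / 2 + 2)).
assert (E : Rpower (INR k) (- (alpha / 2 + 2)) * K = 1).
{ unfold K; rewrite <- Rpower_plus, Rplus_opp_l, Rpower_O; [reflexivity|apply lt_0_INR; lia]. }
set (a := fun m => (RtoC (frac_partition alpha m) * multiplier alpha n h k (H k h) m *
  (if Nat.leb m q then RtoC (D m * K * B k m) else RtoC 0))%C).
destruct (CSer_finite a (S q)) as [_ Ea].
{ intros m Hm; unfold a; destruct (Nat.leb_spec m q); [lia|ring]. }
change (RtoC (Rpower (INR k) (- (alpha / 2 + 2))) * CSer a =
  sum_n (fun m => RtoC (D m * frac_partition alpha m) * (RtoC (B k m) * multiplier alpha n h k (H k h) m))%C q)%C.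
rewrite Ea, <- Csumn_scal, <- Csumn_sum_n.
apply Csumn_ext; intros m Hm; unfold a; destruct (Nat.leb_spec m q) as [_|]; [|lia].
transitivity (RtoC (Rpower (INR k) (- (alpha / 2 + 2)) * K) *
  (RtoC (D m * frac_partition alpha m) * (RtoC (B k m) * multiplier alpha n h k (H k h) m)))%C;
  [rewrite !RtoC_mult; ring|rewrite E; ring].
Qed.

Lemma farey_row_kloosterman (alpha : R) (n k : nat) (H : nat -> nat -> Z) (q : nat) (D : nat -> R) (B : nat -> nat -> R) :
  0 < alpha -> (0 < k)%nat ->
  sum_n_m (fun h => if Nat.eqb (Nat.gcd h k) 1
    then farey_term alpha n H (fun k m => if Nat.leb m q
           then RtoC (D m * Rpower (INR k) (alpha / 2 + 2) * B k m) else RtoC 0) (h, k)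
    else RtoC 0) 0 (k - 1) =
  sum_n (fun m => RtoC (D m * frac_partition alpha m) *
                  (RtoC (B k m) * kloosterman alpha k (H k) n m))%C q.
Proof.
intros pa pk.
transitivity (sum_n (fun h => sum_n (fun m => RtoC (D m * frac_partition alpha m) * (RtoC (B k m) *
  (if Nat.eqb (Nat.gcd h k) 1 then multiplier alpha n h k (H k h) m else RtoC 0)))%C q) (k - 1)).
- apply sum_n_m_ext; intros h; destruct (Nat.eqb_spec (Nat.gcd h k) 1) as [G|_].
  + now apply farey_term_BesselI.
  + rewrite <- Csumn_sum_n, (Csumn_ext _ (fun _ => 0 * 0)%C) by (intros; ring).
    rewrite Csumn_scal; match goal with |- ?u = ?v => change (@eq C u v) end; ring.
- rewrite sum_n_switch; apply sum_n_ext; intros m.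
  rewrite <- Csumn_sum_n, !Csumn_scal, Csumn_sum_n; reflexivity.
Qed.

(** With [b = 2 PI mu^2] and [c = 2 PI nu^2 / k^2], one has [b c = (z / 2)^2] for the argument [z]
    of the Bessel function. The outer powers come from [b^s (z / 2)^(- s) = (mu k / nu)^s] with
    [s = alpha / 2 + 1]. *)
Lemma line_value (alpha : R) (n m k : nat) :
  0 < alpha -> alpha / 24 < INR n -> INR m <= alpha / 24 -> (0 < k)%nat ->
  is_line (fun t => Fk (alpha / 2 + 2) (2 * PI * (alpha / 24 - INR m))
                       (2 * PI * (INR n - alpha / 24) / (INR k * INR k)) (1, t))
    (RtoC (rpow (nu alpha n) (- (alpha / 2) - 1) * rpow (mu alpha m) (alpha / 2 + 1)
           * Rpower (INR k) (alpha / 2 + 2)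
           * (2 * PI / INR k * BesselI (alpha / 2 + 1) (4 * PI / INR k * nu alpha n * mu alpha m)))).
Proof.
intros pa pn pm pk; pose proof PI_RGT_0 as pP.
assert (kR : 0 < INR k) by (apply lt_0_INR; lia).
assert (Hnu : 0 < nu alpha n) by (apply sqrt_lt_R0; lra).
assert (Enu : nu alpha n * nu alpha n = INR n - alpha / 24) by (apply sqrt_sqrt; lra).
destruct pm as [lt|E].
- assert (Hmu : 0 < mu alpha m) by (apply sqrt_lt_R0; lra).
  assert (Emu : mu alpha m * mu alpha m = alpha / 24 - INR m) by (apply sqrt_sqrt; lra).
  rewrite <- Enu, <- Emu.
  set (v := nu alpha n) in *; set (u := mu alpha m) in *; set (s := alpha / 2 + 1) in *.
  set (z := 4 * PI / INR k * v * u).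
  assert (pz : 0 < z).
  { unfold z; apply Rmult_lt_0_compat; [apply Rmult_lt_0_compat; [apply Rdiv_lt_0_compat|]|]; lra. }
  assert (pb : 0 < 2 * PI * (u * u)) by (apply Rmult_lt_0_compat; [lra|nra]).
  pose proof (Fk_line_BesselI s (2 * PI * (u * u)) z ltac:(unfold s; lra) pb pz) as L.
  replace (z ^ 2 / (4 * (2 * PI * (u * u)))) with (2 * PI * (v * v) / (INR k * INR k)) in L
    by (unfold z; field; lra).
  replace (s + 1) with (alpha / 2 + 2) in L by (unfold s; ring).
  eapply Clim_eq; [exact L|f_equal].
  rewrite !rpow_pos by assumption.
  assert (Eq : Rpower (2 * PI * (u * u)) s * Rpower (z / 2) (- s) =
    Rpower v (- (alpha / 2) - 1) * Rpower u s * Rpower (INR k) (alpha / 2 + 2) * / INR k).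
  { transitivity (Rpower v (- (alpha / 2) - 1) * Rpower u s * Rpower (INR k) (alpha / 2 + 2) * exp (- ln (INR k)));
      [|rewrite exp_Ropp, exp_ln by exact kR; reflexivity].
    unfold Rpower; rewrite <- !exp_plus; f_equal.
    replace (z / 2) with ((2 * PI) * (v * u) / INR k) by (unfold z; field; lra).
    assert (0 < v * u) by nra; assert (0 < u * u) by nra.
    rewrite ln_div, !ln_mult by (lra || (apply Rmult_lt_0_compat; lra)).
    unfold s; ring. }
  transitivity (2 * PI * (Rpower (2 * PI * (u * u)) s * Rpower (z / 2) (- s)) * BesselI s z); [ring|].
  rewrite Eq; field; lra.
(* When [m = alpha / 24], the Bessel function vanishes at [0] and so does the line integral, by a
   shift to the right. *)
- assert (Emu : mu alpha m = 0) by (unfold mu; rewrite E, Rminus_diag, sqrt_0; reflexivity).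
  rewrite Emu, Rmult_0_r, BesselI_0 by lra; rewrite !Rmult_0_r.
  apply Fk_line_right; [lra|rewrite E; lra|].
  apply Rdiv_le_0_compat; [apply Rmult_le_pos; lra|nra].
Qed.

(** The bound [4 exp (b + c)] for the line integral, with [c] at most its value at [k = 1], is read
    backwards through [line_value]: the Bessel factor is [O(k^(- alpha/2 - 1))]. The bound [k] for
    the Kloosterman sum cancels [1 / k], and [alpha / 2 + 1 > 1]. *)
Lemma Csum_kloosterman_BesselI (alpha : R) (n m : nat) (H : nat -> nat -> Z) :
  0 < alpha -> alpha / 24 < INR n -> INR m <= alpha / 24 ->
  Csum (fun j => let k := S j in
    (RtoC (2 * PI / INR k) * kloosterman alpha k (H k) n m
     * RtoC (BesselI (alpha / 2 + 1) (4 * PI / INR k * nu alpha n * mu alpha m)))%C).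
Proof.
intros pa pn pm; pose proof PI_RGT_0 as pP; cbv zeta.
assert (Hnu : 0 < nu alpha n) by (apply sqrt_lt_R0; lra).
pose proof (fun k pk => line_value alpha n m k pa pn pm pk) as L.
destruct pm as [lt|E].
- assert (Hmu : 0 < mu alpha m) by (apply sqrt_lt_R0; lra).
  set (D := rpow (nu alpha n) (- (alpha / 2) - 1) * rpow (mu alpha m) (alpha / 2 + 1)) in *.
  assert (pD : 0 < D) by (unfold D; rewrite !rpow_pos by assumption; apply Rmult_lt_0_compat; apply exp_pos).
  set (M := 4 * exp (2 * PI * (alpha / 24 - INR m) + 2 * PI * (INR n - alpha / 24))).
  apply (Csum_le _ (fun j => M / D * Rpower (INR (S j)) (- (alpha / 2 + 1)))).
  + intros j; set (k := S j).
    assert (kR : 1 <= INR k) by (change 1 with (INR 1); apply le_INR; unfold k; lia).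
    specialize (L k ltac:(unfold k; lia)); set (B := BesselI _ _) in *.
    set (c := 2 * PI * (INR n - alpha / 24) / (INR k * INR k)) in *.
    assert (pc : 0 <= c) by (apply Rdiv_le_0_compat; [apply Rmult_le_pos; lra|nra]).
    apply Fk_line_le in L; [|lra|exact pc].
    rewrite Cmod_R in L.
    assert (Lc : c <= 2 * PI * (INR n - alpha / 24)).
    { unfold c; set (c1 := 2 * PI * (INR n - alpha / 24)).
      assert (0 <= c1) by (apply Rmult_le_pos; lra).
      apply (Rmult_le_reg_r (INR k * INR k)); [nra|].
      replace (c1 / (INR k * INR k) * (INR k * INR k)) with c1 by (field; lra).
      assert (1 <= INR k * INR k) by nra; nra. }
    assert (LM : 4 * exp (2 * PI * (alpha / 24 - INR m) + c) <= M).
    { unfold M; apply Rmult_le_compat_l; [lra|]; apply exp_le; lra. }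
    set (P := Rpower (INR k) (alpha / 2 + 2)) in *.
    assert (pPk : 0 < P) by apply exp_pos.
    assert (EA : Rabs (D * P * (2 * PI / INR k * B)) = D * P * (2 * PI / INR k * Rabs B)).
    { rewrite !Rabs_mult, (Rabs_pos_eq D), (Rabs_pos_eq P), (Rabs_pos_eq (2 * PI / INR k));
        [reflexivity|apply Rdiv_le_0_compat; lra|lra|lra]. }
    rewrite EA in L.
    rewrite !Cmod_mult, !Cmod_R, (Rabs_pos_eq (2 * PI / INR k)) by (apply Rdiv_le_0_compat; lra).
    assert (EP : Rpower (INR k) (- (alpha / 2 + 1)) = INR k * / P).
    { unfold P; rewrite <- Rpower_Ropp; rewrite <- (Rpower_1 (INR k)) at 2 by lra.
      rewrite <- Rpower_plus; f_equal; ring. }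
    rewrite EP.
    pose proof (Cmod_kloosterman alpha k (H k) n m ltac:(unfold k; lia)) as Kl.
    set (X := 2 * PI / INR k) in *.
    assert (pX : 0 <= X) by (unfold X; apply Rdiv_le_0_compat; lra).
    pose proof (Rabs_pos B) as pB.
    apply (Rle_trans _ (X * INR k * Rabs B)).
    { apply Rmult_le_compat_r; [exact pB|]; apply Rmult_le_compat_l; assumption. }
    apply (Rmult_le_reg_r (D * P)); [now apply Rmult_lt_0_compat|].
    replace (M / D * (INR k * / P) * (D * P)) with (INR k * M) by (field; lra).
    replace (X * INR k * Rabs B * (D * P)) with (INR k * (D * P * (X * Rabs B))) by ring.
    apply Rmult_le_compat_l; lra.
  + exact (ex_series_scal (M / D) _ (ex_series_Rpower (alpha / 2 + 1) ltac:(lra))).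
- assert (Emu : mu alpha m = 0) by (unfold mu; rewrite E, Rminus_diag, sqrt_0; reflexivity).
  apply (CSer_finite _ 0); intros j _; rewrite Emu, Rmult_0_r, BesselI_0 by lra; ring.
Qed.

(** The partial sums over Farey fractions are finite sums over [m <= q] of partial sums of the
    series in [k]. Each of these converges on its own, so the limit passes inside the sum over
    [m]. *)
Theorem theorem1p1 (alpha : R) (n : nat) (H : nat -> nat -> Z) :
  0 < alpha ->
  alpha / 24 < INR n ->
  (forall k h : nat, (h < k)%nat -> Nat.gcd h k = 1%nat ->
     ((Z.of_nat h * H k h) mod Z.of_nat k = (-1) mod Z.of_nat k)%Z) ->
  let q := Z.to_nat (Int_part (alpha / 24)) in
  exists T : nat -> C,
    (forall m : nat, (m <= q)%nat ->
       @is_series C_AbsRing C_NormedModule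
         (fun j : nat =>
            let k := S j in
            (RtoC (2 * PI / INR k) * kloosterman alpha k (H k) n m
             * RtoC (BesselI (alpha / 2 + 1)
                       (4 * PI / INR k * nu alpha n * mu alpha m)))%C)
         (T m)) /\
    RtoC (frac_partition alpha n) =
      (RtoC (rpow (nu alpha n) (- (alpha / 2) - 1))
       * sum_n (fun m : nat =>
                  RtoC (rpow (mu alpha m) (alpha / 2 + 1)
                        * frac_partition alpha m) * T m) q)%C.
Proof.
intros pa pn HH q; pose proof PI_RGT_0 as pP.
assert (Hq : INR q <= alpha / 24 < INR q + 1).
{ destruct (base_Int_part (alpha / 24)) as [I1 I2].
  assert (I0 : (0 <= Int_part (alpha / 24))%Z).
  { apply Z.lt_succ_r, lt_IZR; rewrite succ_IZR; simpl; lra. }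
  unfold q; rewrite INR_IZR_INZ, Z2Nat.id by exact I0; lra. }
assert (Le : forall m, (m <= q)%nat -> INR m <= alpha / 24).
{ intros m Hm; apply le_INR in Hm; lra. }
set (a := fun (m j : nat) => let k := S j in
  (RtoC (2 * PI / INR k) * kloosterman alpha k (H k) n m
   * RtoC (BesselI (alpha / 2 + 1) (4 * PI / INR k * nu alpha n * mu alpha m)))%C).
assert (Sa : forall m, (m <= q)%nat -> Csum (a m)).
{ intros m Hm; apply Csum_kloosterman_BesselI; auto. }
exists (fun m => CSer (a m)); split; [intros m Hm; apply Csum_is_series, Sa, Hm|].
set (D := fun m => rpow (nu alpha n) (- (alpha / 2) - 1) * rpow (mu alpha m) (alpha / 2 + 1)).
set (B := fun k m => 2 * PI / INR k * BesselI (alpha / 2 + 1) (4 * PI / INR k * nu alpha n * mu alpha m)).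
(* For [m > q] the exponent [b_m] is negative and the line integral is [0], so the infinite sum over
   [m] stops at [q]. *)
set (l := fun k m => if Nat.leb m q then RtoC (D m * Rpower (INR k) (alpha / 2 + 2) * B k m) else RtoC 0).
assert (HH' : forall k h, (h < k)%nat -> Nat.gcd h k = 1%nat -> (Z.of_nat k | Z.of_nat h * H k h + 1)%Z).
{ intros k h lt G; apply Z.mod_divide; [lia|].
  rewrite <- Zplus_mod_idemp_l, (HH k h lt G), Zplus_mod_idemp_l; reflexivity. }
assert (Hl : forall k m, (0 < k)%nat ->
  is_line (fun t => Fk (alpha / 2 + 2) (2 * PI * (alpha / 24 - INR m))
                       (2 * PI * (INR n - alpha / 24) / (INR k * INR k)) (1, t)) (l k m)).
{ intros k m pk; unfold l; destruct (Nat.leb_spec m q) as [le|gt].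
  - apply line_value; auto.
  - apply (le_INR (S q) m) in gt; rewrite S_INR in gt.
    apply Fk_line_right; [lra| |].
    + assert (0 <= PI * (INR m - alpha / 24)) by (apply Rmult_le_pos; lra); lra.
    + assert (0 < INR k) by (apply lt_0_INR; lia).
      apply Rdiv_le_0_compat; [apply Rmult_le_pos; lra|nra]. }
pose proof (farey_limit alpha n H l pa (Rlt_le _ _ pn) HH' Hl) as L.
assert (L' : Clim eventually (fun N => sum_n (fun m => RtoC (D m * frac_partition alpha m) * sum_n (a m) N)%C q)
               (RtoC (frac_partition alpha n))).
{ intros eps; destruct (L eps) as [N0 HN]; exists N0; intros N leN.
  (* [sum_n] up to [N] runs over [j = 0, ..., N], that is, over [k = 1, ..., N + 1]. *)
  specialize (HN (S N) ltac:(lia)).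
  match type of HN with Cmod (?x - _)%C < _ =>
    replace (sum_n (fun m => RtoC (D m * frac_partition alpha m) * sum_n (a m) N)%C q) with x; [exact HN|] end.
  rewrite <- (sum_n_m_S _ 0 N).
  transitivity (sum_n (fun j => sum_n (fun m => RtoC (D m * frac_partition alpha m) * a m j)%C q) N).
  - apply sum_n_m_ext; intros j; unfold l; rewrite (farey_row_kloosterman alpha n (S j) H q D B pa) by lia.
    apply sum_n_ext; intros m; unfold a, B; cbv zeta; rewrite (RtoC_mult (2 * PI / INR (S j))).
    match goal with |- ?u = ?v => change (@eq C u v) end; ring.
  - rewrite sum_n_switch; apply sum_n_ext; intros m.
    rewrite <- Csumn_sum_n, Csumn_scal, Csumn_sum_n; reflexivity. }
apply (Clim_unique eventually _ _ _ L').
apply (Clim_eq _ _ (sum_n (fun m => RtoC (D m * frac_partition alpha m) * CSer (a m))%C q)).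
- apply (Clim_sum_n eventually (fun m N => RtoC (D m * frac_partition alpha m) * sum_n (a m) N)%C).
  intros m Hm; apply Clim_scal; [apply eventually_filter|].
  intros eps; destruct (CSer_Clim (a m) (Sa m Hm) eps) as [N0 HN]; exists N0; intros N leN.
  rewrite <- Csumn_sum_n; apply (HN (S N)); lia.
- rewrite <- !Csumn_sum_n, <- Csumn_scal; apply Csumn_ext; intros m _.
  unfold D; rewrite !RtoC_mult; ring.
Qed.
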